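(* Let $n \ge 2$, $p > n^{2}/2$ and let $\kappa\in\mathbb{R}$ be a constant. Let $M$ be a closed smooth manifold of dimension $n$, $g$ a $C^{2}$ Riemannian metric on $M$ and $(g_{i})$ a sequence of $C^{2}$ Riemannian metrics on $M$. Assume the following: (1) $(\phi_{i})$ is a sequence of nonnegative continuous functions on $M$ such that for any constant $a > 0$ there is a constant $\Lambda > 0$ such that $\log(\phi_{i} + a)$ is $\Lambda$-Lipschitz on $M$ for all $i$; (2) $(\phi_{i})$ converges uniformly on $M$ to some nonnegative continuous function $\phi$; (3) $R(g_{i}) \ge 0$ on $M$ for each $i$; (4) $\int_{M} R(g_{i})\, \phi_{i}\, d\mathrm{vol}_{g_{i}} \ge \kappa \int_{M} \phi_{i}\, d\mathrm{vol}_{g_{i}}$ for each $i$; (5) $g_{i}$ converges to $g$ in the $W^{1,p}$-sense. Then $$\int_{M} R(g)\, \phi\, d\mathrm{vol}_{g} \ge \kappa \int_{M} \phi\, d\mathrm{vol}_{g}.$$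
   Context: $R(g)$ denotes the scalar curvature and $d\mathrm{vol}_g$ the Riemannian volume measure of $g$. $g_i\to g$ in the $W^{1,p}$-sense means that $g_i$ and all its first weak derivatives converge respectively to those of $g$ with respect to the $L^{p}$-norm of $g$. Closed means compact without boundary. ''$\Lambda$-Lipschitz'' is understood with respect to the Riemannian distance of $g$. *)

(* Defs.v *)
From HB Require Import structures.
From mathcomp Require Import all_boot all_order all_algebra.
From mathcomp Require Import all_classical all_reals all_analysis.
Set Implicit Arguments.
Unset Strict Implicit.
Unset Printing Implicit Defensive.
Import Order.TTheory GRing.Theory Num.Theory.
Import numFieldNormedType.Exports.
Local Open Scope classical_set_scope.
Local Open Scope ring_scope.

Notation borel T := (g_sigma_algebraType (@open T)).

Section Euclidean.
Variable R : realType.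

(* Lebesgue measure on the Borel sets of R^n, as the n-fold product of
   [lebesgue_measure]: the recursive clause is the library's definition of the
   product measure (integrate the measure of the sections). *)
Fixpoint lebesgueN (n : nat) : set (borel 'rV[R]_n) -> \bar R :=
  match n with
  | 0 => fun A => \d_(0 : borel 'rV[R]_0) A
  | n'.+1 => fun A => (\int[@lebesgue_measure R]_t
      lebesgueN [set x : 'rV[R]_n' | A (row_mx (t%:M : 'rV[R]_1) x)])%E
  end.

Variable n : nat.
Implicit Types (U : set 'rV[R]_n) (f w psi : 'rV[R]_n -> R).

Definition partial (i : 'I_n) f (x : 'rV[R]_n) : R := 'D_(delta_mx 0 i) f x.

(* Meant for open U. *)
Fixpoint Ck (k : nat) U f : Prop :=
  (forall x, U x -> {for x, continuous f}) /\
  match k with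
  | 0 => True
  | k'.+1 => forall i : 'I_n,
      (forall x, U x -> derivable f x (delta_mx 0 i)) /\ Ck k' U (partial i f)
  end.

Definition smooth U f : Prop := forall k, Ck k U f.

Definition test_function U psi : Prop :=
  smooth [set: 'rV[R]_n] psi /\
  exists K : set 'rV[R]_n,
    [/\ compact K, K `<=` U & forall x, ~ K x -> psi x = 0].

Definition loc_integrable U f : Prop :=
  measurable_fun (U : set (borel 'rV[R]_n)) (f : borel 'rV[R]_n -> R) /\
  forall K : set 'rV[R]_n, compact K -> K `<=` U ->
    (\int[@lebesgueN n]_(x in K) `|f x|%:E < +oo)%E.

Definition weak_partial U (i : 'I_n) f w : Prop :=
  [/\ loc_integrable U f, loc_integrable U w &
   forall psi, test_function U psi ->
     (\int[@lebesgueN n]_(x in U) (f x * partial i psi x)%:E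
      = - \int[@lebesgueN n]_(x in U) (w x * psi x)%:E)%E].

End Euclidean.

(* Smooth n-manifolds without boundary, presented by a smooth atlas;
   [coordV] is only meaningful on the image of [coord]. *)
Record smoothManifold (R : realType) (n : nat) := SmoothManifold {
  mcarrier :> ptopologicalType ;
  mhausdorff : hausdorff_space mcarrier ;
  msecond_countable : @second_countable mcarrier ;
  chart : Type ;
  dom : chart -> set mcarrier ;
  coord : chart -> mcarrier -> 'rV[R]_n ;
  coordV : chart -> 'rV[R]_n -> mcarrier ;
  chart_at : mcarrier -> chart ;
  dom_chart_at : forall q, dom (chart_at q) q ;
  dom_open : forall a, open (dom a) ;
  img_open : forall a, open (coord a @` dom a) ;
  coordK : forall a q, dom a q -> coordV a (coord a q) = q ;
  coord_cts : forall a q, dom a q -> {for q, continuous (coord a)} ;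
  coordV_cts : forall a q, dom a q -> {for coord a q, continuous (coordV a)} ;
  trans_smooth : forall a b (j : 'I_n),
    smooth (coord a @` (dom a `&` dom b))
           (fun x => coord b (coordV a x) 0 j)
}.

Section Charts.
Variables (R : realType) (n : nat) (M : smoothManifold R n).

Definition img (a : chart M) : set 'rV[R]_n := coord a @` dom a.
Definition overlap (a b : chart M) : set 'rV[R]_n :=
  coord a @` (dom a `&` dom b).
Definition trans (a b : chart M) (x : 'rV[R]_n) : 'rV[R]_n :=
  coord b (coordV a x).

(* Row index: derivation variable (the row-vector convention of [jacobian]). *)
Definition trans_jac (a b : chart M) (x : 'rV[R]_n) : 'M[R]_n :=
  \matrix_(i, k) partial i (fun y => trans a b y 0 k) x.

(* Covariant tensor fields are families of components in the charts; only the
   values on [img a] are meaningful. A (0,3)-tensor has the derivation slot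
   first. *)
Definition field2 := chart M -> 'rV[R]_n -> 'M[R]_n.
Definition field3 := chart M -> 'rV[R]_n -> 'I_n -> 'M[R]_n.

Definition is_tensor2 (h : field2) : Prop := forall a b x, overlap a b x ->
  h a x = trans_jac a b x *m h b (trans a b x) *m (trans_jac a b x)^T.

Definition is_tensor3 (T : field3) : Prop := forall a b x, overlap a b x ->
  forall k, T a x k = \sum_l trans_jac a b x k l *:
    (trans_jac a b x *m T b (trans a b x) l *m (trans_jac a b x)^T).

End Charts.

Record C2metric (R : realType) (n : nat) (M : smoothManifold R n) := C2Metric {
  gmx :> chart M -> 'rV[R]_n -> 'M[R]_n ;
  gmx_tensor : is_tensor2 gmx ;
  gmx_sym : forall a x, img a x -> (gmx a x)^T = gmx a x ;
  gmx_pos : forall a x, img a x ->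
    forall v : 'rV[R]_n, v != 0 -> 0 < (v *m gmx a x *m v^T) 0 0 ;
  gmx_C2 : forall a i j, Ck 2 (img a) (fun x => gmx a x i j)
}.

Section Curvature.
Variables (R : realType) (n : nat).
Variable G : 'rV[R]_n -> 'M[R]_n.
Implicit Types (i j k l : 'I_n) (x : 'rV[R]_n).

Definition christoffel k i j x : R :=
  2^-1 * \sum_l invmx (G x) k l *
    (partial i (fun y => G y j l) x + partial j (fun y => G y i l) x
     - partial l (fun y => G y i j) x).

Definition ricci i j x : R :=
  \sum_k (partial k (christoffel k i j) x - partial j (christoffel k i k) x)
  + \sum_k \sum_l (christoffel k k l x * christoffel l i j x
                   - christoffel k j l x * christoffel l i k x).

Definition scal_coord x : R := \sum_i \sum_j invmx (G x) i j * ricci i j x.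

End Curvature.

Section Riemannian.
Variables (R : realType) (n : nat) (M : smoothManifold R n) (g : C2metric M).

Definition scal (q : M) : R :=
  scal_coord (g (chart_at q)) (coord (chart_at q) q).

(* A Borel set B inside [dom a] has volume
   \int_(coord a @` B) sqrt (det g); an arbitrary Borel set is cut into finitely
   many disjoint Borel pieces, each inside a chart domain. Any family of such
   pieces inside A gives a lower bound of the volume of A. *)
Definition chart_vol (a : chart M) (B : set M) : \bar R :=
  (\int[@lebesgueN R n]_(x in coord a @` B) (Num.sqrt (\det (g a x)))%:E)%E.

Definition vol (A : set (borel M)) : \bar R :=
  ereal_sup [set s : \bar R |
    exists (N : nat) (a : 'I_N -> chart M) (B : 'I_N -> set (borel M)),
    [/\ forall k, measurable (B k),
        trivIset [set: 'I_N] B,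
        forall k, B k `<=` A `&` dom (a k)
      & s = (\sum_(k < N) chart_vol (a k) (B k))%E]].

Definition speed (c : R -> M) (t : R) : R :=
  let a := chart_at (c t) in
  let v := derive1 (coord a \o c) t in
  Num.sqrt ((v *m g a (coord a (c t)) *m v^T) 0 0).

Definition C1_at (c : R -> M) (t : R) : Prop :=
  {for t, continuous c} /\
  forall a : chart M, dom a (c t) ->
    (\forall s \near t, derivable (coord a \o c) s 1) /\
    {for t, continuous (derive1 (coord a \o c))}.

(* On each closed piece the curve agrees with a curve that is C^1 around the
   piece, so that one-sided derivatives at the breakpoints are allowed. *)
Definition piecewise_C1 (c : R -> M) : Prop :=
  exists (N : nat) (t : nat -> R),
  [/\ t 0%N = 0, t N = 1 &
   forall k, (k < N)%N -> t k < t k.+1 /\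
     exists d : R -> M,
       forall s, t k <= s <= t k.+1 -> d s = c s /\ C1_at d s].

Definition curve_length (c : R -> M) : \bar R :=
  (\int[@lebesgue_measure R]_(t in `[0%R, 1%R]) (speed c t)%:E)%E.

(* +oo between distinct connected components *)
Definition rdist (x y : M) : \bar R :=
  ereal_inf [set curve_length c | c in
    [set c : R -> M | [/\ piecewise_C1 c, c 0 = x & c 1 = y]]].

Definition lipschitz_wrt (L : R) (f : M -> R) : Prop :=
  forall x y, (`|f x - f y|%:E <= L%:E * rdist x y)%E.

Definition dot2 (a : chart M) (x : 'rV[R]_n) (A B : 'M[R]_n) : R :=
  \tr (invmx (g a x) *m A *m invmx (g a x) *m B^T).

Definition tnorm2 (h : field2 M) (q : M) : R :=
  let a := chart_at q in let x := coord a q in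
  Num.sqrt (dot2 a x (h a x) (h a x)).

Definition tnorm3 (T : field3 M) (q : M) : R :=
  let a := chart_at q in let x := coord a q in
  Num.sqrt (\sum_k \sum_l invmx (g a x) k l * dot2 a x (T a x k) (T a x l)).

Definition Lp_norm (p : R) (f : M -> R) : \bar R :=
  ((\int[vol]_q (`|f q| `^ p)%:E) `^ p^-1)%E.

(* T is the weak covariant derivative of h for the Levi-Civita connection of g:
   d_k h_ij = T_kij + Gamma^l_ki h_lj + Gamma^l_kj h_il in the weak sense.
   T has to be a tensor at every point, not just almost everywhere: otherwise
   its values in uncountably many charts could be altered independently. *)
Definition weak_cov_deriv (h : field2 M) (T : field3 M) : Prop :=
  is_tensor3 T /\
  forall (a : chart M) (k i j : 'I_n),
    weak_partial (img a) k (fun x => h a x i j)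
      (fun x => T a x k i j
        + \sum_l christoffel (g a) l k i x * h a x l j
        + \sum_l christoffel (g a) l k j x * h a x i l).

Definition W1p_cvg (p : R) (gs : nat -> C2metric M) : Prop :=
  exists (Ts : nat -> field3 M) (T : field3 M),
  [/\ forall m, weak_cov_deriv (gs m) (Ts m),
      weak_cov_deriv g T,
      Lp_norm p (tnorm2 (fun a x => gs m a x - g a x)) @[m --> \oo]
        --> (0 : \bar R)
    & Lp_norm p (tnorm3 (fun a x k => Ts m a x k - T a x k)) @[m --> \oo]
        --> (0 : \bar R)].

End Riemannian.

(* Main.v *)
(** Since [R(g_i) >= 0], the logarithmic Lipschitz hypothesis is not needed. As
    [p > n], Morrey's inequality turns [W^{1,p}] convergence into locally uniform
    convergence of the metric coefficients in charts, while their first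
    derivatives converge in [L^2] on compact sets. Integrating by parts (Palatini's
    form of the Einstein-Hilbert action), the integral of [R(g) psi] over a chart
    involves only [g] and its first derivatives, quadratically, so that
    [int R(g_i) psi dvol_{g_i} --> int R(g) psi dvol_g] for smooth [psi] compactly
    supported in a chart, hence for finite sums [psi] of such functions. Choose
    [psi] with [phi + e <= psi <= phi + 2 e]. Eventually [phi_i <= phi + e <= psi],
    whence
    [kappa int phi_i <= int R(g_i) phi_i <= int R(g_i) psi --> int R(g) psi
     <= int R(g) phi + C e], and [e] tends to [0]. *)
Require Import Defs.
From HB Require Import structures.
From mathcomp Require Import all_boot all_order all_algebra.
From mathcomp Require Import all_classical all_reals all_analysis.
From mathcomp Require Import measurable_realfun.
From mathcomp Require Import ring lra.
Set Implicit Arguments.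
Unset Strict Implicit.
Unset Printing Implicit Defensive.
Import Order.TTheory GRing.Theory Num.Theory.
Import numFieldNormedType.Exports.
Local Open Scope classical_set_scope.
Local Open Scope ring_scope.

(** * Lebesgue measure on row vectors *)

(** The test functions must dominate the limit of the [phis] because nonnegativity is the only
    information on the size of R(g_i): second derivatives of g_i are not controlled, so R(g_i) is
    known to converge only against fixed test functions. The condition p > n^2/2 with n >= 2 yields
    p >= 2 and p > n. The first makes products of two first derivatives converge in L^1 on compact
    sets, as the quadratic terms of Palatini's form demand; the second gives uniform convergence of
    g_i, hence of the inverse metric and volume density that multiply them. Two translations support
    the analysis. The W^{1,p} norm is tensorial and uses weak covariant derivatives; in charts it is
    compared with classical partial derivatives, equal almost everywhere to the weak ones since the
    metrics are C^2. Moreover [vol] is a supremum over chart pieces and [scal] is read in one chosen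
    chart per point; change of variables and invariance of the scalar curvature make both computable
    in any chart. Hoelder's inequality is replaced by a <= d + d^(1-p) a^p with a free d > 0. *)

Section RationalBalls.
Variable R : realType.

Lemma rat_rV_dense n (x : 'rV[R]_n) (e : R) : 0 < e ->
  exists c : 'rV[rat]_n, ball (map_mx ratr c : 'rV[R]_n) e x.
Proof.
move=> e0.
have /choice[f hf] : forall j, exists r : rat, ball (ratr r : R^o) e (x 0 j).
  move=> j; have [_ [/[swap] -[r _ <-] xr]] :=
    @dense_rat R (ball (x 0 j : R^o) e) (ex_intro _ _ (ballxx _ e0)) (@ball_open _ _ _ e).
  by exists r; exact: ball_sym.
by exists (\row_j f j); split => // i j; rewrite !mxE (ord1 i).
Qed.

(** Countability of the family makes preimages of open sets measurable; asking the doubled balls to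
    lie in [O] leaves room for closed balls, hence for compactly supported tents, inside [O]. *)
Lemma open_rV_bigcup n (O : set 'rV[R]_n) : open O ->
  let b (r : R) (ik : 'rV[rat]_n * nat) : set 'rV[R]_n :=
    ball (map_mx ratr ik.1 : 'rV[R]_n) (r * ik.2.+1%:R^-1) in
  O = \bigcup_(ik in [set ik | b 2 ik `<=` O]) b 1 ik.
Proof.
move=> oO b; have le12 ik : b 1 ik `<=` b 2 ik.
  by apply: le_ball; rewrite ler_wpM2r ?invr_ge0// ler1n.
apply/seteqP; split => [x Ox|x [ik ikO /le12/ikO]//].
have /nbhs_ballP[e /= e0 xeO] := open_nbhs_nbhs (conj oO Ox).
have [k hk] : exists k : nat, k.+1%:R^-1 < e / 3.
  have [k _ hk] : \forall k \near \oo, k.+1%:R^-1 < e / 3 :> R.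
    have := @cvg_harmonic R; move/cvgrPdist_lt => /(_ (e/3)).
    rewrite divr_gt0// => /(_ isT); apply: filterS => k /=.
    by rewrite sub0r normrN ger0_norm ?invr_ge0.
  by exists k; exact: (hk k (leqnn k)).
have k0 : 0 < k.+1%:R^-1 :> R by rewrite invr_gt0.
have [c xc] := rat_rV_dense x k0.
exists (c, k); last by rewrite /b mul1r.
move=> y cy; apply: xeO.
apply: (@le_ball _ _ _ (k.+1%:R^-1 + 2 * k.+1%:R^-1)); last first.
  by apply: ball_triangle cy; exact: ball_sym.
by have : forall r : R, r < e / 3 -> r + 2 * r <= e by [move=> r hr; lra]; exact.
Qed.

End RationalBalls.

Section MeasurableOpen.
Context {d} {T : measurableType d}.

Lemma measurable_fun_borel (Y : ptopologicalType) (D : set T) (f : T -> borel Y) :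
  (forall O : set Y, open O -> measurable (D `&` f @^-1` O)) -> measurable_fun D f.
Proof. by move=> h; apply: (@measurability _ _ T (borel Y) D f (@open Y)) => // _ [V oV <-]; exact: h. Qed.

Lemma measurable_fun_real {R : realType} (D : set T) (f : T -> R) :
  (forall O : set R, open O -> measurable (D `&` f @^-1` O)) -> measurable_fun D f.
Proof.
move=> h; apply: (measurability _ (RGenOpens.measurableE R)) => _ [_ [a [b ->]] <-].
by apply: h; exact: itv_open.
Qed.

End MeasurableOpen.

Section BorelContinuous.
Variable R : realType.

Lemma borel_open (X : ptopologicalType) (O : set X) :
  open O -> measurable (O : set (borel X)).
Proof. by move=> oO; exact: sub_sigma_algebra. Qed.

Lemma borel_closed (X : ptopologicalType) (O : set X) :
  closed O -> measurable (O : set (borel X)).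
Proof.
move=> cO; have := @measurableC _ (borel X) (~` O) (borel_open (closed_openC cO)).
by rewrite setCK.
Qed.

Lemma borel_compact (X : ptopologicalType) (K : set X) :
  hausdorff_space X -> compact K -> measurable (K : set (borel X)).
Proof. by move=> hX cK; apply: borel_closed; exact: compact_closed. Qed.

Lemma open_preimage (X Y : topologicalType) (U : set X) (f : X -> Y) (O : set Y) :
  open U -> (forall x, U x -> {for x, continuous f}) -> open O -> open (U `&` f @^-1` O).
Proof.
rewrite !openE => oU cf oO x [Ux Ofx]; apply: filterI; first exact: oU.
by apply: (cf x Ux); exact: oO.
Qed.

Lemma continuous_borel (X Y : ptopologicalType) (U : set X) (f : X -> Y) :
  open U -> (forall x, U x -> {for x, continuous f}) ->
  measurable_fun (U : set (borel X)) (f : borel X -> borel Y).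
Proof. by move=> oU cf; apply: measurable_fun_borel => O oO; apply: borel_open; exact: open_preimage. Qed.

Lemma continuous_borelR (X : ptopologicalType) (U : set X) (f : X -> R) :
  open U -> (forall x, U x -> {for x, continuous f}) ->
  measurable_fun (U : set (borel X)) (f : borel X -> R).
Proof. by move=> oU cf; apply: measurable_fun_real => O oO; apply: borel_open; exact: open_preimage. Qed.

Lemma continuous_borelRT (X : ptopologicalType) (f : X -> R) :
  continuous f -> measurable_fun [set: borel X] (f : borel X -> R).
Proof. by move=> cf; apply: continuous_borelR => // [|x _]; [exact: openT|exact: cf]. Qed.

Lemma borel_real : (fun t : R => t : borel R) = id /\
  measurable_fun [set: measurableTypeR R] (fun t : R => t : borel R).
Proof.
by split => //; apply: measurable_fun_borel => O oO; rewrite setTI; exact: open_measurable.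
Qed.

(** In the sup norm a ball is a product of intervals, so its preimage is the complement in [D] of a
    finite union of coordinate preimages; countably many rational balls then exhaust any open
    set. *)
Lemma measurable_rV n d (T : measurableType d) (D : set T) (f : T -> borel 'rV[R]_n) :
  (forall j, measurable_fun D (fun x => (f x : 'rV[R]_n) 0 j)) -> measurable_fun D f.
Proof.
move=> mf mD; apply: measurable_fun_borel => // O oO.
rewrite (open_rV_bigcup oO) preimage_bigcup setI_bigcupr bigcup_set_type.
apply: countable_bigcupT_measurable => [|ik].
  by apply: sub_countable (card_leT _) _; exact: countableP.
set c := map_mx _ _; set r := 1 * _^-1.
have r0 : 0 < r by rewrite /r mul1r invr_gt0.
rewrite (_ : _ `&` _ = D `\`
    \bigcup_j (D `&` (fun x => (f x : 'rV[R]_n) 0 j) @^-1` (~` ball (c 0 j : R^o) r))); last first.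
  apply/seteqP; split => [x [Dx [_ h]]|x [Dx h]].
    by split => // -[j _ [_]]; apply; exact: h.
  split => //; split => // i j; rewrite (ord1 i).
  by apply: contrapT => hj; apply: h; exists j.
apply: measurableD => //; apply: countable_bigcupT_measurable => // j.
by apply: mf => //; apply: measurableC; exact: measurable_ball.
Qed.

Lemma measurable_coord n j : measurable_fun [set: borel 'rV[R]_n] (fun x => (x : 'rV[R]_n) 0 j).
Proof. by apply: continuous_borelRT; exact: coord_continuous. Qed.

End BorelContinuous.

Section ImageMeasure.
Context d1 d2 (T1 : measurableType d1) (T2 : measurableType d2) (R : realType).
Variables (mu : {measure set T1 -> \bar R}) (f : T1 -> T2) (mf : measurable_fun setT f).

(** The measurability proof is built in, so that the pushforward along a given map is itself a
    bundled measure. *)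
Definition image_measure : {measure set T2 -> \bar R}.
Proof. refine (pushforward mu f); exact: mf. Defined.

Lemma image_measureE A : image_measure A = mu (f @^-1` A).
Proof. by []. Qed.

Lemma ge0_integral_image_measure (D : set T2) (g : T2 -> \bar R) : measurable D ->
  measurable_fun D g -> (forall y, D y -> (0 <= g y)%E) ->
  (\int[image_measure]_(y in D) g y = \int[mu]_(x in f @^-1` D) g (f x))%E.
Proof.
by move=> mD mg g0; rewrite ge0_integral_pushforward// => y /[!inE]; exact: g0.
Qed.

End ImageMeasure.

(** * The recursive volume as a sigma-finite measure *)

Section Leb.
Variable R : realType.

Definition consr n (z : measurableTypeR R * borel 'rV[R]_n) : borel 'rV[R]_n.+1 :=
  row_mx ((z.1 : R)%:M : 'rV[R]_1) (z.2 : 'rV[R]_n).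

Definition unconsr n (x : borel 'rV[R]_n.+1) : measurableTypeR R * borel 'rV[R]_n :=
  ((x : 'rV[R]_n.+1) 0 0, rsubmx (x : 'rV[R]_(1 + n))).

Lemma consr0 n z : (@consr n z : 'rV[R]_n.+1) 0 0 = z.1.
Proof.
have -> : (0 : 'I_n.+1) = lshift n (0 : 'I_1) by apply: val_inj.
by rewrite /consr (@row_mxEl _ 1 1 n) mxE.
Qed.

Lemma consr_lift n (z : _ * borel 'rV[R]_n) j :
  (consr z : 'rV[R]_n.+1) 0 (lift ord0 j) = (z.2 : 'rV[R]_n) 0 j.
Proof.
have -> : lift ord0 j = rshift 1 j by apply: val_inj.
by rewrite /consr (@row_mxEr _ 1 1 n).
Qed.

Lemma consrK n : cancel (@consr n) (@unconsr n).
Proof. by move=> [t x]; rewrite /unconsr consr0 /consr row_mxKr. Qed.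

Lemma unconsrK n : cancel (@unconsr n) (@consr n).
Proof.
move=> x; apply/rowP => j; case: (unliftP ord0 j) => [i ->|->]; last by rewrite consr0.
by rewrite consr_lift mxE; congr (x _ _); apply: val_inj.
Qed.

Lemma measurable_consr n : measurable_fun setT (@consr n).
Proof.
apply: measurable_rV => j; case: (unliftP ord0 j) => [i ->|->]; last first.
  under [X in measurable_fun _ X]eq_fun do rewrite consr0; exact: measurable_fst.
under [X in measurable_fun _ X]eq_fun do rewrite consr_lift.
apply: (measurableT_comp (f := fun x : borel 'rV[R]_n => (x : 'rV[R]_n) 0 i)).
  exact: measurable_coord.
exact: measurable_snd.
Qed.

Lemma measurable_unconsr n : measurable_fun setT (@unconsr n).
Proof.
apply: measurable_fun_pair; first exact: measurable_coord.
apply: measurable_rV => j.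
under [X in measurable_fun _ X]eq_fun do rewrite mxE.
exact: measurable_coord.
Qed.

Section Step.
Variables (n : nat) (mu : {sigma_finite_measure set (borel 'rV[R]_n) -> \bar R}).

Let push := image_measure (@lebesgue_measure R \x mu)%E (@measurable_consr n).

Let push_sigma_finite : sigma_finite setT push.
Proof.
have /sigma_finiteP[F [TF ndF Foo]] := sigma_finiteT (@lebesgue_measure R).
have /sigma_finiteP[G [TG ndG Goo]] := sigma_finiteT mu.
exists (fun k => @unconsr n @^-1` (F k `*` G k)).
  rewrite -preimage_bigcup (_ : \bigcup_k _ = setT) ?preimage_setT//.
  rewrite -setXTT TF TG predeqE => -[x y]; split; first by move=> [k _ []/= ? ?]; split; exists k.
  move=> [/= [k _ Fnx] [l _ Gky]]; exists (maxn k l) => //; split.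
  - by move: x Fnx; exact/subsetPset/ndF/leq_maxl.
  - by move: y Gky; exact/subsetPset/ndG/leq_maxr.
move=> k; have [mF Fk] := Foo k; have [mG Gk] := Goo k; split.
  by rewrite -[X in measurable X]setTI; apply: measurable_unconsr => //; exact: measurableX.
change ((@lebesgue_measure R \x mu)%E ((@unconsr n \o @consr n) @^-1` (F k `*` G k)) < +oo)%E.
rewrite (_ : _ \o _ = id); last by apply/funext => z /=; rewrite consrK.
by rewrite preimage_id product_measure1E// lte_mul_pinfty// ge0_fin_numE.
Qed.

(** Sigma-finiteness is packed into each step because the product with the next line and Tonelli's
    theorem both ask for it. *)
Definition leb_step : {sigma_finite_measure set (borel 'rV[R]_n.+1) -> \bar R} :=
  HB.pack (Measure.sort push) (Measure.class push)
    (Measure_isSigmaFinite.Build _ _ _ (Measure.sort push) push_sigma_finite).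
End Step.

Fixpoint leb n : {sigma_finite_measure set (borel 'rV[R]_n) -> \bar R} :=
  match n with
  | 0 => \d_(0 : borel 'rV[R]_0)
  | n'.+1 => leb_step (leb n')
  end.

(** The product measure integrates the measure of the sections by definition, so the two recursions
    agree on all sets, measurable or not. *)
Lemma lebesgueNE n : @lebesgueN R n = leb n.
Proof.
elim: n => [|n IH] //; apply/funext => A.
rewrite [LHS]/= IH [RHS]/= /leb_step /pushforward /product_measure1.
apply: eq_integral => t _ /=; congr (leb n _).
by rewrite xsectionE.
Qed.

Lemma leb0E (f : 'rV[R]_0 -> \bar R) : (\int[leb 0]_x f x = f 0%R)%E.
Proof.
have mf : measurable_fun [set: borel 'rV[R]_0] (f : borel 'rV[R]_0 -> _).
  move=> _ B mB; rewrite setTI; have [h|h] := pselect (B (f 0%R)).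
    rewrite (_ : _ @^-1` _ = setT) //; apply/seteqP; split => // x _ /=.
    by rewrite (thinmx0 x).
  rewrite (_ : _ @^-1` _ = set0) //; apply/seteqP; split => // x /=.
  by rewrite (thinmx0 x).
by rewrite /= integral_dirac// diracT mul1e.
Qed.

Lemma lebSE n (f : borel 'rV[R]_n.+1 -> \bar R) : measurable_fun setT f ->
  (forall x, (0 <= f x)%E) ->
  (\int[leb n.+1]_x f x = \int[@lebesgue_measure R]_t \int[leb n]_x f (consr (t, x)))%E.
Proof.
move=> mf f0; rewrite [LHS](ge0_integral_image_measure _ (@measurable_consr n))//.
rewrite preimage_setT (fubini_tonelli1 (f \o @consr n))//; last by move=> x; exact: f0.
by apply: measurableT_comp => //; exact: measurable_consr.
Qed.

End Leb.

(** * Linear changes of variables *)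

Section LebLinear.
Variable R : realType.
Implicit Types n : nat.

(** Lebesgue measure is determined by its values on half-open intervals, and the rescaled image
    under t -> t a + b gives them the right length. *)
Lemma lebesgue_affine (a b : R) (f : R -> \bar R) : a != 0 ->
  measurable_fun [set: measurableTypeR R] f -> (forall t, (0 <= f t)%E) ->
  (`|a|%:E * \int[@lebesgue_measure R]_t f ((t : R) * a + b)%R = \int[@lebesgue_measure R]_t f t)%E.
Proof.
move=> a0 mf f0.
pose phi : measurableTypeR R -> measurableTypeR R := fun t => t * a + b.
have mphi : measurable_fun setT phi.
  apply: measurable_funD => //; exact: measurable_funM.
pose mu : {measure set (measurableTypeR R) -> \bar R} :=
  mscale (NngNum (normr_ge0 a)) (image_measure (@lebesgue_measure R) mphi).
have muE A : measurable A -> @lebesgue_measure R A = mu A.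
  apply: lebesgue_measure_unique => _ [[x y] _ <-] /=.
  rewrite /mu /mscale /= /pushforward.
  (* A negative slope reverses the interval, so the included endpoint moves to the left. *)
  rewrite (_ : phi @^-1` _ = if 0 < a then `](x - b) / a, (y - b) / a]%classic
     else `[(y - b) / a, (x - b) / a[%classic); last first.
    have h : 0 < a \/ a < 0 by case: (ltgtP a 0) a0 => //; [right|left].
    apply/seteqP; split => t; case: h => ha; rewrite /phi /= ?ha ?(lt_gtF ha) /= !in_itv/=.
    - by move=> /andP[h1 h2]; rewrite ltr_pdivrMr// ler_pdivlMr// ltrBlDr lerBrDr h1 h2.
    - by move=> /andP[h1 h2]; rewrite ler_ndivrMr// ltr_ndivlMr// ltrBlDr lerBrDr h1 h2.
    - by rewrite ltr_pdivrMr// ler_pdivlMr// ltrBlDr lerBrDr.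
    - by rewrite ler_ndivrMr// ltr_ndivlMr// ltrBlDr lerBrDr andbC.
  case: ifPn => ha; rewrite !lebesgue_measure_itv/= !lte_fin.
    rewrite ltr_pM2r ?invr_gt0// ltrD2r; case: ifP => _; last by rewrite mule0.
    by rewrite -EFinD -EFinM -mulrBl gtr0_norm// mulrC divfK// opprD addrACA subrr addr0.
  have {}ha : a < 0 by rewrite lt_neqAle a0 leNgt.
  rewrite ltr_nM2r ?invr_lt0// ltrD2r; case: ifP => _; last by rewrite mule0.
  rewrite -EFinD -EFinM -mulrBl ltr0_norm// mulrC mulrN divfK// ; congr EFin; ring.
rewrite [RHS](eq_measure_integral mu); last by move=> A mA _; exact: muE.
by rewrite ge0_integral_mscale// ge0_integral_image_measure.
Qed.

Lemma measurable_section n (f : borel 'rV[R]_n.+1 -> \bar R) (t : R) :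
  measurable_fun setT f -> measurable_fun setT (fun x => f (consr (t, x))).
Proof.
move=> mf; apply: (measurableT_comp mf); apply: (measurableT_comp (@measurable_consr R n)).
exact: measurable_fun_pair.
Qed.

Lemma measurable_int_section n (f : borel 'rV[R]_n.+1 -> \bar R) :
  measurable_fun setT f -> (forall x, (0 <= f x)%E) ->
  measurable_fun setT (fun t => \int[leb R n]_x f (consr (t, x)))%E.
Proof.
move=> mf f0.
apply: (@measurable_fun_fubini_tonelli_F _ _ _ _ _ (leb R n) (f \o @consr R n)) => [|x].
  exact: (measurableT_comp mf (@measurable_consr R n)).
exact: f0.
Qed.

Lemma measurable_affine m n (A : 'M[R]_(m, n)) (b : 'rV[R]_n) :
  measurable_fun setT (fun x : borel 'rV[R]_m => (x : 'rV[R]_m) *m A + b : borel 'rV[R]_n).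
Proof.
apply: measurable_rV => j; under eq_fun do rewrite !mxE.
apply: measurable_funD => //; apply: measurable_sum => i.
by apply: measurable_funM => //; exact: measurable_coord.
Qed.

Lemma leb_translate n (b : 'rV[R]_n) (f : borel 'rV[R]_n -> \bar R) :
  measurable_fun setT f -> (forall x, (0 <= f x)%E) ->
  (\int[leb R n]_x f ((x : 'rV[R]_n) + b)%R = \int[leb R n]_x f x)%E.
Proof.
elim: n b f => [|n IH] b f mf f0; first by rewrite !leb0E (thinmx0 b) addr0.
have mfb : measurable_fun setT (fun x : borel 'rV[R]_n.+1 => f ((x : 'rV[R]_n.+1) + b)).
  apply: (measurableT_comp mf); have := measurable_affine 1%:M b.
  by under eq_fun do rewrite mulmx1.
rewrite !lebSE//.
have H t (x : 'rV[R]_n) : (consr (t, x) : 'rV[R]_n.+1) + b =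
    consr (t * 1 + b 0 0, x + rsubmx (b : 'rV[R]_(1 + n))).
  apply/rowP => j; case: (unliftP ord0 j) => [i ->|->].
    rewrite mxE !consr_lift/= mxE; congr (_ + _); rewrite mxE; congr (b _ _); exact: val_inj.
  by rewrite mxE !consr0 /= mulr1.
under eq_integral => t _ do under eq_integral => x _ do rewrite H.
transitivity (\int[@lebesgue_measure R]_t \int[leb R n]_x f (consr ((t : R) * 1 + b 0 0, x)%R))%E.
  apply: eq_integral => t _; apply: (IH _ (fun x => f (consr (_, x)))) => //.
  exact: measurable_section.
rewrite -[RHS](@lebesgue_affine 1 (b 0 0)) ?normr1 ?mul1e//.
- exact: measurable_int_section.
- by move=> t; exact: integral_ge0.
Qed.

Let mlin m (A : 'M[R]_m) (f : borel 'rV[R]_m -> \bar R) : measurable_fun setT f ->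
  measurable_fun setT (fun x : borel 'rV[R]_m => f ((x : 'rV[R]_m) *m A)).
Proof.
move=> mf; apply: (measurableT_comp mf); have := measurable_affine A 0.
by under eq_fun do rewrite addr0.
Qed.

(** Stated as a predicate on matrices because it is multiplicative: it then suffices to treat the
    factors of a block factorisation. *)
Let cov m (A : 'M[R]_m) := forall f : borel 'rV[R]_m -> \bar R,
  measurable_fun setT f -> (forall x, (0 <= f x)%E) ->
  (`|\det A|%:E * \int[leb R m]_x f ((x : 'rV[R]_m) *m A)%R = \int[leb R m]_x f x)%E.

Let cov_mul m (A B : 'M[R]_m) : cov A -> cov B -> cov (A *m B).
Proof.
move=> cA cB f mf f0; rewrite det_mulmx mulrC normrM EFinM -muleA -[RHS]cB//; congr (_ * _)%E.
rewrite -[RHS](cA (fun x => f (x *m B)))//; last exact: mlin.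
by under eq_integral do rewrite mulmxA.
Qed.

Let cov_ublock n (a : R) (w : 'rV[R]_n) (B : 'M[R]_n) : a != 0 -> cov B ->
  cov (block_mx (a%:M : 'M[R]_1) w 0 B : 'M[R]_n.+1).
Proof.
move=> a0 uB g mg g0; rewrite !lebSE//; last exact: mlin.
have H t (x : 'rV[R]_n) : (consr (t, x) : 'rV[R]_n.+1) *m block_mx (a%:M : 'M[R]_1) w 0 B =
    consr (t * a + 0, (x : 'rV[R]_n) *m B + t *: w).
  rewrite /consr /= (@mul_row_block _ 1 1 n) mulmx0 addr0 -scalar_mxM addr0.
  by rewrite mul_scalar_mx addrC.
under eq_integral => t _ do under eq_integral => x _ do rewrite H.
rewrite (@det_ublock _ 1 n) det_scalar1 normrM EFinM -muleA -ge0_integralZl//=; last 2 first.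
- have := @measurable_int_section n _ (mlin (block_mx (a%:M : 'M[R]_1) w 0 B) mg) (fun x => g0 _).
  by under eq_fun do under eq_integral do rewrite H.
- by move=> t _; exact: integral_ge0.
rewrite -[RHS](@lebesgue_affine a 0)//; last 2 first.
- exact: measurable_int_section.
- by move=> t; exact: integral_ge0.
congr (_ * _)%E; apply: eq_integral => t _.
set s := (_ * a + 0)%R.
have ms := measurable_section s mg.
rewrite -[RHS](leb_translate ((t : R) *: w) ms)//; rewrite -[RHS]uB//.
apply: (measurableT_comp ms); have := measurable_affine 1%:M ((t : R) *: w).
by under eq_fun do rewrite mulmx1.
Qed.

(** Here the shift of the first coordinate depends on the remaining ones, so the integral over the
    first coordinate has to be the inner one: Tonelli exchanges the order, and exchanges it back at
    the end. In the upper triangular case the given order is already the right one. *)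
Let cov_lblock n (a : R) (v : 'cV[R]_n) (B : 'M[R]_n) : a != 0 -> cov B ->
  cov (block_mx (a%:M : 'M[R]_1) 0 v B : 'M[R]_n.+1).
Proof.
move=> a0 uB g mg g0; rewrite !lebSE//; last exact: mlin.
have H t (x : 'rV[R]_n) : (consr (t, x) : 'rV[R]_n.+1) *m block_mx (a%:M : 'M[R]_1) 0 v B =
    consr (t * a + ((x : 'rV[R]_n) *m v) 0 0, (x : 'rV[R]_n) *m B).
  rewrite /consr /= (@mul_row_block _ 1 1 n) mulmx0 add0r -scalar_mxM raddfD /=.
  by congr (row_mx (_ + _) _); apply/matrixP => i j; rewrite !ord1 [RHS]mxE eqxx mulr1n.
have mgc (k : borel 'rV[R]_n.+1 -> \bar R) : measurable_fun setT k ->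
    measurable_fun setT (k \o @consr R n).
  by move=> mk; exact: (measurableT_comp mk (@measurable_consr R n)).
have mA := mgc _ (@mlin n.+1 (block_mx (a%:M : 'M[R]_1) 0 v B) g mg).
pose B1 : 'M[R]_(1 + n) := block_mx (1%:M : 'M[R]_1) 0 0 B.
have HB1 t (x : 'rV[R]_n) : (consr (t, x) : 'rV[R]_n.+1) *m B1 =
    consr (t, (x : 'rV[R]_n) *m B).
  by rewrite /consr /B1 /= (@mul_row_block _ 1 1 n) !mulmx0 add0r addr0 mulmx1.
rewrite (fubini_tonelli ((fun x : borel 'rV[R]_n.+1 => g ((x : 'rV[R]_n.+1) *m block_mx (a%:M : 'M[R]_1) 0 v B)) \o @consr R n))//; last by move=> z; exact: g0.
rewrite (@det_lblock _ 1 n) det_scalar1 normrM mulrC EFinM -muleA -ge0_integralZl//=; last 2 first.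
- apply: (@measurable_fun_fubini_tonelli_G _ _ _ _ _ (@lebesgue_measure R)
    ((fun x : borel 'rV[R]_n.+1 => g ((x : 'rV[R]_n.+1) *m _)) \o @consr R n)).
  exact: mA.
  by move=> z; exact: g0.
- by move=> x _; exact: integral_ge0.
transitivity (`|\det B|%:E * \int[leb R n]_x \int[@lebesgue_measure R]_t
    g (consr (t, ((x : 'rV[R]_n) *m B)%R)))%E.
  congr (_ * _)%E; apply: eq_integral => x _.
  rewrite -[RHS](@lebesgue_affine a (((x : 'rV[R]_n) *m v) 0 0))//; last first.
    apply: (measurableT_comp mg); apply: (measurableT_comp (@measurable_consr R n)).
    exact: measurable_fun_pair.
  by congr (_ * _)%E; apply: eq_integral => t _; rewrite H.
rewrite -(fubini_tonelli (fun z : measurableTypeR R * borel 'rV[R]_n => g (consr (z.1, ((z.2 : 'rV[R]_n) *m B)%R))))//; last first.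
  rewrite (_ : (fun z => _) = (fun x : borel 'rV[R]_n.+1 => g ((x : 'rV[R]_n.+1) *m B1)) \o @consr R n).
    exact: (mgc _ (@mlin n.+1 B1 _ mg)).
  by apply/funext => -[t x]; rewrite /= HB1.
rewrite -ge0_integralZl//=.
- by apply: eq_integral => t _; exact: (uB _ (measurable_section t mg)).
- have := @measurable_int_section n _ (@mlin n.+1 B1 _ mg) (fun x => g0 _).
  by under eq_fun do under eq_integral do rewrite HB1.
- by move=> t _; exact: integral_ge0.
Qed.

(** Induction on the dimension: both block triangular factors of an elimination step are covered,
    the Schur complement [S] being invertible of size n. When the corner entry vanishes, a row with
    nonzero first entry is added to the top row, which is again multiplication by a block triangular
    matrix. *)
Lemma leb_linear n (A : 'M[R]_n) (f : borel 'rV[R]_n -> \bar R) :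
  A \in unitmx -> measurable_fun setT f -> (forall x, (0 <= f x)%E) ->
  (`|\det A|%:E * \int[leb R n]_x f ((x : 'rV[R]_n) *m A)%R = \int[leb R n]_x f x)%E.
Proof.
move=> uA; move: f; rewrite -/(cov A); elim: n A uA => [|n IH] A uA.
  by move=> f mf f0; rewrite !leb0E det_mx00 normr1 mul1e mul0mx.
have unz m (B : 'M[R]_m) : (B \in unitmx) = (\det B != 0) by rewrite unitmxE unitfE.
have cov1 : cov (1%:M : 'M[R]_n).
  by move=> f mf f0; rewrite det1 normr1 mul1e; under eq_integral do rewrite mulmx1.
(* block LU factorisation when the upper left entry does not vanish *)
have main (B : 'M[R]_(1 + n)) : B \in unitmx -> B 0 0 != 0 -> cov B.
  move=> uB b0; pose a := B 0 0; pose w := ursubmx B; pose v := dlsubmx B.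
  pose S := drsubmx B - a^-1 *: (v *m w).
  have Ba : ulsubmx B = (a%:M : 'M[R]_1).
    by apply/matrixP => i j; rewrite !ord1 !mxE eqxx mulr1n; congr (B _ _); exact: val_inj.
  have E : B = block_mx (1%:M : 'M[R]_1) 0 (a^-1 *: v) 1%:M *m block_mx (a%:M : 'M[R]_1) w 0 S.
    rewrite mulmx_block !mul1mx !mul0mx !addr0.
    rewrite mul_mx_scalar scalerA divff// scale1r -scalemxAl addrC subrK.
    by rewrite -{1}(submxK B) Ba.
  rewrite E; apply: cov_mul; first exact: cov_lblock (oner_neq0 _) cov1.
  apply: cov_ublock => //; apply: IH; move: uB; rewrite !unz E det_mulmx.
  by rewrite (@det_lblock _ 1 n) !det1 !mul1r (@det_ublock _ 1 n) det_scalar1 mulf_eq0 negb_or => /andP[].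
have [A0|A0] := eqVneq (A 0 0) 0; last exact: main.
(* Otherwise the first column is zero, and so is the determinant. *)
have [i Ai] : exists i, A (lift ord0 i) 0 != 0.
  apply: contrapT => h; move: uA; rewrite unz (expand_det_col _ 0) big1 ?eqxx// => j _.
  case: (unliftP ord0 j) => [k ->|->]; last by rewrite A0 mul0r.
  by have [->|hk] := eqVneq (A (lift ord0 k) 0) 0; [rewrite mul0r|case: h; exists k].
pose e : 'rV[R]_n := delta_mx 0 i.
pose E (s : R) : 'M[R]_(1 + n) := block_mx (1%:M : 'M[R]_1) (s *: e) 0 1%:M.
have EE : E (-1) *m E 1 = 1%:M.
  rewrite mulmx_block !mul1mx !mul0mx !mulmx1 !mulmx0 !addr0 add0r scale1r scaleN1r subrr.
  by rewrite -scalar_mx_block.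
have detE s : \det (E s) = 1 by rewrite (@det_ublock _ 1 n) !det1 mulr1.
have -> : A = E (-1) *m (E 1 *m A) by rewrite mulmxA EE mul1mx.
apply: cov_mul; first exact: cov_ublock (oner_neq0 _) cov1.
apply: main; first by rewrite unz det_mulmx detE mul1r -unz.
rewrite mxE big_ord_recl /= A0 mulr0 add0r (bigD1 i)//= big1 ?addr0; last first.
  move=> j ji; rewrite (_ : E 1 0 (lift ord0 j) = 0) ?mul0r//.
  have -> : lift ord0 j = rshift 1 j by apply: val_inj.
  have -> : (0 : 'I_(1 + n)) = lshift n (0 : 'I_1) by apply: val_inj.
  by rewrite block_mxEur !mxE eqxx (negbTE ji) mulr0.
rewrite (_ : E 1 0 (lift ord0 i) = 1) ?mul1r//.
have -> : lift ord0 i = rshift 1 i by apply: val_inj.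
have -> : (0 : 'I_(1 + n)) = lshift n (0 : 'I_1) by apply: val_inj.
by rewrite block_mxEur !mxE !eqxx mulr1.
Qed.

End LebLinear.

(** * Cubes and compact sets *)

Section NormRV.
Variable R : realType.

Lemma ler_rVP n (x : 'rV[R]_n) (r : R) : 0 <= r -> (`|x| <= r <-> forall j, `|x 0 j| <= r).
Proof.
move=> r0; rewrite /Num.Def.normr /= mx_normrE; split => [h j|h].
  by apply: le_trans h; apply: (le_bigmax _ (fun ij : 'I_1 * 'I_n => `|x ij.1 ij.2|) (0, j)).
rewrite (bigmax_le _ r0)//= => -[i j] _; rewrite (ord1 i); exact: h.
Qed.

Lemma ltr_rVP n (x : 'rV[R]_n) (r : R) : 0 < r -> (`|x| < r <-> forall j, `|x 0 j| < r).
Proof.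
move=> r0; rewrite /Num.Def.normr /= mx_normrE; split => [h j|h].
  by apply: le_lt_trans h; apply: (le_bigmax _ (fun ij : 'I_1 * 'I_n => `|x ij.1 ij.2|) (0, j)).
rewrite (bigmax_lt _ r0)//= => -[i j] _; rewrite (ord1 i); exact: h.
Qed.

Lemma ler_coord n (x : 'rV[R]_n) j : `|x 0 j| <= `|x|.
Proof. by move: j; apply/ler_rVP. Qed.

Lemma compact_rV_ball n (r : R) : compact [set x : 'rV[R]_n | `|x| <= r].
Proof.
apply: bounded_closed_compact.
  exists r; split; first exact: num_real.
  by move=> M rM x /= /le_trans; apply; exact: ltW.
rewrite (_ : [set _ | _] = (fun x : 'rV[R]_n => `|x|) @^-1` [set t | t <= r]) //.
by apply: closed_comp => [x _|]; [exact: norm_continuous|exact: closed_le].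
Qed.

(** Balls of the sup norm are cubes of side 2 r; in dimension 0 the ball is the single point
    carrying the Dirac mass. *)
Lemma leb_ball n (r : R) : 0 < r ->
  leb R n [set x | `|x : 'rV[R]_n| < r] = ((2 * r) ^+ n)%:E.
Proof.
move=> r0; elim: n => [|n IH].
  by rewrite /= expr0 diracE mem_set//= normr0.
transitivity (\int[@lebesgue_measure R]_t (((2 * r) ^+ n)%:E * (\1_(ball (0 : R) r) t)%:E))%E.
  rewrite -lebesgueNE /=; apply: eq_integral => t _; rewrite lebesgueNE.
  have H (x : 'rV[R]_n) : (`|consr (t, x) : 'rV[R]_n.+1| < r) <-> (`|t : R| < r /\ `|x| < r).
    rewrite !ltr_rVP//; split => [h|[ht hx] j].
      by split => [|j]; [have := h 0; rewrite consr0|have := h (lift ord0 j); rewrite consr_lift].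
    by case: (unliftP ord0 j) => [i ->|->]; rewrite ?consr0// consr_lift; exact: hx.
  rewrite indicE; case: (boolP (t \in (ball (0 : R) r : set R))) => [|/negP]; rewrite inE /ball /= sub0r normrN => ht.
    by rewrite mule1 -IH; congr (leb R n _); apply/seteqP; split => x /=; [move/H => []|move=> hx; apply/H].
  rewrite mule0 (_ : [set _ | _] = set0) ?measure0//.
  by apply/seteqP; split => x //= /H[].
rewrite ge0_integralZl//; last 2 first.
- by apply/measurable_EFinP; apply: measurable_indic; exact: measurable_ball.
- by rewrite lee_fin exprn_ge0// mulr_ge0// ltW.
rewrite integral_indic//; last exact: measurable_ball.
rewrite setIT [X in (_ * X)%E](_ : _ = (r *+ 2)%:E); last first.
  exact: (lebesgue_measure_ball _ (ltW r0)).
by rewrite -EFinM -(mulr_natl r 2) exprSr.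
Qed.

Lemma leb_compact n (K : set 'rV[R]_n) : compact K -> (leb R n K < +oo)%E.
Proof.
move=> cK; have [M [_ hM]] := compact_bounded cK.
have M0 : 0 < `|M| + 2 by rewrite ltr_wpDl.
apply: (@le_lt_trans _ _ (leb R n [set x | `|x : 'rV[R]_n| < `|M| + 2])).
  apply: le_measure; rewrite ?inE.
  - by apply: borel_compact => //; exact: norm_hausdorff.
  - apply: borel_open; rewrite (_ : [set _ | _] = (fun x : 'rV[R]_n => `|x|) @^-1` [set t | t < `|M| + 2])//.
    by apply: open_comp => [x _|]; [exact: norm_continuous|exact: open_lt].
  - move=> x /(hM (`|M| + 1)) /= h; apply: le_lt_trans (h _) _; last by rewrite ltrD2l ltr1n.
    by rewrite (le_lt_trans (ler_norm M))// ltrDl.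
by rewrite leb_ball// ltry.
Qed.

Lemma compact_rV_bounded n (K : set 'rV[R]_n) : compact K ->
  exists2 r : R, 0 < r & K `<=` [set x | `|x| <= r].
Proof.
move=> /compact_bounded[M [_ hM]]; exists (`|M| + 1); first by rewrite ltr_wpDl.
by move=> x /(hM (`|M| + 1)); apply; rewrite (le_lt_trans (ler_norm M))// ltrDl.
Qed.

(** Compactness in its near-covering form gives one radius for which every ball centred in [K] stays
    in [U]; [K'] is the sum of [K] and a smaller closed ball, a continuous image of a compact
    product. *)
Lemma compact_thicken n (U K : set 'rV[R]_n) : open U -> compact K -> K `<=` U ->
  exists2 r : R, 0 < r & exists K' : set 'rV[R]_n, [/\ compact K', K' `<=` U &
    forall x y, K x -> `|x - y| <= r -> K' y].
Proof.
move=> oU cK KU.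
have := (compact_near_coveringP K).1 cK R (nbhs 0^'+) (fun r x => ball x r `<=` U) _.
case=> [x Kx|r /= r0 hr].
  have /nbhs_ballP[e /= e0 xe] := open_nbhs_nbhs (conj oU (KU _ Kx)).
  exists (ball x (e/2), ball 0 (e/2)) => /=.
    split; first by apply: nbhsx_ballx; rewrite divr_gt0.
    by exists (e/2) => /=; [rewrite divr_gt0|move=> t ? _].
  move=> [y s] /= [xy hs] z yz; apply: xe; rewrite (splitr e).
  apply: ball_triangle xy _; apply: le_ball yz.
  by move: hs; rewrite /ball /= sub0r normrN => /(le_lt_trans (ler_norm _))/ltW.
have r2 : 0 < r / 2 by rewrite divr_gt0.
pose K' := (fun z : 'rV[R]_n * 'rV[R]_n => z.1 + z.2) @` (K `*` [set x | `|x| <= r / 2 / 2]).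
exists (r / 2 / 2); first by rewrite divr_gt0.
exists K'; split.
- apply: continuous_compact; last first.
    by apply: compact_setX => //; exact: compact_rV_ball.
  apply: continuous_subspaceT => z; apply: add_continuous.
- move=> _ [[x y] [/= Kx xy] <-].
  have := hr (r / 2); rewrite /ball_ /= sub0r normrN gtr0_norm// => /(_ _ r2 x Kx); apply.
    by rewrite ltr_pdivrMr// ltr_pMr// ltr1n.
  rewrite -ball_normE /ball_ /= opprD addrA subrr sub0r normrN; apply: le_lt_trans xy _.
  by rewrite ltr_pdivrMr// ltr_pMr// ltr1n.
- move=> x y Kx xy; exists (x, y - x); last by rewrite /= addrC subrK.
  by split => //=; rewrite distrC.
Qed.

End NormRV.

Lemma tent_continuous (R : realType) n (c : 'rV[R]_n) (r : R) :
  continuous (fun x : 'rV[R]_n => Num.max 0 (r - `|c - x|)).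
Proof.
move=> x; apply: (@continuous_max _ _ (fun=> 0) (fun y : 'rV[R]_n => r - `|c - y|)); first exact: cst_continuous.
apply: (@continuousB _ R^o 'rV[R]_n (fun=> r) (fun y => `|c - y|)); first exact: cst_continuous.
apply: continuous_comp; last exact: norm_continuous.
by apply: (@continuousB _ _ 'rV[R]_n (fun=> c) id); [exact: cst_continuous|exact: cvg_id].
Qed.

(** * Borel measures determined by continuous functions *)

Section BorelUnique.
Variables (R : realType) (n : nat).
Implicit Types (U V K : set 'rV[R]_n) (mu nu : {measure set (borel 'rV[R]_n) -> \bar R}).

Definition supported_in U (f : 'rV[R]_n -> R) :=
  exists K, [/\ compact K, K `<=` U & forall x, ~ K x -> f x = 0].

Lemma supported_in_max U f g : supported_in U f -> supported_in U g ->
  supported_in U (fun x => Num.max (f x) (g x)).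
Proof.
move=> [K [cK KU fK]] [L [cL LU gL]]; exists (K `|` L); split.
- exact: compactU.
- by move=> x [/KU|/LU].
- by move=> x /not_orP[/fK-> /gL->]; rewrite maxxx.
Qed.

Lemma continuous_rV_max (f g : 'rV[R]_n -> R) : continuous f -> continuous g ->
  continuous (fun x => Num.max (f x) (g x)).
Proof. by move=> cf cg x; apply: (@continuous_max _ _ f g); [exact: cf|exact: cg]. Qed.

(* An open set is an increasing union of positivity sets of continuous
   functions with compact support. *)
Lemma open_exhaustion V : open V -> exists H : nat -> 'rV[R]_n -> R,
  [/\ forall k, continuous (H k) /\ supported_in V (H k), forall k x, 0 <= H k x,
    forall k l x, (k <= l)%N -> H k x <= H l x &
    V = \bigcup_k [set x | 0 < H k x]].
Proof.
move=> oV.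
pose h (ik : 'rV[rat]_n * nat) (x : 'rV[R]_n) : R :=
  Num.max 0 (1 * ik.2.+1%:R^-1 - `|map_mx ratr ik.1 - x|).
(* The rational balls whose double lies in [V] are enumerated by [unpickle]; every other index
   contributes the zero function. *)
pose g (i : nat) (x : 'rV[R]_n) : R := if choice.unpickle i is Some ik then
  (if `[< ball (map_mx ratr ik.1 : 'rV[R]_n) (2 * ik.2.+1%:R^-1) `<=` V >] then h ik x else 0) else 0.
have g0 i x : 0 <= g i x.
  by rewrite /g; case: choice.unpickle => // ik; case: ifP => // _; rewrite le_max lexx.
have sg i : continuous (g i) /\ supported_in V (g i).
  have z : continuous (fun _ : 'rV[R]_n => 0 : R) /\ supported_in V (fun _ => 0).
    split; first by move=> x; exact: cst_continuous.
    by exists set0; split => //; exact: compact0.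
  rewrite /g; case: choice.unpickle => // ik; case: asboolP => // hV; split.
    exact: tent_continuous.
  exists [set x | `|map_mx ratr ik.1 - x| <= ik.2.+1%:R^-1]; split.
  - rewrite (_ : [set _ | _] = (fun x => map_mx ratr ik.1 - x) @` [set x : 'rV[R]_n | `|x| <= ik.2.+1%:R^-1]).
      apply: continuous_compact; last exact: compact_rV_ball.
      apply: continuous_subspaceT => x.
      by apply: (@continuousB _ _ 'rV[R]_n (fun=> map_mx ratr ik.1) id); [exact: cst_continuous|exact: cvg_id].
    apply/seteqP; split => [x /= hx|_ [x hx <-]]; last by rewrite /= opprB addrC subrK.
    by exists (map_mx ratr ik.1 - x) => //; rewrite opprB addrC subrK.
  - move=> x /= hx; apply: hV; rewrite -ball_normE /ball_ /=; apply: le_lt_trans hx _.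
    by rewrite ltr_pMl ?invr_gt0// ltr1n.
  - move=> x /= /negP; rewrite -ltNge => hx; rewrite /h max_l// mul1r subr_le0; exact: ltW.
pose fix H (k : nat) (x : 'rV[R]_n) {struct k} : R := if k is k'.+1 then Num.max (H k' x) (g k' x) else 0.
have HS k x : H k x <= H k.+1 x by rewrite /= le_max lexx.
have Hg k x : g k x <= H k.+1 x by rewrite /= le_max lexx orbT.
have Hmono k l x : (k <= l)%N -> H k x <= H l x.
  by apply: (homo_leq (f := fun k => H k x) (r := <=%R)) => // ? ? ?; exact: le_trans.
have sH k : continuous (H k) /\ supported_in V (H k).
  elim: k => [|k [cH tH]].
    split; first by move=> x; exact: cst_continuous.
    by exists set0; split => //; exact: compact0.
  split; first by apply: continuous_rV_max => //; exact: (sg k).1.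
  by apply: supported_in_max => //; exact: (sg k).2.
exists H; split => // [k x|]; first exact: (Hmono 0%N).
apply/seteqP; split => x.
  rewrite {1}(open_rV_bigcup oV) => -[ik /= ikV xik].
  exists (choice.pickle ik).+1 => //=; rewrite lt_max; apply/orP; right.
  rewrite /g choice.pickleK; case: asboolP => // _; rewrite /h lt_max; apply/orP; right.
  by rewrite subr_gt0; move: xik; rewrite -ball_normE.
move=> [k _ /= hk]; have [K [_ KV hK]] := (sH k).2; apply: KV; apply: contrapT => /hK h0.
by rewrite h0 ltxx in hk.
Qed.

(** Agreement propagates in three stages: to positivity sets of continuous functions by monotone
    convergence, to open subsets of [U] by [open_exhaustion], and to Borel sets because open sets
    form a generating class stable under intersection. *)
Lemma borel_measure_unique U mu nu : open U ->
  (forall K, compact K -> K `<=` U -> (mu K < +oo)%E) ->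
  (forall f : 'rV[R]_n -> R, continuous f -> supported_in U f -> (forall x, 0 <= f x) ->
    (\int[mu]_x (f x)%:E = \int[nu]_x (f x)%:E)%E) ->
  forall B : set (borel 'rV[R]_n), measurable B -> B `<=` U -> mu B = nu B.
Proof.
move=> oU muK muf.
have opos (h : 'rV[R]_n -> R) : continuous h -> open [set x | 0 < h x].
  move=> ch; rewrite (_ : [set _ | _] = h @^-1` [set t | 0 < t])//.
  by apply: open_comp => [x _|]; [exact: ch|exact: open_gt].
have pos h : continuous h -> supported_in U h -> (forall x, 0 <= h x) ->
    mu [set x | 0 < h x] = nu [set x | 0 < h x].
  move=> ch [K [cK KU hK]] h0.
  have mp : measurable ([set x | 0 < h x] : set (borel 'rV[R]_n)) by apply: borel_open; apply: opos.
  (* These functions increase to the indicator of the set where [h] is positive. *)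
  pose f k x : R := Num.min 1 (k%:R * h x).
  have fc k : continuous (f k).
    move=> x; apply: (@continuous_min _ _ (fun=> 1) (fun x => k%:R * h x)); first exact: cst_continuous.
    by apply: (@continuousM _ _ (fun=> k%:R) h); [exact: cst_continuous|exact: ch].
  have f0 k x : 0 <= f k x by rewrite /f le_min ler01 mulr_ge0.
  have E (m : {measure set (borel 'rV[R]_n) -> \bar R}) :
      m [set x | 0 < h x] = limn (fun k => \int[m]_x (f k x)%:E)%E.
    rewrite -monotone_convergence//.
    - transitivity (\int[m]_x (\1_[set x | 0 < h x] x)%:E)%E; first by rewrite integral_indic// setIT.
      apply: eq_integral => x _; apply/esym/cvg_lim => //; rewrite indicE.
      case: (ltgtP 0 (h x)) => hx.
      + rewrite mem_set//=; apply: cvg_near_cst; near=> k; rewrite /f min_l// -ler_pdivrMr//.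
        by near: k; exact: nbhs_infty_ger.
      + by have := h0 x; rewrite leNgt hx.
      + rewrite memNset /=; last by rewrite -hx ltxx.
        by rewrite /f -hx; under eq_fun do rewrite mulr0 min_r//; exact: cvg_cst.
    - by move=> k; apply/measurable_EFinP; exact: continuous_borelRT.
    - by move=> k x _; rewrite lee_fin.
    - move=> x _ k l kl; rewrite lee_fin /f le_min ge_min lexx/= ge_min; apply/orP; right.
      by rewrite ler_wpM2r// ler_nat.
  rewrite !E; congr (limn _); apply/funext => k; apply: muf => //.
  by exists K; split => // x /hK; rewrite /f => ->; rewrite mulr0 min_r.
have lim (m : {measure set (borel 'rV[R]_n) -> \bar R}) (H : nat -> 'rV[R]_n -> R) (B : set (borel 'rV[R]_n)) :
    measurable B -> (forall k, continuous (H k)) -> (forall k l x, (k <= l)%N -> H k x <= H l x) ->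
    (fun k => m (B `&` [set x | 0 < H k x])) @ \oo --> m (B `&` \bigcup_k [set x | 0 < H k x]).
  move=> mB cH Hm; rewrite setI_bigcupr; apply: nondecreasing_cvg_mu.
  - by move=> k; apply: measurableI => //; apply: borel_open; apply: opos.
  - by apply: bigcupT_measurable => k; apply: measurableI => //; apply: borel_open; apply: opos.
  - move=> k l kl; apply/subsetPset => x [Bx /= hx]; split => //=.
    by apply: lt_le_trans hx _; exact: Hm.
have op V : open V -> V `<=` U -> mu V = nu V.
  move=> oV VU; have [H [cH H0 Hm ->]] := open_exhaustion oV.
  have l (m : {measure set (borel 'rV[R]_n) -> \bar R}) : (fun k => m [set x | 0 < H k x]) @ \oo --> m (\bigcup_k [set x | 0 < H k x]).
    have := @lim m H setT measurableT (fun k => (cH k).1) Hm; rewrite setTI.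
    by under eq_fun do rewrite setTI.
  have E : (fun k => mu [set x | 0 < H k x]) = (fun k => nu [set x | 0 < H k x]).
    apply/funext => k; apply: pos; [exact: (cH k).1| |exact: H0].
    by have [K [cK KV hK]] := (cH k).2; exists K; split => // x /KV/VU.
  by have := l mu; rewrite E => h; exact: (cvg_unique _ h (l nu)).
move=> B mB BU; have [H [cH H0 Hm UH]] := open_exhaustion oU.
have mH k : measurable ([set x | 0 < H k x] : set (borel 'rV[R]_n)).
  by apply: borel_open; apply: opos; exact: (cH k).1.
have HU k : [set x | 0 < H k x] `<=` U by move=> x hx; rewrite UH; exists k.
have Bk k : mu (B `&` [set x | 0 < H k x]) = nu (B `&` [set x | 0 < H k x]).
  change (mrestr mu (mH k) B = mrestr nu (mH k) B).
  (* Both measures are restricted to the positivity set of [H k]; it lies in a compact subset of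
     [U], which provides the finiteness required here. *)
  apply: (@measure_unique _ R (borel 'rV[R]_n) (@open 'rV[R]_n) (fun=> setT)) => //.
  - exact: openI.
  - by move=> i; exact: openT.
  - by rewrite bigcup_const.
  - move=> A oA; apply: op; first by apply: openI => //; apply: opos; exact: (cH k).1.
    by move=> x [_ /HU].
  - move=> i; rewrite /= /mrestr /= setTI; have [K [cK KU hK]] := (cH k).2.
    apply: le_lt_trans (muK K cK KU); apply: le_measure; rewrite ?inE//.
      by apply: borel_compact => //; exact: norm_hausdorff.
    by move=> x /= hx; apply: contrapT => /hK h0; rewrite h0 ltxx in hx.
have l m := @lim m H B mB (fun k => (cH k).1) Hm.
have E : B `&` \bigcup_k [set x | 0 < H k x] = B by rewrite -UH; exact/setIidPl.
rewrite E in l; have := l mu; under eq_fun do rewrite Bk.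
by move=> h; exact: (cvg_unique _ h (l nu)).
Unshelve. all: by end_near. Qed.

End BorelUnique.

(** * Functions of class C^k *)

Lemma near_eq_continuous (T S : topologicalType) (f g : T -> S) (x : T) :
  (\near x, f x = g x) -> {for x, continuous f} -> {for x, continuous g}.
Proof.
move=> fg cf; have e : f x = g x := nbhs_singleton fg.
rewrite /prop_for /continuous_at -e; apply: cvg_trans cf; apply: near_eq_cvg.
by apply: filterS fg.
Qed.

Section Calculus.
Variable R : realType.

Lemma derivable_line (V W : normedModType R) (f : V -> W) (z v : V) (t : R) :
  derivable f (z + t *: v) v -> is_derive t (1 : R) (fun s => f (z + s *: v)) ('D_v f (z + t *: v)).
Proof.
move=> df.
have E : (fun h : R => h^-1 *: (((fun s => f (z + s *: v)) \o shift t) (h *: 1) - f (z + t *: v))) =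
    (fun h => h^-1 *: ((f \o shift (z + t *: v)) (h *: v) - f (z + t *: v))).
  apply/funext => h; rewrite /shift /=; congr (_ *: (f _ - _)).
  by rewrite [h *: 1]mulr1 scalerDl addrCA.
by apply: DeriveDef; rewrite /derivable /derive E.
Qed.

(** The intermediate point is located by |s| <= |c|, so that increments of either sign are served by
    one statement. *)
Lemma line_MVT (V : normedModType R) (f : V -> R) (z v : V) (c : R) :
  (forall s : R, `|s| <= `|c| -> derivable f (z + s *: v) v) ->
  exists2 s : R, `|s| <= `|c| & f (z + c *: v) - f z = c * 'D_v f (z + s *: v).
Proof.
move=> df; pose g s := f (z + s *: v).
have dg (s : R) : `|s| <= `|c| -> is_derive s (1 : R) g ('D_v f (z + s *: v)).
  by move=> /df; exact: derivable_line.
have cg a b : (forall s, a <= s <= b -> `|s| <= `|c|) -> {within `[a, b], continuous g}.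
  move=> h; apply: derivable_within_continuous => s /[!in_itv]/= /h /dg sd.
  exact: ex_derive.
have g0 : g 0 = f z by rewrite /g scale0r addr0.
rewrite -g0; change (exists2 s : R, `|s| <= `|c| & g c - g 0 = c * 'D_v f (z + s *: v)).
have [c0|c0] := leP 0 c.
- have hs s : 0 <= s <= c -> `|s| <= `|c| by move=> /andP[s0 sc]; rewrite !ger0_norm.
  have H s : s \in `]0, c[ -> is_derive s (1 : R) g ('D_v f (z + s *: v)).
    by rewrite in_itv/= => /andP[/ltW s0 /ltW sc]; apply: dg; rewrite hs// s0.
  have [s] := MVT_segment c0 H (cg _ _ hs).
  by rewrite in_itv /= => /hs hs' ->; exists s => //; rewrite subr0 mulrC.
- have hs s : c <= s <= 0 -> `|s| <= `|c|.
    by move=> /andP[s0 sc]; rewrite !ler0_norm ?lerN2// ltW.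
  have H s : s \in `]c, 0[ -> is_derive s (1 : R) g ('D_v f (z + s *: v)).
    by rewrite in_itv/= => /andP[/ltW s0 /ltW sc]; apply: dg; rewrite hs// s0.
  have [s] := MVT_segment (ltW c0) H (cg _ _ hs).
  rewrite in_itv /= => /hs hs' E; exists s => //.
  by rewrite -opprB E sub0r mulrN opprK mulrC.
Qed.

Variable n : nat.
Implicit Types (f g : 'rV[R]_n -> R) (x : 'rV[R]_n) (U : set 'rV[R]_n).

(** The increment from x to x + h is split into n legs parallel to the axes, each controlled by the
    mean value theorem and the continuity of one partial derivative. *)
Lemma C1_differentiable f x :
  (\forall y \near x, forall i, derivable f y (delta_mx 0 i)) ->
  (forall i, {for x, continuous (partial i f)}) -> differentiable f x.
Proof.
move=> df cf.
pose L (v : 'rV[R]_n) : R := \sum_i v 0 i * partial i f x.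
have Llin : linear L.
  move=> a u v; rewrite /L scaler_sumr -big_split /=; apply: eq_bigr => i _.
  by rewrite !mxE mulrDl -mulrA.
pose LL : {linear 'rV[R]_n -> R} := HB.pack L (GRing.isLinear.Build _ _ _ _ L Llin).
have cL : continuous LL.
  apply: (@linear_bounded_continuous _ _ _ LL).1; apply/linear_boundedP.
  exists (\sum_i `|partial i f x|); split; first exact: num_real.
  move=> M hM v; rewrite /LL /= /L; apply: le_trans (ler_norm_sum _ _ _) _.
  apply: (@le_trans _ _ (\sum_i `|partial i f x| * `|v|)).
    by apply: ler_sum => i _; rewrite normrM mulrC ler_wpM2l// ler_coord.
  by rewrite -mulr_suml ler_wpM2r// ltW.
have dL : (f : 'rV[R]_n -> R^o) \o shift x = cst (f x) + (LL : 'rV[R]_n -> R^o) +o_ (0 : 'rV[R]_n) id.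
  apply/eqaddoP => _/posnumP[e].
  (* Each of the n legs may cost d |h|; the successor keeps the denominator nonzero when n = 0. *)
  pose d := e%:num / n.+1%:R; have d0 : 0 < d by rewrite divr_gt0.
  have : \forall y \near x, forall i, derivable f y (delta_mx 0 i) /\ `|partial i f y - partial i f x| <= d.
    near=> y => i; split; first by move: i; near: y.
    rewrite distrC; move: i; near: y; apply: filter_forall => i.
    by have /cvgrPdist_le := cf i; apply.
  move=> /nbhs_ballP[r /= r0 hr].
  near=> h; have hr' : `|h| < r.
    by near: h; apply/nbhs_ballP; exists r => //= h; rewrite -ball_normE /ball_ /= sub0r normrN.
  (* [hk k] keeps the first k coordinates of h, so that consecutive points differ along one axis. *)
  pose hk (k : nat) : 'rV[R]_n := \row_j (if (j < k)%N then h 0 j else 0).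
  have E k : (k <= n)%N -> `|f (x + hk k) - f x - \sum_(i < n | (i < k)%N) h 0 i * partial i f x| <= k%:R * (d * `|h|).
    elim: k => [_|k IH kn].
      rewrite big_pred0// mul0r subr0 (_ : hk 0%N = 0) ?addr0 ?subrr ?normr0//.
      by apply/rowP => j; rewrite !mxE.
    pose i := Ordinal kn.
    have hkS : hk k.+1 = hk k + h 0 i *: delta_mx 0 i.
      apply/rowP => j; rewrite !mxE eqxx /= ltnS leq_eqVlt.
      have [->|ji] := eqVneq j i; first by rewrite /= eqxx ltnn mulr1 add0r.
      rewrite mulr0 addr0 (_ : (j == k :> nat) = false)//.
      by apply: contra_neqF ji => /eqP jk; apply: val_inj.
    have near_h s : `|s| <= `|h 0 i| -> ball x r (x + hk k + s *: delta_mx 0 i).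
      move=> hs; rewrite -ball_normE /ball_ /= -addrA opprD addrA subrr sub0r normrN.
      apply: le_lt_trans hr'; apply/ler_rVP => // j; rewrite !mxE eqxx /=.
      have [->|ji] := eqVneq j i; first by rewrite /= ltnn mulr1 add0r (le_trans hs)// ler_coord.
      by rewrite mulr0 addr0; case: ifP => _; rewrite ?ler_coord// normr0.
    have [s hs Es] := @line_MVT _ f (x + hk k) (delta_mx 0 i) (h 0 i) (fun s hs => (hr _ (near_h s hs) i).1).
    rewrite hkS addrA; rewrite (bigD1 i) /=; last by rewrite ltnSn.
    rewrite (eq_bigl (fun j : 'I_n => (j < k)%N)); last first.
      move=> j /=; rewrite ltnS; have [->|ji] := eqVneq j i; first by rewrite /= ltnn andbF.
      rewrite andbT leq_eqVlt (_ : (j == k :> nat) = false)//.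
      by apply: contra_neqF ji => /eqP jk; apply: val_inj.
    rewrite (_ : _ - _ - _ = h 0 i * (partial i f (x + hk k + s *: delta_mx 0 i) - partial i f x) +
      (f (x + hk k) - f x - \sum_(i < n | (i < k)%N) h 0 i * partial i f x)); last first.
      have {}Es : h 0 i * partial i f (x + hk k + s *: delta_mx 0 i) = _ := esym Es.
      by rewrite mulrBr Es; ring.
    apply: le_trans (ler_normD _ _) _; rewrite -natr1 mulrDl mul1r addrC lerD ?(IH (ltnW kn))//.
    by rewrite normrM mulrC ler_pM// ?ler_coord//; exact: (hr _ (near_h s hs) i).2.
  have := E n (leqnn n); rewrite (_ : hk n = h); last by apply/rowP => j; rewrite mxE ltn_ord.
  rewrite (eq_bigl predT) => [E'|i]; last by rewrite ltn_ord.
  rewrite /= [X in `|X| <= _](_ : _ = f (x + h) - f x - \sum_i h 0 i * partial i f x); last first.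
    by rewrite !fctE /shift /= /L addrC [h + x]addrC -/(L h) /L; ring.
  apply: le_trans E' _; rewrite mulrA ler_wpM2r// /d mulrCA ler_piMr//.
  by rewrite ler_pdivrMr// mul1r ler_nat.
have dE := diff_unique cL dL.
by apply/diff_locallyP; rewrite dE.
Unshelve. all: by end_near. Qed.

Lemma derive_sum_partial f x v : differentiable f x ->
  'D_v f x = \sum_i v 0 i * partial i f x.
Proof.
move=> df; rewrite deriveE// {1}[v]row_sum_delta linear_sum; apply: eq_bigr => i _.
by rewrite linearZ /= /partial deriveE.
Qed.

Lemma differentiable_rV m (V : normedModType R) (t : V -> 'rV[R]_m) (x : V) :
  (forall l, differentiable (fun y => t y 0 l) x) -> differentiable t x.
Proof.
move=> dt; rewrite (_ : t = \sum_(l < m) (fun y => t y 0 l *: delta_mx 0 l)).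
  by apply: differentiable_sum => l; exact: differentiableZl.
by apply/funext => y; rewrite fct_sumE; exact: row_sum_delta.
Qed.

Lemma partial_comp m (t : 'rV[R]_m -> 'rV[R]_n) f (x : 'rV[R]_m) (i : 'I_m) :
  (forall l, differentiable (fun y => t y 0 l) x) -> differentiable f (t x) ->
  partial i (f \o t) x = \sum_l partial i (fun y => t y 0 l) x * partial l f (t x).
Proof.
move=> dt df; have dT := differentiable_rV dt.
rewrite /partial deriveE; last exact: differentiable_comp.
rewrite diff_comp//= -deriveE// -[X in 'D_X f _]deriveE// derive_sum_partial//.
apply: eq_bigr => l _; rewrite derive_mx; last exact: diff_derivable.
by rewrite mxE.
Qed.

Lemma Ck_open_eq k U f g : open U -> (forall x, U x -> f x = g x) -> Ck k U f -> Ck k U g.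
Proof.
move=> oU; have near_fg f' g' x : (forall x, U x -> f' x = g' x) -> U x -> \near x, f' x = g' x :> R.
  by move=> fg Ux; apply: filterS (open_nbhs_nbhs (conj oU Ux)).
elim: k f g => [|k IH] f g fg [cf df].
  by split => // x Ux; apply: near_eq_continuous (cf x Ux); exact: near_fg.
split; first by move=> x Ux; apply: near_eq_continuous (cf x Ux); exact: near_fg.
move=> i; have [d1 d2] := df i; split.
  by move=> x Ux; apply: near_eq_derivable (d1 x Ux); exact: near_fg.
by apply: IH d2 => x Ux; apply: near_eq_derive; exact: near_fg.
Qed.

Lemma Ck_sub k U V f : V `<=` U -> Ck k U f -> Ck k V f.
Proof.
move=> VU; elim: k f => [|k IH] f [cf df]; split => //; do ?by move=> x /VU; exact: cf.
by move=> i; have [d1 d2] := df i; split; [move=> x /VU; exact: d1|exact: IH].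
Qed.

Lemma Ck_continuous k U f x : Ck k U f -> U x -> {for x, continuous f}.
Proof. by case: k => [|k] [cf _]; exact: cf. Qed.

Lemma CkW k U f : Ck k.+1 U f -> Ck k U f.
Proof.
elim: k f => [|k IH] f [cf df]; split => // i; have [d1 d2] := df i; split => //.
exact: IH.
Qed.

Lemma Ck_le k l U f : (k <= l)%N -> Ck l U f -> Ck k U f.
Proof. by move=> /subnK <-; elim: (l - k)%N => // m IH /CkW. Qed.

Lemma Ck_cst k U (c : R) : Ck k U (fun=> c).
Proof.
elim: k c => [|k IH] c; split => //; do ?by move=> x _; exact: cst_continuous.
move=> i; split; first by move=> x _; exact: derivable_cst.
by rewrite (_ : partial i _ = fun=> 0)//; apply/funext => x; exact: derive_cst.
Qed.

Lemma CkD k U f g : open U -> Ck k U f -> Ck k U g -> Ck k U (fun x => f x + g x).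
Proof.
move=> oU; elim: k f g => [|k IH] f g [cf df] [cg dg].
  by split => // x Ux; apply: (@continuousD R R^o _ f g); [exact: cf|exact: cg].
split => [x Ux|i]; first by apply: (@continuousD R R^o _ f g); [exact: cf|exact: cg].
have [d1 d2] := df i; have [e1 e2] := dg i; split.
  by move=> x Ux; apply: derivableD; [exact: d1|exact: e1].
apply: Ck_open_eq oU _ (IH _ _ d2 e2) => x Ux.
by rewrite [RHS](deriveD (d1 x Ux) (e1 x Ux)).
Qed.

Lemma CkM k U f g : open U -> Ck k U f -> Ck k U g -> Ck k U (fun x => f x * g x).
Proof.
move=> oU; elim: k f g => [|k IH] f g [cf df] [cg dg].
  by split => // x Ux; apply: (@continuousM R _ f g); [exact: cf|exact: cg].
split => [x Ux|i]; first by apply: (@continuousM R _ f g); [exact: cf|exact: cg].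
have [d1 d2] := df i; have [e1 e2] := dg i; split.
  by move=> x Ux; apply: derivableM; [exact: d1|exact: e1].
have h1 := IH _ _ (CkW (conj cf df)) e2; have h2 := IH _ _ (CkW (conj cg dg)) d2.
apply: Ck_open_eq oU _ (CkD oU h1 h2) => x Ux.
by rewrite [RHS](deriveM (d1 x Ux) (e1 x Ux)).
Qed.

Lemma CkZ k U (c : R) f : open U -> Ck k U f -> Ck k U (fun x => c * f x).
Proof. by move=> oU; apply: CkM => //; exact: Ck_cst. Qed.

Lemma CkN k U f : open U -> Ck k U f -> Ck k U (fun x => - f x).
Proof.
by move=> oU hf; apply: Ck_open_eq oU _ (CkZ (-1) oU hf) => x _; rewrite mulN1r.
Qed.

Lemma CkB k U f g : open U -> Ck k U f -> Ck k U g -> Ck k U (fun x => f x - g x).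
Proof. by move=> oU hf hg; apply: CkD => //; exact: CkN. Qed.

Lemma Ck_sum k U (I : Type) (s : seq I) (P : pred I) (f : I -> 'rV[R]_n -> R) : open U ->
  (forall i, P i -> Ck k U (f i)) -> Ck k U (fun x => \sum_(i <- s | P i) f i x).
Proof.
move=> oU hf; elim: s => [|i s IH].
  by rewrite (_ : (fun x => _) = (fun=> 0)); [exact: Ck_cst|apply/funext => x; rewrite big_nil].
rewrite (_ : (fun x => _) = (fun x => if P i then f i x + \sum_(j <- s | P j) f j x
    else \sum_(j <- s | P j) f j x)); last by apply/funext => x; rewrite big_cons.
by have := hf i; case: (P i) => [/(_ isT) hi|_ //]; apply: CkD.
Qed.

Lemma Ck_prod k U (I : Type) (s : seq I) (P : pred I) (f : I -> 'rV[R]_n -> R) : open U ->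
  (forall i, P i -> Ck k U (f i)) -> Ck k U (fun x => \prod_(i <- s | P i) f i x).
Proof.
move=> oU hf; elim: s => [|i s IH].
  by rewrite (_ : (fun x => _) = (fun=> 1)); [exact: Ck_cst|apply/funext => x; rewrite big_nil].
rewrite (_ : (fun x => _) = (fun x => if P i then f i x * \prod_(j <- s | P j) f j x
    else \prod_(j <- s | P j) f j x)); last by apply/funext => x; rewrite big_cons.
by have := hf i; case: (P i) => [/(_ isT) hi|_ //]; apply: CkM.
Qed.

Lemma CkV k U f : open U -> (forall x, U x -> f x != 0) -> Ck k U f -> Ck k U (fun x => (f x)^-1).
Proof.
move=> oU f0; elim: k => [|k IH] [cf df].
  by split => // x Ux; apply: (@continuousV R _ f); [exact: f0|exact: cf].
split => [x Ux|i]; first by apply: (@continuousV R _ f); [exact: f0|exact: cf].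
have [d1 d2] := df i; split.
  by move=> x Ux; apply: derivableV; [exact: f0|exact: d1].
have hk := IH (CkW (conj cf df)).
apply: Ck_open_eq oU _ (CkN oU (CkM oU (CkM oU hk hk) d2)) => x Ux.
by rewrite [RHS](deriveV (f0 x Ux) (d1 x Ux)) -exprVn expr2 scaleNr.
Qed.

Lemma Ck_differentiable k U f x : open U -> Ck k.+1 U f -> U x -> differentiable f x.
Proof.
move=> oU [cf df] Ux; have nU := open_nbhs_nbhs (conj oU Ux).
apply: C1_differentiable => [|i]; last exact: Ck_continuous (df i).2 Ux.
by near=> y => i; apply: (df i).1; near: y.
Unshelve. all: by end_near. Qed.

Lemma derive_comp1 (h : R -> R) f x v (dh : R) : differentiable f x ->
  is_derive (f x) 1 h dh ->
  differentiable (h \o f) x /\ 'D_v (h \o f) x = dh * 'D_v f x.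
Proof.
move=> df [hd hE]; have dh' : differentiable h (f x) by exact/derivable1_diffP.
have dc := differentiable_comp df dh'; split => //.
rewrite deriveE// diff_comp//= -[X in 'd h _ X]deriveE//.
have -> : 'D_v f x = 'D_v f x *: (1 : R) by rewrite /GRing.scale /= mulr1.
by rewrite linearZ /= -deriveE// hE /GRing.scale /= mulrC mulr1.
Qed.

Lemma Ck_det k U m (A : 'rV[R]_n -> 'M[R]_m) : open U ->
  (forall i j, Ck k U (fun x => A x i j)) -> Ck k U (fun x => \det (A x)).
Proof.
move=> oU hA; rewrite /determinant.
by apply: Ck_sum => // p _; apply: CkZ => //; apply: Ck_prod.
Qed.

Lemma Ck_invmx k U m (A : 'rV[R]_n -> 'M[R]_m) : open U ->
  (forall x, U x -> A x \in unitmx) ->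
  (forall i j, Ck k U (fun x => A x i j)) -> forall i j, Ck k U (fun x => invmx (A x) i j).
Proof.
move=> oU uA hA i j.
apply: (@Ck_open_eq _ _ (fun x => (\det (A x))^-1 * cofactor (A x) j i)) => //.
  by move=> x Ux; rewrite /invmx uA// !mxE.
apply: CkM => //.
  apply: CkV => // [x Ux|]; last exact: Ck_det.
  by rewrite -unitfE -unitmxE uA.
apply: CkM => //; first exact: Ck_cst.
apply: Ck_det => // a b; rewrite (_ : (fun x => _) = fun x => A x (lift j a) (lift i b))//.
by apply/funext => x; rewrite !mxE.
Qed.

Lemma Ck_sqrt k U f : open U -> (forall x, U x -> 0 < f x) -> Ck k U f ->
  Ck k U (fun x => Num.sqrt (f x)).
Proof.
move=> oU f0; have s0 x : U x -> 2 * Num.sqrt (f x) != 0.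
  by move=> /f0 h; rewrite mulf_neq0 ?pnatr_eq0// gt_eqF// sqrtr_gt0.
have cs g : (forall x, U x -> {for x, continuous g}) ->
    forall x, U x -> {for x, continuous (fun x => Num.sqrt (g x))}.
  by move=> cg x Ux; apply: continuous_comp; [exact: cg|exact: sqrt_continuous].
elim: k => [|k IH] hf; first by split => //; apply: cs; exact: hf.1.
split; first by apply: cs; exact: hf.1.
move=> i; have dc x (Ux : U x) := @derive_comp1 (@Num.sqrt R) f x (delta_mx 0 i) _
  (Ck_differentiable oU hf Ux) (is_derive1_sqrt (f0 x Ux)).
split; first by move=> x Ux; apply: diff_derivable; exact: (dc x Ux).1.
have hk := CkV oU s0 (CkZ 2 oU (IH (CkW hf))).
by apply: Ck_open_eq oU _ (CkM oU hk (hf.2 i).2) => x Ux; rewrite [RHS](dc x Ux).2.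
Qed.

Lemma is_derive_translate (V : normedModType R) (f : V -> R) (w y v : V) : derivable f (y + w) v ->
  is_derive y v (fun z => f (z + w)) ('D_v f (y + w)).
Proof.
move=> df.
have E : (fun h : R => h^-1 *: (((fun z => f (z + w)) \o shift y) (h *: v) - f (y + w))) =
    (fun h => h^-1 *: ((f \o shift (y + w)) (h *: v) - f (y + w))).
  by apply/funext => h; rewrite /shift /= addrA.
by apply: DeriveDef; rewrite /derivable /derive E.
Qed.

(** The second difference of [f] over a small square of side r is symmetric in the two directions;
    two applications of the mean value theorem write it as r^2 times a mixed derivative at a nearby
    point, in either order. *)
Lemma partial_sym U f x i j : open U -> Ck 2 U f -> U x ->
  partial i (partial j f) x = partial j (partial i f) x.
Proof.
move=> oU hf Ux.
have key a b e : 0 < e -> exists2 d : R, 0 < d & forall r : R, 0 < r -> r < d -> exists2 q : R,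
    f (x + r *: delta_mx 0 a + r *: delta_mx 0 b) - f (x + r *: delta_mx 0 a)
     - (f (x + r *: delta_mx 0 b) - f x) = r * (r * q) &
    `|partial b (partial a f) x - q| <= e.
  move=> e0; have [_ hab] := hf.2 a; have {}hab := hab.2 b.
  have /cvgrPdist_le /(_ _ e0) h1 := hab.2.1 x Ux.
  have [d /= d0 hd] := (nbhs_ballP _ _).1 (filterI h1 (open_nbhs_nbhs (conj oU Ux))).
  exists (d / 2) => [|r r0 rd]; first by rewrite divr_gt0.
  have inU s t : `|s| <= `|r| -> `|t| <= `|r| ->
      ball x d (x + s *: delta_mx 0 a + t *: delta_mx 0 b).
    move=> sr tr; rewrite -ball_normE /ball_ /= -addrA opprD addrA subrr sub0r normrN.
    apply: (@le_lt_trans _ _ (`|r| + `|r|)); last by rewrite gtr0_norm//; lra.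
    have de c k : `|c| <= `|r| -> `|c *: delta_mx 0 k : 'rV[R]_n| <= `|r|.
      move=> h; apply/ler_rVP => // l; rewrite !mxE eqxx /=.
      by case: eqP => _; rewrite ?mulr1// mulr0 normr0.
    by apply: le_trans (ler_normD _ _) _; apply: lerD; exact: de.
  have h0 : `|0 : R| <= `|r| by rewrite normr0.
  pose u (y : 'rV[R]_n) := f (y + r *: delta_mx 0 b) - f y.
  have du s : `|s| <= `|r| -> is_derive (x + s *: delta_mx 0 a) (delta_mx 0 a) u
      (partial a f (x + s *: delta_mx 0 a + r *: delta_mx 0 b) - partial a f (x + s *: delta_mx 0 a)).
    move=> sr; apply: is_deriveB.
      by apply: is_derive_translate; apply: (hf.2 a).1; exact: (hd _ (inU _ _ sr (lexx _))).2.
    apply: derivableP; apply: (hf.2 a).1.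
    by have := (hd _ (inU _ _ sr h0)).2; rewrite scale0r addr0.
  have [s sr Es] := @line_MVT _ u x (delta_mx 0 a) r (fun s hs => @ex_derive _ _ _ _ _ _ _ (du s hs)).
  have [t tr Et] := @line_MVT _ (partial a f) (x + s *: delta_mx 0 a) (delta_mx 0 b) r
    (fun t ht => hab.1 _ (hd _ (inU _ _ sr ht)).2).
  exists (partial b (partial a f) (x + s *: delta_mx 0 a + t *: delta_mx 0 b)).
    rewrite -Et -(@derive_val _ _ _ _ _ _ _ (du s sr)) -Es /u; ring.
  exact: (hd _ (inU _ _ sr tr)).1.
apply/eqP; rewrite -subr_eq0 -normr_le0; apply/ler_addgt0Pr => e e0; rewrite add0r.
have e2 : 0 < e / 2 by rewrite divr_gt0.
have [d1 d10 H1] := key j i _ e2; have [d2 d20 H2] := key i j _ e2.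
pose r := Num.min d1 d2 / 2.
have r0 : 0 < r by rewrite divr_gt0// lt_min d10.
have rm : r < Num.min d1 d2 by rewrite /r ltr_pdivrMr// ltr_pMr ?ltr1n// lt_min d10.
have [r1 r2] : r < d1 /\ r < d2 by move: rm; rewrite lt_min => /andP.
have [q Eq hq] := H1 r r0 r1; have [q' Eq' hq'] := H2 r r0 r2.
have qq : q = q'.
  apply: (mulfI (lt0r_neq0 r0)); apply: (mulfI (lt0r_neq0 r0)); rewrite -Eq -Eq'.
  rewrite -[x + r *: delta_mx 0 j + _]addrA [r *: delta_mx 0 j + _]addrC addrA; ring.
rewrite -qq distrC in hq'; apply: le_trans (ler_distD q _ _) _.
by rewrite (splitr e) lerD.
Qed.

End Calculus.

(** * Change of variables *)

Section Density.
Local Open Scope ereal_scope.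
Context d (T : measurableType d) (R : realType).
Variables (mu : {measure set T -> \bar R}) (w : T -> R).
Hypotheses (mw : measurable_fun setT w) (w0 : forall x, (0 <= w x)%R).

Definition density_fun (A : set T) : \bar R := \int[mu]_(x in A) (w x)%:E.

Let density0 : density_fun set0 = 0.
Proof. exact: integral_set0. Qed.

Let density_ge0 A : 0 <= density_fun A.
Proof. by apply: integral_ge0 => x _; rewrite lee_fin; exact: w0. Qed.

Let density_sigma_additive : semi_sigma_additive density_fun.
Proof.
move=> F mF tF mUF; rewrite /density_fun ge0_integral_bigcup//.
  - by apply: is_cvg_nneseries => n _ _; exact: density_ge0.
- by apply/measurable_EFinP; exact: measurable_funTS.
- by move=> x _; rewrite lee_fin.
Qed.

HB.instance Definition _ := isMeasure.Build _ _ _ density_fun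
  density0 density_ge0 density_sigma_additive.

Definition density : {measure set T -> \bar R} := density_fun.

Import HBNNSimple.

Lemma ge0_integral_density (g : T -> \bar R) : measurable_fun setT g -> (forall x, 0 <= g x) ->
  \int[density]_x g x = \int[mu]_x (g x * (w x)%:E).
Proof.
move=> mg g0.
have sf (h : {nnsfun T >-> R}) : \int[density]_x (h x)%:E = \int[mu]_x ((h x)%:E * (w x)%:E).
  transitivity (\sum_(r \in range h) \int[mu]_x (r%:E * (\1_(h @^-1` [set r]) x)%:E * (w x)%:E)).
    rewrite integralT_nnsfun sintegralE; apply: eq_fsbigr => r /[!inE] -[t _ ht].
    rewrite -[RHS]/(\int[mu]_x _).
    under [RHS]eq_integral do rewrite -muleA.
    rewrite ge0_integralZl//; last 3 first.
    - by apply: emeasurable_funM; last exact/measurable_EFinP; apply/measurable_EFinP; exact: measurable_indic.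
    - by move=> x _; rewrite mule_ge0// lee_fin.
    - by rewrite lee_fin -ht.
    congr (_ * _); rewrite /= /density_fun integral_mkcond; apply: eq_integral => x _.
    by rewrite /patch indicE; case: (x \in _); rewrite ?mul1e ?mul0e.
  rewrite -ge0_integral_fsum//; last 2 first.
  - move=> r; apply: emeasurable_funM; last exact/measurable_EFinP; apply: emeasurable_funM => //.
    by apply/measurable_EFinP; exact: measurable_indic.
  - by move=> r x _; apply: mule_ge0; [exact: nnfun_muleindic_ge0|rewrite lee_fin].
  apply: eq_integral => x _; rewrite [in RHS]fimfunE -fsumEFin// ge0_mule_fsuml//.
  by move=> r; rewrite EFinM nnfun_muleindic_ge0.
pose g_ := nnsfun_approx measurableT mg.
transitivity (limn (fun n => \int[density]_x (g_ n x)%:E)).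
  rewrite -monotone_convergence//.
  - by apply: eq_integral => x _; apply/esym/cvg_lim => //; exact: cvg_nnsfun_approx.
  - by move=> n; exact/measurable_EFinP/measurable_funP.
  - by move=> n x _; rewrite lee_fin.
  - by move=> x _ m n mn; rewrite lee_fin; exact/lefP/nd_nnsfun_approx.
under eq_fun do rewrite sf; rewrite -monotone_convergence//.
- apply: eq_integral => x _; apply/cvg_lim => //; apply: cvgeZr => //; exact: cvg_nnsfun_approx.
- by move=> n; apply: emeasurable_funM; last exact/measurable_EFinP; exact/measurable_EFinP/measurable_funP.
- by move=> n x _; rewrite mule_ge0// lee_fin.
- move=> x _ m n mn; apply: lee_wpmul2r; first (by rewrite lee_fin); rewrite lee_fin; exact/lefP/nd_nnsfun_approx.
Qed.

End Density.

Section Tools.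
Variable R : realType.

Lemma dominated_cvgR d (T : measurableType d) (mu : {measure set T -> \bar R})
    (f_ : nat -> T -> R) (f g : T -> R) :
  (forall k, measurable_fun setT (f_ k)) -> mu.-integrable setT (EFin \o g) ->
  (forall x, f_ ^~ x @ \oo --> f x) -> (forall k x, `|f_ k x| <= g x) ->
  mu.-integrable setT (EFin \o f) /\
  (\int[mu]_x (f_ k x)%:E @[k --> \oo] --> \int[mu]_x (f x)%:E)%E.
Proof.
move=> mf ig fcvg fg.
have mfl : measurable_fun setT f by apply: (@measurable_fun_cvg _ _ _ _ f_) => // x _; exact: fcvg.
have [] := @dominated_convergence _ _ _ mu setT measurableT (fun k => EFin \o f_ k)
  (EFin \o f) (EFin \o g).
- by move=> k; exact/measurable_EFinP.
- exact/measurable_EFinP.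
- by apply: aeW => x _; apply: cvg_EFin; [exact: nearW|exact: fcvg].
- exact: ig.
- by apply: aeW => x k _; rewrite lee_fin; exact: fg.
- by move=> ? _ h; split.
Qed.

Lemma mule_fin_inj (r : R) (a b : \bar R) : r != 0 -> (r%:E * a = r%:E * b)%E -> a = b.
Proof. by move=> r0 h; rewrite -[a]mul1e -[b]mul1e -(mulVf r0) EFinM -!muleA h. Qed.

Lemma compact_bound (T : topologicalType) (K : set T) (f : T -> R) : compact K ->
  (forall x, K x -> {for x, continuous f}) -> exists2 C, 0 < C & forall x, K x -> `|f x| <= C.
Proof.
move=> cK cf; have : compact (f @` K : set R^o).
  by apply: continuous_compact => //; apply: continuous_in_subspaceT => x /[!inE]; exact: cf.
move=> /compact_bounded[M [_ hM]]; exists (`|M| + 1); first by rewrite ltr_wpDl.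
move=> x Kx; apply: (hM (`|M| + 1)); last by exists x.
by rewrite (le_lt_trans (ler_norm M))// ltrDl.
Qed.

Lemma leb_affine n (c : R) (b : 'rV[R]_n) (f : borel 'rV[R]_n -> \bar R) : c != 0 ->
  measurable_fun setT f -> (forall x, (0 <= f x)%E) ->
  ((`|c| ^+ n)%:E * \int[leb R n]_x f (c *: (x : 'rV[R]_n) + b)%R = \int[leb R n]_x f x)%E.
Proof.
move=> c0 mf f0; have uc : (c%:M : 'M[R]_n) \in unitmx.
  by rewrite unitmxE det_scalar unitfE expf_neq0.
rewrite -[RHS](leb_translate b mf f0) -[RHS](leb_linear uc)//; last first.
  apply: (measurableT_comp mf); have := measurable_affine 1%:M b.
  by under eq_fun do rewrite mulmx1.
by rewrite det_scalar normrX; congr (_ * _)%E; apply: eq_integral => x _; rewrite mul_mx_scalar.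
Qed.

(** The hypothesis covers the segment prolonged backwards beyond x because [line_MVT] locates its
    point only up to sign. *)
Lemma C1_lipschitz n (f : 'rV[R]_n -> R) (x y : 'rV[R]_n) (C : R) :
  (forall t : R, `|t| <= 1 -> differentiable f (x + t *: (y - x)) /\
     forall i, `|partial i f (x + t *: (y - x))| <= C) ->
  `|f y - f x| <= n%:R * C * `|y - x|.
Proof.
move=> h; have [t|t t1] := @line_MVT _ _ f x (y - x) 1.
  by rewrite normr1 => /h[d _]; exact: diff_derivable.
rewrite scale1r mul1r [X in f X]addrC subrK => ->; rewrite normr1 in t1.
rewrite derive_sum_partial; last exact: (h t t1).1.
apply: le_trans (ler_norm_sum _ _ _) _.
apply: (@le_trans _ _ (\sum_(i < n) C * `|y - x|)).
  by apply: ler_sum => i _; rewrite normrM mulrC ler_pM// ?ler_coord//; exact: (h t t1).2.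
by rewrite sumr_const card_ord -mulrA mulr_natl.
Qed.

Lemma integrable_indic_compact n (K : set 'rV[R]_n) (C : R) : compact K ->
  (leb R n).-integrable setT (EFin \o (fun x : borel 'rV[R]_n => C * \1_K (x : 'rV[R]_n))).
Proof.
move=> cK; have mK := borel_compact (@norm_hausdorff _ _) cK.
have mI : measurable_fun setT (\1_K : borel 'rV[R]_n -> R) by exact: measurable_indic.
have mIE : measurable_fun setT (fun x : borel 'rV[R]_n => (\1_K x : R)%:E) by exact/measurable_EFinP.
apply/integrableP; split; first by apply/measurable_EFinP; exact: measurable_funM.
rewrite (_ : (fun x => _) = (fun x => `|C|%:E * (\1_K x)%:E)%E); last first.
  by apply/funext => x /=; rewrite -EFinM normrM [X in (_ * X)%R]ger0_norm.
rewrite ge0_integralZl//.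
have -> : (\int[leb R n]_x (\1_K x)%:E = leb R n K)%E by rewrite integral_indic// setIT.
by rewrite lte_mul_pinfty// leb_compact.
Qed.

End Tools.

(** * Change of variables by mollification *)

Section ChangeOfVariables.
Variables (R : realType) (n : nat).
Variables (U V : set 'rV[R]_n) (t s : 'rV[R]_n -> 'rV[R]_n).
Hypotheses (oU : open U) (oV : open V).
Hypotheses (C1t : forall l, Ck 1 U (fun x => t x 0 l)) (C1s : forall l, Ck 1 V (fun x => s x 0 l)).
Hypotheses (tK : forall x, U x -> V (t x) /\ s (t x) = x).
Hypotheses (sK : forall y, V y -> U (s y) /\ t (s y) = y).

Definition jac (f : 'rV[R]_n -> 'rV[R]_n) (x : 'rV[R]_n) : 'M[R]_n :=
  \matrix_(i, k) partial i (fun y => f y 0 k) x.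

(** A tent kernel, left unnormalised: its integral [ck] occurs on both sides of the identity and has
    only to be positive and finite. *)
Let k1 (z : 'rV[R]_n) : R := Num.max 0 (1 - `|0 - z|).

Let ck := (\int[leb R n]_z (k1 z)%:E)%E.

Let k1_ge0 z : 0 <= k1 z.
Proof. by rewrite /k1 le_max lexx. Qed.

Let k1_le1 z : k1 z <= 1.
Proof. by rewrite /k1 ge_max ler01 /= gerBl. Qed.

Let k1_supp z : k1 z != 0 -> `|z| < 1.
Proof.
apply: contra_neqT; rewrite -leNgt => h; rewrite /k1 max_l// sub0r normrN subr_le0//.
Qed.

Let mk1 : measurable_fun [set: borel 'rV[R]_n] k1.
Proof. by apply: continuous_borelRT; exact: tent_continuous. Qed.

Let ck_fin : (0 < ck < +oo)%E.
Proof.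
apply/andP; split.
  pose B := [set x : 'rV[R]_n | `|x| < 2^-1].
  have H : (0 < (2^-1)%:E * leb R n B)%E.
    by rewrite leb_ball ?invr_gt0// -EFinM lte_fin mulr_gt0 ?invr_gt0// exprn_gt0// mulr_gt0 ?invr_gt0.
  apply: (lt_le_trans H).
  have mB : measurable (B : set (borel 'rV[R]_n)).
    apply: borel_open; rewrite (_ : B = (fun x : 'rV[R]_n => `|x|) @^-1` [set t | t < 2^-1])//.
    by apply: open_comp => [x _|]; [exact: norm_continuous|exact: open_lt].
  have mI : measurable_fun setT (fun x : borel 'rV[R]_n => (\1_B x : R)%:E).
    by apply/measurable_EFinP; exact: measurable_indic.
  have -> : leb R n B = (\int[leb R n]_x (\1_B x)%:E)%E by rewrite integral_indic// setIT.
  rewrite -ge0_integralZl//.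
  apply: ge0_le_integral => //.
  - exact: measurable_funeM.
  - exact/measurable_EFinP.
  - move=> x _; rewrite -EFinM lee_fin indicE; case: (boolP (_ \in _)) => [|_]; last by rewrite mulr0.
    rewrite inE /= => hx; rewrite mulr1 /k1 le_max; apply/orP; right.
    by rewrite sub0r normrN; move: hx; rewrite /B /=; lra.
pose K := [set x : 'rV[R]_n | `|x| <= 1].
have cK : compact K by exact: compact_rV_ball.
have /integrableP[m1 h1] := integrable_indic_compact 1 cK.
apply: le_lt_trans h1; apply: ge0_le_integral => //.
- by move=> x _; rewrite lee_fin.
- exact/measurable_EFinP.
- exact: measurableT_comp.
- move=> x _; rewrite /= lee_fin mul1r indicE.
  have [/k1_supp h|] := boolP (k1 x != 0); last by move=> /negbNE/eqP ->.
  by rewrite mem_set//= ?normr1//; exact: ltW.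
Qed.

Let jac_mul x : U x -> jac t x *m jac s (t x) = 1%:M.
Proof.
move=> Ux; have [Vtx stx] := tK Ux; apply/matrixP => i k; rewrite !mxE.
have dt l : differentiable (fun x => t x 0 l) x by apply: (@Ck_differentiable _ _ 0 U).
have ds : differentiable (fun y => s y 0 k) (t x) by apply: (@Ck_differentiable _ _ 0 V).
transitivity (partial i ((fun y => s y 0 k) \o t) x).
  by rewrite (partial_comp i dt ds); apply: eq_bigr => l _; rewrite !mxE.
have nU := open_nbhs_nbhs (conj oU Ux).
rewrite /partial (@near_eq_derive _ _ _ _ (fun y : 'rV[R]_n => y 0 k)); last first.
  by apply: filterS nU => y Uy /=; rewrite (tK Uy).2.
rewrite deriveE; last exact: differentiable_coord.
have lin : linear (fun y : 'rV[R]_n => y 0 k) by move=> a u v; rewrite !mxE.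
pose L : {linear 'rV[R]_n -> R} := HB.pack (fun y : 'rV[R]_n => y 0 k) (GRing.isLinear.Build _ _ _ _ _ lin).
rewrite (_ : (fun y : 'rV[R]_n => y 0 k) = L)// diff_lin /= ?mxE ?eqxx ?(eq_sym k)//.
exact: coord_continuous.
Qed.

Let jac_unit x : U x -> jac t x \in unitmx.
Proof. by move=> Ux; have [] := mulmx1_unit (jac_mul Ux). Qed.

Let det_jac_continuous x : U x -> {for x, continuous (fun x => `|\det (jac t x)|)}.
Proof.
move=> Ux; apply: continuous_comp; last exact: norm_continuous.
apply: (@Ck_continuous _ _ 0 U) => //; apply: Ck_det => // i k.
rewrite (_ : (fun x => _) = partial i (fun y => t y 0 k)); last by apply/funext => y; rewrite mxE.
exact: ((C1t k).2 i).2.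
Qed.

(** Extension by zero off [U] turns a density and a map known on [U] into Borel functions on the
    whole space. *)
Let w : borel 'rV[R]_n -> R := fun x => if `[< U x >] then `|\det (jac t x)| else 0.
Let t0 : borel 'rV[R]_n -> borel 'rV[R]_n := fun x => if `[< U x >] then t x else 0.

Let w0 x : 0 <= w x.
Proof. by rewrite /w; case: ifP. Qed.

Let mif (T : ptopologicalType) d (S : measurableType d) (D : set T) (f g : T -> S) : open D ->
  measurable_fun (D : set (borel T)) (f : borel T -> S) ->
  measurable_fun (~` D : set (borel T)) (g : borel T -> S) ->
  measurable_fun [set: borel T] (fun x : borel T => if `[< D x >] then f x else g x).
Proof.
move=> oD mf mg; rewrite -(setUv D); apply/measurable_funU.
- exact: borel_open.
- by apply: measurableC; exact: borel_open.
split.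
- by apply: eq_measurable_fun mf => x /[!inE] Dx; case: asboolP.
- by apply: eq_measurable_fun mg => x /[!inE] Dx; case: asboolP.
Qed.

Let mw : measurable_fun setT w.
Proof.
apply: mif => //.
by apply: continuous_borelR => // x; exact: det_jac_continuous.
Qed.

Let ct x : U x -> {for x, continuous t}.
Proof.
move=> Ux; apply: differentiable_continuous; apply: differentiable_rV => l.
exact: (@Ck_differentiable _ _ 0 U).
Qed.

Let mt0 : measurable_fun setT t0.
Proof.
by apply: mif => //; apply: continuous_borel => // x; exact: ct.
Qed.

Section Kernel.
Variable f : 'rV[R]_n -> R.
Hypotheses (cf : continuous f) (f0 : forall x, 0 <= f x).
Variable K : set 'rV[R]_n.
Hypotheses (cK : compact K) (KV : K `<=` V) (fK : forall x, ~ K x -> f x = 0).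
Variables (r : R) (K' : set 'rV[R]_n).
Hypotheses (r0 : 0 < r) (cK' : compact K') (K'V : K' `<=` V).
Hypothesis hK' : forall x y, K x -> `|x - y| <= r -> K' y.

(** The double integral of F(x) k1((y - t x) / e) is computed in two ways. Over y first, it is e^n
    ck times the integral of [F]. Over x first, with x = e z + s y, it is e^n times the integral of
    [G]; as e tends to 0, [G] tends to f(y) |det J| times the integral of k1(z J), where J is the
    Jacobian of t at s y, and this is ck f(y) by the linear case. *)
Let F (x : borel 'rV[R]_n) : R := f (t0 x) * w x.
Let e (j : nat) : R := r / j.+1%:R.

Let e0 j : 0 < e j.
Proof. by rewrite divr_gt0. Qed.

Let er j : e j <= r.
Proof. by rewrite ler_pdivrMr// ler_peMr ?ler1n// ltW. Qed.

Let e_cvg : e @ \oo --> 0.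
Proof.
rewrite -(mulr0 r); apply: cvgM; first exact: cvg_cst.
exact: cvg_harmonic.
Qed.

Let F0 x : 0 <= F x.
Proof. by rewrite mulr_ge0. Qed.

Let mF : measurable_fun setT F.
Proof.
apply: measurable_funM => //; apply: measurableT_comp => //.
exact: continuous_borelRT.
Qed.

Let F_supp x : F x != 0 -> [/\ U x, K (t x) & F x = f (t x) * `|\det (jac t x)|].
Proof.
rewrite /F /w /t0; case: asboolP => [Ux|]; last by rewrite mulr0 eqxx.
by rewrite mulf_eq0 negb_or => /andP[h _]; split => //; apply: contrapT => /fK /eqP; rewrite (negbTE h).
Qed.

Let F_bound : exists2 C, 0 < C & forall x, F x <= C.
Proof.
have [C1 C10 h1] := compact_bound cK (fun x _ => @cf x).
have csK : compact (s @` K).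
  apply: continuous_compact => //; apply: continuous_in_subspaceT => y /[!inE] /KV Vy.
  apply: differentiable_continuous; apply: differentiable_rV => l.
  exact: (@Ck_differentiable _ _ 0 V).
have cdet x : (s @` K) x -> {for x, continuous (fun x => `|\det (jac t x)|)}.
  by move=> [y /KV/sK[Us _] <-]; exact: det_jac_continuous.
have [C2 C20 h2] := compact_bound csK cdet.
exists (C1 * C2) => [|x]; first exact: mulr_gt0.
have [/F_supp[Ux Kx ->]|/negbNE/eqP ->] := boolP (F x != 0); last by rewrite mulr_ge0// ltW.
apply: ler_pM => //; first by apply: le_trans (h1 _ Kx); exact: ler_norm.
rewrite -[leLHS]normr_id.
by apply: h2; exists (t x) => //; rewrite (tK Ux).2.
Qed.

(** Confines z: if the integrand is nonzero at x = e z + s y, then t x and y are at distance at most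
    e, whence |e z| = |x - s y| <= C e. This gives a dominating function independent of e. *)
Let s_lip : exists2 C, 0 < C & forall x y, K x -> `|x - y| <= r -> `|s y - s x| <= C * `|y - x|.
Proof.
have /choice[C hC] : forall il : 'I_n * 'I_n, exists C : R, 0 < C /\
    forall y, K' y -> `|partial il.1 (fun y => s y 0 il.2) y| <= C.
  move=> [i l]; have [C C0 h] := @compact_bound _ _ _ (partial i (fun y => s y 0 l)) cK'
    (fun y K'y => ((C1s l).2 i).2.1 _ (K'V K'y)).
  by exists C.
pose C0 := \sum_il C il; have C0_ge0 : 0 <= C0 by apply: sumr_ge0 => il _; apply: ltW; exact: (hC il).1.
(* The added 1 keeps the constant positive when n or [C0] is 0. *)
exists (n%:R * C0 + 1) => [|x y Kx xy]; first by rewrite ltr_wpDl// mulr_ge0.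
have h0 : 0 <= (n%:R * C0 + 1) * `|y - x| by rewrite mulr_ge0// addr_ge0// mulr_ge0.
apply/ler_rVP => // l; rewrite !mxE; apply: (@le_trans _ _ (n%:R * C0 * `|y - x|)); last first.
  by rewrite ler_wpM2r// lerDl.
apply: (@C1_lipschitz _ _ (fun y => s y 0 l)) => u u1.
have Ku : K' (x + u *: (y - x)).
  apply: (hK' Kx); rewrite opprD addrA subrr sub0r normrN normrZ.
  by apply: le_trans xy; rewrite distrC ler_piMl.
split; first exact: (@Ck_differentiable _ _ 0 V _ _ oV (C1s l) (K'V Ku)).
move=> i; apply: le_trans ((hC (i, l)).2 _ Ku) _.
by rewrite /C0 (bigD1 (i, l))//= lerDl sumr_ge0// => il _; apply: ltW; exact: (hC il).1.
Qed.

Let kern j x y : R := k1 ((e j)^-1 *: (y - t0 x)).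

Let Q j (x y : borel 'rV[R]_n) : \bar R := (F x * kern j x y)%:E.

Let Q0 j x y : (0 <= Q j x y)%E.
Proof. by rewrite lee_fin mulr_ge0// k1_ge0. Qed.

Let mQ j : measurable_fun setT (fun z : borel 'rV[R]_n * borel 'rV[R]_n => Q j z.1 z.2).
Proof.
apply/measurable_EFinP; apply: measurable_funM; first exact: (measurableT_comp mF measurable_fst).
apply: (measurableT_comp mk1); apply: measurable_rV => l.
rewrite (_ : (fun _ => _) = fun z : borel 'rV[R]_n * borel 'rV[R]_n =>
  (e j)^-1 * ((z.2 : 'rV[R]_n) 0 l - (t0 z.1 : 'rV[R]_n) 0 l)); last by apply/funext => z; rewrite !mxE.
apply: measurable_funM => //; apply: measurable_funB.
  exact: (measurableT_comp (measurable_coord l) measurable_snd).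
exact: (measurableT_comp (measurable_coord l) (measurableT_comp mt0 measurable_fst)).
Qed.

Let mQ1 j y : measurable_fun setT (fun x => Q j x y).
Proof.
have h : measurable_fun setT (fun x : borel 'rV[R]_n => (x, y)) by exact: measurable_fun_pair.
exact: (measurableT_comp (mQ j) h).
Qed.

Let mQ2 j x : measurable_fun setT (fun y => Q j x y).
Proof.
have h : measurable_fun setT (fun y : borel 'rV[R]_n => (x, y)) by exact: measurable_fun_pair.
exact: (measurableT_comp (mQ j) h).
Qed.

Let mkern j x : measurable_fun setT (fun y : borel 'rV[R]_n => (kern j x y)%:E).
Proof.
apply/measurable_EFinP; apply: (measurableT_comp mk1).
have := measurable_affine ((e j)^-1%:M) (- ((e j)^-1 *: (t0 x : 'rV[R]_n))).
by under eq_fun do rewrite mul_mx_scalar -scalerBr.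
Qed.

Let int_kern j x : (\int[leb R n]_y (kern j x y)%:E = (e j ^+ n)%:E * ck)%E.
Proof.
have en : e j != 0 by rewrite gt_eqF.
have L := @leb_affine _ n (e j) (t0 x) (fun y => (kern j x y)%:E) en (mkern j x)
  (fun y => k1_ge0 _).
rewrite -L (gtr0_norm (e0 j)).
apply: (congr1 (fun u => (e j ^+ n)%:E * u)%E); apply: eq_integral => z _.
by rewrite /kern addrK scalerA mulVf ?scale1r.
Qed.

Let G j (y : borel 'rV[R]_n) := (\int[leb R n]_z Q j (e j *: (z : 'rV[R]_n) + s y)%R y)%E.

Let mG j : measurable_fun setT (G j).
Proof.
rewrite (_ : G j = fun y => ((e j ^- n)%:E * \int[leb R n]_x Q j x y)%E).
  apply: measurable_funeM.
  exact: (@measurable_fun_fubini_tonelli_G _ _ _ _ _ (leb R n) (fun z => Q j z.1 z.2)).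
apply/funext => y; rewrite -(@leb_affine _ n (e j) (s y) (fun x => Q j x y))//; last by rewrite gt_eqF.
by rewrite muleA -EFinM gtr0_norm// mulVf ?mul1e// gt_eqF// exprn_gt0//.
Qed.

Let int_G j : (\int[leb R n]_y G j y = ck * \int[leb R n]_x (F x)%:E)%E.
Proof.
have ej : (0 < (e j ^+ n)%:E)%E by rewrite lte_fin exprn_gt0.
have ejf : ((e j ^+ n)%:E \is a fin_num)%E by [].
apply: (@mule_fin_inj _ (e j ^+ n)); first by rewrite gt_eqF// exprn_gt0.
rewrite -ge0_integralZl//; last 2 first.
- by move=> y _; exact: integral_ge0.
- by rewrite ltW.
transitivity (\int[leb R n]_y \int[leb R n]_x Q j x y)%E.
  apply: eq_integral => y _; rewrite -(@leb_affine _ n (e j) (s y) (fun x => Q j x y))//.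
    by rewrite gtr0_norm.
  by rewrite gt_eqF.
rewrite -(fubini_tonelli (fun z => Q j z.1 z.2))//=.
transitivity (\int[leb R n]_x ((F x)%:E * ((e j ^+ n)%:E * ck)))%E.
  apply: eq_integral => x _; rewrite -(int_kern j x) -ge0_integralZl//.
  - by move=> y _; rewrite lee_fin k1_ge0.
  - by rewrite lee_fin.
have [ck0 ckoo] := andP ck_fin.
rewrite -(@fineK _ ck) ?ge0_fin_numE ?ltW// -EFinM ge0_integralZr//.
- by rewrite EFinM muleC -muleA.
- exact/measurable_EFinP.
- by move=> x _; rewrite lee_fin.
- by rewrite lee_fin; apply: mulr_ge0; [exact/exprn_ge0/ltW|exact/fine_ge0/ltW].
Qed.

Let kN z : k1 (- z) = k1 z.
Proof. by rewrite /k1 !sub0r !normrN. Qed.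

(** The argument of the kernel is, up to sign, a difference quotient of t at s y in the direction
    z. *)
Let limit_point y z : V y ->
  F (e j *: z + s y) * kern j (e j *: z + s y) y @[j --> \oo] -->
    f y * `|\det (jac t (s y))| * k1 (z *m jac t (s y)).
Proof.
move=> Vy; have [Us ts] := sK Vy; have nU := open_nbhs_nbhs (conj oU Us).
have xcvg : e j *: z + s y @[j --> \oo] --> s y.
  rewrite -[X in _ --> X]add0r -(scale0r z); apply: cvgD; last exact: cvg_cst.
  exact: cvgZr_tmp.
have ev : \forall j \near \oo, U (e j *: z + s y) by exact: xcvg.
apply: cvgM.
  have cF : {for s y, continuous F}.
    apply: (@near_eq_continuous _ _ (fun x => f (t x) * `|\det (jac t x)|)).
      by apply: filterS nU => x Ux; rewrite /F /t0 /w; case: asboolP.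
    apply: (@continuousM R _ (f \o t)); last exact: det_jac_continuous.
    by apply: continuous_comp; [exact: ct|exact: cf].
  have -> : f y * `|\det (jac t (s y))| = F (s y).
    by rewrite /F /t0 /w; case: asboolP => //; rewrite ts.
  by apply: (@continuous_cvg _ 'rV[R]_n _ _ _ _ (F : 'rV[R]_n -> R)).
rewrite -kN.
have ck1 : continuous k1 by exact: tent_continuous.
have dt : differentiable t (s y).
  by apply: differentiable_rV => l; exact: (@Ck_differentiable _ _ 0 U).
have Dt : 'D_z t (s y) = z *m jac t (s y).
  rewrite derive_mx; last exact: diff_derivable.
  apply/rowP => l; rewrite !mxE derive_sum_partial; last exact: (@Ck_differentiable _ _ 0 U).
  by apply: eq_bigr => i _; rewrite mxE.
have lim : (e j)^-1 *: (t (e j *: z + s y) - t (s y)) @[j --> \oo] --> z *m jac t (s y).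
  have e_dnbhs : e @ \oo --> (0 : R)^'.
    move=> A hA; have h0 : nbhs (0 : R) (fun x => x != 0 -> A x) by exact: hA.
    have {}h0 : \forall j \near \oo, e j != 0 -> A (e j) := e_cvg h0.
    suff : \forall j \near \oo, A (e j) by [].
    by apply: filterS h0 => j; apply; rewrite gt_eqF.
  pose q (h : R) := h^-1 *: (t (h *: z + s y) - t (s y)).
  have dq : q @ (0 : R)^' --> 'D_z t (s y) by exact: (diff_derivable dt).
  by rewrite -Dt; exact: (cvg_comp _ _ e_dnbhs dq).
apply: (@continuous_cvg _ 'rV[R]_n _ _ _ _ k1); first exact: ck1.
apply: cvg_trans (cvgN lim); apply: near_eq_cvg; apply: filterS ev => j Uj /=.
rewrite ?opprfctE /= -scalerN opprB ts; congr (_ *: (_ - _)).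
by rewrite /t0; case: asboolP.
Qed.

(** Dominated convergence in z for fixed y. The resulting bound is uniform in j and supported in
    [K'], which prepares a second dominated convergence in y. *)
Let G_cvg : exists C, [/\ 0 < C, forall j y, (0 <= G j y <= (C * \1_K' (y : 'rV[R]_n))%:E)%E &
  forall y, (G j y @[j --> \oo] --> ck * (f y)%:E)%E].
Proof.
have [CF CF0 hF] := F_bound; have [Cs Cs0 hs] := s_lip.
pose B := [set z : 'rV[R]_n | `|z| <= Cs].
have cB : compact B by exact: compact_rV_ball.
have bd j (y z : 'rV[R]_n) : F (e j *: z + s y) * kern j (e j *: z + s y) y != 0 ->
    K' y /\ B z.
  set x := e j *: z + s y; rewrite mulf_eq0 negb_or => /andP[/F_supp[Ux Kx _] /k1_supp].
  have -> : t0 x = t x by rewrite /t0; case: asboolP.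
  rewrite normrZ gtr0_norm ?invr_gt0// mulrC ltr_pdivrMr// mul1r => h.
  have h' : `|t x - y| <= r by rewrite distrC (le_trans (ltW h)).
  split; first exact: hK' Kx h'.
  have := hs _ _ Kx h'; rewrite (tK Ux).2 /x opprD addrCA subrr addr0 normrN normrZ gtr0_norm//.
  move=> h2; rewrite /B /= -(ler_pM2l (e0 j)); apply: le_trans h2 _.
  by rewrite mulrC ler_wpM2r// ltW.
have Qle j (y z : 'rV[R]_n) : (Q j (e j *: z + s y)%R y <= (CF * \1_B z * \1_K' y)%:E)%E.
  rewrite lee_fin; have [/bd[K'y Bz]|/negbNE/eqP->] := boolP (F (e j *: z + s y) * kern j (e j *: z + s y) y != 0).
    rewrite !indicE !mem_set//= !mulr1; apply: le_trans (hF (e j *: z + s y)).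
    by rewrite ler_piMr ?F0 ?/kern ?k1_le1.
  by rewrite !mulr_ge0// ltW.
pose I := (\int[leb R n]_z (CF * \1_B (z : 'rV[R]_n))%:E)%E.
have iB := integrable_indic_compact CF cB.
have I0 : (0 <= I)%E by apply: integral_ge0 => z _; rewrite lee_fin mulr_ge0// ltW.
have Ifin : (I < +oo)%E.
  have /integrableP[_] := iB; apply: le_lt_trans; rewrite /I.
  rewrite (eq_integral (abse \o (EFin \o (fun z : borel 'rV[R]_n => CF * \1_B (z : 'rV[R]_n)))))//.
  by move=> z _ /=; rewrite ger0_norm// mulr_ge0// ltW.
have /integrableP[miB _] := iB.
have mQE j y : measurable_fun setT (fun z : borel 'rV[R]_n => Q j (e j *: (z : 'rV[R]_n) + s y)%R y).
  apply: eq_measurable_fun (measurableT_comp (mQ1 j y) (@measurable_affine _ n n ((e j)%:M) (s y))).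
  by move=> z _ /=; rewrite mul_mx_scalar.
have mQG j y : measurable_fun setT (fun z : borel 'rV[R]_n => F (e j *: (z : 'rV[R]_n) + s y) * kern j (e j *: (z : 'rV[R]_n) + s y) y).
  by apply/measurable_EFinP; exact: mQE.
exists (fine I + 1); split; first by rewrite ltr_wpDl// fine_ge0.
  move=> j y; apply/andP; split; first by apply: integral_ge0 => z _; exact: Q0.
  apply: (@le_trans _ _ (I * (\1_K' y)%:E)%E).
    rewrite /I -ge0_integralZr//; last by move=> z _; rewrite lee_fin mulr_ge0// ltW.
    apply: ge0_le_integral => //; first by apply: emeasurable_funM; [exact: miB|exact: measurable_cst].
  have IE : I = (fine I)%:E by rewrite fineK// ge0_fin_numE.
  rewrite {1}IE -EFinM lee_fin ler_wpM2r//.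
  by rewrite lerDl.
move=> y; have [Ky|nKy] := pselect (K' y); last first.
  have G0 j : G j y = 0%E.
    apply: integral0_eq => z _; rewrite /Q.
    have [/bd[//]|/negbNE/eqP->//] := boolP (F (e j *: z + s y) * kern j (e j *: z + s y) y != 0).
  have -> : f y = 0.
    by apply: fK => Ky; apply: nKy; apply: (hK' Ky); rewrite subrr normr0 ltW.
  by rewrite mule0; under eq_fun do rewrite G0; exact: cvg_cst.
have Vy := K'V Ky; have [Us ts] := sK Vy.
have [] := @dominated_cvgR R _ _ (leb R n)
  (fun j z => F (e j *: z + s y) * kern j (e j *: z + s y) y)
  (fun z => f y * `|\det (jac t (s y))| * k1 (z *m jac t (s y))) (fun z => CF * \1_B z) _ iB.
- by move=> j; exact: mQG.
- by move=> z; exact: limit_point.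
- move=> j z; rewrite ger0_norm; last by rewrite mulr_ge0// k1_ge0.
  by have := Qle j y z; rewrite lee_fin => /le_trans; apply; rewrite ler_piMr// ?mulr_ge0// ?ltW// indicE lern1 leq_b1.
have mkJ : measurable_fun setT (fun z : borel 'rV[R]_n => (k1 ((z : 'rV[R]_n) *m jac t (s y)))%:E).
  apply/measurable_EFinP; apply: (measurableT_comp mk1).
  by have := measurable_affine (jac t (s y)) 0; under eq_fun do rewrite addr0.
have L : (`|\det (jac t (s y))|%:E *
    \int[leb R n]_z (k1 ((z : 'rV[R]_n) *m jac t (s y)))%:E)%E = ck.
  by apply: (leb_linear (jac_unit Us)) => //; exact/measurable_EFinP.
move=> _ H; have -> : (ck * (f y)%:E)%E =
    (\int[leb R n]_z (f y * `|\det (jac t (s y))| * k1 ((z : 'rV[R]_n) *m jac t (s y)))%:E)%E.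
  under eq_integral do rewrite EFinM.
  rewrite -L muleC muleA -EFinM ge0_integralZl//; last 2 first.
  - by move=> z _; rewrite lee_fin k1_ge0.
  - by rewrite lee_fin mulr_ge0.
exact: H.
Qed.

Lemma cov_continuous : (\int[leb R n]_x (f (t0 x) * w x)%:E = \int[leb R n]_y (f y)%:E)%E.
Proof.
have [C [C0 hG G_lim]] := G_cvg; have [ck0 ckoo] := andP ck_fin.
have ckE : ck = (fine ck)%:E by rewrite fineK// ge0_fin_numE// ltW.
have Gfin j y : (G j y = (fine (G j y))%:E)%E.
  have /andP[g0 g1] := hG j y; rewrite fineK// ge0_fin_numE//.
  exact: le_lt_trans g1 (ltry _).
have mGf j : measurable_fun setT (fun y => fine (G j y)).
  by apply: measurableT_comp => //; exact: mG.
have [] := @dominated_cvgR R _ _ (leb R n) (fun j y => fine (G j y)) (fun y => fine ck * f y)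
  (fun y => C * \1_K' y) _ (integrable_indic_compact C cK').
- exact: mGf.
- by move=> y; have := G_lim y; rewrite ckE -EFinM => /fine_cvg.
- by move=> j y; rewrite ger0_norm -?lee_fin -Gfin; have /andP[] := hG j y.
move=> _; rewrite (_ : (fun j => _) = fun=> (ck * \int[leb R n]_x (F x)%:E)%E); last first.
  by apply/funext => j; rewrite -(int_G j); apply: eq_integral => y _; rewrite -Gfin.
move=> /(cvg_unique _ (cvg_cst _)) h; apply: (@mule_fin_inj _ (fine ck)).
  by rewrite gt_eqF// fine_gt0// ck0.
rewrite -ckE h //; under eq_integral do rewrite EFinM; rewrite ge0_integralZl -?ckE//.
- by apply/measurable_EFinP; exact: continuous_borelRT.
- by move=> y _; rewrite lee_fin.
- exact: ltW.
Qed.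

End Kernel.

(** By [cov_continuous], Lebesgue measure and the image under [t0] of the density [w] integrate
    alike all nonnegative continuous functions with compact support in [V], so they agree on Borel
    subsets of [V]. Points outside [U], which [t0] sends to 0, carry no mass since [w] vanishes
    there. *)
Theorem change_of_variables (g : borel 'rV[R]_n -> \bar R) : measurable_fun setT g ->
  (forall y, (0 <= g y)%E) ->
  (\int[leb R n]_(y in V) g y = \int[leb R n]_(x in U) (g (t x) * `|\det (jac t x)|%:E))%E.
Proof.
move=> mg g0.
pose nu : {measure set (borel 'rV[R]_n) -> \bar R} := image_measure (density (leb R n) mw w0) mt0.
have E (B : set (borel 'rV[R]_n)) : measurable B -> B `<=` V -> leb R n B = nu B.
  apply: borel_measure_unique => //; first by move=> K cK _; exact: leb_compact.
  move=> f cf [K [cK KV fK]] f0; have [r r0 [K' [cK' K'V hK']]] := compact_thicken oV cK KV.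
  have mf : measurable_fun setT (fun x : borel 'rV[R]_n => (f x)%:E).
    by apply/measurable_EFinP; exact: continuous_borelRT.
  rewrite /nu ge0_integral_image_measure//; last by move=> y _; rewrite lee_fin.
  rewrite preimage_setT ge0_integral_density; last 2 first.
  - exact: (measurableT_comp mf mt0).
  - by move=> y; rewrite lee_fin.
  under eq_integral do rewrite -EFinM.
  by apply/esym; exact: (cov_continuous cf f0 cK KV fK r0 cK' K'V hK').
have mV : measurable (V : set (borel 'rV[R]_n)) by exact: borel_open.
have mpV : measurable (t0 @^-1` V) by rewrite -[X in measurable X]setTI; exact: mt0.
rewrite (eq_measure_integral nu); last by move=> A mA AV; exact: E.
have mgV : measurable_fun (V : set (borel 'rV[R]_n)) g by exact: measurable_funS mg.
rewrite /nu ge0_integral_image_measure//.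
rewrite integral_mkcond ge0_integral_density; last 2 first.
- have h : measurable_fun (t0 @^-1` V) (g \o t0).
    exact: (measurable_funS measurableT (@subsetT _ _) (measurableT_comp mg mt0)).
  exact: ((measurable_restrictT _ mpV).1 h).
- by move=> x; rewrite /patch; case: ifP.
rewrite [RHS]integral_mkcond; apply: eq_integral => x _; rewrite /patch.
have [Ux|nUx] := pselect (U x); last first.
  rewrite [in RHS]memNset// (_ : w x = 0) ?mule0//.
  by rewrite /w; case: asboolP.
have tE : t0 x = t x by rewrite /t0; case: asboolP.
rewrite [in RHS]mem_set// mem_set /= ?tE; last exact: (tK Ux).1.
by rewrite /w; case: asboolP.
Qed.

End ChangeOfVariables.

(** * Test functions and integration by parts *)

Section FlatFunctions.
Variable R : realType.

(** The index k makes the family closed under differentiation up to linear combinations, so that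
    smoothness of every order follows from one derivative formula. *)
Definition flat (k : nat) (t : R) : R := if 0 < t then t^-1 ^+ k * expR (- t^-1) else 0.

Lemma flat_ge0 k t : 0 <= flat k t.
Proof. by rewrite /flat; case: ifP => // t0; rewrite mulr_ge0 ?expR_ge0// exprn_ge0// invr_ge0 ltW. Qed.

Lemma flat_gt0 t : 0 < t -> 0 < flat 0 t.
Proof. by move=> t0; rewrite /flat t0 expr0 mul1r expR_gt0. Qed.

Lemma flat_le0 k t : t <= 0 -> flat k t = 0.
Proof. by rewrite /flat leNgt => /negbTE ->. Qed.

(** From exp q >= q^(k+2) / (k+2)! at q = 1/t. A quadratic bound is what makes the derivative at 0
    exist and vanish. *)
Lemma flat_bound k : exists2 C, 0 < C & forall t, flat k t <= C * t ^+ 2.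
Proof.
exists (k.+2`!%:R) => [|t]; first by rewrite ltr0n fact_gt0.
rewrite /flat; case: ifPn => [t0|_]; last by rewrite mulr_ge0// sqr_ge0.
have q0 : 0 <= t^-1 by rewrite invr_ge0 ltW.
rewrite expRN ler_pdivrMr ?expR_gt0//.
have := expR_ge1Dxn k.+1 q0.
have f0 : 0 < k.+2`!%:R :> R by rewrite ltr0n fact_gt0.
move=> h; apply: (@le_trans _ _ (k.+2`!%:R * t ^+ 2 * (t^-1 ^+ k.+2 / k.+2`!%:R))); last first.
  apply: ler_wpM2l; first by rewrite mulr_ge0 ?sqr_ge0 ?(ltW f0).
  by apply: le_trans h; rewrite lerDr.
rewrite [leRHS](_ : _ = t^-1 ^+ k * (t * t^-1) ^+ 2 * (k.+2`!%:R / k.+2`!%:R)).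
  by rewrite !divff ?gt_eqF// expr1n !mulr1.
have -> : t^-1 ^+ k.+2 = t^-1 ^+ k * t^-1 ^+ 2 by rewrite -exprD addn2.
by rewrite exprMn; ring.
Qed.

Lemma is_derive_flat k t : is_derive t (1 : R) (flat k) (- k%:R * flat k.+1 t + flat k.+2 t).
Proof.
have [t0|t0|->] := ltrgt0P t.
- have nt : \forall s \near t, 0 < s by exact: (open_nbhs_nbhs (conj (@open_gt _ 0) t0)).
  have main : is_derive t (1 : R) (fun s => s^-1 ^+ k * expR (- s^-1))
      (- k%:R * (t^-1 ^+ k.+1 * expR (- t^-1)) + t^-1 ^+ k.+2 * expR (- t^-1)).
    have dinv : is_derive t (1 : R) (fun s : R => s^-1) (- (t^-1 ^+ 2)).
      have t00 : t != 0 by rewrite gt_eqF.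
      have := @is_deriveV _ id t 1 1 t00 (is_derive_id _ _).
      by rewrite /GRing.scale /= mulr1 exprVn.
    elim: k => [|k IH].
      have d1 : is_derive t (1 : R) (fun s : R => - s^-1) (t^-1 ^+ 2).
        by have := is_deriveN dinv; rewrite opprK.
      have := @is_derive1_comp R expR (fun s : R => - s^-1) t _ _ (is_derive_expR _) d1.
      rewrite oppr0 mul0r add0r mulrC (_ : (fun s => s^-1 ^+ 0 * _) = expR \o (fun s => - s^-1))//.
      by apply/funext => s; rewrite expr0 mul1r.
    have E : (fun s : R => s^-1 ^+ k.+1 * expR (- s^-1)) = (fun s => s^-1 ^+ k * expR (- s^-1)) * (fun s => s^-1).
      by apply/funext => s; rewrite fctE exprSr mulrAC.
    rewrite E; apply: is_derive_eq (is_deriveM IH dinv) _.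
    by rewrite /GRing.scale /= !exprS -natr1; ring.
  rewrite /flat t0; apply: near_eq_is_derive main; near=> s.
  by rewrite (near nt s).
- rewrite !flat_le0 ?(ltW t0)// mulr0 addr0.
  have nt : \forall s \near t, s < 0 by exact: (open_nbhs_nbhs (conj (@open_lt _ 0) t0)).
  apply: (@near_eq_is_derive _ _ _ (cst 0) (flat k)) (is_derive_cst _ _ _).
  by near=> s; rewrite flat_le0// ltW//; near: s.
- rewrite !flat_le0// mulr0 addr0.
  have [C C0 hC] := flat_bound k.
  have c : (h^-1 *: ((flat k \o shift 0) (h *: (1 : R)) - flat k 0)) @[h --> (0 : R)^'] --> (0 : R).
    apply/cvgrPdist_le => e e0; near=> h; rewrite /= (flat_le0 k (lexx 0)) subr0 sub0r normrN addr0.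
    rewrite /GRing.scale /= mulr1 normrM normfV.
    have h0 : h != 0 by near: h; exact: nbhs_dnbhs_neq.
    rewrite ler_pdivrMl ?normr_gt0// ger0_norm ?flat_ge0//.
    apply: le_trans (hC h) _; rewrite -real_normK ?num_real// expr2 mulrCA ler_wpM2l//.
    rewrite -ler_pdivlMl//; near: h; apply: dnbhs0_le; rewrite mulr_gt0// invr_gt0//.
  by apply: DeriveDef; [apply/cvg_ex; exists 0|apply: cvg_lim].
Unshelve. all: by end_near. Qed.

Variable n : nat.

Lemma Ck_flat m k (U : set 'rV[R]_n) (i : 'I_n) (c s : R) :
  Ck m U (fun x => flat k (c + s * x 0 i)).
Proof.
have oT := @openT 'rV[R]_n.
pose L (x : 'rV[R]_n) : R := c + s * x 0 i.
have dL x v : is_derive x v L (s * (v : 'rV[R]_n) 0 i).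
  have dc : is_derive x v (fun x : 'rV[R]_n => x 0 i) ((v : 'rV[R]_n) 0 i).
    apply: DeriveDef; first by apply: diff_derivable; exact: differentiable_coord.
    have d : derivable (id : 'rV[R]_n -> 'rV[R]_n) x v by exact: derivable_id.
    by have := derive_mx d; rewrite derive_id => /matrixP/(_ 0 i); rewrite mxE => <-.
  have := is_deriveD (is_derive_cst c x v) (is_deriveZ s dc).
  by rewrite add0r.
have dl x : differentiable L x.
  by apply: differentiableD => //; apply: differentiableZ; exact: differentiable_coord.
suff H l : forall k, Ck l setT (fun x : 'rV[R]_n => flat k (c + s * x 0 i)).
  exact: Ck_sub (@subsetT _ U) (H _ _).
have cf k' : forall x : 'rV[R]_n, {for x, continuous (fun x : 'rV[R]_n => flat k' (c + s * x 0 i))}.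
  move=> x; have [d _] := derive_comp1 (delta_mx 0 i) (dl x) (is_derive_flat k' (L x)).
  exact: differentiable_continuous d.
elim: l => [|l IH] {}k; first by split.
split => // j; split.
  move=> x _; have [d _] := derive_comp1 (delta_mx 0 j) (dl x) (is_derive_flat k (L x)).
  exact: diff_derivable.
have h := CkM oT (CkD oT (CkZ (- k%:R) oT (IH k.+1)) (IH k.+2)) (Ck_cst l setT (s * (delta_mx 0 j : 'rV[R]_n) 0 i)).
apply: Ck_open_eq oT _ h => x _.
have [_ e] := derive_comp1 (delta_mx 0 j) (dl x) (is_derive_flat k (L x)).
by rewrite [RHS]e (@derive_val _ _ _ _ _ _ _ (dL x _)).
Qed.

End FlatFunctions.

Lemma lipschitz_continuous (R : realType) (V W : normedModType R) (f : V -> W) (L : R) : 0 <= L ->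
  (forall x y, `|f x - f y| <= L * `|x - y|) -> continuous f.
Proof.
move=> L0 key x; apply/cvgrPdist_le => e e0.
have L1 : 0 < L + 1 by rewrite ltr_wpDl.
have e1 : 0 < (L + 1)^-1 * e by rewrite mulr_gt0// invr_gt0.
near=> y; apply: le_trans (key x y) _.
apply: (@le_trans _ _ ((L + 1) * `|x - y|)); first by rewrite ler_wpM2r// lerDl.
rewrite -ler_pdivlMl//; near: y.
Unshelve. all: by end_near. Qed.

(** * Mollification *)

Section Mollify.
Variables (R : realType) (n : nat).
Implicit Types (f k : 'rV[R]_n -> R).

Definition bump (r : R) (x : 'rV[R]_n) : R :=
  \prod_(i < n) (flat 0 (r + (-1) * x 0 i) * flat 0 (r + 1 * x 0 i)).

Lemma Ck_bump m (U : set 'rV[R]_n) r : open U -> Ck m U (bump r).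
Proof. by move=> oU; apply: Ck_prod => // i _; apply: CkM => //; exact: Ck_flat. Qed.

Lemma bump_ge0 r x : 0 <= bump r x.
Proof. by apply: prodr_ge0 => i _; rewrite mulr_ge0// flat_ge0. Qed.

Lemma bump_gt0 r x : `|x| < r -> 0 < bump r x.
Proof.
move=> xr; apply: prodr_gt0 => i _.
have := le_lt_trans (ler_coord x i) xr; rewrite ltr_norml => /andP[h1 h2].
by rewrite mulr_gt0// flat_gt0; lra.
Qed.

Lemma bump_supp r x : 0 < r -> bump r x != 0 -> `|x| < r.
Proof.
move=> r0 /prodf_neq0 h; apply/ltr_rVP => // i; have := h i isT.
rewrite mulf_eq0 negb_or => /andP[h1 h2].
have l t : flat 0 t != 0 :> R -> 0 < t by apply: contra_neqT; rewrite -leNgt; exact: flat_le0.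
by have := l _ h1; have := l _ h2; rewrite ltr_norml => *; apply/andP; split; lra.
Qed.

Lemma bounded_support_integrable (K : set 'rV[R]_n) (C : R) (f : borel 'rV[R]_n -> R) :
  compact K -> measurable_fun setT f -> (forall x, ~ K x -> f x = 0) -> (forall x, `|f x| <= C) ->
  (leb R n).-integrable setT (EFin \o f).
Proof.
move=> cK mf f0 fC; apply: le_integrable (integrable_indic_compact C cK) => //.
  exact/measurable_EFinP.
move=> x _; rewrite /= lee_fin indicE.
have [Kx|nKx] := pselect (K x); last by rewrite f0// normr0.
by rewrite mem_set//= mulr1 (le_trans (fC x))// ler_norm.
Qed.

Lemma compact_support_bounded (K : set 'rV[R]_n) f : compact K -> continuous f ->
  (forall x, ~ K x -> f x = 0) -> exists2 C, 0 < C & forall x, `|f x| <= C.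
Proof.
move=> cK cf f0; have [C C0 h] := compact_bound cK (fun x _ => @cf x).
exists C => // x; have [/h//|/f0->] := pselect (K x); by rewrite normr0 ltW.
Qed.

Definition conv f k (x : 'rV[R]_n) : R := (\int[leb R n]_y (f y * k (x - (y : 'rV[R]_n))))%R.

Section Conv.
Variables (f : 'rV[R]_n -> R) (K : set 'rV[R]_n).
Hypotheses (cf : continuous f) (cK : compact K) (fK : forall x, ~ K x -> f x = 0).

Let sub_continuous (x : 'rV[R]_n) k : continuous k -> continuous (fun y : 'rV[R]_n => k (x - y)).
Proof.
move=> ck y; apply: continuous_comp; last exact: ck.
by apply: (@continuousB _ _ 'rV[R]_n (fun=> x) id); [exact: cst_continuous|exact: cvg_id].
Qed.

Lemma conv_integrable k x : continuous k -> (leb R n).-integrable setT (EFin \o (fun y : borel 'rV[R]_n => f y * k (x - (y : 'rV[R]_n)))).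
Proof.
move=> ck; have c : continuous (fun y : 'rV[R]_n => f y * k (x - y)).
  by move=> y; apply: (@continuousM R _ f (fun y : 'rV[R]_n => k (x - y))); [exact: cf|exact: sub_continuous].
have z y : ~ K y -> f y * k (x - y) = 0 by move=> /fK->; rewrite mul0r.
have [C C0 hC] := compact_support_bounded cK c z.
by apply: bounded_support_integrable cK _ z hC; exact: continuous_borelRT.
Qed.

Let smoothT k := forall m, Ck m setT k.

Let smoothT_continuous k : smoothT k -> continuous k.
Proof. by move=> sk x; exact: (Ck_continuous (sk 0%N)). Qed.

Let partial_far r k i : (forall x, r < `|x| -> k x = 0) -> forall x, r < `|x| -> partial i k x = 0.
Proof.
move=> k0 x rx; have oV : open [set x : 'rV[R]_n | r < `|x|].
  rewrite (_ : [set _ | _] = (fun x : 'rV[R]_n => `|x|) @^-1` [set t | r < t])//.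
  by apply: open_comp => [y _|]; [exact: norm_continuous|exact: open_gt].
rewrite /partial (@near_eq_derive _ _ _ _ (cst 0)) ?derive_cst//.
by apply: filterS (open_nbhs_nbhs (conj oV rx)) => y; exact: k0.
Qed.

Let far_bounded r k : (forall x, r < `|x| -> k x = 0) -> continuous k ->
  exists2 C, 0 < C & forall x, `|k x| <= C.
Proof.
move=> k0 ck; apply: (compact_support_bounded (@compact_rV_ball R n r) ck) => x /= /negP.
by rewrite -ltNge; exact: k0.
Qed.

Let conv_continuous r k : smoothT k -> (forall x, r < `|x| -> k x = 0) -> continuous (conv f k).
Proof.
move=> sk k0.
have /choice[C hC] : forall i : 'I_n, exists C : R, 0 < C /\ forall y, `|partial i k y| <= C.
  move=> i; have [C C0 h] := far_bounded (@partial_far r k i k0)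
    (fun x => ((sk 1%N).2 i).2.1 x Logic.I).
  by exists C.
pose C0 := \sum_i C i; have C0_ge0 : 0 <= C0 by apply: sumr_ge0 => i _; apply: ltW; exact: (hC i).1.
have lip x y : `|k y - k x| <= n%:R * C0 * `|y - x|.
  apply: C1_lipschitz => t _; split; first exact: (Ck_differentiable openT (sk 1%N)).
  move=> i; apply: le_trans ((hC i).2 _) _.
  by rewrite /C0 (bigD1 i)//= lerDl sumr_ge0// => j _; apply: ltW; exact: (hC j).1.
have [Cf Cf0 hf] := compact_support_bounded cK cf fK.
pose L := (\int[leb R n]_y (Cf * (n%:R * C0) * \1_K (y : 'rV[R]_n)))%R.
have L0 : 0 <= L by apply: Rintegral_ge0 => y _; rewrite !mulr_ge0// ltW.
have key x x' : `|conv f k x - conv f k x'| <= L * `|x - x'|.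
  rewrite /conv -RintegralB//; [|exact/conv_integrable/smoothT_continuous..].
  have ii : (leb R n).-integrable setT (EFin \o (fun y : borel 'rV[R]_n => f y * k (x - (y : 'rV[R]_n)) - f y * k (x' - (y : 'rV[R]_n)))).
    rewrite /comp; under [X in integrable _ _ X]eq_fun do rewrite EFinB.
    by apply: integrableB => //; exact/conv_integrable/smoothT_continuous.
  apply: le_trans (le_normr_Rintegral _ ii) _ => //.
  rewrite mulrC -RintegralZl//; last exact: integrable_indic_compact.
  apply: le_Rintegral => //.
  - exact: integrable_norm.
  - rewrite /comp; under [X in integrable _ _ X]eq_fun do rewrite EFinM.
    by apply: integrableZl => //; exact: integrable_indic_compact.
  - move=> y _; rewrite -mulrBr normrM indicE.
    have [Ky|nKy] := pselect (K y); last by rewrite fK// normr0 mul0r mulr_ge0// !mulr_ge0// ltW.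
    rewrite mem_set//= mulr1 [leRHS]mulrC -mulrA; apply: ler_pM => //.
    by have := lip (x' - y) (x - y); rewrite opprB addrA subrK.
exact: (@lipschitz_continuous R 'rV[R]_n R^o (conv f k) L L0 key).
Qed.

(** The derivative falls on the kernel, so that continuity of [f] suffices; as [f] vanishes off [K],
    a multiple of the indicator of [K] dominates the differentiated integrand. *)
Let conv_derive r k i x : smoothT k -> (forall x, r < `|x| -> k x = 0) ->
  is_derive x (delta_mx 0 i) (conv f k) (conv f (partial i k) x).
Proof.
move=> sk k0; have ck := smoothT_continuous sk.
have cpk : continuous (partial i k) by move=> y; exact: ((sk 1%N).2 i).2.1.
pose F (t : R) (y : borel 'rV[R]_n) : R := f y * k (x - (y : 'rV[R]_n) + t *: delta_mx 0 i).
have dF t (y : 'rV[R]_n) : is_derive t (1 : R) (F ^~ y) (f y * partial i k (x - y + t *: delta_mx 0 i)).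
  have d : derivable k (x - y + t *: delta_mx 0 i) (delta_mx 0 i) by apply: ((sk 1%N).2 i).1.
  by have := is_deriveZ (f y) (derivable_line d).
have [Cf Cf0 hf] := compact_support_bounded cK cf fK.
have [C C0 hC] := far_bounded (@partial_far r k i k0) cpk.
have FE t : F t = (fun y : borel 'rV[R]_n => f y * k (x + t *: delta_mx 0 i - (y : 'rV[R]_n))).
  by apply/funext => y; rewrite /F addrAC.
have d1E t (y : 'rV[R]_n) : partial1of2 F t y = f y * partial i k (x - y + t *: delta_mx 0 i).
  by rewrite partial1of2E; exact: derive_val.
have I0 : (0 : R) \in `](-1), 1[ by rewrite in_itv/= ltr01 ltrN10.
have := @cvg_differentiation_under_integral R _ _ (leb R n) F setT measurableT 0 (-1) 1 I0 _ _
  (fun y => Cf * C * \1_K (y : 'rV[R]_n)).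
move=> /(_ (fun t _ => _)) H.
have {H} lim : h^-1 *: (\int[leb R n]_y F (h + 0) y - \int[leb R n]_y F 0 y) @[h --> (0 : R)^'] -->
    \int[leb R n]_y partial1of2 F 0 y.
  apply: H.
  - by move=> t; rewrite FE; exact: conv_integrable.
  - by move=> t y _ _; exact: @ex_derive _ _ _ _ _ _ _ (dF t y).
  - by move=> y; rewrite !mulr_ge0// ltW.
  - exact: integrable_indic_compact.
  - move=> t y _ _; rewrite d1E normrM indicE.
    have [Ky|nKy] := pselect (K y); last by rewrite fK// normr0 mul0r !mulr_ge0// ltW.
    by rewrite mem_set//= mulr1 ler_pM.
have E : (fun h : R => h^-1 *: ((conv f k \o shift x) (h *: delta_mx 0 i) - conv f k x)) =
    (fun h => h^-1 *: (\int[leb R n]_y F (h + 0) y - \int[leb R n]_y F 0 y)%R).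
  by apply/funext => h; rewrite !FE /conv /= addr0 scale0r addr0 [x + _]addrC.
have v : (\int[leb R n]_y partial1of2 F 0 y)%R = conv f (partial i k) x.
  by apply: eq_Rintegral => y _; rewrite d1E scale0r addr0.
rewrite v -E in lim.
by apply: DeriveDef; [apply/cvg_ex; exists (conv f (partial i k) x)|exact: cvg_lim].
Qed.

(** The induction runs over all kernels at once: a partial derivative of the convolution is the
    convolution with a partial derivative of the kernel, which vanishes beyond the same radius. *)
Lemma conv_smooth r k : smoothT k -> (forall x, r < `|x| -> k x = 0) -> smoothT (conv f k).
Proof.
move=> sk k0 m; elim: m k sk k0 => [|m IH] k sk k0.
  by split => // x _; exact: (conv_continuous sk k0).
split; first by move=> x _; exact: (conv_continuous sk k0).
move=> i; split; first by move=> x _; exact: @ex_derive _ _ _ _ _ _ _ (conv_derive i x sk k0).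
rewrite (_ : partial i _ = conv f (partial i k)); last first.
  by apply/funext => x; exact: @derive_val _ _ _ _ _ _ _ (conv_derive i x sk k0).
apply: IH; last exact: partial_far.
by move=> l; exact: ((sk l.+1).2 i).2.
Qed.

End Conv.
End Mollify.

(** * Density of test functions, and integrals of derivatives *)

Section TestFunctions.
Variables (R : realType) (n : nat).
Implicit Types (f g : 'rV[R]_n -> R) (U K : set 'rV[R]_n).

Lemma uniform_continuity f K : compact K -> continuous f -> (forall x, ~ K x -> f x = 0) ->
  forall e : R, 0 < e -> exists2 r : R, 0 < r & forall x y, `|x - y| <= r -> `|f x - f y| <= e.
Proof.
move=> cK cf fK e e0.
have [r0 r00 [K' [cK' _ hK']]] := compact_thicken openT cK (@subsetT _ K).
have := (compact_near_coveringP K').1 cK' R (nbhs 0^'+)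
  (fun r x => forall y, `|x - y| <= r -> `|f x - f y| <= e) _.
case=> [x K'x|r1 /= r10 hr1].
  have e2 : 0 < e / 2 by rewrite divr_gt0.
  have /cvgrPdist_le /(_ _ e2) /nbhs_ballP[d /= d0 hd] := cf x.
  have d2 : 0 < d / 2 by rewrite divr_gt0.
  exists (ball x (d / 2), ball 0 (d / 2)) => /=.
    split; first exact: nbhsx_ballx.
    by exists (d / 2) => //= t ? _.
  move=> [z s] /= [xz hs] y zy.
  have xz' : ball x d z by apply: le_ball xz; rewrite ler_pdivrMr// ler_peMr ?ler1n// ltW.
  have xy' : ball x d y.
    rewrite (splitr d); apply: ball_triangle xz _; rewrite -ball_normE /ball_ /=.
    apply: le_lt_trans zy _; move: hs; rewrite /ball /= sub0r normrN.
    exact: le_lt_trans (ler_norm _).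
  rewrite (splitr e); apply: le_trans (ler_distD (f x) _ _) _.
  by apply: lerD; [rewrite distrC; exact: hd|exact: hd].
pose r := Num.min r0 (r1 / 2).
have rr : 0 < r by rewrite lt_min r00 divr_gt0.
exists r => // x y xy.
have h : ball_ [eta Num.Def.normr] 0 r1 r.
  rewrite /ball_ /= sub0r normrN gtr0_norm//; apply: (@le_lt_trans _ _ (r1 / 2)).
    by rewrite ge_min lexx orbT.
  by rewrite ltr_pdivrMr// ltr_pMr// ltr1n.
have xyr0 : `|x - y| <= r0 by apply: le_trans xy _; rewrite ge_min lexx.
have [K'x|nK'x] := pselect (K' x); first exact: (hr1 r h rr x K'x).
have nKx : ~ K x by move=> Kx; apply: nK'x; apply: (hK' x) => //; rewrite subrr normr0 ltW.
have nKy : ~ K y by move=> Ky; apply: nK'x; apply: (hK' y) => //; rewrite distrC.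
by rewrite !fK// subrr normr0 ltW.
Qed.

(** [K'] is chosen before the precision e, so that quantities depending on the supports can be
    bounded before e is fixed. The approximation is a convolution with a bump divided by its own
    integral c. *)
Theorem test_function_density U K f : open U -> compact K -> K `<=` U -> continuous f ->
  (forall x, ~ K x -> f x = 0) ->
  exists K' : set 'rV[R]_n, [/\ compact K', K' `<=` U & forall e : R, 0 < e ->
    exists psi : 'rV[R]_n -> R, [/\ smooth setT psi, forall x, ~ K' x -> psi x = 0,
      forall x, `|psi x - f x| <= e & (forall x, 0 <= f x) -> forall x, 0 <= psi x]].
Proof.
move=> oU cK KU cf fK; have [r0 r00 [K' [cK' K'U hK']]] := compact_thicken oU cK KU.
exists K'; split => // e e0.
have [r1 r10 hr1] := uniform_continuity cK cf fK e0.
(* [r0] keeps the support in [K']; [r1] bounds the oscillation of [f] over the bump. *)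
pose r := Num.min r0 r1; have rr : 0 < r by rewrite lt_min r00.
pose b := @bump R n r.
have b0 x : 0 <= b x by exact: bump_ge0.
have sb m : Ck m setT b by apply: Ck_bump; exact: openT.
have cb : continuous b by move=> x; exact: (Ck_continuous (sb 0%N)).
have bK x : ~ [set x : 'rV[R]_n | `|x| <= r] x -> b x = 0.
  by move=> h; apply/eqP; apply: contrapT => /negP /(bump_supp rr) /ltW.
have cB := @compact_rV_ball R n r.
have [Cb Cb0 hCb] := compact_support_bounded cB cb bK.
have mb : measurable_fun [set: borel 'rV[R]_n] (b : borel 'rV[R]_n -> R) by exact: continuous_borelRT.
have mbE : measurable_fun setT (fun x : borel 'rV[R]_n => (b x)%:E) by exact/measurable_EFinP.
have ib : (leb R n).-integrable setT (EFin \o (b : borel 'rV[R]_n -> R)).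
  exact: bounded_support_integrable cB mb bK hCb.
pose c := (\int[leb R n]_y b y)%R.
have c0 : 0 < c.
  apply: fine_gt0; apply/andP; split; last first.
    have /integrableP[_] := ib; apply: le_lt_trans.
    by apply: ge0_le_integral => //; [move=> x _; rewrite lee_fin|exact: measurableT_comp|move=> x _ /=; rewrite lee_fin ler_norm].
  rewrite lt_neqAle integral_ge0 ?andbT; last by move=> x _; rewrite lee_fin.
  (* A vanishing integral would make the bump zero almost everywhere, although it is positive on a
     ball of positive volume. *)
  apply/negP => /eqP/esym h.
  have oB : open [set x : 'rV[R]_n | `|x| < r].
    rewrite (_ : [set _ | _] = (fun x : 'rV[R]_n => `|x|) @^-1` [set t | t < r])//.
    by apply: open_comp => [x _|]; [exact: norm_continuous|exact: open_lt].
  have : leb R n [set x | `|x : 'rV[R]_n| < r] = 0%E.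
    have [+ _] := ae_eq_integral_abs (leb R n) measurableT mbE.
    rewrite (eq_integral (fun x : borel 'rV[R]_n => (b x)%:E)); last first.
      by move=> x _; rewrite gee0_abs// lee_fin.
    move=> /(_ h) [A [mA A0 hA]]; apply: (subset_measure0 _ mA _ A0); first exact: borel_open.
    move=> x xr; apply: hA => /= /(_ Logic.I) [] /eqP; rewrite gt_eqF//; exact: bump_gt0.
  by rewrite leb_ball// => -[] /eqP; rewrite gt_eqF// exprn_gt0// mulr_gt0.
have refl x : (\int[leb R n]_y b (x - (y : 'rV[R]_n)))%R = c.
  have n1 : -1 != 0 :> R by rewrite oppr_eq0 oner_eq0.
  have b0E y : (0 <= (b y)%:E)%E by rewrite lee_fin.
  have L := leb_affine x n1 mbE b0E.
  rewrite /c /Rintegral -L normrN1 expr1n mul1e; apply: (congr1 fine).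
  by apply: eq_integral => y _; rewrite scaleN1r addrC.
have ibx x : (leb R n).-integrable setT (EFin \o (fun y : borel 'rV[R]_n => b (x - (y : 'rV[R]_n)))).
  have cx : continuous (fun y : 'rV[R]_n => b (x - y)).
    move=> y; apply: continuous_comp; last exact: cb.
    by apply: (@continuousB _ _ 'rV[R]_n (fun=> x) id); [exact: cst_continuous|exact: cvg_id].
  apply: (@bounded_support_integrable _ _ [set y : 'rV[R]_n | `|y| <= `|x| + r] Cb) => //.
  - exact: compact_rV_ball.
  - exact: continuous_borelRT.
  - move=> y hy; apply: bK => /= hxy; apply: hy => /=.
    by rewrite -[y](subrK x) (le_trans (ler_normD _ _))// addrC lerD2l distrC.
have cfar : forall x : 'rV[R]_n, r < `|x| -> b x = 0.
  by move=> x rx; apply: bK => /= h; have := le_lt_trans h rx; rewrite ltxx.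
exists (fun x => c^-1 * conv f b x); split.
- by move=> m; apply: CkZ; [exact: openT|exact: (conv_smooth cf cK fK sb cfar)].
- move=> x nK'x; rewrite /conv (_ : (\int[_]_y _)%R = 0) ?mulr0//.
  rewrite /Rintegral integral0_eq// => y _.
  have [->|by0] := eqVneq (b (x - (y : 'rV[R]_n))) 0; first by rewrite mulr0.
  rewrite fK ?mul0r// => Ky; apply: nK'x; apply: (hK' y) => //.
  by rewrite distrC (le_trans (ltW (bump_supp rr by0)))// ge_min lexx.
- move=> x; have ic := conv_integrable cf cK fK x cb.
  have iz (a : R) : (leb R n).-integrable setT (EFin \o (fun y : borel 'rV[R]_n => a * b (x - (y : 'rV[R]_n)))).
    rewrite /comp; under [X in integrable _ _ X]eq_fun do rewrite EFinM.
    by apply: integrableZl => //; exact: ibx.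
  have E : conv f b x - c * f x = (\int[leb R n]_y ((f y - f x) * b (x - (y : 'rV[R]_n))))%R.
    rewrite -(refl x) mulrC -RintegralZl// /conv -RintegralB//.
    by apply: eq_Rintegral => y _; rewrite mulrBl.
  have -> : c^-1 * conv f b x - f x = c^-1 * (conv f b x - c * f x).
    by rewrite mulrBr mulKf// gt_eqF.
  rewrite normrM gtr0_norm ?invr_gt0// ler_pdivrMl// [leRHS]mulrC E -(refl x) -RintegralZl//.
  have iE : (leb R n).-integrable setT (EFin \o (fun y : borel 'rV[R]_n => (f y - f x) * b (x - (y : 'rV[R]_n)))).
    rewrite (_ : (fun y => _) = (fun y : borel 'rV[R]_n => f y * b (x - (y : 'rV[R]_n)) - f x * b (x - (y : 'rV[R]_n)))).
      rewrite /comp; under [X in integrable _ _ X]eq_fun do rewrite EFinB.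
      by apply: (integrableB _ ic (iz (f x))).
    by apply/funext => y; rewrite mulrBl.
  apply: le_trans (le_normr_Rintegral _ iE) _ => //.
  apply: le_Rintegral => //; first exact: integrable_norm.
  move=> y _; rewrite normrM [X in _ * X <= _]ger0_norm//.
  have [->|by0] := eqVneq (b (x - (y : 'rV[R]_n))) 0; first by rewrite !mulr0.
  apply: ler_wpM2r => //; apply: hr1; rewrite distrC.
  by rewrite (le_trans (ltW (bump_supp rr by0)))// ge_min lexx orbT.
- move=> f0 x; rewrite mulr_ge0// ?invr_ge0 ?(ltW c0)//; apply: Rintegral_ge0 => y _.
  by rewrite mulr_ge0.
Qed.

Lemma leb_translate_real (b : 'rV[R]_n) (f : borel 'rV[R]_n -> R) : measurable_fun setT f ->
  (\int[leb R n]_x (f ((x : 'rV[R]_n) + b)%R)%:E = \int[leb R n]_x (f x)%:E)%E.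
Proof.
move=> mf; have mE : measurable_fun setT (EFin \o f) by exact/measurable_EFinP.
rewrite integralE [RHS]integralE; congr (_ - _)%E.
  have L := leb_translate b (measurable_funepos mE) (fun x => funepos_ge0 _ x).
  by rewrite -[RHS]L; apply: eq_integral => x _; rewrite !funeposE.
have L := leb_translate b (measurable_funeneg mE) (fun x => funeneg_ge0 _ x).
by rewrite -[RHS]L; apply: eq_integral => x _; rewrite !funenegE.
Qed.

(** By translation invariance the integral of f(x + t e_i) does not depend on t; differentiation
    under the integral sign at t = 0 gives the claim. *)
Lemma integral_partial f K i : Ck 1 setT f -> compact K -> (forall x, ~ K x -> f x = 0) ->
  (\int[leb R n]_x (partial i f x)%:E = 0)%E.
Proof.
move=> hf cK fK; have cf : continuous f by move=> x; exact: (Ck_continuous hf).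
have cpf : continuous (partial i f) by move=> x; exact: (hf.2 i).2.1.
have pK x : ~ K x -> partial i f x = 0.
  move=> nK; have oK : open (~` K) by apply: closed_openC; apply: compact_closed => //; exact: norm_hausdorff.
  rewrite /partial (@near_eq_derive _ _ _ _ (cst 0)) ?derive_cst//.
  by apply: filterS (open_nbhs_nbhs (conj oK nK)) => y; exact: fK.
have [C C0 hC] := compact_support_bounded cK cpf pK.
have [M M0 hM] := compact_rV_bounded cK.
pose F (t : R) (x : borel 'rV[R]_n) : R := f ((x : 'rV[R]_n) + t *: delta_mx 0 i).
have dF t (x : 'rV[R]_n) : is_derive t (1 : R) (F ^~ x) (partial i f (x + t *: delta_mx 0 i)).
  by apply: derivable_line; exact: (hf.2 i).1.
have d1E t (x : 'rV[R]_n) : partial1of2 F t x = partial i f (x + t *: delta_mx 0 i).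
  by rewrite partial1of2E; exact: derive_val.
have mf : measurable_fun setT (f : borel 'rV[R]_n -> R) by exact: continuous_borelRT.
have [Cf Cf0 hCf] := compact_support_bounded cK cf fK.
(* Translating by |t| < 1 a function supported in the ball of radius M leaves its support in the
   ball of radius M + 1. *)
have cBM := @compact_rV_ball R n (M + 1).
have Kt t : t \in `](-1), 1[ -> forall x : 'rV[R]_n, ~ [set x : 'rV[R]_n | `|x| <= M + 1] x -> ~ K (x + t *: delta_mx 0 i).
  rewrite in_itv/= -ltr_norml => t1 x hx /hM /= h; apply: hx => /=.
  rewrite -[x](addrK (t *: delta_mx 0 i)); apply: le_trans (ler_normB _ _) _; apply: lerD => //.
  apply/ler_rVP => // j; rewrite !mxE eqxx /=; case: eqP => _; rewrite ?mulr1 ?mulr0 ?normr0//.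
  exact: ltW.
have mF t : measurable_fun setT (F t).
  apply: continuous_borelRT => x; apply: continuous_comp; last exact: cf.
  by apply: (@continuousD _ _ 'rV[R]_n id (fun=> t *: delta_mx 0 i)); [exact: cvg_id|exact: cst_continuous].
have I0 : (0 : R) \in `](-1), 1[ by rewrite in_itv/= ltr01 ltrN10.
have iF t : t \in `](-1), 1[ -> (leb R n).-integrable setT (EFin \o F t).
  move=> ht; apply: (bounded_support_integrable cBM (mF t) _ (C := Cf)) => x; last exact: hCf.
  by move=> hx; apply: fK; exact: Kt ht x hx.
have lim : h^-1 *: (\int[leb R n]_y F (h + 0) y - \int[leb R n]_y F 0 y) @[h --> (0 : R)^'] -->
    \int[leb R n]_y partial1of2 F 0 y.
  apply: (@cvg_differentiation_under_integral R _ _ (leb R n) F setT measurableT 0 (-1) 1 I0 _ _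
    (fun y => C * \1_[set x : 'rV[R]_n | `|x| <= M + 1] (y : 'rV[R]_n))).
  - by move=> t ht; exact: iF.
  - by move=> t y _ _; exact: @ex_derive _ _ _ _ _ _ _ (dF t y).
  - by move=> y; rewrite mulr_ge0// ltW.
  - exact: integrable_indic_compact.
  - move=> t y ht _; rewrite d1E indicE.
    have [Ky|nKy] := pselect ([set x : 'rV[R]_n | `|x| <= M + 1] y); first by rewrite mem_set//= mulr1.
    by rewrite pK ?normr0 ?mulr_ge0// ?(ltW C0)//; exact: Kt ht y nKy.
have E0 t : (\int[leb R n]_y F t y)%R = (\int[leb R n]_y f y)%R.
  by rewrite /Rintegral (leb_translate_real _ mf).
have Z : (\int[leb R n]_y partial1of2 F 0 y)%R = 0.
  apply: cvg_unique lim _ => //; rewrite (_ : (fun h => _) = fun=> 0); first exact: cvg_cst.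
  by apply/funext => h; rewrite !E0 subrr scaler0.
have ip : (leb R n).-integrable setT (EFin \o (partial i f : borel 'rV[R]_n -> R)).
  by apply: bounded_support_integrable cK _ pK hC; exact: continuous_borelRT.
rewrite -(@fineK _ (\int[leb R n]_x (partial i f x)%:E)%E); last exact: integrable_fin_num.
congr EFin; rewrite -[RHS]Z; apply: eq_Rintegral => y _.
by rewrite d1E scale0r addr0.
Qed.

End TestFunctions.

Lemma fin_num_sub0 (R : numDomainType) (a b : \bar R) :
  a \is a fin_num -> b \is a fin_num -> (a - b = 0)%E -> a = b.
Proof. by case: a => // a; case: b => // b _ _ [] /eqP; rewrite subr_eq0 => /eqP ->. Qed.

(** * Weak derivatives and the fundamental lemma *)

Section WeakDerivatives.
Variables (R : realType) (n : nat).
Implicit Types (f g v psi : 'rV[R]_n -> R) (U K : set 'rV[R]_n).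

Lemma Ck_cover k U V f : Ck k U f -> Ck k V f -> Ck k (U `|` V) f.
Proof.
elim: k f => [|k IH] f [cU hU] [cV hV]; split => //.
- by move=> x [/cU|/cV].
- by move=> x [/cU|/cV].
- by move=> i; split; [move=> x [/(hU i).1|/(hV i).1]|apply: IH; [exact: (hU i).2|exact: (hV i).2]].
Qed.

(** [f] is controlled on [U] only; the product is C^k on [U] and zero on the open complement of [K],
    and these two sets cover the space. *)
Lemma Ck_mul_supp k U K f psi : open U -> compact K -> K `<=` U -> Ck k U f -> Ck k setT psi ->
  (forall x, ~ K x -> psi x = 0) -> Ck k setT (fun x => f x * psi x).
Proof.
move=> oU cK KU hf hp pK.
have oK : open (~` K) by apply: closed_openC; apply: compact_closed => //; exact: norm_hausdorff.
have -> : [set: 'rV[R]_n] = U `|` ~` K.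
  by apply/seteqP; split => // x _; have [/KU|] := pselect (K x); [left|right].
apply: Ck_cover; first by apply: CkM => //; exact: Ck_sub hp.
by apply: (Ck_open_eq (f := fun=> 0) oK); [move=> x nK; rewrite pK ?mulr0|exact: Ck_cst].
Qed.

Lemma partial_supp K f i x : compact K -> (forall x, ~ K x -> f x = 0) -> ~ K x -> partial i f x = 0.
Proof.
move=> cK fK nK; have oK : open (~` K) by apply: closed_openC; apply: compact_closed => //; exact: norm_hausdorff.
rewrite /partial (@near_eq_derive _ _ _ _ (cst 0)) ?derive_cst//.
by apply: filterS (open_nbhs_nbhs (conj oK nK)) => y; exact: fK.
Qed.

Lemma partialM f g i x : derivable f x (delta_mx 0 i) -> derivable g x (delta_mx 0 i) ->
  partial i (fun y => f y * g y) x = partial i f x * g x + f x * partial i g x.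
Proof.
move=> df dg; rewrite /partial (_ : (fun y => f y * g y) = f * g)// deriveM//.
by rewrite /GRing.scale /= addrC [g x * _]mulrC.
Qed.

Lemma integral_shrink U K (h : borel 'rV[R]_n -> \bar R) : K `<=` U -> (forall x, U x -> ~ K x -> h x = 0%E) ->
  (\int[leb R n]_(x in U) h x = \int[leb R n]_(x in K) h x)%E.
Proof.
move=> KU hK; rewrite integral_mkcond [RHS]integral_mkcond; congr integral.
apply/funext => x; rewrite !patchE.
have [Kx|nK] := pselect (K x); first by rewrite !mem_set//; exact: KU.
rewrite [in RHS]memNset//; case: ifPn => // /set_mem Ux; exact: hK.
Qed.

Lemma supp_integrable U K (a : 'rV[R]_n -> R) : open U -> compact K -> K `<=` U ->
  (forall x, U x -> {for x, continuous a}) -> (forall x, U x -> ~ K x -> a x = 0) ->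
  (leb R n).-integrable (U : set (borel 'rV[R]_n)) (EFin \o (a : borel 'rV[R]_n -> R)).
Proof.
move=> oU cK KU ca aK.
have [C C0 hC] := compact_bound cK (fun x Kx => ca x (KU x Kx)).
have mU : measurable (U : set (borel 'rV[R]_n)) by exact: borel_open.
have I := integrableS measurableT mU (@subsetT _ _) (integrable_indic_compact C cK).
apply: (le_integrable mU _ _ I).
- by apply/measurable_EFinP; exact: continuous_borelR.
- move=> x Ux; rewrite /= lee_fin indicE.
  have [Kx|nK] := pselect (K x).
    by rewrite mem_set//= mulr1 (le_trans (hC x Kx))// ler_norm.
  by rewrite aK// normr0.
Qed.

Lemma loc_integrable_mul U K v psi : open U -> compact K -> K `<=` U -> loc_integrable U v ->
  continuous psi -> (forall x, ~ K x -> psi x = 0) ->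
  (leb R n).-integrable (U : set (borel 'rV[R]_n)) (EFin \o (fun x : borel 'rV[R]_n => v x * psi x)).
Proof.
move=> oU cK KU [mv iv] cp pK.
have mU : measurable (U : set (borel 'rV[R]_n)) by exact: borel_open.
have mK : measurable (K : set (borel 'rV[R]_n)) by apply: borel_compact => //; exact: norm_hausdorff.
have mp : measurable_fun setT (psi : borel 'rV[R]_n -> R) by exact: continuous_borelRT.
have mvp : measurable_fun (U : set (borel 'rV[R]_n)) (fun x : borel 'rV[R]_n => v x * psi x).
  by apply: measurable_funM => //; apply: measurable_funS mp.
have [C C0 hC] := compact_support_bounded cK cp pK.
have mvK : measurable_fun (K : set (borel 'rV[R]_n)) (v : borel 'rV[R]_n -> R).
  by apply: measurable_funS mv.
apply/integrableP; split; first exact/measurable_EFinP.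
rewrite (integral_shrink KU); last by move=> x _ nK; rewrite /= pK// mulr0 normr0.
apply: (@le_lt_trans _ _ (\int[leb R n]_(x in K) (C%:E * `|v x|%:E))%E).
  apply: ge0_le_integral => //.
  - apply: measurableT_comp => //; apply: (measurable_funS mU KU); exact/measurable_EFinP.
  - by apply: measurable_funeM; apply/measurable_EFinP; exact: measurableT_comp mvK.
  - by move=> x _; rewrite /= lee_fin normrM mulrC ler_wpM2r.
rewrite ge0_integralZl//; last 2 first.
  - by apply/measurable_EFinP; exact: measurableT_comp mvK.
  - by rewrite lee_fin ltW.
by rewrite lte_mul_pinfty ?lee_fin ?(ltW C0)//; have := iv K cK KU; rewrite lebesgueNE.
Qed.

Lemma continuous_loc_integrable U f : open U -> (forall x, U x -> {for x, continuous f}) -> loc_integrable U f.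
Proof.
move=> oU cf; split; first exact: continuous_borelR.
move=> K cK KU; rewrite lebesgueNE.
have [C C0 hC] := compact_bound cK (fun x Kx => cf x (KU x Kx)).
have mK : measurable (K : set (borel 'rV[R]_n)) by apply: borel_compact => //; exact: norm_hausdorff.
have mU : measurable (U : set (borel 'rV[R]_n)) by exact: borel_open.
apply: (@le_lt_trans _ _ (\int[leb R n]_(x in K) C%:E)%E).
  have mf : measurable_fun (K : set (borel 'rV[R]_n)) (fun x : borel 'rV[R]_n => `|f x|%:E).
    apply/measurable_EFinP; apply: measurableT_comp => //.
    by apply: (measurable_funS mU KU); exact: continuous_borelR.
  by apply: ge0_le_integral => // x Kx; rewrite lee_fin; exact: hC.
by rewrite integral_cst// lte_mul_pinfty ?lee_fin ?(ltW C0)//; exact: leb_compact.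
Qed.

Lemma integral_by_parts U K f psi i : open U -> compact K -> K `<=` U -> Ck 1 U f -> Ck 1 setT psi ->
  (forall x, ~ K x -> psi x = 0) ->
  (\int[leb R n]_(x in U) (f x * partial i psi x)%:E = - \int[leb R n]_(x in U) (partial i f x * psi x)%:E)%E.
Proof.
move=> oU cK KU hf hp pK.
have cpsi : continuous psi by move=> x; exact: (Ck_continuous hp).
have cdp : continuous (partial i psi) by move=> x; exact: (hp.2 i).2.1.
have ppK x : ~ K x -> partial i psi x = 0 by exact: partial_supp.
have F := integral_partial i (Ck_mul_supp oU cK KU hf hp pK) cK.
have {F} F : (\int[leb R n]_x (partial i (fun x => (f x * psi x)%R) x)%:E = 0)%E.
  by apply: F => x nK; rewrite pK// mulr0.
rewrite (integral_shrink (@subsetT _ U)) in F; last first.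
  by move=> x _ nU; rewrite (@partial_supp K)// => [y nK|/KU//]; rewrite pK// mulr0.
have i1 : (leb R n).-integrable (U : set (borel 'rV[R]_n)) (EFin \o (fun x : borel 'rV[R]_n => partial i f x * psi x)).
  apply: (supp_integrable oU cK KU) => [x Ux|x _ nK]; last by rewrite pK ?mulr0.
  by apply: (@continuousM R _ (partial i f) psi x); [exact: (hf.2 i).2.1|exact: cpsi].
have i2 : (leb R n).-integrable (U : set (borel 'rV[R]_n)) (EFin \o (fun x : borel 'rV[R]_n => f x * partial i psi x)).
  apply: (supp_integrable oU cK KU) => [x Ux|x _ nK]; last by rewrite ppK ?mulr0.
  by apply: (@continuousM R _ f (partial i psi) x); [exact: hf.1|exact: cdp].
have mU : measurable (U : set (borel 'rV[R]_n)) by exact: borel_open.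
have f1 := integrable_fin_num mU i1.
have f2 := integrable_fin_num mU i2.
have E : (\int[leb R n]_(x in U) (partial i f x * psi x)%:E + \int[leb R n]_(x in U) (f x * partial i psi x)%:E = 0)%E.
  rewrite -(integralD mU i1 i2) -[RHS]F; apply: eq_integral => x /set_mem Ux.
  by rewrite /= -EFinD partialM//; [exact: (hf.2 i).1|exact: (hp.2 i).1].
move: E f1 f2; rewrite /comp.
case: (\int[leb R n]_(x in U) (partial i f x * psi x)%:E)%E => // a.
case: (\int[leb R n]_(x in U) (f x * partial i psi x)%:E)%E => // b.
by move=> [] /eqP; rewrite addr_eq0 => /eqP -> _ _; rewrite EFinN oppeK.
Qed.

Section FundamentalLemma.
Variables (U : set 'rV[R]_n) (v : 'rV[R]_n -> R).
Hypotheses (oU : open U) (vU : loc_integrable U v).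
Hypothesis v_test : forall psi, test_function U psi -> (\int[leb R n]_(x in U) (v x * psi x)%:E = 0)%E.

Let mU : measurable (U : set (borel 'rV[R]_n)). Proof. exact: borel_open. Qed.

Let v_continuous f : continuous f -> supported_in U f -> (\int[leb R n]_(x in U) (v x * f x)%:E = 0)%E.
Proof.
move=> cf [K [cK KU fK]].
have [K1 [cK1 K1U h]] := test_function_density oU cK KU cf fK.
have cKK : compact (K `|` K1) by exact: compactU.
have KKU : K `|` K1 `<=` U by move=> x [/KU|/K1U].
have iv := vU.2 _ cKK KKU; rewrite lebesgueNE in iv.
have if_ := loc_integrable_mul oU cK KU vU cf fK.
have fn := integrable_fin_num mU if_.
apply/eqP; rewrite -abse_eq0 eq_le abse_ge0 andbT; apply/lee_addgt0Pr => e e0; rewrite add0e.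
set I := (\int[leb R n]_(x in K `|` K1) `|v x|%:E)%E in iv.
have I0 : (0 <= I)%E by apply: integral_ge0 => x _; rewrite lee_fin.
have Ifin : I \is a fin_num by rewrite ge0_fin_numE.
(* Replacing [f] by a test function within d changes the integral by at most d I, which is at most
   e. *)
pose d := e / (fine I + 1).
have I1 : 0 < fine I + 1 by rewrite ltr_wpDl// fine_ge0.
have d0 : 0 < d by rewrite divr_gt0.
have [psi [sp pK1 psif _]] := h d d0.
have cp : continuous psi by move=> x; exact: (Ck_continuous (sp 0%N)).
have ip := loc_integrable_mul oU cK1 K1U vU cp pK1.
have cfp : continuous (fun x => f x - psi x).
  by move=> x; apply: (@continuousB _ R^o _ f psi); [exact: cf|exact: cp].
have fpK x : ~ (K `|` K1) x -> f x - psi x = 0.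
  by move=> nK; rewrite fK ?pK1 ?subrr// => ?; apply: nK; [right|left].
have ifp := loc_integrable_mul oU cKK KKU vU cfp fpK.
have E : (\int[leb R n]_(x in U) (v x * f x)%:E = \int[leb R n]_(x in U) (v x * (f x - psi x))%:E)%E.
  rewrite -[LHS]sube0 -(v_test (psi := psi)); last by split => //; exists K1.
  rewrite -(integralB mU if_ ip); apply: eq_integral => x _.
  by rewrite /= -EFinB mulrBr.
rewrite E; apply: le_trans (le_abse_integral _ mU _) _.
  by have /integrableP[] := ifp.
rewrite (integral_shrink KKU); last by move=> x _ nK; rewrite /= fpK// mulr0 normr0.
have mK : measurable (K `|` K1 : set (borel 'rV[R]_n)) by apply: borel_compact => //; exact: norm_hausdorff.
have mvK : measurable_fun (K `|` K1 : set (borel 'rV[R]_n)) (v : borel 'rV[R]_n -> R).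
  by apply: (measurable_funS mU KKU); exact: vU.1.
apply: (@le_trans _ _ (\int[leb R n]_(x in K `|` K1) (d%:E * `|v x|%:E))%E).
  apply: ge0_le_integral => //.
  - apply: measurableT_comp => //; apply: (measurable_funS mU KKU).
    by have /integrableP[] := ifp.
  - by apply: measurable_funeM; apply/measurable_EFinP; exact: measurableT_comp mvK.
  - by move=> x _; rewrite /= lee_fin normrM mulrC ler_wpM2r// distrC.
rewrite ge0_integralZl//; last 2 first.
  - by apply/measurable_EFinP; exact: measurableT_comp mvK.
  - by rewrite lee_fin ltW.
rewrite -/I -(fineK Ifin) -EFinM lee_fin /d mulrAC ler_pdivrMr// ler_pM2l//.
by rewrite lerDl.
Qed.

(** The positive and negative parts of v, taken as densities, integrate alike every nonnegative
    continuous function with compact support in [U], so they define the same measure on Borel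
    subsets of [U]. The set where v > 0 has measure 0 for the negative part, hence for the positive
    part, which forces it to be a null set. *)
Lemma fundamental_lemma_pos : leb R n [set x | U x /\ 0 < v x] = 0%E.
Proof.
pose wp (x : borel 'rV[R]_n) : R := if `[< U x >] then Num.max (v x) 0 else 0.
pose wm (x : borel 'rV[R]_n) : R := if `[< U x >] then Num.max (- v x) 0 else 0.
have mif (w : 'rV[R]_n -> R) : measurable_fun (U : set (borel 'rV[R]_n)) (w : borel 'rV[R]_n -> R) ->
    measurable_fun setT (fun x : borel 'rV[R]_n => if `[< U x >] then w x else 0).
  move=> mw; rewrite (_ : (fun x => _) = (w : borel 'rV[R]_n -> R) \_ U).
    by apply/(measurable_restrictT (w : borel 'rV[R]_n -> R) mU).
  by apply/funext => x; rewrite patchE; case: asboolP => h; [rewrite mem_set|rewrite memNset].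
have mwp : measurable_fun setT wp.
  by apply: (mif (fun x => Num.max (v x) 0)); apply: measurable_maxr => //; exact: vU.1.
have mwm : measurable_fun setT wm.
  apply: (mif (fun x => Num.max (- v x) 0)); apply: measurable_maxr => //.
  by apply: measurableT_comp => //; exact: vU.1.
have wp0 x : 0 <= wp x by rewrite /wp; case: ifP => // _; rewrite le_max lexx orbT.
have wm0 x : 0 <= wm x by rewrite /wm; case: ifP => // _; rewrite le_max lexx orbT.
have wpU x : ~ U x -> wp x = 0 by move=> nU; rewrite /wp asboolF.
have wmU x : ~ U x -> wm x = 0 by move=> nU; rewrite /wm asboolF.
have wpv x : wp x <= `|v x|.
  by rewrite /wp; case: ifP => // _; rewrite ge_max normr_ge0 ler_norm.
have wmv x : wm x <= `|v x|.
  by rewrite /wm; case: ifP => // _; rewrite ge_max normr_ge0 andbT -normrN ler_norm.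
have wpm x : U x -> wp x - wm x = v x.
  move=> Ux; rewrite /wp /wm asboolT//; have mx (a : R) : Num.max a 0 - Num.max (- a) 0 = a.
    rewrite !maxEle oppr_le0; case: (ltgtP a 0) => [h|h|->]; by rewrite ?sub0r ?subr0 ?opprK ?oppr0.
  exact: mx.
pose B : set (borel 'rV[R]_n) := [set x | U x /\ 0 < v x].
have mB : measurable B.
  rewrite (_ : B = U `&` v @^-1` `]0, +oo[); first by apply: (vU.1 mU); exact: measurable_itv.
  by apply/seteqP; split => x [Ux]; rewrite /= in_itv/= andbT.
have fin (K : set 'rV[R]_n) : compact K -> K `<=` U -> (density (leb R n) mwp wp0 K < +oo)%E.
  move=> cK KU; have := vU.2 K cK KU; rewrite lebesgueNE; apply: le_lt_trans.
  have mK : measurable (K : set (borel 'rV[R]_n)) by apply: borel_compact => //; exact: norm_hausdorff.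
  apply: ge0_le_integral => //.
  - by move=> x _; rewrite lee_fin.
  - by apply/measurable_EFinP; apply: measurable_funS mwp.
  - apply/measurable_EFinP; apply: measurableT_comp => //.
    by apply: (measurable_funS mU KU); exact: vU.1.
  - by move=> x _; rewrite lee_fin.
have agree f : continuous f -> supported_in U f -> (forall x, 0 <= f x) ->
    (\int[density (leb R n) mwp wp0]_x (f x)%:E = \int[density (leb R n) mwm wm0]_x (f x)%:E)%E.
  move=> cf sf f0.
  have mf : measurable_fun setT (fun x : borel 'rV[R]_n => (f x)%:E).
    by apply/measurable_EFinP; exact: continuous_borelRT.
  have f0E (x : borel 'rV[R]_n) : (0 <= (f x)%:E)%E by rewrite lee_fin.
  rewrite (ge0_integral_density (leb R n) mwp wp0 mf f0E) (ge0_integral_density (leb R n) mwm wm0 mf f0E).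
  have zp (x : borel 'rV[R]_n) : setT x -> ~ U x -> ((f x)%:E * (wp x)%:E = 0)%E.
    by move=> _ nU; rewrite wpU// mule0.
  have zm (x : borel 'rV[R]_n) : setT x -> ~ U x -> ((f x)%:E * (wm x)%:E = 0)%E.
    by move=> _ nU; rewrite wmU// mule0.
  rewrite (integral_shrink (@subsetT _ U) zp) (integral_shrink (@subsetT _ U) zm).
  have [K [cK KU fK]] := sf.
  have if_ := loc_integrable_mul oU cK KU vU cf fK.
  have iw (w : borel 'rV[R]_n -> R) : measurable_fun setT w -> (forall x, 0 <= w x) -> (forall x, w x <= `|v x|) ->
      (leb R n).-integrable (U : set (borel 'rV[R]_n)) (fun x => (f x)%:E * (w x)%:E)%E.
    move=> mw w0 wv; apply: (le_integrable mU _ _ if_).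
      apply: emeasurable_funM; first by apply: measurable_funS mf.
      by apply/measurable_EFinP; apply: measurable_funS mw.
    by move=> x Ux; rewrite /= lee_fin !normrM mulrC ler_wpM2r// ger0_norm.
  have ip := iw _ mwp wp0 wpv; have im := iw _ mwm wm0 wmv.
  apply: (fin_num_sub0 (integrable_fin_num mU ip) (integrable_fin_num mU im)).
  rewrite -(integralB mU ip im) -(v_continuous cf sf); apply: eq_integral => x /set_mem Ux.
  by rewrite -!EFinM -EFinB -mulrBr wpm// mulrC.
have BU : B `<=` U by move=> x [].
have E := borel_measure_unique oU fin agree mB BU.
have Z : density (leb R n) mwp wp0 B = 0%E.
  rewrite E /density /= /density_fun; apply: integral0_eq => x [Ux vx]; rewrite /wm asboolT//.
  by rewrite max_r// oppr_le0 ltW.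
have mwB : measurable_fun B (fun x => (wp x)%:E) by apply/measurable_EFinP; exact (measurable_funS measurableT (@subsetT _ B) mwp).
have Z' : (\int[leb R n]_(x in B) `|(wp x)%:E| = 0)%E.
  by rewrite -[RHS]Z; apply: eq_integral => x _; rewrite gee0_abs// lee_fin.
have [+ _] := ae_eq_integral_abs (leb R n) mB mwB.
move=> /(_ Z') [A [mA A0 hA]]; apply: (subset_measure0 mB mA _ A0) => x Bx; apply: hA => /= /(_ Bx) [].
have [Ux vx] := Bx; rewrite /wp asboolT// => /eqP; rewrite max_l ?(ltW vx)//.
by rewrite gt_eqF.
Qed.

End FundamentalLemma.

Theorem fundamental_lemma U v : open U -> loc_integrable U v ->
  (forall psi, test_function U psi -> (\int[leb R n]_(x in U) (v x * psi x)%:E = 0)%E) ->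
  leb R n [set x | U x /\ v x <> 0] = 0%E.
Proof.
move=> oU vU h.
have mU : measurable (U : set (borel 'rV[R]_n)) by exact: borel_open.
have mp (w : 'rV[R]_n -> R) : loc_integrable U w -> measurable ([set x | U x /\ 0 < w x] : set (borel 'rV[R]_n)).
  move=> wU; rewrite (_ : [set x | _] = U `&` w @^-1` `]0, +oo[); first by apply: (wU.1 mU); exact: measurable_itv.
  by apply/seteqP; split => x [Ux]; rewrite /= in_itv/= andbT.
have nU : loc_integrable U (fun x => - v x).
  split; first by apply: measurableT_comp => //; exact: vU.1.
  move=> K cK KU; rewrite (_ : (fun x => _) = (fun x => `|v x|%:E)); first exact: vU.2.
  by apply/funext => x; rewrite normrN.
have hn psi : test_function U psi -> (\int[leb R n]_(x in U) (- v x * psi x)%:E = 0)%E.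
  move=> tp; have [sp [K [cK KU pK]]] := tp.
  have ip := loc_integrable_mul oU cK KU vU (fun x => Ck_continuous (sp 0%N) Logic.I) pK.
  have := h _ tp; under [X in _ -> X = _]eq_integral do rewrite mulNr EFinN.
  rewrite integralN/=; first by move=> ->; rewrite oppe0.
  exact: integrable_add_def.
have P1 := fundamental_lemma_pos oU vU h; have P2 := fundamental_lemma_pos oU nU hn.
have -> : [set x | U x /\ v x <> 0] = [set x | U x /\ 0 < v x] `|` [set x | U x /\ 0 < - v x].
  apply/seteqP; split => x /=.
    by move=> [Ux /eqP]; rewrite neq_lt oppr_gt0 => /orP[]; [right|left].
  by move=> [|] [Ux]; rewrite ?oppr_gt0 => v0; split => //; apply/eqP; [rewrite gt_eqF|rewrite lt_eqF].
by rewrite measureU0//; exact: mp.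
Qed.

(** Integration by parts shows that the classical derivative is also a weak one, and the difference
    of two weak derivatives annihilates all test functions. This lets classical derivatives of the
    metrics be bounded by weak covariant ones. *)
Corollary weak_partial_C1 U i f w : open U -> Ck 1 U f -> weak_partial U i f w ->
  leb R n [set x | U x /\ w x <> partial i f x] = 0%E.
Proof.
move=> oU hf [fU wU h]; have cf x : U x -> {for x, continuous f} by exact: hf.1.
have cdf x : U x -> {for x, continuous (partial i f)} by exact: (hf.2 i).2.1.
have pU := continuous_loc_integrable oU cdf.
have mU : measurable (U : set (borel 'rV[R]_n)) by exact: borel_open.
have dU : loc_integrable U (fun x => w x - partial i f x).
  split; first by apply: measurable_funB; [exact: wU.1|exact: pU.1].
  move=> K cK KU; rewrite lebesgueNE.
  have mK : measurable (K : set (borel 'rV[R]_n)) by apply: borel_compact => //; exact: norm_hausdorff.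
  have mKw (u : 'rV[R]_n -> R) : loc_integrable U u ->
    measurable_fun (K : set (borel 'rV[R]_n)) (fun x : borel 'rV[R]_n => `|u x|%:E).
    by move=> uU; apply/measurable_EFinP; apply: measurableT_comp => //; apply: (measurable_funS mU KU); exact: uU.1.
  apply: (@le_lt_trans _ _ (\int[leb R n]_(x in K) (`|w x|%:E + `|partial i f x|%:E))%E).
    apply: ge0_le_integral => //; last by move=> x _; rewrite -EFinD lee_fin ler_normB.
    - apply/measurable_EFinP; apply: measurableT_comp => //; apply: (measurable_funS mU KU).
      by apply: measurable_funB; [exact: wU.1|exact: pU.1].
    - by apply: emeasurable_funD; exact: mKw.
  rewrite ge0_integralD//; try exact: mKw.
  by rewrite lte_add_pinfty//; [have := wU.2 K cK KU|have := pU.2 K cK KU]; rewrite lebesgueNE.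
rewrite (_ : [set x | _] = [set x | U x /\ w x - partial i f x <> 0]); last first.
  apply/seteqP; split => x [Ux h']; split => //.
    by move=> /eqP; rewrite subr_eq0 => /eqP.
  by move=> wx; apply: h'; rewrite wx subrr.
apply: fundamental_lemma => // psi tp; have [sp [K [cK KU pK]]] := tp.
have cp := fun x => Ck_continuous (sp 0%N) (Logic.I : setT x).
have ip := loc_integrable_mul oU cK KU pU cp pK.
have iw := loc_integrable_mul oU cK KU wU cp pK.
have E := h psi tp; rewrite lebesgueNE (integral_by_parts i oU cK KU hf (sp 1%N) pK) in E.
under eq_integral do rewrite mulrBl EFinB.
rewrite (integralB mU iw ip) -(oppe_inj E); apply: subee.
rewrite (oppe_inj E); exact: (integrable_fin_num mU iw).
Qed.

End WeakDerivatives.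

(** * Morrey's inequality *)

(** If a > d then a/d <= (a/d)^p. The free parameter d stands in for Hoelder's inequality: the
    constant part is made small first, and the energy afterwards. *)
Lemma young (R : realType) (a d p : R) : 0 <= a -> 0 < d -> 1 <= p ->
  a <= d + d * d^-1 `^ p * a `^ p.
Proof.
move=> a0 d0 p1; have [ad|/ltW da] := leP a d.
  by rewrite (le_trans ad)// lerDl !mulr_ge0 ?powR_ge0 ?ltW.
rewrite -mulrA -powRM ?invr_ge0 ?(ltW d0)// [leLHS](_ : a = d * (d^-1 * a)); last first.
  by rewrite mulVKf// gt_eqF.
apply: ler_wpDl; first exact: ltW.
rewrite ler_wpM2l ?(ltW d0)//.
have h1 : 1 <= d^-1 * a by rewrite mulrC ler_pdivlMr// mul1r.
by rewrite -[leLHS]powRr1 ?(le_trans ler01 h1)//; exact: ler_powR.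
Qed.

Section Morrey.
Variables (R : realType) (n : nat).
Variables (U : set 'rV[R]_n) (f : 'rV[R]_n -> R) (x : 'rV[R]_n) (r p d : R) (q : nat).
Hypotheses (oU : open U) (hf : Ck 1 U f) (r0 : 0 < r) (d0 : 0 < d) (p1 : 1 <= p).
Hypotheses (q0 : (0 < q)%N) (hq : (q * n)%:R <= q.-1%:R * p).
Let B : set 'rV[R]_n := [set y | `|y - x| < r].
Hypothesis BU : B `<=` U.

Let E (z : 'rV[R]_n) : R := \sum_i `|partial i f z| `^ p.
Let C := d * d^-1 `^ p.
Let C0 : 0 <= C. Proof. by rewrite mulr_ge0 ?powR_ge0 ?ltW. Qed.
Let E_ge0 z : 0 <= E z. Proof. by apply: sumr_ge0 => i _; exact: powR_ge0. Qed.

Let oB : open B.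
Proof.
rewrite (_ : B = ball x r); first exact: ball_open.
by apply/seteqP; split => y; rewrite -ball_normE /ball_ /B /= distrC.
Qed.

Let mB : measurable (B : set (borel 'rV[R]_n)). Proof. exact: borel_open. Qed.

Let mpowf (g : 'rV[R]_n -> R) : (forall y, U y -> {for y, continuous g}) ->
  measurable_fun (B : set (borel 'rV[R]_n)) (fun y : borel 'rV[R]_n => `|g y| `^ p).
Proof.
move=> cg; apply: (measurableT_comp (measurable_powR p)); apply: measurableT_comp => //.
by apply: (@continuous_borelR R 'rV[R]_n B g oB) => y By; apply: cg; exact: BU.
Qed.

Let mE : measurable_fun (B : set (borel 'rV[R]_n)) (E : borel 'rV[R]_n -> R).
Proof. by apply: measurable_sum => i; apply: mpowf; exact: (hf.2 i).2.1. Qed.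

Let E0 : borel 'rV[R]_n -> R := (E : borel 'rV[R]_n -> R) \_ B.
Let E0_ge0 z : 0 <= E0 z. Proof. by rewrite /E0 patchE; case: ifP. Qed.
Let mE0 : measurable_fun setT E0. Proof. by apply/(measurable_restrictT _ mB). Qed.

(** The weight u^(q-1) comes from the speed of u -> x + u^q (y - x). Raised to the power p it is at
    most u^(q n) by [hq], and u^(q n) is the Jacobian of the homothety of ratio u^q. *)
Let scaled_young (u a : R) : 0 <= u <= 1 -> 0 <= a -> u ^+ q.-1 * a <= d + C * (u ^+ (q * n) * a `^ p).
Proof.
move=> /andP[u0 u1] a0; have ua : 0 <= u ^+ q.-1 * a by rewrite mulr_ge0// exprn_ge0.
apply: (le_trans (young ua d0 p1)); rewrite lerD2l ler_wpM2l// powRM ?exprn_ge0// ler_wpM2r ?powR_ge0//.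
have p0 : 0 < p by exact: lt_le_trans p1.
have [qn0|qn0] := eqVneq (q * n)%N 0%N.
  have E1 : 1 `^ p = 1 :> R by rewrite powR1.
  rewrite qn0 expr0 -[leRHS]E1; apply: (ge0_ler_powR (ltW p0)); rewrite ?nnegrE ?exprn_ge0//.
  exact: exprn_ile1.
(* For u = 0 the weight vanishes unless q = 1, and then [hq] forces q n = 0, which is the case
   already treated. *)
have [u00|un0] := eqVneq u 0.
  rewrite u00 [X in X `^ _](_ : _ = 0) ?powR0 ?exprn_ge0 ?gt_eqF//.
  rewrite expr0n; case: eqP => // q10; move: hq; rewrite q10 mul0r lern0 => h.
  by rewrite h in qn0.
rewrite -!powR_mulrn// -powRrM; apply: ger_powR => //.
by rewrite u1 andbT lt_neqAle eq_sym un0.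
Qed.

(** The segment from x to y run with parameter u^q: the slow start at x compensates the factor u^(-q
    n) that the substitution y -> path u y produces when averaging over y. *)
Let path (u : R) (y : 'rV[R]_n) : 'rV[R]_n := u ^+ q *: y + (x - u ^+ q *: x).
Let path_sub u y : path u y - x = u ^+ q *: (y - x).
Proof. by rewrite /path scalerBr; apply/rowP => j; rewrite !mxE; ring. Qed.

Let path_B u y : 0 <= u <= 1 -> B y -> B (path u y).
Proof.
move=> /andP[u0 u1] By; rewrite /B /= path_sub normrZ ger0_norm ?exprn_ge0//.
by apply: le_lt_trans By; rewrite ler_piMl// exprn_ile1.
Qed.

Let mpath : measurable_fun setT (fun z : measurableTypeR R * borel 'rV[R]_n => path z.1 z.2 : borel 'rV[R]_n).
Proof.
apply: measurable_rV => j; rewrite /path.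
rewrite (_ : (fun z => _) = (fun z : measurableTypeR R * borel 'rV[R]_n =>
  (z.1 : R) ^+ q * (z.2 : 'rV[R]_n) 0 j + (x 0 j - (z.1 : R) ^+ q * x 0 j))); last first.
  by apply/funext => z; rewrite !mxE.
have m1 : measurable_fun setT (fun z : measurableTypeR R * borel 'rV[R]_n => (z.1 : R) ^+ q).
  by apply: measurable_funX; exact: measurable_fst.
apply: measurable_funD; first apply: measurable_funM => //.
  exact: (measurableT_comp (measurable_coord j) measurable_snd).
apply: measurable_funB => //; exact: measurable_funM.
Qed.

Let H (z : measurableTypeR R * borel 'rV[R]_n) : R :=
  q%:R * r * (n%:R * d + C * ((z.1 : R) ^+ (q * n) * E0 (path z.1 z.2))).

Let mH : measurable_fun setT H.
Proof.
apply: measurable_funM => //; apply: measurable_funD => //; apply: measurable_funM => //.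
apply: measurable_funM; first by apply: measurable_funX; exact: measurable_fst.
exact: measurableT_comp mE0 mpath.
Qed.

Let qr0 : 0 <= q%:R * r. Proof. by rewrite mulr_ge0// ltW. Qed.

Let H_ge0 u y : 0 <= u -> 0 <= H (u, y).
Proof.
move=> u0; rewrite /H mulr_ge0// addr_ge0//; first by rewrite mulr_ge0// ltW.
by apply: mulr_ge0; [exact: C0|apply: mulr_ge0; [exact: exprn_ge0|exact: E0_ge0]].
Qed.

Let line_bound (y : 'rV[R]_n) : B y ->
  (`|f x|%:E <= `|f y|%:E + \int[@lebesgue_measure R]_(u in `[0%R, 1%R]) (H (u, y))%:E)%E.
Proof.
move=> By; pose v := y - x.
pose phi (u : R) := f (x + u ^+ q *: v).
pose dphi (u : R) := 'D_v f (x + u ^+ q *: v) * (q%:R * u ^+ q.-1).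
have pathE u : x + u ^+ q *: v = path u y.
  by rewrite /v -[RHS](subrK x) path_sub addrC.
have inU u : 0 <= u <= 1 -> U (x + u ^+ q *: v) by move=> u01; apply: BU; rewrite pathE; exact: path_B.
have dphiE (u : R) : 0 <= u <= 1 -> is_derive u (1 : R) phi (dphi u).
  move=> u01; have df := Ck_differentiable oU hf (inU u u01).
  have dfv : derivable f (x + u ^+ q *: v) v by exact: diff_derivable.
  have dl := derivable_line dfv.
  have dX : is_derive u (1 : R) (fun s : R => s ^+ q) (q%:R * u ^+ q.-1).
    have := @is_deriveX R R^o id q u 1 1 (is_derive_id _ _).
    by rewrite (_ : id ^+ q = (fun s : R => s ^+ q)) ?exprfctE// /GRing.scale /= mulr1.
  have := @is_derive1_comp R (fun s => f (x + s *: v)) (fun s : R => s ^+ q) u _ _ dl dX.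
  by rewrite /dphi /phi.
have cpart i u : 0 <= u <= 1 -> {for u, continuous (fun u : R => partial i f (x + u ^+ q *: v))}.
  move=> u01; apply: (@continuous_comp _ _ _ (fun u : R => x + u ^+ q *: v)); last first.
    exact: ((hf.2 i).2.1 _ (inU u u01)).
  apply: (@continuousD _ 'rV[R]_n R^o (fun=> x)); first exact: cst_continuous.
  apply: (@continuousZr_tmp _ _ R^o); exact: exprn_continuous.
have dphi_sum u : 0 <= u <= 1 -> dphi u = (\sum_i v 0 i * partial i f (x + u ^+ q *: v)) * (q%:R * u ^+ q.-1).
  by move=> u01; rewrite /dphi derive_sum_partial//; exact: Ck_differentiable oU hf (inU u u01).
(* Equal to [dphi] on the unit interval, but written with partial derivatives so that continuity is
   visible. *)
pose psi (u : R) := (\sum_i v 0 i * partial i f (x + u ^+ q *: v)) * (q%:R * u ^+ q.-1).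
have cpsi u : 0 <= u <= 1 -> {for u, continuous psi}.
  move=> u01; apply: (@continuousM R R^o).
    rewrite (_ : (fun u => _) = \sum_i (fun u : R => v 0 i * partial i f (x + u ^+ q *: v))); last first.
      by apply/funext => s; rewrite fct_sumE.
    elim/big_ind: _ => [|g h cg ch|i _]; first exact: cst_continuous.
      exact: (@continuousD _ R^o R^o g h).
    apply: (@continuousM R R^o (fun=> _)); first exact: cst_continuous.
    exact: cpart.
  apply: (@continuousM R R^o (fun=> _)); first exact: cst_continuous.
  exact: exprn_continuous.
have ftc : (\int[@lebesgue_measure R]_(u in `[0%R, 1%R]) (psi u)%:E = (phi 1)%:E - (phi 0)%:E)%E.
  apply: continuous_FTC2 => //.
  - by apply: continuous_in_subspaceT => u; rewrite inE /= in_itv /=; exact: cpsi.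
  - have cphi u : 0 <= u <= 1 -> {for u, continuous phi}.
      move=> u01; apply: (@differentiable_continuous R R^o R^o).
      by apply/derivable1_diffP; exact: @ex_derive _ _ _ _ _ _ _ (dphiE u u01).
    split.
    + move=> u; rewrite in_itv /= => /andP[u0 u1].
      by apply: @ex_derive _ _ _ _ _ _ _ (dphiE u _); rewrite !ltW.
    + by apply: cvg_at_right_filter; apply: cphi; rewrite lexx ler01.
    + by apply: cvg_at_left_filter; apply: cphi; rewrite lexx ler01.
  - move=> u; rewrite in_itv /= => /andP[u0 u1].
    have u01 : 0 <= u <= 1 by rewrite !ltW.
    by rewrite derive1E (@derive_val _ _ _ _ _ _ _ (dphiE u u01)) dphi_sum.
have phi0 : phi 0 = f x by rewrite /phi expr0n gtn_eqF// scale0r addr0.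
have phi1 : phi 1 = f y by rewrite /phi expr1n scale1r /v addrC subrK.
have m01 : measurable (`[0%R, 1%R]%classic : set (measurableTypeR R)) by exact: measurable_itv.
have mpsi : measurable_fun (`[0%R, 1%R]%classic : set (measurableTypeR R)) (fun u : measurableTypeR R => (psi u)%:E).
  apply/measurable_EFinP; apply: subspace_continuous_measurable_fun => //.
  by apply: continuous_in_subspaceT => u; rewrite inE /= in_itv /=; exact: cpsi.
have mHy : measurable_fun setT (fun u : measurableTypeR R => (H (u, y))%:E).
  by apply/measurable_EFinP; apply: measurableT_comp mH _; exact: measurable_pair2.
have key : (\int[@lebesgue_measure R]_(u in `[0%R, 1%R]) `|(psi u)%:E| <= \int[@lebesgue_measure R]_(u in `[0%R, 1%R]) (H (u, y))%:E)%E.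
  apply: ge0_le_integral => //.
  - exact: measurableT_comp mpsi.
  - by apply: measurable_funS mHy.
  - move=> u; rewrite /= in_itv /= => u01; rewrite lee_fin /psi normrM.
    have [u0 u1] := andP u01.
    rewrite [X in _ * X]ger0_norm; last by rewrite mulr_ge0// exprn_ge0.
    rewrite /H /= -pathE /E0 patchE mem_set; last by rewrite pathE; exact: path_B.
    rewrite mulrCA -mulrA ler_wpM2l//.
    rewrite mulr_sumr mulr_sumr mulrC [n%:R * d](_ : _ = \sum_(i < n) d); last first.
      by rewrite sumr_const card_ord mulr_natl.
    rewrite -big_split mulr_sumr /=; apply: le_trans (_ : \sum_i r * (u ^+ q.-1 * `|partial i f (x + u ^+ q *: v)|) <= _).
      apply: le_trans (ler_wpM2l _ (ler_norm_sum _ _ _)) _; first exact: exprn_ge0.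
      rewrite mulr_sumr; apply: ler_sum => i _; rewrite normrM mulrCA ler_wpM2r ?mulr_ge0 ?exprn_ge0//.
      by rewrite (le_trans (ler_coord _ _))// ltW.
    by apply: ler_sum => i _; rewrite ler_wpM2l ?(ltW r0)//; exact: scaled_young.
apply: (@le_trans _ _ (`|f y|%:E + `|((phi 1)%:E - (phi 0)%:E)%E|)%E).
  rewrite -EFinB abse_EFin -EFinD lee_fin phi0 phi1.
  by rewrite -[X in `|X| <= _](subKr (f y)) (le_trans (ler_normB _ _)).
rewrite leeD2l// -ftc; apply: le_trans key; exact: le_abse_integral.
Qed.

Let leb_B : leb R n B = ((2 * r) ^+ n)%:E.
Proof.
have hI (A : set (borel 'rV[R]_n)) : measurable A -> leb R n A = (\int[leb R n]_z (\1_A z)%:E)%E.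
  by move=> mA; rewrite integral_indic// setIT.
rewrite -leb_ball// !hI//; last first.
  apply: borel_open; rewrite (_ : [set _ | _] = (fun x : 'rV[R]_n => `|x|) @^-1` [set t | t < r])//.
  by apply: open_comp => [z _|]; [exact: norm_continuous|exact: open_lt].
have mI : measurable_fun setT (fun z : borel 'rV[R]_n => (\1_B (z : 'rV[R]_n))%:E : \bar R).
  by apply/measurable_EFinP; exact: measurable_indic.
have L := leb_translate x mI (fun z => _).
rewrite -L; last by move=> z; rewrite lee_fin.
by apply: eq_integral => z _; rewrite !indicE /B; congr (_%:R%:E); congr nat_of_bool; apply/idP/idP; rewrite !inE /= addrK.
Qed.

(** The map y -> path u y scales volumes by u^(q n), and [E0] vanishes off [B]. *)
Let avg u : 0 <= u <= 1 -> ((u ^+ (q * n))%:E * \int[leb R n]_(y in B) (E0 (path u y))%:E <= \int[leb R n]_(y in B) (E y)%:E)%E.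
Proof.
move=> /andP[u0 u1].
have mE0E : measurable_fun setT (fun z => (E0 z)%:E) by exact/measurable_EFinP.
have E0E (z : borel 'rV[R]_n) : (0 <= (E0 z)%:E)%E by rewrite lee_fin.
have -> : (\int[leb R n]_(y in B) (E y)%:E = \int[leb R n]_y (E0 y)%:E)%E.
  by rewrite integral_mkcond; apply: eq_integral => y _; rewrite /E0 !patchE; case: ifP.
have mp : measurable_fun setT (fun y : borel 'rV[R]_n => (E0 (path u y))%:E).
  apply/measurable_EFinP; apply: measurableT_comp mE0 _.
  exact: (measurableT_comp mpath (measurable_pair1 u)).
have sub : (\int[leb R n]_(y in B) (E0 (path u y))%:E <= \int[leb R n]_y (E0 (path u y))%:E)%E.
  apply: ge0_subset_integral => //.
(* At u = 0 the factor u^(q n) vanishes, except in dimension 0, where the space is a single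
   point. *)
have [u00|un0] := eqVneq u 0.
  have [n0|nn0] := eqVneq (q * n)%N 0%N.
    have nz : n = 0%N by move/eqP: n0; rewrite muln_eq0 (gtn_eqF q0) => /eqP.
    have Ex (z w : 'rV[R]_n) : z = w by apply/rowP => j; exfalso; move: j; rewrite nz; case.
    rewrite n0 expr0 mul1e; apply: le_trans sub _.
    by rewrite le_eqVlt; apply/orP; left; apply/eqP; apply: eq_integral => y _; rewrite (Ex (path u y) y).
  by rewrite u00 expr0n (negbTE nn0) mul0e; apply: integral_ge0 => y _.
have c0 : u ^+ q != 0 by rewrite expf_neq0.
have L := leb_affine (x - u ^+ q *: x) c0 mE0E E0E.
rewrite -L ger0_norm ?exprn_ge0// -exprM; apply: lee_wpmul2l => //.
by rewrite lee_fin exprn_ge0.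
Qed.

(** The fundamental theorem of calculus along the path from x to y is integrated over y in [B],
    whose volume is (2 r)^n; Tonelli then lets [avg] bound the gradient term for each u, and [young]
    bounds the integral of |f|. *)
Theorem morrey :
  (((2 * r) ^+ n * `|f x|)%:E <= ((2 * r) ^+ n * (d * (1 + q%:R * r * n%:R)))%:E +
    C%:E * (\int[leb R n]_(y in B) (`|f y| `^ p)%:E + (q%:R * r)%:E * \int[leb R n]_(y in B) (E y)%:E))%E.
Proof.
have m01 : measurable (`[0%R, 1%R]%classic : set (measurableTypeR R)) by exact: measurable_itv.
have mf : measurable_fun (B : set (borel 'rV[R]_n)) (fun y : borel 'rV[R]_n => `|f y|%:E).
  apply/measurable_EFinP; apply: measurableT_comp => //.
  by apply: (@continuous_borelR R 'rV[R]_n B f oB) => y By; apply: hf.1; exact: BU.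
pose H' (z : measurableTypeR R * borel 'rV[R]_n) : \bar R :=
  ((EFin \o H) \_ (`[0%R, 1%R] `*` B)) z.
have mD : measurable (`[0%R, 1%R] `*` B : set (measurableTypeR R * borel 'rV[R]_n)) by exact: measurableX.
have mH' : measurable_fun setT H'.
  apply/(measurable_restrictT (EFin \o H) mD).
  by apply: (measurable_funS measurableT (@subsetT _ _)); exact/measurable_EFinP.
have H'0 z : (0 <= H' z)%E.
  rewrite /H' patchE; case: ifP => // /set_mem [/= ]; rewrite in_itv /= => /andP[u0 _] _.
  by rewrite lee_fin; case: z u0 => u y /= u0; exact: H_ge0.
have inner y : B y -> (\int[@lebesgue_measure R]_(u in `[0%R, 1%R]) (H (u, y))%:E = \int[@lebesgue_measure R]_u H' (u, y))%E.
  move=> By; rewrite integral_mkcond; apply: eq_integral => u _; rewrite /H' !patchE.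
  case: ifPn => h; case: ifPn => h' //.
    by move: h'; rewrite notin_setE => -[]; split => //; exact: set_mem h.
  by move: h; rewrite notin_setE => -[]; have [] := set_mem h'.
have nB y : ~ B y -> (\int[@lebesgue_measure R]_u H' (u, y) = 0)%E.
  by move=> nBy; apply: integral0_eq => u _; rewrite /H' patchE memNset// => -[].
have mG : measurable_fun (B : set (borel 'rV[R]_n)) (fun y => \int[@lebesgue_measure R]_u H' (u, y))%E.
  apply: (measurable_funS measurableT (@subsetT _ _)).
  by apply: (@measurable_fun_fubini_tonelli_G _ _ _ _ _ (@lebesgue_measure R) H').
have step1 : (((2 * r) ^+ n * `|f x|)%:E <= \int[leb R n]_(y in B) `|f y|%:E +
    \int[leb R n]_(y in B) \int[@lebesgue_measure R]_u H' (u, y))%E.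
  rewrite -ge0_integralD//; last by move=> y _; apply: integral_ge0 => u _.
  rewrite mulrC EFinM -leb_B -integral_cst//.
  have mS := emeasurable_funD mf mG.
  apply: (ge0_le_integral (leb R n) mB _ _ mS); [by move=> y _; rewrite lee_fin|exact: measurable_cst|].
  by move=> y By; rewrite /= -inner//; exact: line_bound.
have step2 : (\int[leb R n]_(y in B) \int[@lebesgue_measure R]_u H' (u, y) =
    \int[@lebesgue_measure R]_(u in `[0%R, 1%R]) \int[leb R n]_(y in B) (H (u, y))%:E)%E.
  rewrite [RHS]integral_mkcond [LHS]integral_mkcond.
  transitivity (\int[leb R n]_y \int[@lebesgue_measure R]_u H' (u, y))%E.
    by apply: eq_integral => y _; rewrite patchE; case: ifPn => //; rewrite notin_setE => /nB ->.
  rewrite -(@fubini_tonelli _ _ _ _ _ (@lebesgue_measure R) (leb R n) H' mH' H'0).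
  apply: eq_integral => u _; rewrite patchE; case: ifPn => hu.
    rewrite [RHS]integral_mkcond; apply: eq_integral => y _; rewrite /H' !patchE.
    case: ifPn => h; case: ifPn => h' //.
      by move: h'; rewrite notin_setE; have [] := set_mem h.
    by move: h; rewrite notin_setE => -[]; split; [exact: set_mem hu|exact: set_mem h'].
  apply: integral0_eq => y _; rewrite /H' patchE memNset// => -[/= h _].
  by move: hu; rewrite notin_setE.
have step3 : (\int[@lebesgue_measure R]_(u in `[0%R, 1%R]) \int[leb R n]_(y in B) (H (u, y))%:E <=
    (q%:R * r)%:E * ((n%:R * d * (2 * r) ^+ n)%:E + C%:E * \int[leb R n]_(y in B) (E y)%:E))%E.
  have ub (u : R) : 0 <= u <= 1 -> (\int[leb R n]_(y in B) (H (u, y))%:E <=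
      (q%:R * r)%:E * ((n%:R * d * (2 * r) ^+ n)%:E + C%:E * \int[leb R n]_(y in B) (E y)%:E))%E.
    move=> u01; have [u0 u1] := andP u01.
    have mp : measurable_fun (B : set (borel 'rV[R]_n)) (fun y : borel 'rV[R]_n => (E0 (path u y))%:E).
      apply: (measurable_funS measurableT (@subsetT _ _)).
      apply/measurable_EFinP; apply: measurableT_comp mE0 _.
      exact: (measurableT_comp mpath (measurable_pair1 u)).
    have Cu0 : 0 <= C * u ^+ (q * n) by rewrite mulr_ge0// exprn_ge0.
    have -> : (\int[leb R n]_(y in B) (H (u, y))%:E =
      \int[leb R n]_(y in B) ((q%:R * r)%:E * ((n%:R * d)%:E + (C * u ^+ (q * n))%:E * (E0 (path u y))%:E)))%E.
      apply: eq_integral => y _.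
      transitivity ((q%:R * r * (n%:R * d + C * u ^+ (q * n) * E0 (path u y)))%:E); last by [].
      by congr (_%:E); rewrite /H /= mulrA.
    have nd0 : 0 <= n%:R * d by rewrite mulr_ge0// ltW.
    have t0 (y : borel 'rV[R]_n) : (0 <= (C * u ^+ (q * n))%:E * (E0 (path u y))%:E)%E by rewrite mule_ge0 ?lee_fin.
    have mt := measurable_funeM (C * u ^+ (q * n))%:E mp.
    rewrite ge0_integralZl//; first last.
    - by move=> y _; apply: adde_ge0; [rewrite lee_fin|exact: t0].
    - by apply: emeasurable_funD.
    apply: lee_wpmul2l; first by rewrite lee_fin.
    have IC (c : \bar R) : (\int[leb R n]_(y in B) c = c * leb R n B)%E by exact: integral_cst.
    rewrite ge0_integralD// IC leb_B -EFinM; apply: leeD => //.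
    rewrite ge0_integralZl//; last by move=> y _; rewrite lee_fin.
    rewrite EFinM -muleA; apply: lee_wpmul2l; first by rewrite lee_fin.
    exact: avg.
  set c := (_ * _)%E in ub *.
  have c0 : (0 <= c)%E by apply: le_trans (ub 0 _); [apply: integral_ge0 => y _; rewrite lee_fin H_ge0|rewrite lexx ler01].
  apply: (@le_trans _ _ (\int[@lebesgue_measure R]_(u in `[0%R, 1%R]) c)%E).
    apply: ge0_le_integral => //.
    - move=> u; rewrite /= in_itv/= => /andP[u0 _]; apply: integral_ge0 => y _.
      by rewrite lee_fin H_ge0.
    - have mF' : measurable_fun setT (fun u => \int[leb R n]_y H' (u, y))%E.
        by apply: (@measurable_fun_fubini_tonelli_F _ _ _ _ _ (leb R n) H').
      have mFs : measurable_fun (`[0%R, 1%R]%classic : set (measurableTypeR R)) (fun u => \int[leb R n]_y H' (u, y))%E.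
        exact (measurable_funS measurableT (@subsetT _ _) mF').
      apply: (eq_measurable_fun _ _ mFs) => u hu; rewrite [RHS]integral_mkcond; apply: eq_integral => y _.
      rewrite /H' !patchE; case: ifPn => h; case: ifPn => h' //.
        by move: h'; rewrite notin_setE; have [] := set_mem h.
      by move: h; rewrite notin_setE => -[]; split; [exact: set_mem hu|exact: set_mem h'].
  have -> : (\int[@lebesgue_measure R]_(u in `[0%R, 1%R]) c = c * @lebesgue_measure R `[0%R, 1%R])%E.
    exact: integral_cst.
  by rewrite lebesgue_measure_itv/= lte01 sube0 mule1.
have step4 : (\int[leb R n]_(y in B) `|f y|%:E <= (d * (2 * r) ^+ n)%:E + C%:E * \int[leb R n]_(y in B) (`|f y| `^ p)%:E)%E.
  have mfp : measurable_fun (B : set (borel 'rV[R]_n)) (fun y : borel 'rV[R]_n => (`|f y| `^ p)%:E).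
    by apply/measurable_EFinP; apply: mpowf; exact: hf.1.
  have mt := measurable_funeM C%:E mfp.
  rewrite EFinM -leb_B -(integral_cst _ mB) -ge0_integralZl//.
  have p0 (y : borel 'rV[R]_n) : B y -> (0 <= C%:E * (`|f y| `^ p)%:E)%E by rewrite mule_ge0 ?lee_fin// powR_ge0.
  have dd (y : borel 'rV[R]_n) : B y -> (0 <= cst d%:E y)%E by rewrite lee_fin ltW.
  have mc : measurable_fun (B : set (borel 'rV[R]_n)) (cst d%:E : borel 'rV[R]_n -> \bar R) by exact: measurable_cst.
  rewrite -(ge0_integralD (leb R n) mB dd mc p0 mt).
  apply: (ge0_le_integral (leb R n) mB _ mf (emeasurable_funD mc mt)) => [y _|y By]; first by rewrite lee_fin.
  by rewrite /= -EFinM -EFinD lee_fin; exact: young.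
apply: (le_trans step1); rewrite step2; apply: le_trans (leeD step4 step3) _.
set I1 := (\int[_]_(_ in _) _)%E; set I2 := (\int[_]_(_ in _) _)%E.
have I10 : (0 <= I1)%E by apply: integral_ge0 => y _; rewrite lee_fin powR_ge0.
have I20 : (0 <= I2)%E by apply: integral_ge0 => y _; rewrite lee_fin.
have nd0 : 0 <= n%:R * d * (2 * r) ^+ n by rewrite !mulr_ge0 ?exprn_ge0 ?mulr_ge0// ltW.
have CI2 : (0 <= C%:E * I2)%E by rewrite mule_ge0 ?lee_fin.
have qI2 : (0 <= (q%:R * r)%:E * I2)%E by rewrite mule_ge0 ?lee_fin.
have ndE : (0 <= (n%:R * d * (2 * r) ^+ n)%:E)%E by rewrite lee_fin.
rewrite (ge0_muleDr (q%:R * r)%:E ndE CI2) (ge0_muleDr C%:E I10 qI2) -EFinM.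
rewrite addeACA -EFinD (muleCA (q%:R * r)%:E C%:E I2).
apply: leeD => //; rewrite lee_fin le_eqVlt; apply/orP; left; apply/eqP; ring.
Qed.

End Morrey.

(** * Riemannian metrics in coordinates *)

Section PositiveDefinite.
Variable R : realType.

Definition posdef n (G : 'M[R]_n) :=
  G^T = G /\ forall v : 'rV[R]_n, v != 0 -> 0 < (v *m G *m v^T) 0 0.

(** Induction by Schur complement: S = D - w^T w / a is again positive definite, and its factor
    completes that of [G]. *)
Lemma posdef_cholesky n (G : 'M[R]_n) : posdef G -> exists B : 'M[R]_n, G = B *m B^T.
Proof.
elim: n G => [|n IH] G [symG posG]; first by exists 0; apply/matrixP => i; case: i.
pose G' : 'M[R]_(1 + n) := G.
pose a : R := G' 0 0; pose w : 'rV[R]_n := ursubmx G'; pose D : 'M[R]_n := drsubmx G'.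
have GE : G' = block_mx (a%:M : 'M[R]_1) w w^T D.
  rewrite -[LHS]submxK; congr block_mx.
    by apply/matrixP => i j; rewrite !ord1 !mxE eqxx mulr1n; congr (G _ _); apply/val_inj.
  by rewrite -[X in X = _]trmxK trmx_dlsub -/G' symG.
have quad (s : 'rV[R]_1) (v : 'rV[R]_n) : row_mx s v *m G' *m (row_mx s v)^T =
    a *: (s *m s^T) + (s *m w *m v^T + v *m w^T *m s^T) + v *m D *m v^T.
  rewrite GE mul_row_block tr_row_mx mul_row_col !mulmxDl mul_mx_scalar -scalemxAl.
  by rewrite !addrA; congr (_ + _); rewrite -!addrA; congr (_ + _); rewrite addrC.
have a0 : 0 < a.
  have e0 : row_mx (1%:M : 'rV[R]_1) (0 : 'rV[R]_n) != 0.
    by apply/eqP => /matrixP /(_ 0 (lshift n 0)); rewrite row_mxEl !mxE eqxx => /eqP; rewrite oner_eq0.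
  have := posG _ e0; rewrite -/G' quad !mul0mx trmx0 !mulmx0 !addr0 trmx1 mulmx1.
  by rewrite !mxE eqxx mulr1.
pose S : 'M[R]_n := D - a^-1 *: (w^T *m w).
have pS : posdef S.
  have symD : D^T = D by rewrite /D trmx_drsub symG.
  split; first by rewrite /S linearB linearZ /= trmx_mul trmxK symD.
  move=> v v0; pose t := v *m w^T; have wv : w *m v^T = t^T by rewrite trmx_mul trmxK.
  have vs : v *m S *m v^T = v *m D *m v^T - a^-1 *: (t *m t^T).
    by rewrite /S mulmxBr mulmxBl -scalemxAr -scalemxAl -wv /t !mulmxA.
  (* This first coordinate completes the square, so that the form of [G] at (s, v) equals the form
     of [S] at v. *)
  pose s : 'rV[R]_1 := - a^-1 *: t.
  have e0 : row_mx s v != 0.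
    apply: contra_neq v0 => h; have := congr1 (@rsubmx _ 1 1 n) h.
    by rewrite row_mxKr => ->; apply/matrixP => i j; rewrite !mxE.
  have := posG _ e0; rewrite -/G' quad -/t.
  have -> : a *: (s *m s^T) + (s *m w *m v^T + t *m s^T) + v *m D *m v^T = v *m S *m v^T.
    have sw : s *m w *m v^T = - a^-1 *: (t *m t^T) by rewrite -mulmxA wv /s -scalemxAl.
    have ts : t *m s^T = - a^-1 *: (t *m t^T) by rewrite /s linearZ /= -scalemxAr.
    have ss : s *m s^T = (- a^-1 * - a^-1) *: (t *m t^T).
      by rewrite /s linearZ /= -scalemxAl -scalemxAr scalerA.
    rewrite vs sw ts ss.
    rewrite -scalerDl scalerA -scalerDl addrC -scaleNr; congr (_ + _ *: _).
    by field; rewrite gt_eqF.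
  by [].
have [B hB] := IH S pS.
pose sa := Num.sqrt a.
have sa2 : sa * sa = a by rewrite -expr2 sqr_sqrtr// ltW.
have sa0 : sa != 0 by rewrite gt_eqF// sqrtr_gt0.
exists (block_mx (sa%:M : 'M[R]_1) 0 (sa^-1 *: w^T) B).
rewrite [LHS]GE (tr_block_mx (sa%:M : 'M[R]_1) 0 (sa^-1 *: w^T) B).
apply: etrans (esym (mulmx_block (sa%:M : 'M[R]_1) 0 (sa^-1 *: w^T) B (sa%:M : 'M[R]_1)^T (sa^-1 *: w^T)^T 0^T B^T)).
rewrite tr_scalar_mx trmx0 !mul0mx !mulmx0 !addr0 linearZ /= trmxK.
congr block_mx.
- by rewrite -scalar_mxM sa2.
- by rewrite mul_scalar_mx scalerA mulfV// scale1r.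
- by rewrite mul_mx_scalar scalerA mulfV// scale1r.
- rewrite -hB -scalemxAl -scalemxAr scalerA -invfM sa2 /S addrC subrK//.
Qed.

Lemma posdef_unit n (G : 'M[R]_n) : posdef G -> G \in unitmx.
Proof.
move=> [_ pG]; rewrite -row_free_unit; apply: inj_row_free => v vG.
by apply: contrapT => /eqP /pG; rewrite vG mul0mx mxE ltxx.
Qed.

Lemma posdef_det n (G : 'M[R]_n) : posdef G -> 0 < \det G.
Proof.
move=> pG; have [B GB] := posdef_cholesky pG; have := posdef_unit pG.
rewrite unitmxE unitfE GB det_mulmx det_tr -expr2 => h.
by rewrite lt_neqAle eq_sym h sqr_ge0.
Qed.

Definition mdot n (G A B : 'M[R]_n) : R := \tr (invmx G *m A *m invmx G *m B^T).

(** The factors [J] cancel under the trace by cyclicity. *)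
Lemma mdot_congr n (J G A B : 'M[R]_n) : J \in unitmx -> G \in unitmx ->
  mdot (J *m G *m J^T) (J *m A *m J^T) (J *m B *m J^T) = mdot G A B.
Proof.
move=> uJ uG; have uJT : J^T \in unitmx by rewrite unitmx_tr.
have invE : invmx (J *m G *m J^T) = invmx J^T *m invmx G *m invmx J.
  have uJGJ : J *m G *m J^T \in unitmx by rewrite !unitmx_mul uJ uG uJT.
  apply: (can_inj (mulKmx uJGJ)); rewrite mulmxV//.
  by rewrite !mulmxA mulmxK// mulmxK// mulmxV.
rewrite /mdot invE !trmx_mul trmxK.
rewrite (_ : _ *m _ = invmx J^T *m (invmx G *m A *m invmx G *m B^T) *m J^T).
  by rewrite mxtrace_mulC (mulmxA J^T (invmx J^T)) mulmxV// mul1mx.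
by rewrite !mulmxA !(mulmxKV uJ) (mulmxK uJT).
Qed.

Lemma mdot_sumr n (G A : 'M[R]_n) (I : finType) (c : I -> R) (B : I -> 'M[R]_n) :
  mdot G A (\sum_i c i *: B i) = \sum_i c i * mdot G A (B i).
Proof.
rewrite /mdot linear_sum mulmx_sumr raddf_sum; apply: eq_bigr => i _.
by rewrite /= linearZ /= -scalemxAr mxtraceZ.
Qed.

Lemma mdot_suml n (G B : 'M[R]_n) (I : finType) (c : I -> R) (A : I -> 'M[R]_n) :
  mdot G (\sum_i c i *: A i) B = \sum_i c i * mdot G (A i) B.
Proof.
rewrite /mdot mulmx_sumr !mulmx_suml raddf_sum; apply: eq_bigr => i _.
by rewrite /= -scalemxAr -!scalemxAl mxtraceZ.
Qed.

Lemma cholesky_entry n (B : 'M[R]_n) i k : `|B i k| <= Num.sqrt ((B *m B^T) i i).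
Proof.
rewrite -sqrtr_sqr; apply: ler_wsqrtr; rewrite mxE (bigD1 k)//= mxE -expr2 lerDl.
by apply: sumr_ge0 => l _; rewrite mxE -expr2 sqr_ge0.
Qed.

(** In the orthonormal frame given by the inverse of [B], the tensor norm is the Frobenius norm. *)
Lemma mdot_cholesky n (B A : 'M[R]_n) : B \in unitmx ->
  mdot (B *m B^T) A A = \sum_k \sum_l (invmx B *m A *m (invmx B)^T) k l ^+ 2.
Proof.
move=> uB; set X := invmx B *m A *m _.
have uBT : B^T \in unitmx by rewrite unitmx_tr.
have AE : A = B *m X *m B^T.
  by rewrite /X !mulmxA mulmxV// mul1mx trmx_inv mulmxKV.
have := mdot_congr X X uB (unitmx1 R n); rewrite mulmx1 -AE => ->.
rewrite /mdot invmx1 mul1mx mulmx1 /mxtrace; apply: eq_bigr => k _.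
by rewrite mxE; apply: eq_bigr => l _; rewrite [X^T l k]mxE expr2.
Qed.

Lemma mdot_ge0 n (G A : 'M[R]_n) : posdef G -> 0 <= mdot G A A.
Proof.
move=> pG; have [B GB] := posdef_cholesky pG; have := posdef_unit pG.
rewrite GB unitmx_mul => /andP[uB _]; rewrite mdot_cholesky//.
by apply: sumr_ge0 => k _; apply: sumr_ge0 => l _; exact: sqr_ge0.
Qed.

(** A = B X B^T, where X holds the components in an orthonormal frame; the entries in row i of B are
    at most sqrt(G_ii), and n^2 counts the terms of the double sum. *)
Lemma mdot_entry n (G A : 'M[R]_n) i j : posdef G ->
  `|A i j| <= n%:R ^+ 2 * (Num.sqrt (G i i) * Num.sqrt (G j j) * Num.sqrt (mdot G A A)).
Proof.
move=> pG; have [B GB] := posdef_cholesky pG; have := posdef_unit pG.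
rewrite GB unitmx_mul => /andP[uB _]; rewrite mdot_cholesky//; set X := invmx B *m A *m _.
have uBT : B^T \in unitmx by rewrite unitmx_tr.
have AE : A = B *m X *m B^T.
  by rewrite /X !mulmxA mulmxV// mul1mx trmx_inv mulmxKV.
have XN k l : `|X k l| <= Num.sqrt (\sum_k \sum_l X k l ^+ 2).
  rewrite -sqrtr_sqr; apply: ler_wsqrtr; rewrite (bigD1 k)//= (bigD1 l)//= -addrA lerDl.
  by rewrite addr_ge0//; [|apply: sumr_ge0 => ? _]; apply: sumr_ge0 => ? _; exact: sqr_ge0.
set N := Num.sqrt (\sum_k _) in XN *.
rewrite {1}AE mxE; apply: le_trans (ler_norm_sum _ _ _) _.
apply: (@le_trans _ _ (\sum_(l < n) \sum_(k < n) Num.sqrt ((B *m B^T) i i) * Num.sqrt ((B *m B^T) j j) * N)).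
  apply: ler_sum => l _; rewrite [(B *m X) i l]mxE mulr_suml; apply: le_trans (ler_norm_sum _ _ _) _.
  apply: ler_sum => k _; rewrite !normrM [B^T l j]mxE mulrAC; apply: ler_pM => //.
    by apply: ler_pM => //; exact: cholesky_entry.
set c := (_ * _ * N); have sc (a : R) : \sum_(l < n) a = n%:R * a by rewrite sumr_const card_ord mulr_natl.
by rewrite (eq_bigr (fun=> n%:R * c)) ?sc ?mulrA -?expr2// => l _; exact: sc.
Qed.

Definition mdot3 n (G : 'M[R]_n) (T : 'I_n -> 'M[R]_n) : R :=
  \sum_k \sum_l invmx G k l * mdot G (T k) (T l).

Lemma mdot3_congr n (J G : 'M[R]_n) (T : 'I_n -> 'M[R]_n) : J \in unitmx -> G \in unitmx ->
  mdot3 (J *m G *m J^T) (fun k => \sum_l J k l *: (J *m T l *m J^T)) = mdot3 G T.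
Proof.
move=> uJ uG; have uJT : J^T \in unitmx by rewrite unitmx_tr.
pose d (l m : 'I_n) := mdot G (T l) (T m).
have E k k' : mdot (J *m G *m J^T) (\sum_l J k l *: (J *m T l *m J^T)) (\sum_l J k' l *: (J *m T l *m J^T))
   = \sum_l \sum_m J k l * J k' m * d l m.
  rewrite mdot_suml; apply: eq_bigr => l _; rewrite mdot_sumr mulr_sumr; apply: eq_bigr => m _.
  by rewrite mdot_congr// mulrA.
rewrite /mdot3; under eq_bigr => k _ do under eq_bigr => k' _ do rewrite E mulr_sumr.
under eq_bigr => k _ do rewrite exchange_big /=.
rewrite exchange_big /=; apply: eq_bigr => l _.
under eq_bigr => k _ do under eq_bigr => k' _ do rewrite mulr_sumr.
under eq_bigr => k _ do rewrite exchange_big /=.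
rewrite exchange_big /=; apply: eq_bigr => m _.
have uJGJ : J *m G *m J^T \in unitmx by rewrite !unitmx_mul uJ uG uJT.
have -> : invmx G = J^T *m invmx (J *m G *m J^T) *m J.
  apply: (can_inj (mulKmx uG)); rewrite mulmxV//.
  apply: (can_inj (mulKmx uJ)); rewrite mulmx1 !mulmxA.
  by rewrite mulmxV// mul1mx.
rewrite -/(d l m) mxE mulr_suml exchange_big /=; apply: eq_bigr => k' _.
rewrite mxE !mulr_suml; apply: eq_bigr => k _; rewrite !mxE; ring.
Qed.

(** Orthonormalising the derivative slot alone reduces a tensor with three slots to n tensors with
    two. *)
Lemma mdot3_cholesky n (B : 'M[R]_n) (T : 'I_n -> 'M[R]_n) : B \in unitmx ->
  mdot3 (B *m B^T) T = \sum_k mdot (B *m B^T) (\sum_l invmx B k l *: T l) (\sum_l invmx B k l *: T l).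
Proof.
move=> uB; have uBT : B^T \in unitmx by rewrite unitmx_tr.
have invE : invmx (B *m B^T) = (invmx B)^T *m invmx B.
  have uG : B *m B^T \in unitmx by rewrite unitmx_mul uB uBT.
  apply: (can_inj (mulKmx uG)); rewrite mulmxV// mulmxA -[B *m B^T *m _]mulmxA trmx_inv mulmxV//.
  by rewrite mulmx1 mulmxV.
have E p : mdot (B *m B^T) (\sum_l invmx B p l *: T l) (\sum_l invmx B p l *: T l) =
    \sum_k \sum_l invmx B p k * invmx B p l * mdot (B *m B^T) (T k) (T l).
  rewrite mdot_suml; apply: eq_bigr => k _; rewrite mdot_sumr mulr_sumr; apply: eq_bigr => l _.
  by rewrite mulrA.
under [RHS]eq_bigr => p _ do rewrite E.
rewrite exchange_big; apply: eq_bigr => k _; rewrite exchange_big; apply: eq_bigr => l _.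
by rewrite invE mxE mulr_suml; apply: eq_bigr => p _; rewrite !mxE.
Qed.

Lemma mdot3_ge0 n (G : 'M[R]_n) (T : 'I_n -> 'M[R]_n) : posdef G -> 0 <= mdot3 G T.
Proof.
move=> pG; have [B GB] := posdef_cholesky pG; have := posdef_unit pG.
rewrite GB unitmx_mul => /andP[uB _]; rewrite mdot3_cholesky// -GB.
by apply: sumr_ge0 => k _; exact: mdot_ge0.
Qed.

Lemma mdot3_entry n (G : 'M[R]_n) (T : 'I_n -> 'M[R]_n) k i j : posdef G ->
  `|T k i j| <= n%:R ^+ 3 * (Num.sqrt (G k k) * Num.sqrt (G i i) * Num.sqrt (G j j) * Num.sqrt (mdot3 G T)).
Proof.
move=> pG; have [B GB] := posdef_cholesky pG; have := posdef_unit pG.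
rewrite {1}GB unitmx_mul => /andP[uB _].
pose S p := \sum_l invmx B p l *: T l.
have TE : T k = \sum_p B k p *: S p.
  transitivity (\sum_l (B *m invmx B) k l *: T l).
    rewrite mulmxV// (bigD1 k)//= mxE eqxx scale1r big1 ?addr0// => l lk.
    by rewrite mxE eq_sym (negbTE lk) scale0r.
  under eq_bigr => l _ do rewrite mxE scaler_suml.
  rewrite exchange_big; apply: eq_bigr => p _; rewrite /S scaler_sumr.
  by apply: eq_bigr => l _; rewrite scalerA.
have SN p : mdot G (S p) (S p) <= mdot3 G T.
  rewrite {2}GB mdot3_cholesky// -GB (bigD1 p)//= lerDl.
  by apply: sumr_ge0 => l _; exact: mdot_ge0.
rewrite TE summxE; apply: le_trans (ler_norm_sum _ _ _) _.
apply: (@le_trans _ _ (\sum_(p < n) Num.sqrt (G k k) *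
    (n%:R ^+ 2 * (Num.sqrt (G i i) * Num.sqrt (G j j) * Num.sqrt (mdot3 G T))))).
  apply: ler_sum => p _; rewrite mxE normrM; apply: ler_pM => //.
    by rewrite GB; exact: cholesky_entry.
  apply: le_trans (mdot_entry _ _ _ pG) _.
  by rewrite ler_wpM2l ?exprn_ge0// ler_wpM2l ?mulr_ge0 ?sqrtr_ge0//; exact: ler_wsqrtr.
rewrite sumr_const card_ord -mulr_natl le_eqVlt; apply/orP; left; apply/eqP; ring.
Qed.

End PositiveDefinite.

(** Locked, like the two definitions that follow, so that it stays a single matrix in the matrix
    algebra instead of unfolding to entries. *)
HB.lock Definition pmx (R : realType) (n : nat) (i : 'I_n) (A : 'rV[R]_n -> 'M[R]_n) (x : 'rV[R]_n) : 'M[R]_n :=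
  \matrix_(j, k) partial i (fun y => A y j k) x.
Canonical pmx_unlockable := Unlockable pmx.unlock.

(** The connection acting on the coordinate frame: nabla_i e_j is the sum over k of (conn i)_jk e_k.
    In this form compatibility, curvature and change of coordinates become matrix identities. *)
HB.lock Definition conn (R : realType) (n : nat) (A : 'rV[R]_n -> 'M[R]_n) (i : 'I_n) (x : 'rV[R]_n) : 'M[R]_n :=
  \matrix_(j, k) christoffel A k j i x.
Canonical conn_unlockable := Unlockable conn.unlock.

(** Christoffel symbols of the first kind. *)
HB.lock Definition lower_conn (R : realType) (n : nat) (A : 'rV[R]_n -> 'M[R]_n) (i : 'I_n) (x : 'rV[R]_n) : 'M[R]_n :=
  \matrix_(j, l)
  (2^-1 * (partial j (fun y => A y i l) x + partial i (fun y => A y j l) x - partial l (fun y => A y j i) x)).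
Canonical lower_conn_unlockable := Unlockable lower_conn.unlock.

Section MatrixCalculus.
Variables (R : realType) (n : nat).
Implicit Types (A B : 'rV[R]_n -> 'M[R]_n) (x : 'rV[R]_n) (U : set 'rV[R]_n).


Lemma addmxE (M N : 'M[R]_n) i j : (M + N) i j = M i j + N i j. Proof. by rewrite mxE. Qed.
Lemma oppmxE (M : 'M[R]_n) i j : (- M) i j = - M i j. Proof. by rewrite mxE. Qed.

Lemma pmxE i A x j k : pmx i A x j k = partial i (fun y => A y j k) x.
Proof. by rewrite unlock mxE. Qed.
Lemma conn_mxE A i x j k : conn A i x j k = christoffel A k j i x.
Proof. by rewrite unlock mxE. Qed.
Lemma lower_conn_mxE A i x j l : lower_conn A i x j l =
  2^-1 * (partial j (fun y => A y i l) x + partial i (fun y => A y j l) x - partial l (fun y => A y j i) x).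
Proof. by rewrite unlock mxE. Qed.
Lemma mulmxE (M N : 'M[R]_n) i j : (M *m N) i j = \sum_l M i l * N l j. Proof. by rewrite mxE. Qed.
Lemma scalemxE (c : R) (M : 'M[R]_n) i j : (c *: M) i j = c * M i j. Proof. by rewrite mxE. Qed.

Lemma partial_eq i U (f g : 'rV[R]_n -> R) x : open U -> U x -> (forall y, U y -> f y = g y) ->
  partial i f x = partial i g x.
Proof.
move=> oU Ux fg; rewrite /partial; apply: near_eq_derive.
by apply: filterS (open_nbhs_nbhs (conj oU Ux)) => y; exact: fg.
Qed.

Lemma pmx_eq i U A B x : open U -> U x -> (forall y, U y -> A y = B y) -> pmx i A x = pmx i B x.
Proof.
move=> oU Ux AB; apply/matrixP => j k; rewrite !pmxE; apply: (partial_eq i oU Ux) => y Uy.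
by rewrite AB.
Qed.

Lemma partial_sum (I : Type) (s : seq I) i (f : I -> 'rV[R]_n -> R) x :
  (forall l, derivable (f l) x (delta_mx 0 i)) ->
  partial i (fun y => \sum_(l <- s) f l y) x = \sum_(l <- s) partial i (f l) x.
Proof.
move=> df; rewrite /partial (_ : (fun y => _) = \sum_(l <- s) f l); last first.
  by apply/funext => y; rewrite fct_sumE.
elim: s => [|l s IH]; first by rewrite !big_nil derive_cst.
have ds : derivable (\sum_(l <- s) f l) x (delta_mx 0 i).
  by elim/big_ind: _ => [|g h dg dh|l' _]; [exact: derivable_cst|exact: derivableD|exact: df].
by rewrite !big_cons deriveD// IH.
Qed.

Lemma pmxD i A B x : (forall j k, derivable (fun y => A y j k) x (delta_mx 0 i)) ->
  (forall j k, derivable (fun y => B y j k) x (delta_mx 0 i)) ->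
  pmx i (fun y => A y + B y) x = pmx i A x + pmx i B x.
Proof.
move=> dA dB; apply/matrixP => j k; rewrite pmxE addmxE !pmxE /partial -deriveD//.
by congr ('D_ _ _ _); apply/funext => y; rewrite mxE.
Qed.

Lemma pmxM i A B x : (forall j k, derivable (fun y => A y j k) x (delta_mx 0 i)) ->
  (forall j k, derivable (fun y => B y j k) x (delta_mx 0 i)) ->
  pmx i (fun y => A y *m B y) x = pmx i A x *m B x + A x *m pmx i B x.
Proof.
move=> dA dB; apply/matrixP => j k; rewrite pmxE addmxE !mulmxE.
rewrite (_ : (fun y => _) = (fun y => \sum_l A y j l * B y l k)); last first.
  by apply/funext => y; rewrite mxE.
rewrite partial_sum; last by move=> l; exact: derivableM.
by rewrite -big_split; apply: eq_bigr => l _; rewrite partialM// !pmxE.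
Qed.

Lemma pmx_tr i A x : pmx i (fun y => (A y)^T) x = (pmx i A x)^T.
Proof.
by apply/matrixP => j k; rewrite pmxE [RHS]mxE pmxE; congr partial; apply/funext => y; rewrite mxE.
Qed.

Lemma derivable_mulmx i A B x : (forall j k, derivable (fun y => A y j k) x (delta_mx 0 i)) ->
  (forall j k, derivable (fun y => B y j k) x (delta_mx 0 i)) ->
  forall j k, derivable (fun y => (A y *m B y) j k) x (delta_mx 0 i).
Proof.
move=> dA dB j k; rewrite (_ : (fun y => _) = \sum_l (fun y => A y j l * B y l k)); last first.
  by apply/funext => y; rewrite mxE fct_sumE.
by elim/big_ind: _ => [|g h dg dh|l _]; [exact: derivable_cst|exact: derivableD|exact: derivableM].
Qed.

Lemma connE A i x : conn A i x = lower_conn A i x *m (invmx (A x))^T.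
Proof.
apply/matrixP => j k; rewrite conn_mxE mulmxE /christoffel mulr_sumr; apply: eq_bigr => l _.
rewrite lower_conn_mxE [X in _ = _ * X]mxE; ring.
Qed.

Section SymmetricMetric.
Variables (U : set 'rV[R]_n) (G : 'rV[R]_n -> 'M[R]_n).
Hypotheses (oU : open U) (pG : forall x, U x -> posdef (G x)).

Let uG x : U x -> G x \in unitmx. Proof. by move=> Ux; apply: posdef_unit; exact: pG. Qed.
Let iG x : U x -> (invmx (G x))^T = invmx (G x).
Proof. by move=> Ux; rewrite trmx_inv (pG Ux).1. Qed.

Let dG i j k x : U x -> partial i (fun y => G y j k) x = partial i (fun y => G y k j) x.
Proof. by move=> Ux; apply: (partial_eq i oU Ux) => y Uy; rewrite -{1}(pG Uy).1 mxE. Qed.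

Lemma conn_torsion i j k x : U x -> conn G i x j k = conn G j x i k.
Proof.
move=> Ux; rewrite !conn_mxE /christoffel; congr (_ * _); apply: eq_bigr => l _.
by rewrite (dG l j i Ux) [partial j _ x + _]addrC.
Qed.

Lemma conn_lower i x : U x -> conn G i x *m G x = lower_conn G i x.
Proof. by move=> Ux; rewrite connE iG// mulmxKV// uG. Qed.

Lemma conn_compat i x : U x -> pmx i G x = conn G i x *m G x + G x *m (conn G i x)^T.
Proof.
move=> Ux; rewrite -[X in X *m (_)^T](pG Ux).1 -trmx_mul conn_lower//.
apply/matrixP => j l; rewrite pmxE addmxE [X in _ = _ + X]mxE !lower_conn_mxE (dG i l j Ux) (dG l j i Ux) (dG j l i Ux).
by field.
Qed.

(** Uniqueness of the Levi-Civita connection: once the upper index is lowered, compatibility and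
    symmetry form a linear system whose solution is the Koszul formula. *)
Lemma conn_unique (C : 'I_n -> 'M[R]_n) x : U x ->
  (forall i, pmx i G x = C i *m G x + G x *m (C i)^T) ->
  (forall i j k, C i j k = C j i k) -> forall i, conn G i x = C i.
Proof.
move=> Ux cC tC i; apply: (can_inj (mulmxK (uG Ux))); rewrite conn_lower//.
pose P i := C i *m G x.
have tP a b c : P a b c = P b a c by rewrite !mulmxE; apply: eq_bigr => l _; rewrite tC.
have dP a b c : partial a (fun y => G y b c) x = P a b c + P a c b.
  have := congr1 (fun M : 'M[R]_n => M b c) (cC a).
  rewrite -[X in X *m (_)^T](pG Ux).1 -trmx_mul addmxE -/(P a).
  by rewrite pmxE [(P a)^T b c]mxE.
apply/matrixP => j l; rewrite -/(P i) lower_conn_mxE !dP (tP j i l) (tP j l i) (tP i l j).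
by field.
Qed.

(** The products come in reversed order because the matrices act on the column of frame vectors:
    nabla_i nabla_j e = (d_i C_j + C_j C_i) e. *)
Definition curv (i j : 'I_n) x : 'M[R]_n :=
  pmx i (conn G j) x - pmx j (conn G i) x + (conn G j x *m conn G i x - conn G i x *m conn G j x).

Lemma ricci_curv i j x : U x -> ricci G i j x = \sum_k curv k j x i k.
Proof.
move=> Ux; rewrite /ricci -big_split; apply: eq_bigr => k _ /=.
have E (M N P Q : 'M[R]_n) : (M - N + (P - Q)) i k = M i k - N i k + (P i k - Q i k) by rewrite !mxE.
rewrite /curv E (pmxE k (conn G j) x i k) (pmxE j (conn G k) x i k).
have e1 a b c : (fun y => conn G a y b c) = christoffel G c b a by apply/funext => y; rewrite conn_mxE.
rewrite !e1; apply: (congr1 (fun z => _ + z)); rewrite !mulmxE.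
rewrite -sumrB; apply: eq_bigr => l _.
have T a b c : christoffel G a b c x = christoffel G a c b x.
  by have := conn_torsion c b a Ux; rewrite !conn_mxE.
have e2 a b c : conn G a x b c = christoffel G c b a x by rewrite conn_mxE.
by rewrite !e2 [christoffel G k k l x]T (T k j l) mulrC [X in _ - X]mulrC.
Qed.

Lemma scal_curv x : U x -> scal_coord G x = \sum_k \sum_j (invmx (G x) *m curv k j x) j k.
Proof.
move=> Ux; rewrite /scal_coord.
under eq_bigr => i _ do under eq_bigr => j _ do rewrite ricci_curv// mulr_sumr.
under eq_bigr => i _ do rewrite exchange_big /=.
rewrite exchange_big; apply: eq_bigr => k _; rewrite exchange_big; apply: eq_bigr => j _.
by rewrite mulmxE; apply: eq_bigr => i _; rewrite -{1}(iG Ux) mxE.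
Qed.

Lemma Ck_christoffel k a b c : (forall i j, Ck k.+1 U (fun x => G x i j)) -> Ck k U (christoffel G a b c).
Proof.
move=> hG; have dGk i j l : Ck k U (partial i (fun y => G y j l)) by exact: ((hG j l).2 i).2.
apply: CkZ => //; apply: Ck_sum => // l _; apply: CkM => //.
  by apply: Ck_invmx => // i j; exact: CkW.
by apply: CkB => //; exact: CkD.
Qed.

Lemma Ck_conn k i a b : (forall i j, Ck k.+1 U (fun x => G x i j)) -> Ck k U (fun x => conn G i x a b).
Proof.
move=> hG; rewrite (_ : (fun x => _) = christoffel G b a i); last by apply/funext => x; rewrite conn_mxE.
exact: Ck_christoffel.
Qed.

End SymmetricMetric.

End MatrixCalculus.

Lemma invmx_congr (R : comUnitRingType) n (J G : 'M[R]_n) : J \in unitmx -> G \in unitmx ->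
  invmx (J *m G *m J^T) = invmx J^T *m invmx G *m invmx J.
Proof.
move=> uJ uG; have uJT : J^T \in unitmx by rewrite unitmx_tr.
have uJGJ : J *m G *m J^T \in unitmx by rewrite !unitmx_mul uJ uG uJT.
by apply: (can_inj (mulKmx uJGJ)); rewrite mulmxV// !mulmxA mulmxK// mulmxK// mulmxV.
Qed.

(** * Invariance of the scalar curvature *)

Section ChangeOfCoordinates.
Variables (R : realType) (n : nat) (U V : set 'rV[R]_n) (t : 'rV[R]_n -> 'rV[R]_n).
Variables (G H : 'rV[R]_n -> 'M[R]_n).
Hypotheses (oU : open U) (oV : open V) (tUV : forall x, U x -> V (t x)).
Hypothesis st : forall j, smooth U (fun x => t x 0 j).
Hypotheses (pG : forall x, U x -> posdef (G x)) (pH : forall x, V x -> posdef (H x)).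
Hypotheses (G2 : forall i j, Ck 2 U (fun x => G x i j)) (H2 : forall i j, Ck 2 V (fun x => H x i j)).
Let J := jac t.
Hypothesis GJ : forall x, U x -> G x = J x *m H (t x) *m (J x)^T.

Let uG x : U x -> G x \in unitmx. Proof. by move=> Ux; apply: posdef_unit; exact: pG. Qed.
Let uH x : U x -> H (t x) \in unitmx. Proof. by move=> Ux; apply: posdef_unit; apply: pH; exact: tUV. Qed.

Let uJ x : U x -> J x \in unitmx.
Proof. by move=> Ux; have := uG Ux; rewrite GJ// !unitmx_mul => /andP[/andP[]]. Qed.

Let CJ k i j : Ck k U (fun x => J x i j).
Proof.
rewrite (_ : (fun x => _) = partial i (fun y => t y 0 j)); last by apply/funext => x; rewrite mxE.
exact: ((st j k.+1).2 i).2.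
Qed.

Let derJ x i a b : U x -> derivable (fun y => J y a b) x (delta_mx 0 i).
Proof. by move=> Ux; exact: ((CJ 1 a b).2 i).1. Qed.

Let dt x l : U x -> differentiable (fun y => t y 0 l) x.
Proof. by move=> Ux; exact: Ck_differentiable oU (st l 1) Ux. Qed.

Let comp_derivable f x i : U x -> Ck 1 V f -> derivable (f \o t) x (delta_mx 0 i).
Proof.
move=> Ux hf; apply: diff_derivable; apply: differentiable_comp.
  by apply: differentiable_rV => l; exact: dt.
by apply: Ck_differentiable oV hf _; exact: tUV.
Qed.

Let comp_partial f x i : U x -> Ck 1 V f -> partial i (f \o t) x = \sum_l J x i l * partial l f (t x).
Proof.
move=> Ux hf; rewrite partial_comp; last 2 first.
- by move=> l; exact: dt.
- by apply: Ck_differentiable oV hf _; exact: tUV.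
by apply: eq_bigr => l _; rewrite mxE.
Qed.

Let comp_pmx (A : 'rV[R]_n -> 'M[R]_n) x i : U x -> (forall a b, Ck 1 V (fun y => A y a b)) ->
  pmx i (A \o t) x = \sum_l J x i l *: pmx l A (t x).
Proof.
move=> Ux hA; apply/matrixP => a b; rewrite pmxE summxE (comp_partial i Ux (hA a b)).
by apply: eq_bigr => l _; rewrite scalemxE pmxE.
Qed.

Let symJ x i j l : U x -> partial i (fun y => J y j l) x = partial j (fun y => J y i l) x.
Proof.
move=> Ux; rewrite (_ : (fun y => J y j l) = partial j (fun y => t y 0 l)); last first.
  by apply/funext => y; rewrite mxE.
rewrite (_ : (fun y => J y i l) = partial i (fun y => t y 0 l)); last first.
  by apply/funext => y; rewrite mxE.
exact: (partial_sym i j oU (st l 2) Ux).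
Qed.

(** The connection of [H] pulled back along t, with the derivative slot transformed and the two
    matrix indices left in the target frame. *)
Let Bt i x : 'M[R]_n := \sum_l J x i l *: conn H l (t x).

Let H1 i j : Ck 1 V (fun x => H x i j). Proof. exact: CkW. Qed.
Let CB l a b : Ck 1 V (fun y => conn H l y a b). Proof. exact: Ck_conn. Qed.
Let CA l a b : Ck 1 U (fun y => conn G l y a b). Proof. exact: Ck_conn. Qed.

Let BtE i a b : (fun y => Bt i y a b) = (fun y => \sum_l J y i l * ((fun z => conn H l z a b) \o t) y).
Proof. by apply/funext => y; rewrite summxE; apply: eq_bigr => l _; rewrite scalemxE. Qed.

Let derBt x i j a b : U x -> derivable (fun y => Bt j y a b) x (delta_mx 0 i).
Proof.
move=> Ux; rewrite BtE (_ : (fun y => _) = \sum_l (fun y => J y j l * ((fun z => conn H l z a b) \o t) y)); last first.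
  by apply/funext => y; rewrite fct_sumE.
elim/big_ind: _ => [|g h dg dh|l _]; [exact: derivable_cst|exact: derivableD|].
by apply: derivableM; [exact: derJ|exact: comp_derivable].
Qed.

(** The right side times the inverse of J is compatible with [G], because the connection of [H] is
    compatible with [H], and symmetric in its lower indices, because second derivatives of t
    commute; [conn_unique] identifies it with the connection of [G]. *)
Lemma gauge i x : U x -> conn G i x *m J x = pmx i J x + J x *m Bt i x.
Proof.
move=> Ux; pose N i := pmx i J x + J x *m Bt i x.
have tN a b c : N a b c = N b a c.
  have NE a' b' c' : N a' b' c' = partial a' (fun y => J y b' c') x + \sum_l J x b' l * Bt a' x l c'.
    by rewrite -mulmxE -pmxE -addmxE.
  rewrite !NE (symJ a b c Ux); apply: (congr1 (fun z => _ + z)).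
  under eq_bigr => l _ do rewrite summxE mulr_sumr.
  rewrite exchange_big; apply: eq_bigr => m _; rewrite summxE mulr_sumr; apply: eq_bigr => l _.
  rewrite !scalemxE (conn_torsion oV pH l m c (tUV Ux)); ring.
have E : forall j, conn G j x = N j *m invmx (J x).
  move=> j0; apply: (conn_unique pG (C := fun j => N j *m invmx (J x)) Ux) => [j|j a b]; last first.
    by rewrite !mulmxE; apply: eq_bigr => l _; rewrite tN.
  have dHt a b : derivable (fun y => H (t y) a b) x (delta_mx 0 j).
    exact (@comp_derivable (fun y => H y a b) x j Ux (H1 a b)).
  have dJ a b : derivable (fun y => J y a b) x (delta_mx 0 j) by exact: derJ.
  have dJT a b : derivable (fun y => (J y)^T a b) x (delta_mx 0 j).
    by rewrite (_ : (fun y => _) = (fun y => J y b a)) //; apply/funext => y; rewrite mxE.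
  rewrite (pmx_eq j oU Ux GJ) pmxM//; last exact: derivable_mulmx.
  rewrite pmxM// pmx_tr (comp_pmx j Ux H1) GJ//.
  have cH : \sum_l J x j l *: pmx l H (t x) = Bt j x *m H (t x) + H (t x) *m (Bt j x)^T.
    rewrite /Bt linear_sum mulmx_suml mulmx_sumr -big_split; apply: eq_bigr => l _ /=.
    by rewrite (conn_compat oV pH l (tUV Ux)) scalerDr linearZ /= -scalemxAl -scalemxAr.
  have VJ : J x *m H (t x) *m (J x)^T *m (invmx (J x))^T = J x *m H (t x).
    by rewrite trmx_inv mulmxK// unitmx_tr uJ.
  have RT : (N j *m invmx (J x))^T = (invmx (J x))^T *m ((pmx j J x)^T + (Bt j x)^T *m (J x)^T).
    by rewrite trmx_mul /N linearD /= [(J x *m _)^T]trmx_mul.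
  rewrite /= cH RT !mulmxA (mulmxKV (uJ Ux)) VJ /N !(mulmxDl, mulmxDr) !mulmxA -!addrA.
  by apply: (congr1 (fun z => _ + z)); apply: (congr1 (fun z => _ + z)); rewrite addrC.
by rewrite E -/(N i) mulmxKV// uJ.
Qed.

(** Differentiating [gauge] and antisymmetrising cancels the second derivatives of J, so the
    curvature transforms as a tensor although the connection does not. *)
Lemma curv_gauge i j x : U x ->
  curv G i j x *m J x = J x *m \sum_l \sum_m (J x i l * J x j m) *: curv H l m (t x).
Proof.
move=> Ux; pose A a := conn G a x; pose dJ a := pmx a J x; pose B a := Bt a x.
pose dA a b := pmx a (conn G b) x; pose ddJ a b := pmx a (pmx b J) x; pose dB a b := pmx a (Bt b) x.
have derpJ a b c d : derivable (fun y => pmx b J y c d) x (delta_mx 0 a).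
  rewrite (_ : (fun y => _) = partial b (fun y => J y c d)); last by apply/funext => y; rewrite pmxE.
  exact: ((((CJ 2 c d).2 b).2).2 a).1.
have E1 a b : dA a b *m J x + A b *m dJ a = ddJ a b + dJ a *m B b + J x *m dB a b.
  have := pmx_eq a oU Ux (fun y Uy => gauge b Uy).
  rewrite pmxM; [|by move=> c d; exact: ((CA b c d).2 a).1|by move=> c d; exact: derJ].
  rewrite pmxD//; last by apply: derivable_mulmx => c d; [exact: derJ|exact: derBt].
  by rewrite pmxM ?addrA//; [move=> c d; exact: derJ|move=> c d; exact: derBt].
have sJ : ddJ i j = ddJ j i.
  apply/matrixP => c d; rewrite !pmxE.
  rewrite (_ : (fun y => pmx j J y c d) = partial j (fun y => J y c d)); last by apply/funext => y; rewrite pmxE.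
  rewrite (_ : (fun y => pmx i J y c d) = partial i (fun y => J y c d)); last by apply/funext => y; rewrite pmxE.
  exact: (partial_sym i j oU (CJ 2 c d) Ux).
have E2 a b : A b *m (A a *m J x) = A b *m dJ a + (dJ b *m B a + J x *m B b *m B a).
  by rewrite (gauge a Ux) mulmxDr (mulmxA (A b)) (gauge b Ux) mulmxDl.
have main : curv G i j x *m J x = J x *m (dB i j - dB j i + (B j *m B i - B i *m B j)).
  rewrite /curv !(mulmxDl, mulmxDr, mulNmx, mulmxN) -!mulmxA.
  have e1 := E1 i j; have e2 := E1 j i; have e3 := E2 i j; have e4 := E2 j i.
  rewrite sJ in e1; rewrite -!mulmxA in e3 e4.
  (* Entrywise, with the products of matrices kept as atoms, the identity is a linear combination of
     the four relations and is within reach of [lra]. *)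
  apply/matrixP => c d.
  move: (congr1 (fun M : 'M[R]_n => M c d) e1) (congr1 (fun M : 'M[R]_n => M c d) e2)
    (congr1 (fun M : 'M[R]_n => M c d) e3) (congr1 (fun M : 'M[R]_n => M c d) e4).
  have Ea (M N : 'M[R]_n) : (M + N) c d = M c d + N c d by rewrite mxE.
  have Eo (M : 'M[R]_n) : (- M) c d = - M c d by rewrite mxE.
  rewrite /A /dA !Ea !Eo; lra.
rewrite main; congr (_ *m _).
have dBE a b : dB a b = \sum_l partial a (fun y => J y b l) x *: conn H l (t x) +
    \sum_l \sum_m (J x a m * J x b l) *: pmx m (conn H l) (t x).
  apply/matrixP => c d; rewrite pmxE BtE partial_sum; last first.
    by move=> l; apply: derivableM; [exact: derJ|exact: comp_derivable].
  rewrite addmxE !summxE -big_split; apply: eq_bigr => l _ /=.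
  rewrite partialM; [|exact: derJ|exact (@comp_derivable (fun z => conn H l z c d) x a Ux (CB l c d))].
  rewrite (comp_partial a Ux (CB l c d)) scalemxE summxE mulr_sumr; congr (_ + _).
  by apply: eq_bigr => m _; rewrite scalemxE pmxE mulrCA mulrA.
have BB a b : B b *m B a = \sum_l \sum_m (J x a l * J x b m) *: (conn H m (t x) *m conn H l (t x)).
  rewrite /B /Bt mulmx_sumr; apply: eq_bigr => l _; rewrite mulmx_suml; apply: eq_bigr => m _.
  by rewrite -scalemxAl -scalemxAr scalerA mulrC.
(* The terms of [dBE] in which J is differentiated are symmetric in the two directions and
   cancel. *)
have dd : dB i j - dB j i = \sum_l \sum_m (J x i m * J x j l) *: pmx m (conn H l) (t x)
    - \sum_l \sum_m (J x j m * J x i l) *: pmx m (conn H l) (t x).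
  rewrite !dBE opprD addrACA [X in X + _](_ : _ = 0) ?add0r//.
  by rewrite -sumrB big1// => l _; rewrite symJ// subrr.
rewrite dd !BB exchange_big /=.
have sw (X : 'I_n -> 'I_n -> 'M[R]_n) : \sum_l \sum_m (J x j l * J x i m) *: X l m = \sum_l \sum_m (J x i l * J x j m) *: X m l.
  by rewrite exchange_big; apply: eq_bigr => l _; apply: eq_bigr => m _; rewrite mulrC.
rewrite [X in _ - X + _](_ : _ = \sum_l \sum_m (J x i l * J x j m) *: pmx m (conn H l) (t x)); last first.
  by apply: eq_bigr => l _; apply: eq_bigr => m _; rewrite mulrC.
rewrite (sw (fun l m => conn H m (t x) *m conn H l (t x))).
rewrite -!sumrB -big_split; apply: eq_bigr => l _ /=.
rewrite -!sumrB -big_split; apply: eq_bigr => m _ /=.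
by rewrite -!scalerBr -scalerDr.
Qed.

Theorem scal_coord_invariant x : U x -> scal_coord G x = scal_coord H (t x).
Proof.
move=> Ux; rewrite (scal_curv oU pG Ux) (scal_curv oV pH (tUV Ux)).
have uJT : (J x)^T \in unitmx by rewrite unitmx_tr uJ.
pose X l m := invmx (H (t x)) *m curv H l m (t x).
pose Y l m := invmx (J x)^T *m X l m *m invmx (J x).
have E k j : invmx (G x) *m curv G k j x = \sum_l \sum_m (J x k l * J x j m) *: Y l m.
  rewrite -[curv G k j x](mulmxK (uJ Ux)) curv_gauge// GJ// invmx_congr ?uJ ?uH//.
  rewrite !mulmxA (mulmxKV (uJ Ux)) mulmx_sumr mulmx_suml; apply: eq_bigr => l _.
  rewrite mulmx_sumr mulmx_suml; apply: eq_bigr => m _.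
  by rewrite -scalemxAr -scalemxAl /Y /X !mulmxA.
have XY l m : X l m m l = \sum_j \sum_k J x j m * Y l m j k * J x k l.
  have -> : X l m = (J x)^T *m Y l m *m J x by rewrite /Y !mulmxA mulmxV// mul1mx mulmxKV// uJ.
  rewrite mxE exchange_big; apply: eq_bigr => k _; rewrite [((J x)^T *m _) _ _]mxE mulr_suml.
  by apply: eq_bigr => j _; rewrite [(J x)^T _ _]mxE.
under [RHS]eq_bigr => l _ do under eq_bigr => m _ do rewrite -/(X l m) XY.
under [LHS]eq_bigr => k _ do under eq_bigr => j _ do rewrite E summxE.
under [LHS]eq_bigr => k _ do rewrite exchange_big /=.
rewrite [LHS]exchange_big; apply: eq_bigr => l _.
under [LHS]eq_bigr => k _ do under eq_bigr => j _ do rewrite summxE.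
under [LHS]eq_bigr => k _ do rewrite exchange_big /=.
rewrite [LHS]exchange_big; apply: eq_bigr => m _; rewrite [LHS]exchange_big; apply: eq_bigr => j _.
by apply: eq_bigr => k _; rewrite scalemxE; ring.
Qed.

End ChangeOfCoordinates.

(** * Volume measure of a compact manifold *)

Local Notation coord := Defs.coord.

Lemma measurable_open_if (T : ptopologicalType) d (S : measurableType d) (D : set T) (f g : T -> S) : open D ->
  measurable_fun (D : set (borel T)) (f : borel T -> S) ->
  measurable_fun (~` D : set (borel T)) (g : borel T -> S) ->
  measurable_fun [set: borel T] (fun x : borel T => if `[< D x >] then f x else g x).
Proof.
move=> oD mf mg; rewrite -(setUv D); apply/measurable_funU.
- exact: borel_open.
- by apply: measurableC; exact: borel_open.
split.
- by apply: eq_measurable_fun mf => x /[!inE] Dx; case: asboolP.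
- by apply: eq_measurable_fun mg => x /[!inE] Dx; case: asboolP.
Qed.

Section Manifold.
Variables (R : realType) (n : nat) (M : smoothManifold R n).
Implicit Types (a b : chart M) (q : M).

Lemma img_coord a q : dom a q -> img a (coord a q).
Proof. by move=> aq; exists q. Qed.

Lemma dom_coordV a x : img a x -> dom a (coordV a x).
Proof. by move=> [q aq <-]; rewrite coordK. Qed.

Lemma coordVK a x : img a x -> coord a (coordV a x) = x.
Proof. by move=> [q aq <-]; rewrite coordK. Qed.

Lemma overlapP a b x : overlap a b x <-> img a x /\ dom b (coordV a x).
Proof.
split; first by move=> [q [aq bq] <-]; split; [exact: img_coord|rewrite coordK].
move=> [[q aq <-]]; rewrite coordK// => bq; by exists q.
Qed.

Lemma open_overlap a b : open (overlap a b).
Proof.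
rewrite (_ : overlap a b = img a `&` coordV a @^-1` dom b); last first.
  by apply/seteqP; split => x /overlapP.
apply: open_preimage; [exact: img_open| |exact: dom_open].
by move=> x [q aq <-]; exact: coordV_cts.
Qed.

Lemma trans_overlap a b x : overlap a b x -> overlap b a (trans a b x).
Proof.
move=> /overlapP[ax bx]; apply/overlapP; split; first exact: img_coord.
by rewrite /trans coordK//; exact: dom_coordV.
Qed.

Lemma transK a b x : overlap a b x -> trans b a (trans a b x) = x.
Proof. by move=> /overlapP[ax bx]; rewrite /trans coordK// coordVK. Qed.

Variable g : C2metric M.

Lemma metric_posdef a x : img a x -> posdef (g a x).
Proof. by move=> ax; split; [exact: gmx_sym|exact: gmx_pos]. Qed.

(** [scal] reads the curvature in a chart that varies with the point; continuity and integration in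
    coordinates require one fixed chart. *)
Lemma scal_chart a q : dom a q -> scal g q = scal_coord (g a) (coord a q).
Proof.
move=> aq; set b := chart_at q; have bq : dom b q by exact: dom_chart_at.
have ox : overlap a b (coord a q) by exists q.
have sub : overlap a b `<=` img a by move=> x /overlapP[].
have tUV x : overlap a b x -> img b (trans a b x) by move=> /trans_overlap/overlapP[].
rewrite (@scal_coord_invariant R n (overlap a b) (img b) (trans a b) (g a) (g b)) //.
- by rewrite /trans coordK.
- exact: open_overlap.
- exact: img_open.
- by move=> j; exact: trans_smooth.
- by move=> x /sub; exact: metric_posdef.
- exact: metric_posdef.
- by move=> i j; apply: Ck_sub sub _; exact: gmx_C2.
- by move=> i j; exact: gmx_C2.
- by move=> x; exact: gmx_tensor.
Qed.

Lemma trans_jac_unit a b x : overlap a b x -> trans_jac a b x \in unitmx.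
Proof.
move=> ox; have [ax _] := (overlapP a b x).1 ox.
have := posdef_unit (metric_posdef ax); rewrite (gmx_tensor g ox) !unitmx_mul.
by move=> /andP[/andP[]].
Qed.

Lemma tnorm2_chart (h : field2 M) a q : is_tensor2 h -> dom a q ->
  tnorm2 g h q = Num.sqrt (mdot (g a (coord a q)) (h a (coord a q)) (h a (coord a q))).
Proof.
move=> th aq; set b := chart_at q; have bq : dom b q by exact: dom_chart_at.
have ox : overlap a b (coord a q) by exists q.
have tx : trans a b (coord a q) = coord b q by rewrite /trans coordK.
have ub : g b (coord b q) \in unitmx by apply: posdef_unit; apply: metric_posdef; exact: img_coord.
rewrite (gmx_tensor g ox) (th _ _ _ ox) tx mdot_congr//; exact: trans_jac_unit.
Qed.

Lemma tnorm3_chart (T : field3 M) a q : is_tensor3 T -> dom a q ->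
  tnorm3 g T q = Num.sqrt (mdot3 (g a (coord a q)) (T a (coord a q))).
Proof.
move=> tT aq; set b := chart_at q; have bq : dom b q by exact: dom_chart_at.
have ox : overlap a b (coord a q) by exists q.
have tx : trans a b (coord a q) = coord b q by rewrite /trans coordK.
have ub : g b (coord b q) \in unitmx by apply: posdef_unit; apply: metric_posdef; exact: img_coord.
rewrite (gmx_tensor g ox) (_ : T a (coord a q) = fun k => \sum_l trans_jac a b (coord a q) k l *:
  (trans_jac a b (coord a q) *m T b (trans a b (coord a q)) l *m (trans_jac a b (coord a q))^T)); last first.
  by apply/funext => k; exact: tT.
rewrite tx mdot3_congr//; exact: trans_jac_unit.
Qed.

Definition sqdet a (x : 'rV[R]_n) : R := Num.sqrt (\det (g a x)).

Lemma sqdet_gt0 a x : img a x -> 0 < sqdet a x.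
Proof. by move=> ax; rewrite sqrtr_gt0; apply: posdef_det; exact: metric_posdef. Qed.

Lemma Ck_sqdet a : Ck 2 (img a) (sqdet a).
Proof.
apply: Ck_sqrt; first exact: img_open.
  by move=> x ax; apply: posdef_det; exact: metric_posdef.
apply: Ck_det; [exact: img_open|exact: gmx_C2].
Qed.

Lemma sqdet_trans a b x : overlap a b x ->
  sqdet a x = sqdet b (trans a b x) * `|\det (jac (trans a b) x)|.
Proof.
move=> ox; have [ax bx] := (overlapP a b x).1 ox.
rewrite /sqdet (gmx_tensor g ox) !det_mulmx det_tr mulrAC -expr2 mulrC sqrtrM ?sqrtr_sqr//.
by apply: ltW; apply: posdef_det; apply: metric_posdef; have /overlapP[] := trans_overlap ox.
Qed.

Let mM (A : set M) : open A -> measurable (A : set (borel M)). Proof. exact: borel_open. Qed.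

Let mimg a : measurable (img a : set (borel 'rV[R]_n)).
Proof. by apply: borel_open; exact: img_open. Qed.

Let mdom a : measurable (dom a : set (borel M)).
Proof. by apply: borel_open; exact: dom_open. Qed.

Lemma measurable_coord_dom a : measurable_fun (dom a : set (borel M)) (coord a : borel M -> borel 'rV[R]_n).
Proof. by apply: continuous_borel; [exact: dom_open|move=> q; exact: coord_cts]. Qed.

Lemma measurable_coordV_img a : measurable_fun (img a : set (borel 'rV[R]_n)) (coordV a : borel 'rV[R]_n -> borel M).
Proof. by apply: continuous_borel; [exact: img_open|move=> x [q aq <-]; exact: coordV_cts]. Qed.

Lemma coord_image a (B : set M) : B `<=` dom a -> coord a @` B = img a `&` coordV a @^-1` B.
Proof.
move=> Ba; apply/seteqP; split => x.
  by move=> [q Bq <-]; split; [exact: img_coord (Ba q Bq)|rewrite /= coordK//; exact: Ba].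
by move=> [ax Bx]; exists (coordV a x) => //; exact: coordVK.
Qed.

Lemma measurable_coord_image a (B : set (borel M)) : measurable B -> B `<=` dom a ->
  measurable (coord a @` B : set (borel 'rV[R]_n)).
Proof. by move=> mB Ba; rewrite coord_image//; exact: (measurable_coordV_img (mimg a)). Qed.

Let wdet a (x : borel 'rV[R]_n) : R := (sqdet a : borel 'rV[R]_n -> R) \_ (img a) x.

Let wdet_ge0 a x : 0 <= wdet a x.
Proof. by rewrite /wdet patchE; case: ifP => // _; exact: sqrtr_ge0. Qed.

Lemma measurable_sqdet a : measurable_fun (img a : set (borel 'rV[R]_n)) (sqdet a : borel 'rV[R]_n -> R).
Proof. by apply: continuous_borelR; [exact: img_open|exact: (Ck_sqdet a).1]. Qed.

Let mwdet a : measurable_fun setT (wdet a).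
Proof. by apply/(measurable_restrictT _ (mimg a)); exact: measurable_sqdet. Qed.

Let cV0 a (x : borel 'rV[R]_n) : borel M := if `[< img a x >] then coordV a x else point.

Let mcV0 a : measurable_fun setT (cV0 a).
Proof.
apply: measurable_open_if; [exact: img_open|exact: measurable_coordV_img|exact: measurable_cst].
Qed.

(** The Riemannian density of one chart carried to [M]. Off the image of the chart [cV0] takes a
    default value, harmless because [wdet] is 0 there. *)
Definition chart_measure a : {measure set (borel M) -> \bar R} :=
  image_measure (density (leb R n) (mwdet a) (wdet_ge0 a)) (mcV0 a).

Lemma chart_measureE a (B : set (borel M)) : B `<=` dom a -> chart_measure a B = chart_vol g a B.
Proof.
move=> Ba; rewrite /chart_vol lebesgueNE /chart_measure image_measureE.
rewrite /density /= /density_fun integral_mkcond [RHS]integral_mkcond; apply: eq_integral => x _.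
rewrite coord_image// !patchE; have [ax|nax] := pselect (img a x).
  have E : (x \in cV0 a @^-1` B) = (x \in img a `&` coordV a @^-1` B).
    apply/idP/idP => /set_mem.
      by rewrite /= /cV0 asboolT// => h; apply/mem_set; split.
    by move=> [_ h]; apply/mem_set; rewrite /= /cV0 asboolT.
  by rewrite E; case: ifP => // _; rewrite /wdet patchE mem_set.
have h2 : (x \in img a `&` coordV a @^-1` B) = false by apply: memNset => -[].
have -> : wdet a x = 0 by rewrite /wdet patchE memNset.
by rewrite h2; case: ifP.
Qed.

Lemma ge0_integral_chart_measure a (f : borel M -> \bar R) : measurable_fun setT f -> (forall q, (0 <= f q)%E) ->
  (\int[chart_measure a]_q f q = \int[leb R n]_(x in img a) (f (coordV a x) * (sqdet a x)%:E))%E.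
Proof.
move=> mf f0; have fo q : setT q -> (0 <= f q)%E by [].
have mfV := measurableT_comp mf (mcV0 a).
have f0V x : (0 <= (f \o cV0 a) x)%E by exact: f0.
rewrite (ge0_integral_image_measure _ (mcV0 a) measurableT mf fo).
have -> := ge0_integral_density (leb R n) (mwdet a) (wdet_ge0 a) mfV f0V.
rewrite [RHS]integral_mkcond; apply: eq_integral => x _.
rewrite /wdet patchE [in RHS]patchE; case: ifPn => h; last by rewrite mule0.
by rewrite /= /cV0 asboolT//; exact: set_mem.
Qed.

(** Change of variables along the transition map: sqrt(det g) is multiplied by the absolute value of
    its Jacobian determinant. *)
Lemma chart_vol_agree a b (B : set (borel M)) : measurable B -> B `<=` dom a -> B `<=` dom b ->
  chart_vol g a B = chart_vol g b B.
Proof.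
move=> mB Ba Bb; rewrite /chart_vol lebesgueNE.
have mBb := measurable_coord_image mB Bb.
pose h (y : borel 'rV[R]_n) : R := (sqdet b : borel 'rV[R]_n -> R) \_ (coord b @` B) y.
have bsub : coord b @` B `<=` img b by move=> y [q Bq <-]; apply: img_coord; exact: Bb.
have mh : measurable_fun setT (fun y => (h y)%:E).
  apply/measurable_EFinP; apply/(measurable_restrictT _ mBb).
  by apply: (measurable_funS (mimg b) bsub); exact: measurable_sqdet.
have h0 y : (0 <= (h y)%:E)%E.
  by rewrite lee_fin /h patchE; case: ifP => // _; exact: sqrtr_ge0.
have ov (c d : chart M) k : Ck 1 (overlap c d) (fun x => trans c d x 0 k) by exact: trans_smooth.
have tK (c d : chart M) x : overlap c d x -> overlap d c (trans c d x) /\ trans d c (trans c d x) = x.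
  by move=> ox; split; [exact: trans_overlap|exact: transK].
have o1 := @open_overlap a b.
have o2 := @open_overlap b a.
have ov1 := ov a b.
have ov2 := ov b a.
have tK1 := tK a b.
have tK2 := tK b a.
have COV := @change_of_variables R n (overlap a b) (overlap b a) (trans a b) (trans b a)
  o1 o2 ov1 ov2 tK1 tK2 _ mh h0.
have sV : coord b @` B `<=` overlap b a by move=> y [q Bq <-]; exists q => //; split; [exact: Bb|exact: Ba].
have sU : coord a @` B `<=` overlap a b by move=> y [q Bq <-]; exists q => //; split; [exact: Ba|exact: Bb].
transitivity (\int[leb R n]_(y in overlap b a) (h y)%:E)%E; last first.
  rewrite (integral_shrink sV); last by move=> y _ nB; rewrite /h patchE memNset.
  by apply: eq_integral => y yB; rewrite /h patchE yB.
rewrite COV (integral_shrink sU); last first.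
  move=> x ox nB; rewrite /h patchE memNset ?mul0e// => -[q Bq E]; apply: nB; exists q => //.
  have [ax bx] := (overlapP a b x).1 ox.
  have <- : coordV a x = q by rewrite -(coordK bx) -[RHS](coordK (Bb q Bq)) E.
  exact: coordVK.
apply: eq_integral => x /set_mem [q Bq xE].
have ox : overlap a b x by apply: sU; exists q.
rewrite -EFinM /h patchE mem_set; last by exists q => //; rewrite -xE /trans coordK//; exact: Ba.
by rewrite -/(sqdet a x) (sqdet_trans ox).
Qed.

End Manifold.

Lemma bigsetU_ordP T N (F : 'I_N -> set T) q : (\big[setU/set0]_(k < N) F k) q <-> exists k, F k q.
Proof.
split; last by move=> [k Fk]; rewrite (bigD1 k)//=; left.
by elim/big_ind: _ => [//|X Y hX hY [/hX|/hY]//|k _ Fk]; exists k.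
Qed.

Lemma finite_subcover (T : ptopologicalType) (O : T -> set T) : compact [set: T] ->
  (forall p, open (O p)) -> (forall p, O p p) -> exists s : seq T, forall q, exists2 p, p \in s & O p q.
Proof.
rewrite compact_cover => cT oO Op.
have [D _ hD] := cT T setT O (fun p _ => oO p) (fun p _ => ex_intro2 _ _ p Logic.I (Op p)).
by exists (finmap.enum_fset D) => q; have [p Dp Opq] := hD q Logic.I; exists p.
Qed.

(** * The volume as a measure *)

Section Volume.
Variables (R : realType) (n : nat) (M : smoothManifold R n) (g : C2metric M).
Hypothesis hM : compact [set: M].
Implicit Types (a b : chart M) (q : M).

Let mdom a : measurable (dom a : set (borel M)).
Proof. by apply: borel_open; exact: dom_open. Qed.

Lemma chart_cover : exists (N : nat) (c : nat -> chart M), forall q, exists2 k, (k < N)%N & dom (c k) q.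
Proof.
have [s hs] := finite_subcover hM (fun p => dom_open (chart_at p)) (@dom_chart_at R n M).
exists (size s), (fun k => chart_at (nth point s k)) => q; have [p ps pq] := hs q.
by exists (index p s); rewrite ?index_mem// nth_index.
Qed.

Section Pieces.
Variables (N : nat) (c : nat -> chart M).
Hypothesis cov : forall q, exists2 k, (k < N)%N & dom (c k) q.

Let D : nat -> set (borel M) := seqDU (fun k => dom (c k) : set (borel M)).

Let mD k : measurable (D k).
Proof. by rewrite /D /seqDU; apply: measurableD => //; apply: bigsetU_measurable => j _. Qed.

Let tD : trivIset setT D. Proof. exact: trivIset_seqDU. Qed.

Let Dsub k : D k `<=` dom (c k). Proof. by move=> q []. Qed.

Let Dcov q : exists2 k, (k < N)%N & D k q.
Proof.
have ex : exists k, `[< dom (c k) q >] by have [k _ h] := cov q; exists k; exact/asboolP.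
case: (ex_minnP ex) => m /asboolP hm min; exists m.
  have [k kN h] := cov q; apply: leq_ltn_trans (min k _) kN; exact/asboolP.
split=> // /bigsetU_ordP[j hj].
by have := min j (asboolT hj); rewrite leqNgt ltn_ord.
Qed.

Let part (mu : {measure set (borel M) -> \bar R}) (B : set (borel M)) : measurable B ->
  (\sum_(k < N) mu (B `&` D k) = mu B)%E.
Proof.
move=> mB; have mBD (k : 'I_N) : measurable (B `&` D k) by exact: measurableI.
rewrite -measure_semi_additive_ord//.
- congr (mu _); apply/seteqP; split=> q; first by move=> /bigsetU_ordP[k []].
  by move=> Bq; have [k kN Dk] := Dcov q; apply/bigsetU_ordP; exists (Ordinal kN).
- move=> i j _ _ [q [[_ Di] [_ Dj]]]; apply/val_inj.
  by apply: (tD Logic.I Logic.I); exists q.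
- exact: bigsetU_measurable.
Qed.

Let vm : {measure set (borel M) -> \bar R} :=
  msum (fun k => mrestr (chart_measure g (c k)) (mD k)) N.

Let vmE (B : set (borel M)) : (vm B = \sum_(k < N) chart_measure g (c k) (B `&` D k))%E.
Proof. by []. Qed.

Let chart_vol_vm a (B : set (borel M)) : measurable B -> B `<=` dom a -> chart_vol g a B = vm B.
Proof.
move=> mB Ba; rewrite -chart_measureE// vmE -(part (chart_measure g a) mB).
apply: eq_bigr => k _; have mBk : measurable (B `&` D k) by exact: measurableI.
have s1 : B `&` D k `<=` dom a by move=> q [/Ba].
have s2 : B `&` D k `<=` dom (c k) by move=> q [_ /Dsub].
by rewrite !chart_measureE//; exact: chart_vol_agree.
Qed.

(** Every admissible family has total mass at most [vm A] by additivity of the measure [vm], and the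
    disjointified finite chart cover attains this value. *)
Lemma vol_pieces (A : set (borel M)) : measurable A -> vol g A = vm A.
Proof.
move=> mA; apply/eqP; rewrite eq_le; apply/andP; split.
  apply: ge_ereal_sup => _ [N' [a [B [mB tB BA ->]]]].
  have mU : measurable (\big[setU/set0]_(k < N') B k) by apply: bigsetU_measurable => k _.
  have -> : (\sum_(k < N') chart_vol g (a k) (B k) = \sum_(k < N') vm (B k))%E.
    by apply: eq_bigr => k _; apply: chart_vol_vm => // q /BA[].
  rewrite -measure_semi_additive_ord//; apply: le_measure; rewrite ?inE//.
  by elim/big_ind: _ => [//|X Y XA YA q [/XA|/YA]//|k _ q /BA[]].
apply: ereal_sup_ubound; exists N, (fun k => c k), (fun k => A `&` D k); split.
- by move=> k; exact: measurableI.
- move=> i j _ _ [q [[_ Di] [_ Dj]]]; apply/val_inj.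
  by apply: (tD Logic.I Logic.I); exists q.
- by move=> k q [Aq /Dsub].
- by rewrite vmE; apply: eq_bigr => k _; rewrite chart_measureE// => q [_ /Dsub].
Qed.

Lemma vol_chart_pieces a (A : set (borel M)) : measurable A -> A `<=` dom a -> vol g A = chart_vol g a A.
Proof. by move=> mA Aa; rewrite vol_pieces//; exact: esym (chart_vol_vm mA Aa). Qed.

Lemma vol_sigma_additive_pieces : semi_sigma_additive (vol g).
Proof.
move=> F mF tF mUF; rewrite vol_pieces//.
rewrite (_ : (fun k => _) = (fun k => \sum_(0 <= i < k) vm (F i))%E).
  exact: measure_semi_sigma_additive.
by apply/funext => k; apply: eq_bigr => i _; rewrite vol_pieces.
Qed.

End Pieces.

Lemma vol_chart a (A : set (borel M)) : measurable A -> A `<=` dom a -> vol g A = chart_vol g a A.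
Proof. have [N [c cov]] := chart_cover; exact: vol_chart_pieces. Qed.

(** A separate name carries the measure structure, whose proof depends on the compactness [hM]. *)
Definition vol_fun : set (borel M) -> \bar R := vol g.

Let vol0 : vol_fun set0 = 0%E.
Proof.
have [N [c cov]] := chart_cover.
by rewrite /vol_fun (vol_pieces cov)//; exact: measure0.
Qed.

Let vol_ge0 A : (0 <= vol_fun A)%E.
Proof.
apply: ereal_sup_ubound; exists 0%N, (fun=> chart_at point), (fun=> set0); split => //.
- by case.
- by rewrite big_ord0.
Qed.

Let vol_sigma_additive : semi_sigma_additive vol_fun.
Proof. have [N [c cov]] := chart_cover; exact: vol_sigma_additive_pieces cov. Qed.

HB.instance Definition _ := isMeasure.Build _ _ _ vol_fun vol0 vol_ge0 vol_sigma_additive.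

Definition vol_measure : {measure set (borel M) -> \bar R} := vol_fun.

(** Holding by computation, this lets integrals against the set function [vol g] be treated as
    integrals against a measure. *)
Lemma vol_measureE : vol g = vol_measure. Proof. by []. Qed.

Lemma ge0_integral_vol a (f : borel M -> \bar R) : measurable_fun setT f -> (forall q, (0 <= f q)%E) ->
  (forall q, ~ dom a q -> f q = 0%E) ->
  (\int[vol_measure]_q f q = \int[leb R n]_(x in img a) (f (coordV a x) * (sqdet g a x)%:E))%E.
Proof.
move=> mf f0 fd; rewrite -ge0_integral_chart_measure//.
have fE (q : borel M) : f q = (f \_ (dom a)) q.
  by rewrite patchE; case: ifPn => //; rewrite notin_setE => /fd.
under eq_integral do rewrite fE; under [RHS]eq_integral do rewrite fE.
rewrite -!integral_mkcond; apply: eq_measure_integral => A mA Aa.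
by rewrite chart_measureE//; exact: vol_chart.
Qed.

Lemma integral_vol a (f : borel M -> R) : measurable_fun setT f -> (forall q, ~ dom a q -> f q = 0) ->
  (\int[vol_measure]_q (f q)%:E = \int[leb R n]_(x in img a) (f (coordV a x) * sqdet g a x)%:E)%E.
Proof.
move=> mf fd; have mE : measurable_fun setT (EFin \o f) by exact/measurable_EFinP.
have w0 x : 0 <= sqdet g a x by exact: sqrtr_ge0.
rewrite integralE [RHS]integralE; congr (_ - _)%E.
  rewrite (ge0_integral_vol (a := a) (measurable_funepos mE) (fun q => funepos_ge0 _ q)).
    apply: eq_integral => x _; rewrite !funeposE /= -!EFin_max -EFinM.
    by congr (_%:E); rewrite maxr_pMl// mul0r.
  by move=> q nq; rewrite funeposE /= fd// maxxx.
rewrite (ge0_integral_vol (a := a) (measurable_funeneg mE) (fun q => funeneg_ge0 _ q)).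
  apply: eq_integral => x _; rewrite !funenegE (_ : (- (EFin \o f) (coordV a x))%E = (- f (coordV a x))%:E)//.
  rewrite (_ : (- (f (coordV a x) * sqdet g a x)%:E)%E = (- (f (coordV a x) * sqdet g a x))%:E)// -!EFin_max -EFinM.
  by congr (_%:E); rewrite maxr_pMl// mul0r mulNr.
by move=> q nq; rewrite funenegE /= fd// oppr0 maxxx.
Qed.

End Volume.

(** * Modes of convergence *)

Lemma sqr_le_norm (R : realDomainType) (x y : R) : `|x| <= y -> x ^+ 2 <= y ^+ 2.
Proof.
move=> xy; rewrite -[x ^+ 2]real_normK ?num_real// lerXn2r ?nnegrE//.
exact: le_trans xy.
Qed.

Section ConvergenceModes.
Variables (R : realType) (n : nat) (U : set 'rV[R]_n).
Hypothesis oU : open U.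
Implicit Types K : set 'rV[R]_n.

Definition cont_on (f : 'rV[R]_n -> R) := forall x, U x -> {for x, continuous f}.

Lemma cont_onD f g : cont_on f -> cont_on g -> cont_on (fun x => f x + g x).
Proof. by move=> cf cg x Ux; apply: (@continuousD _ R^o _ f g); [exact: cf|exact: cg]. Qed.
Lemma cont_onM f g : cont_on f -> cont_on g -> cont_on (fun x => f x * g x).
Proof. by move=> cf cg x Ux; apply: (@continuousM R _ f g); [exact: cf|exact: cg]. Qed.
Lemma cont_on_cst (c : R) : cont_on (fun=> c).
Proof. by move=> x _; exact: cst_continuous. Qed.
Lemma cont_onN f : cont_on f -> cont_on (fun x => - f x).
Proof. by move=> cf x Ux; apply: (@continuousN _ R^o _ f); exact: cf. Qed.
Lemma cont_onB f g : cont_on f -> cont_on g -> cont_on (fun x => f x - g x).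
Proof. by move=> cf cg; apply: cont_onD => //; exact: cont_onN. Qed.
Lemma cont_on_norm f : cont_on f -> cont_on (fun x => `|f x|).
Proof. by move=> cf x Ux; apply: continuous_comp; [exact: cf|exact: norm_continuous]. Qed.
Lemma cont_onX2 f : cont_on f -> cont_on (fun x => f x ^+ 2).
Proof. by move=> cf; have := cont_onM cf cf; under eq_fun do rewrite -expr2. Qed.

Lemma cont_on_measurable K f : compact K -> K `<=` U -> cont_on f ->
  measurable_fun (K : set (borel 'rV[R]_n)) (fun x : borel 'rV[R]_n => (f x)%:E).
Proof.
move=> cK KU cf; apply/measurable_EFinP.
by apply: (measurable_funS (borel_open oU) KU); exact: continuous_borelR.
Qed.

Lemma measurable_compact K : compact K -> measurable (K : set (borel 'rV[R]_n)).
Proof. by move=> cK; apply: borel_compact => //; exact: norm_hausdorff. Qed.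

Definition mean_to_zero (h_ : nat -> 'rV[R]_n -> R) := [/\ forall m, cont_on (h_ m), forall m x, 0 <= h_ m x &
  forall K, compact K -> K `<=` U -> forall e : R, 0 < e ->
    \forall m \near \oo, (\int[leb R n]_(x in K) (h_ m x)%:E <= e%:E)%E].

Lemma integral_le_affine K f g (a b : R) : compact K -> K `<=` U -> cont_on f -> cont_on g ->
  (forall x, 0 <= f x) -> (forall x, 0 <= g x) -> 0 <= a -> 0 <= b ->
  (forall x, K x -> f x <= a * g x + b) ->
  (\int[leb R n]_(x in K) (f x)%:E <= a%:E * \int[leb R n]_(x in K) (g x)%:E + b%:E * leb R n K)%E.
Proof.
move=> cK KU cf cg f0 g0 a0 b0 fg; have mK := measurable_compact cK.
have mf := cont_on_measurable cK KU cf; have mg := cont_on_measurable cK KU cg.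
have mag := measurable_funeM a%:E mg.
have ag0 (x : borel 'rV[R]_n) : K x -> (0 <= a%:E * (g x)%:E)%E by rewrite lee_fin mulr_ge0.
have mb : measurable_fun (K : set (borel 'rV[R]_n)) (cst b%:E : borel 'rV[R]_n -> \bar R) by exact: measurable_cst.
have b0' (x : borel 'rV[R]_n) : K x -> (0 <= cst b%:E x)%E by rewrite lee_fin.
have gz (x : borel 'rV[R]_n) : K x -> (0 <= (g x)%:E)%E by rewrite lee_fin.
rewrite -(ge0_integralZl (leb R n) mK mg gz) ?lee_fin// -(integral_cst _ mK) -(ge0_integralD (leb R n) mK ag0 mag b0' mb).
apply: (ge0_le_integral (leb R n) mK _ mf (emeasurable_funD mag mb)) => x Kx; rewrite lee_fin//.
exact: fg.
Qed.

(** Comparison up to an arbitrarily small constant b, with a factor a that may depend on b. It takes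
    the place of the Cauchy-Schwarz inequality in the estimates for products. *)
Lemma mean_to_zero_dom g_ h_ : mean_to_zero g_ -> (forall m, cont_on (h_ m)) -> (forall m x, 0 <= h_ m x) ->
  (forall K, compact K -> K `<=` U -> forall b : R, 0 < b -> exists2 a : R, 0 <= a &
    \forall m \near \oo, forall x, K x -> h_ m x <= a * g_ m x + b) -> mean_to_zero h_.
Proof.
move=> [cg g0 gc] ch h0 dom; split => // K cK KU e e0.
have l0 : (0 <= leb R n K)%E by exact: measure_ge0.
have lfin : leb R n K \is a fin_num by rewrite ge0_fin_numE// leb_compact.
pose l := fine (leb R n K); have l0' : 0 <= l by exact: fine_ge0.
have lE : leb R n K = l%:E by rewrite fineK.
(* The constant part contributes b l <= e/2 over [K]; the integral of [g_ m] is then required to be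
   at most e / (2 (a + 1)). *)
pose b := e / (2 * (l + 1)).
have l1 : 0 < l + 1 by rewrite ltr_wpDl.
have b0 : 0 < b by rewrite divr_gt0// mulr_gt0.
have [a a0 ha] := dom K cK KU b b0.
have a1 : 0 < a + 1 by rewrite ltr_wpDl.
have ea : 0 < e / (2 * (a + 1)) by rewrite divr_gt0// mulr_gt0.
apply: filterS2 ha (gc K cK KU _ ea) => m hm gm.
have bl : b * l <= e / 2.
  rewrite /b invfM mulrA -mulrA ler_piMr ?divr_ge0 ?(ltW e0)//.
  by rewrite mulrC ler_pdivrMr// mul1r lerDl.
have al : a * (e / (2 * (a + 1))) <= e / 2.
  rewrite invfM [e * _]mulrA mulrCA ler_piMr ?divr_ge0 ?(ltW e0)//.
  by rewrite ler_pdivrMr// mul1r lerDl.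
apply: le_trans (integral_le_affine cK KU (ch m) (cg m) (h0 m) (g0 m) a0 (ltW b0) hm) _.
rewrite [e]splitr EFinD lE -EFinM; apply: leeD; last by rewrite lee_fin.
by apply: le_trans (lee_wpmul2l _ gm) _; rewrite ?lee_fin// -EFinM lee_fin.
Qed.

Lemma mean_to_zero0 : mean_to_zero (fun _ _ => 0).
Proof.
split => //; first by move=> m; exact: cont_on_cst.
by move=> K cK KU e e0; apply: nearW => m; rewrite integral0 lee_fin ltW.
Qed.

Lemma mean_to_zeroD g_ h_ : mean_to_zero g_ -> mean_to_zero h_ -> mean_to_zero (fun m x => g_ m x + h_ m x).
Proof.
move=> [cg g0 gc] [ch h0 hc]; split; [by move=> m; exact: cont_onD|by move=> m x; rewrite addr_ge0|].
move=> K cK KU e e0; have e2 : 0 < e / 2 by rewrite divr_gt0.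
apply: filterS2 (gc K cK KU _ e2) (hc K cK KU _ e2) => m gm hm.
have mK := measurable_compact cK.
have mg := cont_on_measurable cK KU (cg m); have mh := cont_on_measurable cK KU (ch m).
under eq_integral do rewrite EFinD.
rewrite ge0_integralD//; try by move=> x _; rewrite lee_fin.
by rewrite [e]splitr EFinD; exact: leeD.
Qed.

(** Together with [l2_cvg] and [l1_cvg] this forms a calculus of products: a uniformly converging
    factor preserves both integral modes, and two L^2 factors give L^1. *)
Definition unif_cvg (f_ : nat -> 'rV[R]_n -> R) (f : 'rV[R]_n -> R) := [/\ forall m, cont_on (f_ m), cont_on f &
  forall K, compact K -> K `<=` U -> forall e : R, 0 < e -> \forall m \near \oo, forall x, K x -> `|f_ m x - f x| <= e].

Definition l2_cvg (f_ : nat -> 'rV[R]_n -> R) (f : 'rV[R]_n -> R) := [/\ forall m, cont_on (f_ m), cont_on f & mean_to_zero (fun m x => (f_ m x - f x) ^+ 2)].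

Definition l1_cvg (f_ : nat -> 'rV[R]_n -> R) (f : 'rV[R]_n -> R) := [/\ forall m, cont_on (f_ m), cont_on f & mean_to_zero (fun m x => `|f_ m x - f x|)].

Lemma unif_cvg_cst f : cont_on f -> unif_cvg (fun=> f) f.
Proof.
by move=> cf; split => // K _ _ e e0; apply: nearW => m x _; rewrite subrr normr0 ltW.
Qed.

Lemma unif_cvgD f_ f g_ g : unif_cvg f_ f -> unif_cvg g_ g -> unif_cvg (fun m x => f_ m x + g_ m x) (fun x => f x + g x).
Proof.
move=> [cf_ cf ff] [cg_ cg gg]; split; [by move=> m; exact: cont_onD|exact: cont_onD|].
move=> K cK KU e e0; have e2 : 0 < e / 2 by rewrite divr_gt0.
apply: filterS2 (ff K cK KU _ e2) (gg K cK KU _ e2) => m fm gm x Kx.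
rewrite opprD addrACA (splitr e) (le_trans (ler_normD _ _))// lerD//; [exact: fm|exact: gm].
Qed.

Let bounded K f : compact K -> K `<=` U -> cont_on f -> exists2 C, 0 < C & forall x, K x -> `|f x| <= C.
Proof. by move=> cK KU cf; apply: compact_bound => // x Kx; apply: cf; exact: KU. Qed.

Lemma unif_cvgM f_ f g_ g : unif_cvg f_ f -> unif_cvg g_ g -> unif_cvg (fun m x => f_ m x * g_ m x) (fun x => f x * g x).
Proof.
move=> [cf_ cf ff] [cg_ cg gg]; split; [by move=> m; exact: cont_onM|exact: cont_onM|].
move=> K cK KU e e0; have [C C0 fC] := bounded cK KU cf; have [D D0 gD] := bounded cK KU cg.
pose d := Num.min 1 (e / (C + D + 1)).
have CD : 0 < C + D + 1 by rewrite !addr_gt0.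
have d0 : 0 < d by rewrite lt_min ltr01 divr_gt0.
apply: filterS2 (ff K cK KU _ d0) (gg K cK KU _ d0) => m fm gm x Kx.
have d1 : d <= 1 by rewrite ge_min lexx.
have de : (C + D + 1) * d <= e by rewrite mulrC -ler_pdivlMr// ge_min lexx orbT.
have fx := fm x Kx; have gx := gm x Kx.
have -> : f_ m x * g_ m x - f x * g x = (f_ m x - f x) * (g_ m x - g x) + (f x * (g_ m x - g x) + (f_ m x - f x) * g x) by ring.
apply: le_trans (ler_normD _ _) _; apply: le_trans (lerD _ (ler_normD _ _)) _; first exact: lexx.
rewrite !normrM; have h1 : `|f_ m x - f x| * `|g_ m x - g x| <= d * 1 by apply: ler_pM => //; exact: le_trans gx d1.
have h2 : `|f x| * `|g_ m x - g x| <= C * d by apply: ler_pM => //; exact: fC.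
have h3 : `|f_ m x - f x| * `|g x| <= d * D by apply: ler_pM => //; exact: gD.
by apply: le_trans de; apply: le_trans (lerD h1 (lerD h2 h3)) _; lra.
Qed.

Lemma unif_cvgV f_ f : (forall m, cont_on (fun x => (f_ m x)^-1)) -> cont_on (fun x => (f x)^-1) ->
  (forall m x, U x -> f_ m x != 0) -> (forall x, U x -> f x != 0) ->
  unif_cvg f_ f -> unif_cvg (fun m x => (f_ m x)^-1) (fun x => (f x)^-1).
Proof.
move=> ci_ ci n_ n0 [cf_ cf ff]; split=> // K cK KU e e0.
have [C C0 fC] := bounded cK KU ci.
(* The first bound keeps |f_m| above half of the lower bound 1/C of |f|; the second makes 2 C^2 d at
   most e. *)
pose d := Num.min (2 * C)^-1 (e / (2 * C ^+ 2)).
have C2 : 0 < 2 * C ^+ 2 by rewrite mulr_gt0// exprn_gt0.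
have d0 : 0 < d by rewrite lt_min invr_gt0 mulr_gt0//= divr_gt0.
apply: filterS (ff K cK KU _ d0) => m fm x Kx; have fx := fm x Kx.
have Ux := KU x Kx; have fn := n0 x Ux; have fmn := n_ m x Ux.
have dC : d <= (2 * C)^-1 by rewrite ge_min lexx.
have de : (2 * C ^+ 2) * d <= e by rewrite mulrC -ler_pdivlMr// ge_min lexx orbT.
have fl : C^-1 <= `|f x| by rewrite -[leRHS]invrK -normfV lef_pV2 ?posrE ?normr_gt0 ?invr_neq0//; exact: fC.
have fml : (2 * C)^-1 <= `|f_ m x|.
  have h1 : `|f x| - d <= `|f_ m x|.
    rewrite lerBlDr; apply: le_trans (lerD (lexx _) fx); rewrite distrC.
    by rewrite -{1}[f x](subrK (f_ m x)) addrC ler_normD.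
  apply: le_trans h1; have -> : (2 * C)^-1 = C^-1 - (2 * C)^-1 by rewrite invfM; field; rewrite gt_eqF.
  exact: lerB.
have ub : `|(f_ m x)^-1| <= 2 * C.
  by rewrite normfV -[leRHS]invrK lef_pV2 ?posrE ?normr_gt0// invr_gt0 mulr_gt0.
have -> : (f_ m x)^-1 - (f x)^-1 = (f_ m x)^-1 * (f x)^-1 * (f x - f_ m x) by field; rewrite fn fmn.
rewrite !normrM [`|f x - _|]distrC; apply: le_trans de.
rewrite (_ : 2 * C ^+ 2 * d = 2 * C * C * d); last by rewrite expr2 !mulrA.
by apply: ler_pM; [exact: mulr_ge0|exact: normr_ge0|apply: ler_pM => //; exact: fC|exact: fx].
Qed.

Lemma unif_cvg_sqrt f_ f : (forall m, cont_on (fun x => Num.sqrt (f_ m x))) -> cont_on (fun x => Num.sqrt (f x)) ->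
  cont_on (fun x => (Num.sqrt (f x))^-1) ->
  (forall m x, U x -> 0 < f_ m x) -> (forall x, U x -> 0 < f x) ->
  unif_cvg f_ f -> unif_cvg (fun m x => Num.sqrt (f_ m x)) (fun x => Num.sqrt (f x)).
Proof.
move=> cs_ cs ci p_ p0 [cf_ cf ff]; split=> // K cK KU e e0.
have [C C0 fC] := bounded cK KU ci.
have d0 : 0 < e / C by rewrite divr_gt0.
apply: filterS (ff K cK KU _ d0) => m fm x Kx; have fx := fm x Kx; have Ux := KU x Kx.
have s0 : 0 < Num.sqrt (f x) by rewrite sqrtr_gt0 p0.
have sm0 : 0 < Num.sqrt (f_ m x) by rewrite sqrtr_gt0 p_.
have E : f_ m x - f x = (Num.sqrt (f_ m x) - Num.sqrt (f x)) * (Num.sqrt (f_ m x) + Num.sqrt (f x)).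
  by rewrite -subr_sqr !sqr_sqrtr// ltW ?p0 ?p_.
have h : `|Num.sqrt (f_ m x) - Num.sqrt (f x)| * Num.sqrt (f x) <= e / C.
  apply: le_trans fx; rewrite E normrM [X in _ <= _ * X]ger0_norm ?addr_ge0 ?(ltW s0) ?(ltW sm0)//.
  by apply: ler_wpM2l => //; rewrite lerDr ltW.
rewrite -ler_pdivlMr// in h; apply: le_trans h _.
have hC := fC x Kx; rewrite ger0_norm ?invr_ge0 ?(ltW s0)// in hC.
by apply: le_trans (ler_wpM2l (ltW d0) hC) _; rewrite mulfVK// gt_eqF.
Qed.

Lemma unif_l2_cvg f_ f : unif_cvg f_ f -> l2_cvg f_ f.
Proof.
move=> [cf_ cf ff]; split => //; apply: (mean_to_zero_dom mean_to_zero0).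
- by move=> m; apply: cont_onX2; exact: cont_onB.
- by move=> m x; exact: sqr_ge0.
move=> K cK KU b b0; exists 0 => //; pose d := Num.min 1 b.
have d0 : 0 < d by rewrite lt_min ltr01.
apply: filterS (ff K cK KU d d0) => m fm x Kx; rewrite mul0r add0r.
have d1 : d <= 1 by rewrite ge_min lexx.
have db : d <= b by rewrite ge_min lexx orbT.
rewrite -real_normK ?num_real// expr2; apply: le_trans db; rewrite -[leRHS]mulr1.
by apply: ler_pM => //; [exact: fm|exact: le_trans (fm x Kx) d1].
Qed.

Lemma l2_cvgD f_ f g_ g : l2_cvg f_ f -> l2_cvg g_ g -> l2_cvg (fun m x => f_ m x + g_ m x) (fun x => f x + g x).
Proof.
move=> [cf_ cf ff] [cg_ cg gg]; split; [by move=> m; exact: cont_onD|exact: cont_onD|].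
apply: (mean_to_zero_dom (mean_to_zeroD ff gg)).
- by move=> m; apply: cont_onX2; apply: cont_onB; exact: cont_onD.
- by move=> m x; exact: sqr_ge0.
move=> K cK KU b b0; exists 2 => //; apply: nearW => m x Kx.
have := sqr_ge0 ((f_ m x - f x) - (g_ m x - g x)); nra.
Qed.

Lemma unif_l2_cvgM f_ f v_ v : unif_cvg f_ f -> l2_cvg v_ v -> l2_cvg (fun m x => f_ m x * v_ m x) (fun x => f x * v x).
Proof.
move=> [cf_ cf ff] [cv_ cv vv]; split; [by move=> m; exact: cont_onM|exact: cont_onM|].
apply: (mean_to_zero_dom vv).
- by move=> m; apply: cont_onX2; apply: cont_onB; exact: cont_onM.
- by move=> m x; exact: sqr_ge0.
move=> K cK KU b b0; have [C C0 fC] := bounded cK KU cf; have [D D0 vD] := bounded cK KU cv.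
exists (2 * (C + 1) ^+ 2); first by rewrite mulr_ge0// sqr_ge0.
pose d := Num.min 1 (b / (2 * D ^+ 2)).
have D2 : 0 < 2 * D ^+ 2 by rewrite mulr_gt0// exprn_gt0.
have d0 : 0 < d by rewrite lt_min ltr01 divr_gt0.
apply: filterS (ff K cK KU d d0) => m fm x Kx; have fx := fm x Kx.
have d1 : d <= 1 by rewrite ge_min lexx.
have db : 2 * D ^+ 2 * d <= b by rewrite mulrC -ler_pdivlMr// ge_min lexx orbT.
have X1 : `|f_ m x * (v_ m x - v x)| <= (C + 1) * `|v_ m x - v x|.
  rewrite normrM ler_wpM2r// -[f_ m x](subrK (f x)) addrC (le_trans (ler_normD _ _))//.
  by apply: lerD; [exact: fC|exact: le_trans fx d1].
have X2 : `|(f_ m x - f x) * v x| <= d * D by rewrite normrM; apply: ler_pM => //; exact: vD.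
have -> : f_ m x * v_ m x - f x * v x = f_ m x * (v_ m x - v x) + (f_ m x - f x) * v x by ring.
set X := f_ m x * _ in X1 *; set Y := _ * v x in X2 *.
have s1 : X ^+ 2 <= (C + 1) ^+ 2 * (v_ m x - v x) ^+ 2.
  by rewrite -[(v_ m x - v x) ^+ 2]real_normK ?num_real// -exprMn; exact: sqr_le_norm.
have s2 : Y ^+ 2 <= D ^+ 2 * d.
  apply: le_trans (sqr_le_norm X2) _.
  by rewrite exprMn mulrC ler_wpM2l ?sqr_ge0// expr2 ler_piMr// ltW.
have := sqr_ge0 (X - Y); nra.
Qed.

(** The product of the two errors is at most half the sum of their squares. Terms with a single
    error Z use |Z| <= Z^2 / d + d, whose constant part is made small through d. *)
Lemma l2_l1_cvgM u_ u v_ v : l2_cvg u_ u -> l2_cvg v_ v -> l1_cvg (fun m x => u_ m x * v_ m x) (fun x => u x * v x).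
Proof.
move=> [cu_ cu uu] [cv_ cv vv]; split; [by move=> m; exact: cont_onM|exact: cont_onM|].
apply: (mean_to_zero_dom (mean_to_zeroD uu vv)).
- by move=> m; apply: cont_on_norm; apply: cont_onB; exact: cont_onM.
- by move=> m x.
move=> K cK KU b b0; have [C C0 uC] := bounded cK KU cu; have [D D0 vD] := bounded cK KU cv.
have CD : 0 < C + D by rewrite addr_gt0.
pose d := b / (C + D); have d0 : 0 < d by rewrite divr_gt0.
exists (2^-1 + (C + D) * d^-1); first by rewrite addr_ge0// mulr_ge0 ?invr_ge0 ?(ltW CD) ?(ltW d0).
apply: nearW => m x Kx.
have -> : u_ m x * v_ m x - u x * v x = (u_ m x - u x) * (v_ m x - v x) + (u x * (v_ m x - v x) + (u_ m x - u x) * v x) by ring.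
set X := u_ m x - u x; set Y := v_ m x - v x.
have h1 : `|X * Y| <= 2^-1 * (X ^+ 2 + Y ^+ 2).
  rewrite normrM -[X ^+ 2]real_normK ?num_real// -[Y ^+ 2]real_normK ?num_real//.
  by have := sqr_ge0 (`|X| - `|Y|); nra.
have lin (Z : R) : `|Z| <= Z ^+ 2 * d^-1 + d.
  rewrite -[Z ^+ 2]real_normK ?num_real//; have [Zd|/ltW dZ] := leP `|Z| d.
    by rewrite ler_wpDl// divr_ge0 ?sqr_ge0// ltW.
  by rewrite ler_wpDr ?(ltW d0)// ler_pdivlMr// expr2 ler_wpM2l.
have h2 : `|u x * Y| <= C * (Y ^+ 2 * d^-1 + d) by rewrite normrM; apply: ler_pM => //; exact: uC.
have h3 : `|X * v x| <= D * (X ^+ 2 * d^-1 + d) by rewrite normrM mulrC; apply: ler_pM => //; exact: vD.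
apply: le_trans (ler_normD _ _) _; apply: le_trans (lerD h1 (ler_normD _ _)) _.
apply: le_trans (lerD (lexx _) (lerD h2 h3)) _.
have bE : b = (C + D) * d by rewrite /d mulrC mulfVK// gt_eqF.
have CX : 0 <= C * (X ^+ 2 * d^-1) by apply: mulr_ge0; [exact: ltW|apply: mulr_ge0; [exact: sqr_ge0|rewrite invr_ge0; exact: ltW]].
have DY : 0 <= D * (Y ^+ 2 * d^-1) by apply: mulr_ge0; [exact: ltW|apply: mulr_ge0; [exact: sqr_ge0|rewrite invr_ge0; exact: ltW]].
rewrite [leRHS](_ : _ = 2^-1 * (X ^+ 2 + Y ^+ 2) + (C * (Y ^+ 2 * d^-1 + d) + D * (X ^+ 2 * d^-1 + d)) +
  (C * (X ^+ 2 * d^-1) + D * (Y ^+ 2 * d^-1))); last by rewrite {1}bE; ring.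
by rewrite lerDl addr_ge0.
Qed.

Lemma unif_l1_cvgM f_ f v_ v : unif_cvg f_ f -> l1_cvg v_ v -> l1_cvg (fun m x => f_ m x * v_ m x) (fun x => f x * v x).
Proof.
move=> [cf_ cf ff] [cv_ cv vv]; split; [by move=> m; exact: cont_onM|exact: cont_onM|].
apply: (mean_to_zero_dom vv).
- by move=> m; apply: cont_on_norm; apply: cont_onB; exact: cont_onM.
- by move=> m x.
move=> K cK KU b b0; have [C C0 fC] := bounded cK KU cf; have [D D0 vD] := bounded cK KU cv.
exists (C + 1); first by rewrite addr_ge0// ltW.
pose d := Num.min 1 (b / D).
have d0 : 0 < d by rewrite lt_min ltr01 divr_gt0.
apply: filterS (ff K cK KU d d0) => m fm x Kx; have fx := fm x Kx.
have d1 : d <= 1 by rewrite ge_min lexx.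
have db : d * D <= b by rewrite -ler_pdivlMr// ge_min lexx orbT.
have X1 : `|f_ m x * (v_ m x - v x)| <= (C + 1) * `|v_ m x - v x|.
  rewrite normrM ler_wpM2r// -[f_ m x](subrK (f x)) addrC (le_trans (ler_normD _ _))//.
  by apply: lerD; [exact: fC|exact: le_trans fx d1].
have X2 : `|(f_ m x - f x) * v x| <= b.
  by rewrite normrM; apply: le_trans db; apply: ler_pM => //; exact: vD.
have -> : f_ m x * v_ m x - f x * v x = f_ m x * (v_ m x - v x) + (f_ m x - f x) * v x by ring.
by apply: le_trans (ler_normD _ _) _; exact: lerD.
Qed.

Lemma l1_cvgD f_ f g_ g : l1_cvg f_ f -> l1_cvg g_ g -> l1_cvg (fun m x => f_ m x + g_ m x) (fun x => f x + g x).
Proof.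
move=> [cf_ cf ff] [cg_ cg gg]; split; [by move=> m; exact: cont_onD|exact: cont_onD|].
apply: (mean_to_zero_dom (mean_to_zeroD ff gg)).
- by move=> m; apply: cont_on_norm; apply: cont_onB; exact: cont_onD.
- by move=> m x.
move=> K cK KU b b0; exists 1 => //; apply: nearW => m x Kx.
by rewrite mul1r opprD addrACA (le_trans (ler_normD _ _))// lerDl ltW.
Qed.

Lemma l1_cvg_cst f : cont_on f -> l1_cvg (fun=> f) f.
Proof.
move=> cf; split => //; under eq_fun do under eq_fun do rewrite subrr normr0.
exact: mean_to_zero0.
Qed.

Lemma l1_cvg_sum (I : Type) (s : seq I) (f_ : I -> nat -> 'rV[R]_n -> R) (f : I -> 'rV[R]_n -> R) :
  (forall i, l1_cvg (f_ i) (f i)) -> l1_cvg (fun m x => \sum_(i <- s) f_ i m x) (fun x => \sum_(i <- s) f i x).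
Proof.
move=> h; elim: s => [|i s IH].
  rewrite (_ : (fun m x => _) = fun=> (fun=> 0)).
    rewrite (_ : (fun x => _) = (fun=> 0)); first by apply: l1_cvg_cst; exact: cont_on_cst.
    by apply/funext => x; rewrite big_nil.
  by apply/funext => m; apply/funext => x; rewrite big_nil.
have E_ : (fun m x => \sum_(j <- i :: s) f_ j m x) = (fun m x => f_ i m x + \sum_(j <- s) f_ j m x).
  by apply/funext => m; apply/funext => x; rewrite big_cons.
have E : (fun x => \sum_(j <- i :: s) f j x) = (fun x => f i x + \sum_(j <- s) f j x).
  by apply/funext => x; rewrite big_cons.
rewrite E_ E; exact: (l1_cvgD (h i) IH).
Qed.

Lemma l2_cvg_sum (I : Type) (s : seq I) (f_ : I -> nat -> 'rV[R]_n -> R) (f : I -> 'rV[R]_n -> R) :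
  (forall i, l2_cvg (f_ i) (f i)) -> l2_cvg (fun m x => \sum_(i <- s) f_ i m x) (fun x => \sum_(i <- s) f i x).
Proof.
move=> h; elim: s => [|i s IH].
  rewrite (_ : (fun m x => _) = fun=> (fun=> 0)).
    rewrite (_ : (fun x => _) = (fun=> 0)); first by apply: unif_l2_cvg; apply: unif_cvg_cst; exact: cont_on_cst.
    by apply/funext => x; rewrite big_nil.
  by apply/funext => m; apply/funext => x; rewrite big_nil.
have E_ : (fun m x => \sum_(j <- i :: s) f_ j m x) = (fun m x => f_ i m x + \sum_(j <- s) f_ j m x).
  by apply/funext => m; apply/funext => x; rewrite big_cons.
have E : (fun x => \sum_(j <- i :: s) f j x) = (fun x => f i x + \sum_(j <- s) f j x).
  by apply/funext => x; rewrite big_cons.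
rewrite E_ E; exact: (l2_cvgD (h i) IH).
Qed.

Lemma l2_cvgZ (c : R) f_ f : l2_cvg f_ f -> l2_cvg (fun m x => c * f_ m x) (fun x => c * f x).
Proof. by move=> h; apply: (@unif_l2_cvgM (fun _ _ => c) (fun=> c)) => //; apply: unif_cvg_cst; exact: cont_on_cst. Qed.

Lemma l1_cvgZ (c : R) f_ f : l1_cvg f_ f -> l1_cvg (fun m x => c * f_ m x) (fun x => c * f x).
Proof. by move=> h; apply: (@unif_l1_cvgM (fun _ _ => c) (fun=> c)) => //; apply: unif_cvg_cst; exact: cont_on_cst. Qed.

Lemma l2_cvgN f_ f : l2_cvg f_ f -> l2_cvg (fun m x => - f_ m x) (fun x => - f x).
Proof.
move=> /(l2_cvgZ (-1)); rewrite (_ : (fun m x => -1 * f_ m x) = fun m x => - f_ m x).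
  by rewrite (_ : (fun x => -1 * f x) = fun x => - f x)//; apply/funext => x; rewrite mulN1r.
by apply/funext => m; apply/funext => x; rewrite mulN1r.
Qed.

Lemma l1_cvgN f_ f : l1_cvg f_ f -> l1_cvg (fun m x => - f_ m x) (fun x => - f x).
Proof.
move=> /(l1_cvgZ (-1)); rewrite (_ : (fun m x => -1 * f_ m x) = fun m x => - f_ m x).
  by rewrite (_ : (fun x => -1 * f x) = fun x => - f x)//; apply/funext => x; rewrite mulN1r.
by apply/funext => m; apply/funext => x; rewrite mulN1r.
Qed.

Lemma l1_cvg_integral K f_ f : compact K -> K `<=` U -> l1_cvg f_ f ->
  (forall m x, ~ K x -> f_ m x = 0) -> (forall x, ~ K x -> f x = 0) ->
  (\int[leb R n]_(x in U) f_ m x)%R @[m --> \oo] --> (\int[leb R n]_(x in U) f x)%R.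
Proof.
move=> cK KU [cf_ cf [cd _ dd]] fK_ fK.
have mU : measurable (U : set (borel 'rV[R]_n)) by exact: borel_open.
have i_ m := supp_integrable oU cK KU (cf_ m) (fun x _ => fK_ m x).
have i0 := supp_integrable oU cK KU cf (fun x _ => fK x).
apply/cvgrPdist_le => e e0; apply: filterS (dd K cK KU e e0) => m hm.
have id : (leb R n).-integrable (U : set (borel 'rV[R]_n)) (EFin \o (fun x : borel 'rV[R]_n => f x - f_ m x)).
  by apply: (supp_integrable oU cK KU) => [|x _ nK]; [exact: cont_onB|rewrite fK ?fK_ ?subrr].
rewrite -(RintegralB mU i0 (i_ m)).
apply: le_trans (le_normr_Rintegral mU id) _.
rewrite -lee_fin /Rintegral fineK.
  apply: le_trans hm; rewrite (integral_shrink KU); last by move=> x _ nK; rewrite /= fK ?fK_ ?subrr ?normr0.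
  by rewrite le_eqVlt; apply/orP; left; apply/eqP; apply: eq_integral => x _; rewrite distrC.
by apply: integrable_fin_num => //; exact: (integrable_norm id).
Qed.

(** The form in which W^{1,p} convergence reaches the metric coefficients. It is stable under
    products, inverses and square roots, and so passes to the inverse metric and the volume
    density. *)
Definition c1_cvg (f_ : nat -> 'rV[R]_n -> R) (f : 'rV[R]_n -> R) := [/\ forall m, Ck 1 U (f_ m), Ck 1 U f, unif_cvg f_ f &
  forall i, l2_cvg (fun m => partial i (f_ m)) (partial i f)].

Let pcont f i : Ck 1 U f -> cont_on (partial i f).
Proof. by move=> hf x Ux; exact: (hf.2 i).2.1. Qed.

Let pder f i x : Ck 1 U f -> U x -> derivable f x (delta_mx 0 i).
Proof. by move=> hf Ux; exact: (hf.2 i).1. Qed.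

Lemma cont_on_eq (f g : 'rV[R]_n -> R) : (forall x, U x -> f x = g x) -> cont_on f -> cont_on g.
Proof.
move=> fg cf x Ux; apply: near_eq_continuous (cf x Ux).
by apply: filterS (open_nbhs_nbhs (conj oU Ux)) => y; exact: fg.
Qed.

Lemma l2_cvg_eq (f_ g_ : nat -> 'rV[R]_n -> R) (f g : 'rV[R]_n -> R) : (forall m x, U x -> f_ m x = g_ m x) -> (forall x, U x -> f x = g x) ->
  l2_cvg f_ f -> l2_cvg g_ g.
Proof.
move=> fg_ fg [cf_ cf [cd d0 dd]].
have cg_ m : cont_on (g_ m) by apply: cont_on_eq (cf_ m) => x; exact: fg_.
have cg : cont_on g by apply: cont_on_eq cf.
split=> //; split; [by move=> m; apply: cont_onX2; exact: cont_onB|by move=> m x; exact: sqr_ge0|].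
move=> K cK KU e e0; apply: filterS (dd K cK KU e e0) => m; apply: le_trans.
rewrite le_eqVlt; apply/orP; left; apply/eqP; apply: eq_integral => x /set_mem Kx.
by rewrite fg_ ?fg//; exact: KU.
Qed.

Lemma c1_cvg_cst f : Ck 1 U f -> c1_cvg (fun=> f) f.
Proof.
move=> hf; split => //; first by apply: unif_cvg_cst; exact: hf.1.
by move=> i; apply: unif_l2_cvg; apply: unif_cvg_cst; exact: pcont.
Qed.

Lemma c1_cvgD f_ f g_ g : c1_cvg f_ f -> c1_cvg g_ g -> c1_cvg (fun m x => f_ m x + g_ m x) (fun x => f x + g x).
Proof.
move=> [hf_ hf uf lf] [hg_ hg ug lg]; split; [by move=> m; exact: CkD|exact: CkD|exact: unif_cvgD|].
move=> i; have pD (a b : 'rV[R]_n -> R) x : Ck 1 U a -> Ck 1 U b -> U x -> partial i a x + partial i b x = partial i (fun x => a x + b x) x.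
  by move=> ha hb Ux; rewrite /partial -deriveD//; exact: pder.
by apply: l2_cvg_eq (l2_cvgD (lf i) (lg i)) => [m x|x]; exact: pD.
Qed.

Lemma c1_cvgM f_ f g_ g : c1_cvg f_ f -> c1_cvg g_ g -> c1_cvg (fun m x => f_ m x * g_ m x) (fun x => f x * g x).
Proof.
move=> [hf_ hf uf lf] [hg_ hg ug lg]; split; [by move=> m; exact: CkM|exact: CkM|exact: unif_cvgM|].
move=> i; have pM (a b : 'rV[R]_n -> R) x : Ck 1 U a -> Ck 1 U b -> U x ->
    b x * partial i a x + a x * partial i b x = partial i (fun x => a x * b x) x.
  by move=> ha hb Ux; rewrite partialM; [rewrite mulrC|exact: pder|exact: pder].
by apply: l2_cvg_eq (l2_cvgD (unif_l2_cvgM ug (lf i)) (unif_l2_cvgM uf (lg i))) => [m x|x]; exact: pM.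
Qed.

Lemma c1_cvgV f_ f : (forall m x, U x -> f_ m x != 0) -> (forall x, U x -> f x != 0) ->
  c1_cvg f_ f -> c1_cvg (fun m x => (f_ m x)^-1) (fun x => (f x)^-1).
Proof.
move=> n_ n0 [hf_ hf uf lf]; have hV_ m : Ck 1 U (fun x => (f_ m x)^-1) by apply: CkV => //; exact: n_.
have hV : Ck 1 U (fun x => (f x)^-1) by exact: CkV.
have uV : unif_cvg (fun m x => (f_ m x)^-1) (fun x => (f x)^-1).
  by apply: unif_cvgV => //; [move=> m; exact: (hV_ m).1|exact: hV.1].
split; [exact: hV_|exact: hV|exact: uV|move=> i].
have pV (a : 'rV[R]_n -> R) x : Ck 1 U a -> Ck 1 U (fun x => (a x)^-1) -> (forall x, U x -> a x != 0) -> U x ->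
    - ((a x)^-1 * (a x)^-1 * partial i a x) = partial i (fun x => (a x)^-1) x.
  move=> ha haV an Ux; have da : derivable a x (delta_mx 0 i) by exact: pder.
  have daV : derivable (fun x => (a x)^-1) x (delta_mx 0 i) by exact: pder.
  have E := partialM da daV.
  (* The derivative of the inverse is extracted from the product rule for a a^-1 = 1. *)
  have Z : partial i (fun y => a y * (a y)^-1) x = 0.
    rewrite (@partial_eq _ _ i U _ (fun=> 1) x oU Ux); last by move=> y Uy; rewrite mulfV// an.
    by rewrite /partial derive_cst.
  move: E; rewrite Z => /esym/eqP; rewrite addrC addr_eq0 => /eqP E.
  apply: (mulfI (an x Ux)); rewrite E; set P := partial i a x; have := an x Ux.
  by move: (a x) => c c0; field.
by apply: l2_cvg_eq (l2_cvgN (unif_l2_cvgM (unif_cvgM uV uV) (lf i))) => [m x Ux|x Ux]; apply: pV => //; exact: n_.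
Qed.

Lemma c1_cvg_sqrt f_ f : (forall m x, U x -> 0 < f_ m x) -> (forall x, U x -> 0 < f x) ->
  c1_cvg f_ f -> c1_cvg (fun m x => Num.sqrt (f_ m x)) (fun x => Num.sqrt (f x)).
Proof.
move=> n_ n0 [hf_ hf uf lf].
have hs_ m : Ck 1 U (fun x => Num.sqrt (f_ m x)) by apply: Ck_sqrt => //; exact: n_.
have hs : Ck 1 U (fun x => Num.sqrt (f x)) by exact: Ck_sqrt.
have s0 x : U x -> Num.sqrt (f x) != 0 by move=> Ux; rewrite gt_eqF// sqrtr_gt0 n0.
have s0_ m x : U x -> Num.sqrt (f_ m x) != 0 by move=> Ux; rewrite gt_eqF// sqrtr_gt0 n_.
have hV : Ck 1 U (fun x => (Num.sqrt (f x))^-1) by exact: CkV.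
have hV_ m : Ck 1 U (fun x => (Num.sqrt (f_ m x))^-1) by apply: CkV => //; exact: s0_.
have us : unif_cvg (fun m x => Num.sqrt (f_ m x)) (fun x => Num.sqrt (f x)).
  by apply: unif_cvg_sqrt => //; [move=> m; exact: (hs_ m).1|exact: hs.1|exact: hV.1].
have uV : unif_cvg (fun m x => (Num.sqrt (f_ m x))^-1) (fun x => (Num.sqrt (f x))^-1).
  by apply: unif_cvgV => //; [move=> m; exact: (hV_ m).1|exact: hV.1].
split; [exact: hs_|exact: hs|exact: us|move=> i].
have pS (a : 'rV[R]_n -> R) x : Ck 1 U a -> Ck 1 U (fun x => Num.sqrt (a x)) -> (forall x, U x -> 0 < a x) -> U x ->
    2^-1 * ((Num.sqrt (a x))^-1 * partial i a x) = partial i (fun x => Num.sqrt (a x)) x.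
  move=> ha has ap Ux; have da : derivable (fun x => Num.sqrt (a x)) x (delta_mx 0 i) by exact: pder.
  (* The derivative of the root is extracted from the product rule for sqrt(a) sqrt(a) = a. *)
  have := partialM da da.
  rewrite (@partial_eq _ _ i U _ a x oU Ux); last by move=> y Uy; rewrite -expr2 sqr_sqrtr// ltW// ap.
  move=> ->; have sa : Num.sqrt (a x) != 0 by rewrite gt_eqF// sqrtr_gt0 ap.
  by field.
by apply: l2_cvg_eq (l2_cvgZ 2^-1 (unif_l2_cvgM uV (lf i))) => [m x Ux|x Ux]; apply: pS => //; exact: n_.
Qed.

Lemma c1_cvg_sum (I : Type) (s : seq I) (f_ : I -> nat -> 'rV[R]_n -> R) (f : I -> 'rV[R]_n -> R) :
  (forall i, c1_cvg (f_ i) (f i)) -> c1_cvg (fun m x => \sum_(i <- s) f_ i m x) (fun x => \sum_(i <- s) f i x).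
Proof.
move=> h; elim: s => [|i s IH].
  rewrite (_ : (fun m x => _) = fun=> (fun=> 0)).
    rewrite (_ : (fun x => _) = (fun=> 0)); first by apply: c1_cvg_cst; exact: Ck_cst.
    by apply/funext => x; rewrite big_nil.
  by apply/funext => m; apply/funext => x; rewrite big_nil.
have E_ : (fun m x => \sum_(j <- i :: s) f_ j m x) = (fun m x => f_ i m x + \sum_(j <- s) f_ j m x).
  by apply/funext => m; apply/funext => x; rewrite big_cons.
have E : (fun x => \sum_(j <- i :: s) f j x) = (fun x => f i x + \sum_(j <- s) f j x).
  by apply/funext => x; rewrite big_cons.
rewrite E_ E; exact: (c1_cvgD (h i) IH).
Qed.

Lemma c1_cvg_prod (I : Type) (s : seq I) (f_ : I -> nat -> 'rV[R]_n -> R) (f : I -> 'rV[R]_n -> R) :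
  (forall i, c1_cvg (f_ i) (f i)) -> c1_cvg (fun m x => \prod_(i <- s) f_ i m x) (fun x => \prod_(i <- s) f i x).
Proof.
move=> h; elim: s => [|i s IH].
  rewrite (_ : (fun m x => _) = fun=> (fun=> 1)).
    rewrite (_ : (fun x => _) = (fun=> 1)); first by apply: c1_cvg_cst; exact: Ck_cst.
    by apply/funext => x; rewrite big_nil.
  by apply/funext => m; apply/funext => x; rewrite big_nil.
have E_ : (fun m x => \prod_(j <- i :: s) f_ j m x) = (fun m x => f_ i m x * \prod_(j <- s) f_ j m x).
  by apply/funext => m; apply/funext => x; rewrite big_cons.
have E : (fun x => \prod_(j <- i :: s) f j x) = (fun x => f i x * \prod_(j <- s) f j x).
  by apply/funext => x; rewrite big_cons.
rewrite E_ E; exact: (c1_cvgM (h i) IH).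
Qed.

Lemma c1_cvg_det k (A_ : nat -> 'rV[R]_n -> 'M[R]_k) (A : 'rV[R]_n -> 'M[R]_k) :
  (forall i j, c1_cvg (fun m x => A_ m x i j) (fun x => A x i j)) ->
  c1_cvg (fun m x => \det (A_ m x)) (fun x => \det (A x)).
Proof.
move=> h; rewrite /determinant; apply: c1_cvg_sum => s.
by apply: c1_cvgM; [apply: c1_cvg_cst; exact: Ck_cst|exact: c1_cvg_prod].
Qed.

(** Cramer's rule replaces [invmx], which is defined by cases, by polynomials in the entries and a
    single inverse. *)
Lemma c1_cvg_inv k (A_ : nat -> 'rV[R]_n -> 'M[R]_k) (A : 'rV[R]_n -> 'M[R]_k) :
  (forall m x, U x -> A_ m x \in unitmx) -> (forall x, U x -> A x \in unitmx) ->
  (forall i j, c1_cvg (fun m x => A_ m x i j) (fun x => A x i j)) ->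
  forall i j, c1_cvg (fun m x => (\det (A_ m x))^-1 * \adj (A_ m x) i j) (fun x => (\det (A x))^-1 * \adj (A x) i j).
Proof.
move=> u_ u0 h i j; apply: c1_cvgM.
  apply: c1_cvgV; last exact: c1_cvg_det.
  - by move=> m x Ux; have := u_ m x Ux; rewrite unitmxE unitfE.
  - by move=> x Ux; have := u0 x Ux; rewrite unitmxE unitfE.
under [X in c1_cvg X _]eq_fun do under eq_fun do rewrite mxE.
under [X in c1_cvg _ X]eq_fun do rewrite mxE.
apply: c1_cvgM; first by apply: c1_cvg_cst; exact: Ck_cst.
apply: c1_cvg_det => a b.
under [X in c1_cvg X _]eq_fun do under eq_fun do rewrite !mxE.
by under [X in c1_cvg _ X]eq_fun do rewrite !mxE; exact: h.
Qed.

End ConvergenceModes.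

(** * Functions supported in a chart *)

Section Extension.
Variables (R : realType) (n : nat) (M : smoothManifold R n).
Implicit Types (a : chart M) (h : 'rV[R]_n -> R) (F : M -> R) (K : set 'rV[R]_n).

Definition ext a h (q : M) : R := if `[< dom a q >] then h (coord a q) else 0.
Definition pull a F (x : 'rV[R]_n) : R := if `[< img a x >] then F (coordV a x) else 0.

Definition chart_supported a K F :=
  [/\ compact K, K `<=` img a & forall q, F q != 0 -> dom a q /\ K (coord a q)].

Lemma ext_dom a h q : dom a q -> ext a h q = h (coord a q).
Proof. by move=> aq; rewrite /ext asboolT. Qed.

Lemma ext_img a h x : img a x -> ext a h (coordV a x) = h x.
Proof. by move=> ax; rewrite ext_dom ?coordVK//; exact: dom_coordV. Qed.

Lemma pull_img a F x : img a x -> pull a F x = F (coordV a x).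
Proof. by move=> ax; rewrite /pull asboolT. Qed.

Lemma pull_supp a K F x : chart_supported a K F -> ~ K x -> pull a F x = 0.
Proof.
move=> [cK KU hF] nK; rewrite /pull; case: asboolP => // ax.
by apply/eqP; apply: contrapT => /negP /hF [_]; rewrite coordVK.
Qed.

Lemma ext_supported a K h : compact K -> K `<=` img a -> (forall x, ~ K x -> h x = 0) -> chart_supported a K (ext a h).
Proof.
move=> cK KU hK; split => // q; rewrite /ext; case: asboolP => [aq h0|_]; last by rewrite eqxx.
by split => //; apply: contrapT => /hK h00; rewrite h00 eqxx in h0.
Qed.

(** The support carried to [M] is compact, hence closed since [M] is Hausdorff; its complement and
    the chart domain cover [M]. *)
Lemma ext_continuous a K h : compact K -> K `<=` img a -> (forall x, ~ K x -> h x = 0) -> continuous h ->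
  continuous (ext a h).
Proof.
move=> cK KU hK ch q; pose L := coordV a @` K.
have cVK x : K x -> {for x, continuous (coordV a)}.
  by move=> /KU [p ap <-]; exact: coordV_cts.
have cL : compact L.
  apply: continuous_compact => //; apply: continuous_in_subspaceT => x; rewrite inE; exact: cVK.
have oL : open (~` L) by apply: closed_openC; apply: compact_closed => //; exact: mhausdorff.
have [aq|naq] := pselect (dom a q).
  apply: (@near_eq_continuous _ _ (h \o coord a)).
    by apply: filterS (open_nbhs_nbhs (conj (dom_open a) aq)) => p ap; rewrite ext_dom.
  by apply: continuous_comp; [exact: coord_cts|exact: ch].
have nL : (~` L) q by move=> [x Kx xq]; apply: naq; rewrite -xq; apply: dom_coordV; exact: KU.
apply: (@near_eq_continuous _ _ (fun=> 0)); last exact: cst_continuous.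
apply: filterS (open_nbhs_nbhs (conj oL nL)) => p np; rewrite /ext; case: asboolP => // ap.
by rewrite hK// => Kp; apply: np; exists (coord a p) => //; rewrite coordK.
Qed.

Lemma pull_continuous a K F : chart_supported a K F -> continuous F -> continuous (pull a F).
Proof.
move=> sF cF x; have [cK KU _] := sF.
have oK : open (~` K) by apply: closed_openC; apply: compact_closed => //; exact: norm_hausdorff.
have [ax|nax] := pselect (img a x).
  apply: (@near_eq_continuous _ _ (F \o coordV a)).
    by apply: filterS (open_nbhs_nbhs (conj (@img_open _ _ M a) ax)) => y ay; rewrite pull_img.
  have [p ap px] := ax; apply: continuous_comp; [rewrite -px; exact: coordV_cts|exact: cF].
have nK : (~` K) x by move=> /KU.
apply: (@near_eq_continuous _ _ (fun=> 0)); last exact: cst_continuous.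
by apply: filterS (open_nbhs_nbhs (conj oK nK)) => y nKy; rewrite (pull_supp sF).
Qed.

Hypothesis hM : compact [set: M].

Lemma measurable_chartwise (F : borel M -> R) :
  (forall a, measurable_fun (img a : set (borel 'rV[R]_n)) (fun x : borel 'rV[R]_n => F (coordV a x))) ->
  measurable_fun setT F.
Proof.
move=> mF; have [N [c cov]] := chart_cover hM.
have mdom a : measurable (dom a : set (borel M)) by apply: borel_open; exact: dom_open.
have mimg a : measurable (img a : set (borel 'rV[R]_n)) by apply: borel_open; exact: img_open.
have mD a : measurable_fun (dom a : set (borel M)) F.
  move=> _ Y mY; have := measurable_coord_dom (mdom a) (mF a (mimg a) Y mY).
  congr measurable; apply/seteqP; split => q [aq]; first by move=> [_]; rewrite /= coordK.
  by move=> FY; split => //; split; [exact: img_coord|rewrite /= coordK].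
have <- : \big[setU/set0]_(k < N) (dom (c k) : set (borel M)) = [set: borel M].
  apply/seteqP; split => // q _; have [k kN dk] := cov q.
  by apply/bigsetU_ordP; exists (Ordinal kN).
suff [] : measurable (\big[setU/set0]_(k < N) (dom (c k) : set (borel M))) /\
  measurable_fun (\big[setU/set0]_(k < N) (dom (c k) : set (borel M))) F by [].
elim/big_ind: _ => [|X Y [mX fX] [mY fY]|k _].
- by split; [exact: measurable0|exact: measurable_fun_set0].
- by split; [exact: measurableU|apply/measurable_funU].
- by split; [exact: mdom|exact: mD].
Qed.

(** By compactness finitely many tents have a positive sum everywhere, and dividing by it normalises
    them. Continuity is enough: smoothness is restored later, chart by chart, by mollification. *)
Lemma partition_of_unity : exists (s : seq M) (e : M -> M -> R) (K : M -> set 'rV[R]_n),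
  [/\ forall p, continuous (e p), forall p q, 0 <= e p q, forall q, \sum_(p <- s) e p q = 1 &
   forall p, chart_supported (chart_at p) (K p) (e p)].
Proof.
have tentP (p : M) : exists rK : R * set 'rV[R]_n, [/\ 0 < rK.1, compact rK.2, rK.2 `<=` img (chart_at p) &
    forall y, `|coord (chart_at p) p - y| <= rK.1 -> rK.2 y].
  have sub : [set coord (chart_at p) p] `<=` img (chart_at p).
    by move=> _ ->; apply: img_coord; exact: dom_chart_at.
  have [r r0 [K [cK KU hK]]] := compact_thicken (@img_open _ _ M (chart_at p)) (@compact_set1 _ _) sub.
  by exists (r, K); split => // y; exact: hK.
have [rK hrK] := choice tentP.
pose tent p (x : 'rV[R]_n) : R := Num.max 0 ((rK p).1 - `|coord (chart_at p) p - x|).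
have tent0 p x : 0 <= tent p x by rewrite le_max lexx.
have tentK p x : ~ (rK p).2 x -> tent p x = 0.
  have [_ _ _ hK] := hrK p; move=> nK; rewrite /tent max_l// subr_le0; apply: contrapT => /negP.
  by rewrite -ltNge => /ltW /hK.
pose t p := ext (chart_at p) (tent p).
have ct p : continuous (t p).
  by have [_ cK KU _] := hrK p; apply: ext_continuous cK KU (tentK p) _; exact: tent_continuous.
have t0 p q : 0 <= t p q by rewrite /t /ext; case: ifP.
have tp p : 0 < t p p.
  have [r0 _ _ _] := hrK p; rewrite /t ext_dom; last exact: dom_chart_at.
  by rewrite /tent subrr normr0 subr0 lt_max r0 orbT.
have oO p : open [set q | 0 < t p q].
  rewrite (_ : [set q | _] = t p @^-1` [set x | 0 < x])//.
  by apply: open_comp => [q _|]; [exact: ct|exact: open_gt].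
have [s hs] := finite_subcover hM oO tp.
pose S q := \sum_(p <- s) t p q.
have S0 q : 0 < S q.
  have [p ps tpq] := hs q; rewrite /S (big_rem p)//= ltr_pwDl//.
  by apply: sumr_ge0 => i _.
have cS : continuous S.
  move=> q; rewrite /S (_ : (fun q => _) = \sum_(p <- s) t p); last by apply/funext => x; rewrite fct_sumE.
  elim/big_ind: _ => [|f h cf ch|p _]; [exact: cst_continuous| |exact: ct].
  exact: (@continuousD R R^o _ f h).
exists s, (fun p q => t p q / S q), (fun p => (rK p).2); split.
- move=> p q; apply: (@continuousM R _ (t p) (fun q => (S q)^-1)); first exact: ct.
  by apply: (@continuousV R _ S); [rewrite gt_eqF|exact: cS].
- by move=> p q; rewrite divr_ge0// ltW.
- by move=> q; rewrite -mulr_suml -/(S q) mulfV// gt_eqF// S0.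
- move=> p; have [r0 cK KU hK] := hrK p; have [_ _ h] := ext_supported cK KU (tentK p).
  split => // q; rewrite mulf_eq0 negb_or => /andP[h1 _]; exact: h.
Qed.

End Extension.

(** * Integration against the Riemannian volume *)

Section VolumeIntegrals.
Variables (R : realType) (n : nat) (M : smoothManifold R n) (g : C2metric M).
Hypothesis hM : compact [set: M].
Implicit Types (a : chart M) (F : M -> R) (K : set 'rV[R]_n).

Lemma measurable_continuous F : continuous F -> measurable_fun [set: borel M] (F : borel M -> R).
Proof. by move=> cF; exact: continuous_borelRT. Qed.

Lemma sqdet_continuous a x : img a x -> {for x, continuous (sqdet g a)}.
Proof. exact: (Ck_sqdet g a).1. Qed.

Lemma chart_integrable a K (u : 'rV[R]_n -> R) : compact K -> K `<=` img a -> continuous u -> (forall x, ~ K x -> u x = 0) ->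
  (leb R n).-integrable (img a : set (borel 'rV[R]_n)) (EFin \o (fun x : borel 'rV[R]_n => u x * sqdet g a x)).
Proof.
move=> cK KU cu uK; apply: (supp_integrable (@img_open _ _ _ a) cK KU) => [x ax|x _ nK]; last by rewrite uK ?mul0r.
by apply: (@continuousM R _ u (sqdet g a)); [exact: cu|exact: sqdet_continuous].
Qed.

Lemma integral_vol_supp a K F : chart_supported a K F -> continuous F ->
  (\int[vol_measure g hM]_q (F q)%:E = \int[leb R n]_(x in img a) (pull a F x * sqdet g a x)%:E)%E.
Proof.
move=> [cK KU hF] cF; rewrite (integral_vol g hM (a := a) (measurable_continuous cF)); last first.
  by move=> q nq; apply/eqP; apply: contrapT => /negP /hF[].
by apply: eq_integral => x /set_mem ax; rewrite pull_img.
Qed.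

Lemma vol_finite : (vol_measure g hM setT < +oo)%E.
Proof.
have [s [e [K [ce e0 e1 hK]]]] := partition_of_unity hM.
have -> : vol_measure g hM setT = (\int[vol_measure g hM]_q (\sum_(p <- s) (e p q)%:E))%E.
  rewrite -[LHS]mul1e -integral_cst//; apply: eq_integral => q _.
  by rewrite sumEFin e1.
rewrite ge0_integral_sum//; last 2 first.
- by move=> p; apply/measurable_EFinP; exact: measurable_continuous.
- by move=> p q _; rewrite lee_fin.
apply: lte_sum_pinfty => p _; rewrite (integral_vol_supp (hK p) (ce p)).
have [cK KU _] := hK p.
have I := chart_integrable cK KU (pull_continuous (hK p) (ce p)) (fun x => pull_supp (hK p)).
by have := integrable_fin_num (borel_open (@img_open _ _ _ (chart_at p))) I; rewrite fin_numElt => /andP[].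
Qed.

Lemma continuous_integrable F : continuous F -> (vol_measure g hM).-integrable setT (EFin \o (F : borel M -> R)).
Proof.
move=> cF; have [C C0 hC] := compact_bound hM (fun q _ => cF q).
have mF := measurable_continuous cF.
apply/integrableP; split; first exact/measurable_EFinP.
apply: (@le_lt_trans _ _ (\int[vol_measure g hM]_q C%:E)%E).
  have m1 : measurable_fun [set: borel M] (fun q : borel M => `|(F q)%:E|%E).
    by apply: measurableT_comp => //; exact/measurable_EFinP.
  apply: (ge0_le_integral (vol_measure g hM) measurableT _ m1 (measurable_cst _)) => [q _|q _]; first exact: abse_ge0.
  by rewrite /= lee_fin; exact: hC.
rewrite integral_cst// lte_mul_pinfty ?lee_fin ?(ltW C0)//; exact: vol_finite.
Qed.

Lemma Rintegral_vol_supp a K F : chart_supported a K F -> continuous F ->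
  (\int[vol_measure g hM]_q F q)%R = (\int[leb R n]_(x in img a) (pull a F x * sqdet g a x))%R.
Proof. by move=> sF cF; rewrite /Rintegral (integral_vol_supp sF cF). Qed.

Lemma Rintegral_vol_sum (I : Type) (s : seq I) (F : I -> M -> R) : (forall i, continuous (F i)) ->
  (\int[vol_measure g hM]_q (\sum_(i <- s) F i q))%R = \sum_(i <- s) (\int[vol_measure g hM]_q F i q)%R.
Proof.
move=> cF; elim: s => [|i s IH].
  by rewrite big_nil; under eq_Rintegral do rewrite big_nil; rewrite Rintegral_cst// mul0r.
rewrite big_cons -IH; under eq_Rintegral do rewrite big_cons.
rewrite RintegralD//; apply: continuous_integrable => //.
move=> q; rewrite (_ : (fun q => _) = \sum_(p <- s) F p); last by apply/funext => x; rewrite fct_sumE.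
elim/big_ind: _ => [|f h cf ch|p _]; [exact: cst_continuous| |exact: cF].
exact: (@continuousD R R^o _ f h).
Qed.

Lemma Rintegral_vol_le (F G : M -> R) : continuous F -> continuous G -> (forall q, F q <= G q) ->
  (\int[vol_measure g hM]_q F q)%R <= (\int[vol_measure g hM]_q G q)%R.
Proof. by move=> cF cG FG; apply: le_Rintegral => //; [exact: continuous_integrable|exact: continuous_integrable]. Qed.

End VolumeIntegrals.

Lemma powRD_le (R : realType) (a b p : R) : 0 <= a -> 0 <= b -> 0 <= p ->
  (a + b) `^ p <= 2 `^ p * (a `^ p + b `^ p).
Proof.
move=> a0 b0 p0; wlog ab : a b a0 b0 / a <= b.
  by move=> H; have [/H|/ltW/H] := leP a b; [exact|rewrite addrC [a `^ p + _]addrC; exact].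
apply: le_trans (_ : (2 * b) `^ p <= _).
  by apply: ge0_ler_powR; rewrite ?nnegrE ?addr_ge0 ?mulr_ge0//; lra.
by rewrite powRM// ler_wpM2l ?powR_ge0// lerDr powR_ge0.
Qed.

(** Removes the exponent 1/p of the L^p norm, leaving integrals that can be added and compared. *)
Lemma poweR_small (R : realType) (p : R) (X : nat -> \bar R) : 0 < p -> (forall m, (0 <= X m)%E) ->
  ((X m `^ p^-1)%E @[m --> \oo] --> (0 : \bar R)) -> forall e : R, 0 < e -> \forall m \near \oo, (X m <= e%:E)%E.
Proof.
move=> p0 X0 cX e e0; have d0 : (0 < e%:E `^ p^-1)%E by rewrite poweR_EFin lte_fin powR_gt0.
have H : \forall m \near \oo, (X m `^ p^-1 < e%:E `^ p^-1)%E := cX _ (open_ereal_lt' d0).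
apply: filterS H => m Xm; rewrite leNgt; apply/negP => eX.
have pi0 : 0 <= p^-1 by rewrite invr_ge0 ltW.
have : (e%:E `^ p^-1 <= X m `^ p^-1)%E.
  by apply: (gt0_ler_poweR pi0) (ltW eX); rewrite in_itv /= ?leey ?andbT ?lee_fin ?(ltW e0).
by rewrite leNgt Xm.
Qed.

Section MeasurableMatrices.
Variables (R : realType) (n : nat) (D : set (borel 'rV[R]_n)).

Definition measurable_mx (A : borel 'rV[R]_n -> 'M[R]_n) := forall i j, measurable_fun D (fun x => A x i j).

Lemma measurable_mulmx A B : measurable_mx A -> measurable_mx B -> measurable_mx (fun x => A x *m B x).
Proof.
move=> mA mB i j; under eq_fun do rewrite mxE.
by apply: measurable_sum => l; apply: measurable_funM; [exact: mA|exact: mB].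
Qed.

Lemma measurable_trmx A : measurable_mx A -> measurable_mx (fun x => (A x)^T).
Proof. by move=> mA i j; under eq_fun do rewrite mxE; exact: mA. Qed.

Lemma measurable_mdot (G A B : borel 'rV[R]_n -> 'M[R]_n) : measurable_mx (fun x => invmx (G x)) -> measurable_mx A -> measurable_mx B ->
  measurable_fun D (fun x => mdot (G x) (A x) (B x)).
Proof.
move=> mG mA mB; rewrite /mdot /mxtrace; apply: measurable_sum => i.
have mm := measurable_mulmx (measurable_mulmx (measurable_mulmx mG mA) mG) (measurable_trmx mB).
exact: mm.
Qed.

Lemma measurable_mdot3 (G : borel 'rV[R]_n -> 'M[R]_n) (T : borel 'rV[R]_n -> 'I_n -> 'M[R]_n) :
  measurable_mx (fun x => invmx (G x)) -> (forall k, measurable_mx (fun x => T x k)) ->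
  measurable_fun D (fun x => mdot3 (G x) (T x)).
Proof.
move=> mG mT; apply: measurable_sum => k; apply: measurable_sum => l.
by apply: measurable_funM; [exact: mG|exact: (measurable_mdot mG (mT k) (mT l))].
Qed.

End MeasurableMatrices.

(** * Local comparison of Sobolev norms *)

Section LocalNorms.
Variables (R : realType) (n : nat) (M : smoothManifold R n) (g : C2metric M).
Hypothesis hM : compact [set: M].
Variable p : R.
Hypothesis p2 : 2 <= p.
Implicit Types (a : chart M) (K : set 'rV[R]_n).

Let p0 : 0 < p. Proof. exact: lt_le_trans p2. Qed.

Let mimg a : measurable (img a : set (borel 'rV[R]_n)).
Proof. by apply: borel_open; exact: img_open. Qed.

Let inv_measurable a : measurable_mx (img a) (fun x => invmx (g a x)).
Proof.
move=> i j; apply: continuous_borelR; first exact: img_open.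
have u x : img a x -> g a x \in unitmx by move=> ax; apply: posdef_unit; exact: metric_posdef.
exact: (Ck_invmx (@img_open _ _ M a) u (fun i j => gmx_C2 g a i j) i j).1.
Qed.

Let msqrt : measurable_fun [set: R] (@Num.sqrt R).
Proof. by apply: continuous_measurable_fun; exact: sqrt_continuous. Qed.

Lemma measurable_tnorm2 (h : field2 M) : is_tensor2 h -> (forall a, measurable_mx (img a) (h a)) ->
  measurable_fun [set: borel M] (tnorm2 g h : borel M -> R).
Proof.
move=> th mh; apply: (measurable_chartwise hM) => a.
apply: (@eq_measurable_fun _ _ _ _ _ (fun x : borel 'rV[R]_n => Num.sqrt (mdot (g a x) (h a x) (h a x)))).
  by move=> x /set_mem ax; rewrite (tnorm2_chart g th (dom_coordV ax)) coordVK.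
exact: (measurableT_comp msqrt (measurable_mdot (@inv_measurable a) (mh a) (mh a))).
Qed.

Lemma measurable_tnorm3 (T : field3 M) : is_tensor3 T -> (forall a k, measurable_mx (img a) (fun x => T a x k)) ->
  measurable_fun [set: borel M] (tnorm3 g T : borel M -> R).
Proof.
move=> tT mT; apply: (measurable_chartwise hM) => a.
apply: (@eq_measurable_fun _ _ _ _ _ (fun x : borel 'rV[R]_n => Num.sqrt (mdot3 (g a x) (T a x)))).
  by move=> x /set_mem ax; rewrite (tnorm3_chart g tT (dom_coordV ax)) coordVK.
exact: (measurableT_comp msqrt (measurable_mdot3 (@inv_measurable a) (mT a))).
Qed.

(** On [K] the density sqrt(det g) is at least 1/D. As [D] precedes all functions it is uniform
    along a sequence; the pointwise bound is asked almost everywhere, which is what weak derivatives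
    supply. *)
Lemma compact_integral_le a K : compact K -> K `<=` img a -> exists2 D : R, 0 < D &
  forall (f : borel M -> R) (u : borel 'rV[R]_n -> R) (C : R), measurable_fun setT f -> (forall q, 0 <= f q) -> 0 <= C ->
    measurable_fun (img a : set (borel 'rV[R]_n)) u -> (forall x, 0 <= u x) ->
    {ae leb R n, forall x, K x -> u x <= C * f (coordV a x)} ->
    (\int[leb R n]_(x in K) (u x)%:E <= (C * D)%:E * \int[vol_measure g hM]_q (f q)%:E)%E.
Proof.
move=> cK KU.
have ci x : K x -> {for x, continuous (fun x => (sqdet g a x)^-1)}.
  move=> Kx; apply: (@continuousV R _ (sqdet g a)); first by rewrite gt_eqF// sqdet_gt0//; exact: KU.
  by apply: sqdet_continuous; exact: KU.
have [D D0 hD] := compact_bound cK ci.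
exists D => // f u C mf f0 C0 mu u0 hu.
have mK : measurable (K : set (borel 'rV[R]_n)) by apply: borel_compact => //; exact: norm_hausdorff.
pose A : set M := coordV a @` K.
have cA : compact A.
  apply: continuous_compact => //; apply: continuous_in_subspaceT => x; rewrite inE => /KU [q aq <-].
  exact: coordV_cts.
have mA : measurable (A : set (borel M)) by apply: borel_compact => //; exact: mhausdorff.
pose fA : borel M -> \bar R := (EFin \o f) \_ A.
have mfE : measurable_fun setT (EFin \o f) by exact/measurable_EFinP.
have mfA : measurable_fun setT fA.
  by apply/(measurable_restrictT _ mA); exact (measurable_funS measurableT (@subsetT _ (A : set (borel M))) mfE).
have fA0 q : (0 <= fA q)%E by rewrite /fA patchE; case: ifP => // _; rewrite lee_fin.
have KA x : img a x -> A (coordV a x) -> K x.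
  by move=> ax [y Ky E]; rewrite -(coordVK ax) -E coordVK//; exact: KU.
have E1 : (\int[vol_measure g hM]_q fA q = \int[leb R n]_(x in K) ((f (coordV a x))%:E * (sqdet g a x)%:E))%E.
  rewrite (ge0_integral_vol g hM (a := a) mfA fA0); last first.
    move=> q nq; rewrite /fA patchE memNset// => -[x Kx xq]; apply: nq; rewrite -xq.
    by apply: dom_coordV; exact: KU.
  rewrite (integral_shrink KU); last first.
    by move=> x ax nK; rewrite /fA patchE memNset ?mul0e// => /(KA x ax).
  apply: eq_integral => x /set_mem Kx; rewrite /fA patchE mem_set//.
  by exists x.
have E2 : (\int[vol_measure g hM]_q fA q <= \int[vol_measure g hM]_q (f q)%:E)%E.
  apply: (ge0_le_integral (vol_measure g hM) measurableT _ mfA mfE) => // q _.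
  by rewrite /fA patchE; case: ifP => //= _; rewrite lee_fin.
have mfV : measurable_fun (K : set (borel 'rV[R]_n)) (fun x : borel 'rV[R]_n => ((f (coordV a x))%:E * (sqdet g a x)%:E)%E).
  apply: (measurable_funS (mimg a) KU); apply: emeasurable_funM; apply/measurable_EFinP.
    exact: (measurableT_comp mf (@measurable_coordV_img _ _ M a)).
  exact: measurable_sqdet.
have s0 (x : borel 'rV[R]_n) : K x -> (0 <= (f (coordV a x))%:E * (sqdet g a x)%:E)%E.
  by move=> _; rewrite mule_ge0 ?lee_fin ?sqrtr_ge0.
apply: le_trans (lee_wpmul2l _ E2); last by rewrite lee_fin mulr_ge0// ltW.
rewrite E1 -ge0_integralZl//; last by rewrite lee_fin mulr_ge0// ltW.
apply: ae_ge0_le_integral => //.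
- by move=> x _; rewrite lee_fin.
- by apply/measurable_EFinP; exact: (measurable_funS (mimg a) KU mu).
- by move=> x Kx; rewrite mule_ge0 ?s0// lee_fin mulr_ge0// ltW.
- exact: measurable_funeM.
have [N [mN N0 hN]] := hu; exists N; split => // x nx; apply: hN => hx; apply: nx => Kx.
rewrite -!EFinM lee_fin; apply: le_trans (hx Kx) _.
rewrite -!mulrA ler_wpM2l// mulrCA -[leLHS]mulr1 ler_wpM2l//.
have sx : 0 < sqdet g a x by apply: sqdet_gt0; exact: KU.
by rewrite mulrC -ler_pdivrMl// mulr1 (le_trans (ler_norm _))//; exact: hD.
Qed.

End LocalNorms.

(** * From Sobolev convergence to uniform and L^2 convergence *)

Section SobolevConvergence.
Variables (R : realType) (n : nat) (M : smoothManifold R n) (g : C2metric M) (gs : nat -> C2metric M).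
Hypothesis hM : compact [set: M].
Variables (p : R) (Ts : nat -> field3 M) (T : field3 M).
Hypotheses (p2 : 2 <= p) (pn : n%:R < p).
Hypotheses (hTs : forall m, weak_cov_deriv g (gs m) (Ts m)) (hT : weak_cov_deriv g g T).
Let h m : field2 M := fun a x => gs m a x - g a x.
Let D m : field3 M := fun a x k => Ts m a x k - T a x k.
Hypothesis h_cvg : Lp_norm g p (tnorm2 g (h m)) @[m --> \oo] --> (0 : \bar R).
Hypothesis D_cvg : Lp_norm g p (tnorm3 g (D m)) @[m --> \oo] --> (0 : \bar R).
Implicit Types (a : chart M) (K : set 'rV[R]_n).

Let p0 : 0 < p. Proof. exact: lt_le_trans p2. Qed.
Let p1 : 1 <= p. Proof. by apply: le_trans p2; rewrite ler1n. Qed.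

Let mimg a : measurable (img a : set (borel 'rV[R]_n)).
Proof. by apply: borel_open; exact: img_open. Qed.

Let th m : is_tensor2 (h m).
Proof.
move=> a b x ox; rewrite /h (gmx_tensor (gs m) ox) (gmx_tensor g ox).
by rewrite mulmxBr mulmxBl.
Qed.

Let tD m : is_tensor3 (D m).
Proof.
move=> a b x ox k; rewrite /D ((hTs m).1 a b x ox k) (hT.1 a b x ox k) -sumrB; apply: eq_bigr => l _.
by rewrite mulmxBr mulmxBl scalerBr.
Qed.

Let Ck_h m a i j : Ck 2 (img a) (fun x => h m a x i j).
Proof.
rewrite (_ : (fun x => _) = (fun x => gs m a x i j - g a x i j)); last by apply/funext => x; rewrite !mxE.
by apply: CkB; [exact: img_open|exact: gmx_C2|exact: gmx_C2].
Qed.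

Let mh m a : measurable_mx (img a) (h m a).
Proof. by move=> i j; apply: continuous_borelR; [exact: img_open|exact: (Ck_h m a i j).1]. Qed.

Let christ a l k i := fun x => christoffel (g a) l k i x.

Let Ck_christ a l k i : Ck 1 (img a) (christ a l k i).
Proof.
apply: Ck_christoffel; [exact: img_open|by move=> x ax; exact: metric_posdef|exact: gmx_C2].
Qed.

Let mchrist a l k i : measurable_fun (img a : set (borel 'rV[R]_n)) (christ a l k i : borel 'rV[R]_n -> R).
Proof. by apply: continuous_borelR; [exact: img_open|exact: (Ck_christ a l k i).1]. Qed.

(** A weak derivative is Borel on the chart as part of local integrability; subtracting the
    Christoffel terms, continuous on the chart, isolates [T']. *)
Let mweak (g' : C2metric M) (T' : field3 M) a k : weak_cov_deriv g g' T' -> measurable_mx (img a) (fun x => T' a x k).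
Proof.
move=> [_ wT] i j; have [_ [mw _] _] := wT a k i j.
have mg' i' j' : measurable_fun (img a : set (borel 'rV[R]_n)) (fun x : borel 'rV[R]_n => g' a x i' j').
  by apply: continuous_borelR; [exact: img_open|exact: (gmx_C2 g' a i' j').1].
have m1 : measurable_fun (img a : set (borel 'rV[R]_n)) (fun x : borel 'rV[R]_n => \sum_l christoffel (g a) l k i x * g' a x l j).
  by apply: measurable_sum => l; apply: measurable_funM; [exact: mchrist|exact: mg'].
have m2 : measurable_fun (img a : set (borel 'rV[R]_n)) (fun x : borel 'rV[R]_n => \sum_l christoffel (g a) l k j x * g' a x i l).
  by apply: measurable_sum => l; apply: measurable_funM; [exact: mchrist|exact: mg'].
apply: eq_measurable_fun (measurable_funB (measurable_funB mw m2) m1) => x _ /=.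
by rewrite addrK addrK.
Qed.

Let mD m a k : measurable_mx (img a) (fun x => D m a x k).
Proof.
move=> i j; apply: eq_measurable_fun (measurable_funB (@mweak _ _ a k (hTs m) i j) (@mweak _ _ a k hT i j)) => x _.
by rewrite /D !mxE.
Qed.

Let tau2 m (q : borel M) := `|tnorm2 g (h m) q| `^ p.
Let tau3 m (q : borel M) := `|tnorm3 g (D m) q| `^ p.

Let mtau2 m : measurable_fun setT (tau2 m).
Proof.
apply: (measurableT_comp (measurable_powR p)); apply: measurableT_comp => //.
exact: (measurable_tnorm2 g hM (@th m) (@mh m)).
Qed.

Let mtau3 m : measurable_fun setT (tau3 m).
Proof.
apply: (measurableT_comp (measurable_powR p)); apply: measurableT_comp => //.
exact: (measurable_tnorm3 g hM (@tD m) (@mD m)).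
Qed.

Let energy m := (\int[vol_measure g hM]_q (tau2 m q + tau3 m q)%:E)%E.

Lemma energy_small e : 0 < e -> \forall m \near \oo, (energy m <= e%:E)%E.
Proof.
move=> e0; have e2 : 0 < e / 2 by rewrite divr_gt0.
have t20 m : (0 <= \int[vol_measure g hM]_q (tau2 m q)%:E)%E.
  by apply: integral_ge0 => q _; rewrite lee_fin powR_ge0.
have t30 m : (0 <= \int[vol_measure g hM]_q (tau3 m q)%:E)%E.
  by apply: integral_ge0 => q _; rewrite lee_fin powR_ge0.
apply: filterS2 (poweR_small p0 t20 h_cvg e2) (poweR_small p0 t30 D_cvg e2) => m h1 h2.
have m2 : measurable_fun setT (EFin \o tau2 m) by apply/measurable_EFinP; exact: mtau2.
have m3 : measurable_fun setT (EFin \o tau3 m) by apply/measurable_EFinP; exact: mtau3.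
have s2 (q : borel M) : setT q -> (0 <= (EFin \o tau2 m) q)%E by move=> _; rewrite /= lee_fin powR_ge0.
have s3 (q : borel M) : setT q -> (0 <= (EFin \o tau3 m) q)%E by move=> _; rewrite /= lee_fin powR_ge0.
have E : (energy m = \int[vol_measure g hM]_q (EFin \o tau2 m) q + \int[vol_measure g hM]_q (EFin \o tau3 m) q)%E.
  exact: (ge0_integralD (vol_measure g hM) measurableT s2 m2 s3 m3).
have ee : e%:E = ((e / 2)%:E + (e / 2)%:E)%E by rewrite -EFinD -splitr.
by rewrite E ee; exact (leeD h1 h2).
Qed.

Let tau_ge0 m q : 0 <= tau2 m q + tau3 m q. Proof. by rewrite addr_ge0 ?powR_ge0. Qed.

Let metric_bound a K : compact K -> K `<=` img a -> exists2 B : R, 0 < B & forall x i, K x -> Num.sqrt (g a x i i) <= B.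
Proof.
move=> cK KU; have ci x : K x -> {for x, continuous (fun x => \sum_i `|g a x i i|)}.
  move=> Kx; have U0 := @img_open _ _ M a.
  suff : Ck 0 (img a) (fun x => \sum_i `|g a x i i|) by case=> + _; apply; exact: KU.
  apply: Ck_sum => // i _; split => // y ay; apply: continuous_comp; last exact: norm_continuous.
  exact: ((gmx_C2 g a i i).1 y ay).
have [B B0 hB] := compact_bound cK ci; exists (Num.sqrt B); first by rewrite sqrtr_gt0.
move=> x i Kx; apply: ler_wsqrtr; apply: le_trans (hB x Kx); rewrite ger0_norm ?sumr_ge0//.
by rewrite (bigD1 i)//= (le_trans (ler_norm _))// lerDl sumr_ge0.
Qed.

Let pow_le (u c t : R) : 0 <= u -> 0 <= c -> 0 <= t -> u <= c * t -> u `^ p <= c `^ p * t `^ p.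
Proof.
move=> u0 c0 t0 h'; rewrite -powRM//; apply: ge0_ler_powR; rewrite ?nnegrE ?mulr_ge0//; exact: ltW.
Qed.

(** Entries of a tensor are bounded by its norm. For the derivative, the identity d_k h = D +
    Christoffel terms linear in h holds off the null sets where weak and classical derivatives
    differ. [C] does not depend on m because the fixed metric [g] alone enters it. *)
Lemma local_bound a K : compact K -> K `<=` img a -> exists2 C : R, 0 < C & forall m i j,
  (\int[leb R n]_(x in K) (`|h m a x i j| `^ p)%:E <= C%:E * energy m)%E /\
  forall k, (\int[leb R n]_(x in K) (`|partial k (fun y => h m a y i j) x| `^ p)%:E <= C%:E * energy m)%E.
Proof.
move=> cK KU; have [B B0 hB] := metric_bound cK KU.
have [V V0 hV] := compact_integral_le g hM cK KU.
have [Gb Gb0 hGb] : exists2 Gb : R, 0 < Gb & forall x, K x -> forall l k i, `|christ a l k i x| <= Gb.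
  have ci x : K x -> {for x, continuous (fun x => \sum_l \sum_k \sum_i `|christ a l k i x|)}.
    move=> Kx; have U0 := @img_open _ _ M a.
    suff : Ck 0 (img a) (fun x => \sum_l \sum_k \sum_i `|christ a l k i x|) by case=> + _; apply; exact: KU.
    apply: Ck_sum => // l _; apply: Ck_sum => // k _; apply: Ck_sum => // i _; split => // y ay.
    by apply: continuous_comp; [exact: (Ck_christ a l k i).1|exact: norm_continuous].
  have [Gb Gb0 hGb] := compact_bound cK ci.
  exists Gb => // x Kx l k i; apply: le_trans (hGb x Kx).
  rewrite [leRHS]ger0_norm; last by do 3 (apply: sumr_ge0 => ? _).
  rewrite (bigD1 l)//= (bigD1 k)//= (bigD1 i)//= -!addrA lerDl.
  apply: addr_ge0; first by apply: sumr_ge0.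
  by apply: addr_ge0; [do 2 (apply: sumr_ge0 => ? _)|do 3 (apply: sumr_ge0 => ? _)].
pose C2 := n%:R ^+ 2 * (B * B); pose C3 := n%:R ^+ 3 * (B * B * B).
have B0' := ltW B0.
have C20 : 0 <= C2 by rewrite mulr_ge0 ?exprn_ge0// mulr_ge0.
have C30 : 0 <= C3 by rewrite mulr_ge0 ?exprn_ge0// !mulr_ge0.
(* [C3] bounds [D]; each of the n summands of the connection part contributes Gb C2 twice. *)
pose C4 := C3 + n%:R * (Gb * C2 + Gb * C2).
have C40 : 0 <= C4 by rewrite addr_ge0// mulr_ge0// addr_ge0// mulr_ge0// ltW.
have t20 m x : 0 <= tnorm2 g (h m) x by exact: sqrtr_ge0.
have t30 m x : 0 <= tnorm3 g (D m) x by exact: sqrtr_ge0.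
have e2 m i j x : K x -> `|h m a x i j| <= C2 * tnorm2 g (h m) (coordV a x).
  move=> Kx; have ax := KU x Kx; rewrite (tnorm2_chart g (@th m) (dom_coordV ax)) coordVK//.
  apply: le_trans (mdot_entry _ _ _ (metric_posdef g ax)) _; rewrite /C2 -[leRHS]mulrA.
  apply: ler_wpM2l; [exact: exprn_ge0|apply: ler_wpM2r; first exact: sqrtr_ge0].
  exact (ler_pM (sqrtr_ge0 _) (sqrtr_ge0 _) (hB x i Kx) (hB x j Kx)).
have e3 m k i j x : K x -> `|D m a x k i j| <= C3 * tnorm3 g (D m) (coordV a x).
  move=> Kx; have ax := KU x Kx; rewrite (tnorm3_chart g (@tD m) (dom_coordV ax)) coordVK//.
  apply: le_trans (mdot3_entry _ _ _ _ (metric_posdef g ax)) _; rewrite /C3 -[leRHS]mulrA.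
  apply: ler_wpM2l; [exact: exprn_ge0|apply: ler_wpM2r; first exact: sqrtr_ge0].
  have h2 := ler_pM (sqrtr_ge0 _) (sqrtr_ge0 _) (hB x k Kx) (hB x i Kx).
  exact (ler_pM (mulr_ge0 (sqrtr_ge0 _) (sqrtr_ge0 _)) (sqrtr_ge0 _) h2 (hB x j Kx)).
exists ((C2 `^ p + (C4 `^ p * 2 `^ p)) * V + 1); first by rewrite ltr_wpDl// mulr_ge0 ?(ltW V0)// addr_ge0 ?mulr_ge0 ?powR_ge0.
move=> m i j; have en0 : (0 <= energy m)%E by apply: integral_ge0 => q _; rewrite lee_fin.
have mt : measurable_fun setT (fun q => tau2 m q + tau3 m q) by exact: measurable_funD.
have fin_le (C : R) : 0 <= C -> C <= C2 `^ p + C4 `^ p * 2 `^ p ->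
    ((C * V)%:E * energy m <= ((C2 `^ p + (C4 `^ p * 2 `^ p)) * V + 1)%:E * energy m)%E.
  move=> C0 hC; apply: lee_wpmul2r => //; rewrite lee_fin ler_wpDr// ler_wpM2r// ltW//.
split.
  apply: le_trans (fin_le (C2 `^ p) _ _); rewrite ?powR_ge0 ?lerDl ?mulr_ge0 ?powR_ge0//.
  apply: hV => //.
  - exact: powR_ge0.
  - by apply: (measurableT_comp (measurable_powR p)); apply: measurableT_comp => //; exact: mh.
  apply: aeW => x Kx; apply: (@le_trans _ _ (C2 `^ p * tau2 m (coordV a x))).
    by rewrite /tau2 (ger0_norm (t20 m _)); apply: pow_le => //; exact: e2.
  by rewrite ler_wpM2l ?powR_ge0// lerDl powR_ge0.
move=> k; apply: le_trans (fin_le (C4 `^ p * 2 `^ p) _ _); rewrite ?lerDr ?mulr_ge0 ?powR_ge0//.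
apply: hV => //.
- by rewrite mulr_ge0 ?powR_ge0.
- apply: (measurableT_comp (measurable_powR p)); apply: measurableT_comp => //.
  by apply: continuous_borelR; [exact: img_open|exact: ((Ck_h m a i j).2 k).2.1].
have w1 := weak_partial_C1 (@img_open _ _ M a) (CkW (gmx_C2 (gs m) a i j)) ((hTs m).2 a k i j).
have w2 := weak_partial_C1 (@img_open _ _ M a) (CkW (gmx_C2 g a i j)) (hT.2 a k i j).
set N1 := [set x | _] in w1; set N2 := [set x | _] in w2.
have mN (g' : C2metric M) (T' : field3 M) : weak_cov_deriv g g' T' -> measurable ([set x | img a x /\
    T' a x k i j + \sum_l christoffel (g a) l k i x * g' a x l j + \sum_l christoffel (g a) l k j x * g' a x i l
    <> partial k (fun y => g' a y i j) x] : set (borel 'rV[R]_n)).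
  move=> wT; have [_ [mw _] _] := wT.2 a k i j.
  have mp : measurable_fun (img a : set (borel 'rV[R]_n)) (partial k (fun y => g' a y i j) : borel 'rV[R]_n -> R).
    by apply: continuous_borelR; [exact: img_open|exact: ((gmx_C2 g' a i j).2 k).2.1].
  have h0 := measurable_funB mw mp.
  have := h0 (mimg a) [set~ 0] (measurableC (measurable_set1 (0 : R))).
  congr measurable; apply/seteqP; split => x [ax hx]; split => //; move: hx => /= hx E; apply: hx.
    by rewrite E subrr.
  by apply/eqP; rewrite -subr_eq0; apply/eqP.
exists (N1 `|` N2); split.
- by apply: measurableU; [exact: mN (hTs m)|exact: mN hT].
- by rewrite measureU0//; [exact: mN (hTs m)|exact: mN hT].
move=> x nx; apply: contrapT => nN; apply: nx => Kx; have ax := KU x Kx.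
have W1 : Ts m a x k i j + \sum_l christoffel (g a) l k i x * gs m a x l j + \sum_l christoffel (g a) l k j x * gs m a x i l
    = partial k (fun y => gs m a y i j) x by apply: contrapT => hh; apply: nN; left.
have W2 : T a x k i j + \sum_l christoffel (g a) l k i x * g a x l j + \sum_l christoffel (g a) l k j x * g a x i l
    = partial k (fun y => g a y i j) x by apply: contrapT => hh; apply: nN; right.
have dh : partial k (fun y => h m a y i j) x = D m a x k i j + \sum_l (christ a l k i x * h m a x l j + christ a l k j x * h m a x i l).
  rewrite (_ : (fun y => h m a y i j) = (fun y => gs m a y i j) - (fun y => g a y i j)); last first.
    by apply/funext => y; rewrite /h !mxE.
  rewrite /partial deriveB; [|exact: ((gmx_C2 (gs m) a i j).2 k).1|exact: ((gmx_C2 g a i j).2 k).1].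
  rewrite -/(partial k (fun y => gs m a y i j) x) -/(partial k (fun y => g a y i j) x) -W1 -W2.
  have -> : D m a x k i j = Ts m a x k i j - T a x k i j by rewrite /D !mxE.
  have -> : \sum_l (christ a l k i x * h m a x l j + christ a l k j x * h m a x i l) =
    (\sum_l christoffel (g a) l k i x * gs m a x l j + \sum_l christoffel (g a) l k j x * gs m a x i l)
    - (\sum_l christoffel (g a) l k i x * g a x l j + \sum_l christoffel (g a) l k j x * g a x i l).
    rewrite -!big_split -sumrB; apply: eq_bigr => l _ /=; rewrite /h /christ !mxE; ring.
  ring.
set q := coordV a x.
have main : `|partial k (fun y => h m a y i j) x| <= C4 * (tnorm2 g (h m) q + tnorm3 g (D m) q).
  rewrite dh; apply: le_trans (ler_normD _ _) _.
  have s1 : `|\sum_l (christ a l k i x * h m a x l j + christ a l k j x * h m a x i l)| <=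
      n%:R * (Gb * C2 + Gb * C2) * tnorm2 g (h m) q.
    apply: le_trans (ler_norm_sum _ _ _) _.
    apply: (@le_trans _ _ (\sum_(l < n) (Gb * C2 + Gb * C2) * tnorm2 g (h m) q)).
      apply: ler_sum => l _; apply: le_trans (ler_normD _ _) _; rewrite mulrDl (normrM (christ a l k i x)) (normrM (christ a l k j x)).
      apply: lerD; rewrite -[leRHS]mulrA.
        exact (ler_pM (normr_ge0 _) (normr_ge0 _) (hGb x Kx l k i) (e2 m l j x Kx)).
      exact (ler_pM (normr_ge0 _) (normr_ge0 _) (hGb x Kx l k j) (e2 m i l x Kx)).
    by rewrite sumr_const card_ord -[leLHS]mulr_natl -[leRHS]mulrA.
  apply: le_trans (lerD (e3 m k i j x Kx) s1) _; rewrite -/q.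
  have t2 := t20 m q; have t3 := t30 m q.
  have cc : 0 <= n%:R * (Gb * C2 + Gb * C2) by rewrite mulr_ge0// addr_ge0// mulr_ge0// ltW.
  rewrite /C4; set N := n%:R * (_ + _) in cc *.
  have a1 := mulr_ge0 C30 t2; have a2 := mulr_ge0 cc t3.
  have alg (c3 cn u v : R) : (c3 + cn) * (u + v) = (c3 * v + cn * u) + (c3 * u + cn * v) by ring.
  by rewrite alg lerDl addr_ge0.
apply: le_trans (pow_le _ C40 _ main) _; rewrite ?addr_ge0//.
rewrite -mulrA ler_wpM2l ?powR_ge0//; apply: le_trans (powRD_le _ _ (ltW p0)) _ => //.
by rewrite /tau2 /tau3 (ger0_norm (t20 m q)) (ger0_norm (t30 m q)).
Qed.

(** Morrey's inequality on balls of one radius r around the points of [K], all inside [K'], with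
    energies bounded by [local_bound]. *)
Lemma metric_entries_uniform a i j K : compact K -> K `<=` img a -> forall e : R, 0 < e ->
  \forall m \near \oo, forall x, K x -> `|h m a x i j| <= e.
Proof.
move=> cK KU e e0; have [r r0 [K' [cK' K'U hK']]] := compact_thicken (@img_open _ _ M a) cK KU.
have [C C0 hC] := local_bound cK' K'U.
(* The condition [hq] below amounts to p <= q (p - n), solvable because p > n. *)
pose q := Num.bound (p / (p - n%:R)).
have pn0 : 0 < p - n%:R by rewrite subr_gt0.
have qp : p / (p - n%:R) < q%:R.
  by have := archi_boundP (divr_ge0 (ltW p0) (ltW pn0)).
have q0 : (0 < q)%N by rewrite -(ltr_nat R); apply: le_lt_trans qp; rewrite divr_ge0 ?ltW.
have hq : (q * n)%:R <= q.-1%:R * p.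
  have -> : q.-1%:R = q%:R - 1 :> R by rewrite -[in RHS](prednK q0) -natr1 addrK.
  by rewrite natrM; move: qp; rewrite ltr_pdivrMr// => qp'; nra.
pose L := 1 + q%:R * r * n%:R.
have L0 : 0 < L by rewrite ltr_wpDr// !mulr_ge0// ltW.
(* Makes the constant term of [morrey] equal to half of (2 r)^n e. *)
pose d := e / (2 * L); have d0 : 0 < d by rewrite divr_gt0// mulr_gt0.
pose c := d * d^-1 `^ p; have c0 : 0 < c by rewrite mulr_gt0// powR_gt0// invr_gt0.
have v0 : 0 < (2 * r) ^+ n by rewrite exprn_gt0// mulr_gt0.
(* Makes the energy term c L C e' equal to the other half. None of these constants depends on the
   centre x. *)
pose e' := (2 * r) ^+ n * (e / 2) / (c * L * C).
have e'0 : 0 < e'.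
  apply: divr_gt0; [apply: mulr_gt0 => //; exact: divr_gt0|by apply: mulr_gt0 => //; exact: mulr_gt0].
apply: filterS (energy_small e'0) => m em x Kx.
pose B := [set y : 'rV[R]_n | `|y - x| < r].
have BK : B `<=` K' by move=> y By; apply: (hK' x y Kx); rewrite distrC ltW.
have BU : B `<=` img a by move=> y /BK /K'U.
have mor := morrey (@img_open _ _ M a) (CkW (Ck_h m a i j)) r0 d0 p1 q0 hq BU.
have mK' : measurable (K' : set (borel 'rV[R]_n)) by apply: borel_compact => //; exact: norm_hausdorff.
have mB : measurable (B : set (borel 'rV[R]_n)).
  apply: borel_open; rewrite (_ : B = ball x r); first exact: ball_open.
  by apply/seteqP; split => y; rewrite -ball_normE /ball_ /B /= distrC.
have mpow (u : 'rV[R]_n -> R) : (forall y, img a y -> {for y, continuous u}) ->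
    measurable_fun (K' : set (borel 'rV[R]_n)) (fun y : borel 'rV[R]_n => (`|u y| `^ p)%:E).
  move=> cu; apply: (measurable_funS (mimg a) K'U); apply/measurable_EFinP.
  apply: (measurableT_comp (measurable_powR p)); apply: measurableT_comp => //.
  by apply: continuous_borelR => //; exact: img_open.
have [hm hdm] := hC m i j.
have b1 : (\int[leb R n]_(y in B) (`|h m a y i j| `^ p)%:E <= (C * e')%:E)%E.
  apply: le_trans (_ : \int[leb R n]_(y in K') (`|h m a y i j| `^ p)%:E <= _)%E.
    have mhp := mpow (fun y => h m a y i j) (Ck_h m a i j).1.
    by apply: (ge0_subset_integral (leb R n) mB mK' mhp _ BK) => y _; rewrite lee_fin powR_ge0.
  by apply: le_trans hm _; rewrite EFinM; apply: lee_wpmul2l => //; rewrite lee_fin ltW.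
have b2 : (\int[leb R n]_(y in B) (\sum_k `|partial k (fun y => h m a y i j) y| `^ p)%:E <= (n%:R * (C * e'))%:E)%E.
  under eq_integral do rewrite -sumEFin.
  have mk k : measurable_fun (K' : set (borel 'rV[R]_n)) (fun y : borel 'rV[R]_n => (`|partial k (fun y => h m a y i j) y| `^ p)%:E).
    by apply: mpow; exact: ((Ck_h m a i j).2 k).2.1.
  have mkB k := measurable_funS mK' BK (mk k).
  have k0 (k : 'I_n) (y : borel 'rV[R]_n) : B y -> (0 <= (`|partial k (fun y => h m a y i j) y| `^ p)%:E)%E.
    by move=> _; rewrite lee_fin powR_ge0.
  rewrite (ge0_integral_sum (leb R n) mB mkB k0).
  apply: le_trans (_ : \sum_(k < n) (C * e')%:E <= _)%E; last first.
    by rewrite sumEFin lee_fin sumr_const card_ord mulr_natl.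
  apply: lee_sum => k _.
  apply: le_trans (_ : \int[leb R n]_(y in K') (`|partial k (fun y => h m a y i j) y| `^ p)%:E <= _)%E.
    by apply: (ge0_subset_integral (leb R n) mB mK' (mk k) _ BK) => y _; rewrite lee_fin powR_ge0.
  by apply: le_trans (hdm k) _; rewrite EFinM; apply: lee_wpmul2l => //; rewrite lee_fin ltW.
have qr0 : 0 <= q%:R * r by rewrite mulr_ge0// ltW.
have qrE : (0 <= (q%:R * r)%:E)%E by rewrite lee_fin.
have cE : (0 <= c%:E)%E by rewrite lee_fin ltW.
have b4 := le_trans mor (leeD (lexx _) (lee_wpmul2l cE (leeD b1 (lee_wpmul2l qrE b2)))).
have b5 : (2 * r) ^+ n * `|h m a x i j| <= (2 * r) ^+ n * (d * (1 + q%:R * r * n%:R)) +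
    c * (C * e' + q%:R * r * (n%:R * (C * e'))) by rewrite -lee_fin; exact: b4.
rewrite -(ler_pM2l v0); apply: le_trans b5 _.
rewrite -/L (_ : c * _ = c * L * C * e'); last by rewrite /L; ring.
have cLC : c * L * C != 0 by rewrite gt_eqF//; apply: mulr_gt0 => //; exact: mulr_gt0.
rewrite /e' [X in _ + X]mulrC mulfVK//.
rewrite -mulrDr ler_wpM2l ?(ltW v0)// /d invfM mulrA mulfVK; last by rewrite gt_eqF.
by rewrite -splitr.
Qed.

(** [young] with exponent p/2 >= 1 gives u^2 <= d + c |u|^p, and the constant d is harmless because
    [K] has finite volume. *)
Lemma metric_entries_l2 a i j k : mean_to_zero (img a) (fun m x => partial k (fun y => h m a y i j) x ^+ 2).
Proof.
have cd m := ((Ck_h m a i j).2 k).2.1.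
split; [by move=> m; apply: cont_onX2; exact: cd|by move=> m x; exact: sqr_ge0|].
move=> K cK KU e e0; have [C C0 hC] := local_bound cK KU.
have lfin : leb R n K \is a fin_num by rewrite ge0_fin_numE ?measure_ge0// leb_compact.
pose l := fine (leb R n K); have l0 : 0 <= l by apply: fine_ge0; exact: measure_ge0.
have lE : leb R n K = l%:E by rewrite fineK.
have l1 : 0 < l + 1 by rewrite ltr_wpDl.
pose d := e / (2 * (l + 1)); have d0 : 0 < d by rewrite divr_gt0// mulr_gt0.
pose c := d * d^-1 `^ (p / 2); have c0 : 0 < c by rewrite mulr_gt0// powR_gt0// invr_gt0.
have e'0 : 0 < e / 2 / (c * C) by rewrite !divr_gt0// mulr_gt0.
have dl : d * l <= e / 2.
  rewrite /d invfM mulrA -mulrA ler_piMr ?divr_ge0 ?(ltW e0)//.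
  by rewrite mulrC ler_pdivrMr// mul1r lerDl.
apply: filterS (energy_small e'0) => m em; have [_ /(_ k) hm] := hC m i j.
have mK := measurable_compact cK.
set u := partial k _ in hm *.
have mup : measurable_fun (K : set (borel 'rV[R]_n)) (fun y : borel 'rV[R]_n => (`|u y| `^ p)%:E).
  apply: (measurable_funS (mimg a) KU); apply/measurable_EFinP.
  apply: (measurableT_comp (measurable_powR p)); apply: measurableT_comp => //.
  by apply: continuous_borelR; [exact: img_open|exact: cd].
have mu2 := cont_on_measurable (@img_open _ _ M a) cK KU (cont_onX2 (cd m)).
have mcu := measurable_funeM c%:E mup.
have cu0 (y : borel 'rV[R]_n) : K y -> (0 <= c%:E * (`|u y| `^ p)%:E)%E by rewrite mule_ge0 ?lee_fin ?powR_ge0// ltW.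
have md : measurable_fun (K : set (borel 'rV[R]_n)) (cst d%:E : borel 'rV[R]_n -> \bar R) by exact: measurable_cst.
have dd0 (y : borel 'rV[R]_n) : K y -> (0 <= cst d%:E y)%E by rewrite lee_fin ltW.
apply: (@le_trans _ _ (\int[leb R n]_(x in K) (d%:E + c%:E * (`|u x| `^ p)%:E))%E).
  apply: (ge0_le_integral (leb R n) mK _ mu2 (emeasurable_funD md mcu)) => [x _|x _].
    by rewrite lee_fin sqr_ge0.
  rewrite /= -EFinM -EFinD lee_fin.
  have hp2 : 1 <= p / 2 by rewrite ler_pdivlMr// mul1r.
  apply: le_trans (young (sqr_ge0 (u x)) d0 hp2) _; rewrite -/c lerD2l ler_wpM2l ?(ltW c0)//.
  rewrite -[u x ^+ 2]real_normK ?num_real// -powR_mulrn// -powRrM mulrC mulfVK//.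
have IC : (\int[leb R n]_(x in K) cst d%:E x = d%:E * leb R n K)%E by exact: integral_cst.
rewrite (ge0_integralD (leb R n) mK dd0 md cu0 mcu) IC lE ge0_integralZl//; last by rewrite lee_fin ltW.
rewrite [e]splitr EFinD; apply: leeD.
  by rewrite -EFinM lee_fin.
apply: (@le_trans _ _ (c%:E * (C%:E * (e / 2 / (c * C))%:E))%E).
  apply: lee_wpmul2l; first by rewrite lee_fin ltW.
  by apply: le_trans hm _; apply: lee_wpmul2l => //; rewrite lee_fin ltW.
rewrite -!EFinM lee_fin mulrA [leLHS]mulrC mulfVK// gt_eqF// mulr_gt0//.
Qed.

Theorem metric_c1_cvg a i j : c1_cvg (img a) (fun m x => gs m a x i j) (fun x => g a x i j).
Proof.
have hE m x : h m a x i j = gs m a x i j - g a x i j by rewrite /h !mxE.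
split; [by move=> m; apply: CkW; exact: gmx_C2|by apply: CkW; exact: gmx_C2| |].
  split; [by move=> m; exact: (gmx_C2 (gs m) a i j).1|exact: (gmx_C2 g a i j).1|].
  move=> K cK KU e e0; apply: filterS (metric_entries_uniform i j cK KU e0) => m hm x Kx.
  by rewrite -hE; exact: hm.
move=> k; have cd m := ((gmx_C2 (gs m) a i j).2 k).2.1; have c0 := ((gmx_C2 g a i j).2 k).2.1.
split; [exact: cd|exact: c0|]; have [ch h0 hh] := metric_entries_l2 a i j k.
split; [by move=> m; apply: cont_onX2; apply: cont_onB; [exact: cd|exact: c0]|by move=> m x; exact: sqr_ge0|].
move=> K cK KU e e0; apply: filterS (hh K cK KU e e0) => m; apply: le_trans.
rewrite le_eqVlt; apply/orP; left; apply/eqP; apply: eq_integral => x /set_mem Kx; congr (_ ^+ 2)%:E.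
rewrite (_ : (fun y => h m a y i j) = (fun y => gs m a y i j) - (fun y => g a y i j)); last first.
  by apply/funext => y; rewrite hE.
have ax := KU x Kx.
by rewrite /partial deriveB; [|exact: ((gmx_C2 (gs m) a i j).2 k).1|exact: ((gmx_C2 g a i j).2 k).1].
Qed.

End SobolevConvergence.

(** * Scalar curvature as a distribution *)

Lemma palatini_alg (R : comRingType) (w dA dB dwA dwB A B : R) :
  w * (dA - dB) - (- (dwA * A) + dwB * B) = (dwA * A + w * dA) - (dwB * B + w * dB).
Proof. ring. Qed.

Section Palatini.
Variables (R : realType) (n : nat) (U : set 'rV[R]_n).
Hypothesis oU : open U.
Implicit Types (G : 'rV[R]_n -> 'M[R]_n) (K : set 'rV[R]_n).

(** Entries of the inverse matrix by Cramer's rule, the form handled by the convergence calculus. *)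
Definition inv_entry G (i j : 'I_n) (x : 'rV[R]_n) : R := (\det (G x))^-1 * \adj (G x) i j.

Lemma inv_entryE G i j x : G x \in unitmx -> invmx (G x) i j = inv_entry G i j x.
Proof. by move=> u; rewrite /inv_entry /invmx u mxE. Qed.

Definition weight G (psi : 'rV[R]_n -> R) i j (x : 'rV[R]_n) : R :=
  inv_entry G i j x * Num.sqrt (\det (G x)) * psi x.

(** The curvature density after the derivatives of the Christoffel symbols have been moved onto the
    weights: every term is a product of two L^2-converging factors, or of a uniformly converging
    weight with two Christoffel symbols. *)
Definition palatini G psi (x : 'rV[R]_n) : R := \sum_i \sum_j
  (\sum_k (- (partial k (weight G psi i j) x * christoffel G k i j x)
          + partial j (weight G psi i j) x * christoffel G k i k x)
   + weight G psi i j x * \sum_k \sum_l (christoffel G k k l x * christoffel G l i j x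
                   - christoffel G k j l x * christoffel G l i k x)).

Section OneMetric.
Variables (G : 'rV[R]_n -> 'M[R]_n) (K : set 'rV[R]_n) (psi : 'rV[R]_n -> R).
Hypotheses (pG : forall x, U x -> posdef (G x)) (G2 : forall i j, Ck 2 U (fun x => G x i j)).
Hypotheses (cK : compact K) (KU : K `<=` U) (spsi : smooth setT psi) (psiK : forall x, ~ K x -> psi x = 0).

Let uG x : U x -> G x \in unitmx. Proof. by move=> Ux; apply: posdef_unit; exact: pG. Qed.

Let Ck_inv i j : Ck 2 U (inv_entry G i j).
Proof.
apply: (Ck_open_eq oU _ (Ck_invmx oU uG G2 i j)) => x Ux; exact: inv_entryE (uG Ux).
Qed.

Let Ck_weight i j : Ck 2 U (weight G psi i j).
Proof.
apply: CkM => //; last exact: Ck_sub (spsi 2).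
apply: CkM => //; apply: Ck_sqrt => //; first by move=> x Ux; apply: posdef_det; exact: pG.
exact: Ck_det.
Qed.

Let weightK i j x : ~ K x -> weight G psi i j x = 0.
Proof. by move=> nK; rewrite /weight psiK ?mulr0. Qed.

Let Ck_chr k i j : Ck 1 U (christoffel G k i j). Proof. exact: (Ck_christoffel oU pG). Qed.

Let good (f : 'rV[R]_n -> R) := (leb R n).-integrable (U : set (borel 'rV[R]_n)) (EFin \o (f : borel 'rV[R]_n -> R)).
(** Integrability travels with the vanishing of the integral, since additivity of the integral asks
    for it at each sum. *)
Let null (f : 'rV[R]_n -> R) := good f /\ (\int[leb R n]_(x in U) f x)%R = 0.

Let mU : measurable (U : set (borel 'rV[R]_n)). Proof. exact: borel_open. Qed.

Let nullD f1 f2 : null f1 -> null f2 -> null (fun x => f1 x + f2 x).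
Proof.
move=> [i1 e1] [i2 e2]; split; last by rewrite RintegralD// e1 e2 addr0.
by rewrite /good /comp; under [X in integrable _ _ X]eq_fun do rewrite EFinD; exact: integrableD.
Qed.

Let null0 : null (fun=> 0).
Proof. by split; [exact: integrable0|rewrite /Rintegral integral0]. Qed.

Let nullN f1 : null f1 -> null (fun x => - f1 x).
Proof.
move=> [i1 e1]; split.
  by rewrite /good /comp; under [X in integrable _ _ X]eq_fun do rewrite EFinN; exact: integrableN.
have -> : (fun x => - f1 x) = (fun x => -1 * f1 x) by apply/funext => x; rewrite mulN1r.
by rewrite RintegralZl// e1 mulr0.
Qed.

Let null_sum (I : Type) (s : seq I) (f : I -> 'rV[R]_n -> R) : (forall i, null (f i)) -> null (fun x => \sum_(i <- s) f i x).
Proof.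
move=> h; elim: s => [|i s IH].
  by have -> : (fun x => \sum_(i <- [::]) f i x) = (fun=> 0) by apply/funext => x; rewrite big_nil.
have -> : (fun x => \sum_(j <- i :: s) f j x) = (fun x => f i x + \sum_(j <- s) f j x) by apply/funext => x; rewrite big_cons.
exact: nullD.
Qed.

(** The integrand is a partial derivative of weight times u, a C^1 function with compact support. *)
Let null_div i j k (u : 'rV[R]_n -> R) : Ck 1 U u ->
  null (fun x => partial k (weight G psi i j) x * u x + weight G psi i j x * partial k u x).
Proof.
(* The cutoff [psi] is split off: it is smooth on the whole space, whereas the remaining factor is
   controlled on [U] only. *)
move=> hu; pose f x := inv_entry G i j x * Num.sqrt (\det (G x)) * u x.
have hf : Ck 1 U f.
  apply: CkM => //; apply: CkM => //; first exact: CkW.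
  by apply: CkW; apply: Ck_sqrt => //; [move=> x Ux; apply: posdef_det; exact: pG|exact: Ck_det].
have hw : Ck 1 setT (fun x => f x * psi x) by exact: (Ck_mul_supp oU cK KU hf (spsi 1) psiK).
have wE : (fun x => f x * psi x) = (fun x => weight G psi i j x * u x).
  by apply/funext => x; rewrite /f /weight; ring.
rewrite wE in hw.
have wK x : ~ K x -> weight G psi i j x * u x = 0 by move=> nK; rewrite weightK ?mul0r.
have Z := integral_partial k hw cK wK.
have dw x : U x -> derivable (weight G psi i j) x (delta_mx 0 k) by move=> Ux; exact: (((CkW (Ck_weight i j)).2 k).1).
have du x : U x -> derivable u x (delta_mx 0 k) by move=> Ux; exact: ((hu.2 k).1).
have E x : U x -> partial k (fun x => weight G psi i j x * u x) x = partial k (weight G psi i j) x * u x + weight G psi i j x * partial k u x.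
  by move=> Ux; rewrite partialM//; [exact: dw|exact: du].
have nU x : setT x -> ~ U x -> (partial k (fun x => weight G psi i j x * u x) x)%:E = 0%E.
  by move=> _ nUx; congr EFin; apply: (partial_supp k cK wK) => /KU.
rewrite (integral_shrink (@subsetT _ U) nU) in Z.
split.
  apply: (supp_integrable oU cK KU) => [x Ux|x Ux nK].
    apply: (@continuousD _ R^o _ (fun x => partial k (weight G psi i j) x * u x) (fun x => weight G psi i j x * partial k u x)).
      by apply: (@continuousM R _ (partial k (weight G psi i j)) u); [exact: ((CkW (Ck_weight i j)).2 k).2.1|exact: hu.1].
    by apply: (@continuousM R _ (weight G psi i j) (partial k u)); [exact: (Ck_weight i j).1|exact: (hu.2 k).2.1].
  by rewrite (partial_supp k cK (@weightK i j)) ?weightK// !mul0r addr0.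
rewrite /Rintegral -[RHS](congr1 fine Z); apply: (congr1 fine); apply: eq_integral => x /set_mem Ux.
by rewrite E.
Qed.

(** The product rule read backwards: the terms quadratic in the Christoffel symbols cancel and a sum
    of divergences remains. *)
Lemma palatini_diff x : U x -> scal_coord G x * psi x * Num.sqrt (\det (G x)) - palatini G psi x =
  \sum_i \sum_j \sum_k ((partial k (weight G psi i j) x * christoffel G k i j x + weight G psi i j x * partial k (christoffel G k i j) x)
    - (partial j (weight G psi i j) x * christoffel G k i k x + weight G psi i j x * partial j (christoffel G k i k) x)).
Proof.
move=> Ux; rewrite /scal_coord /palatini -mulrA mulr_suml -sumrB; apply: eq_bigr => i _.
rewrite mulr_suml -sumrB; apply: eq_bigr => j _; rewrite (inv_entryE i j (uG Ux)).
rewrite (_ : _ * ricci G i j x * _ = weight G psi i j x * ricci G i j x); last by rewrite /weight; ring.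
rewrite /ricci mulrDr opprD addrACA [X in _ + X]subrr addr0 mulr_sumr -sumrB.
apply: eq_bigr => k _; exact: palatini_alg.
Qed.

Lemma palatini_integral :
  (\int[leb R n]_(x in U) (scal_coord G x * psi x * Num.sqrt (\det (G x))))%R = (\int[leb R n]_(x in U) palatini G psi x)%R.
Proof.
pose f x := \sum_i \sum_j \sum_k ((partial k (weight G psi i j) x * christoffel G k i j x + weight G psi i j x * partial k (christoffel G k i j) x)
    - (partial j (weight G psi i j) x * christoffel G k i k x + weight G psi i j x * partial j (christoffel G k i k) x)).
have [gf zf] : null f.
  apply: null_sum => i; apply: null_sum => j; apply: null_sum => k.
  by apply: nullD; [exact: null_div|apply: nullN; exact: null_div].
have gp : good (palatini G psi).
  apply: (supp_integrable oU cK KU) => [x Ux|x Ux nK]; last first.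
    rewrite /palatini big1// => i _; rewrite big1// => j _; rewrite weightK// mul0r addr0 big1// => k _.
    by rewrite !(partial_supp _ cK (@weightK i j))// !mul0r oppr0 addr0.
  have cw k i j : Ck 0 U (partial k (weight G psi i j)) by exact: (Ck_le (leq0n 1) ((Ck_weight i j).2 k).2).
  have cw0 i j : Ck 0 U (weight G psi i j) by exact: (Ck_le (leq0n 2) (Ck_weight i j)).
  have cc k i j : Ck 0 U (christoffel G k i j) by exact: CkW.
  suff h : Ck 0 U (palatini G psi) by exact: h.1.
  apply: Ck_sum => // i _; apply: Ck_sum => // j _; apply: CkD => //.
    by apply: Ck_sum => // k _; apply: CkD => //; [apply: CkN => //; exact: CkM|exact: CkM].
  apply: CkM => //; apply: Ck_sum => // k _; apply: Ck_sum => // l _.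
  by apply: CkB => //; exact: CkM.
rewrite -[RHS]addr0 -zf -(RintegralD mU gp gf); apply: eq_Rintegral => x /set_mem Ux.
by rewrite /f -palatini_diff// addrC subrK.
Qed.

End OneMetric.

Section Limit.
Variables (Gs : nat -> 'rV[R]_n -> 'M[R]_n) (G : 'rV[R]_n -> 'M[R]_n) (K : set 'rV[R]_n) (psi : 'rV[R]_n -> R).
Hypotheses (pGs : forall m x, U x -> posdef (Gs m x)) (pG : forall x, U x -> posdef (G x)).
Hypotheses (Gs2 : forall m i j, Ck 2 U (fun x => Gs m x i j)) (G2 : forall i j, Ck 2 U (fun x => G x i j)).
Hypothesis Gcvg : forall i j, c1_cvg U (fun m x => Gs m x i j) (fun x => G x i j).
Hypotheses (cK : compact K) (KU : K `<=` U) (spsi : smooth setT psi) (psiK : forall x, ~ K x -> psi x = 0).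

Lemma sqdet_c1_cvg : c1_cvg U (fun m x => Num.sqrt (\det (Gs m x))) (fun x => Num.sqrt (\det (G x))).
Proof.
apply: c1_cvg_sqrt => //; [by move=> m x Ux; apply: posdef_det; exact: pGs|by move=> x Ux; apply: posdef_det; exact: pG|].
exact: c1_cvg_det.
Qed.

Let inv_cvg i j : c1_cvg U (fun m => inv_entry (Gs m) i j) (inv_entry G i j).
Proof.
by apply: (c1_cvg_inv oU) => // [m x Ux|x Ux]; apply: posdef_unit; [exact: pGs|exact: pG].
Qed.

Let weight_cvg i j : c1_cvg U (fun m => weight (Gs m) psi i j) (weight G psi i j).
Proof.
apply: c1_cvgM => //; first by apply: c1_cvgM => //; exact: sqdet_c1_cvg.
exact: (c1_cvg_cst oU (Ck_sub (@subsetT _ U) (spsi 1))).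
Qed.

Let chr_cvg k i j : l2_cvg U (fun m => christoffel (Gs m) k i j) (christoffel G k i j).
Proof.
have pc l a b : l2_cvg U (fun m => partial l (fun y => Gs m y a b)) (partial l (fun y => G y a b)).
  by have [_ _ _ h] := Gcvg a b; exact: h.
pose c' (H : 'rV[R]_n -> 'M[R]_n) x := 2^-1 * \sum_l inv_entry H k l x *
    (partial i (fun y => H y j l) x + partial j (fun y => H y i l) x - partial l (fun y => H y i j) x).
have E (H : 'rV[R]_n -> 'M[R]_n) x : H x \in unitmx -> c' H x = christoffel H k i j x.
  by move=> u; rewrite /c' /christoffel; congr (_ * _); apply: eq_bigr => l _; rewrite inv_entryE.
apply: (l2_cvg_eq oU (f_ := fun m => c' (Gs m)) (f := c' G)).
- by move=> m x Ux; apply: E; apply: posdef_unit; exact: pGs.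
- by move=> x Ux; apply: E; apply: posdef_unit; exact: pG.
apply: l2_cvgZ => //; apply: l2_cvg_sum => // l; apply: unif_l2_cvgM => //.
  by have [_ _ h _] := inv_cvg k l.
by apply: l2_cvgD => //; [apply: l2_cvgD|apply: l2_cvgN].
Qed.

(** Derivatives of the weights and Christoffel symbols converge in L^2, so their products converge
    in L^1; the undifferentiated weights converge uniformly. *)
Let palatini_cvg : l1_cvg U (fun m => palatini (Gs m) psi) (palatini G psi).
Proof.
have pw k i j : l2_cvg U (fun m => partial k (weight (Gs m) psi i j)) (partial k (weight G psi i j)).
  by have [_ _ _ h] := weight_cvg i j; exact: h.
have uw i j : unif_cvg U (fun m => weight (Gs m) psi i j) (weight G psi i j).
  by have [_ _ h _] := weight_cvg i j.
apply: l1_cvg_sum => // i; apply: l1_cvg_sum => // j; apply: l1_cvgD => //.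
  apply: l1_cvg_sum => // k; apply: l1_cvgD => //; last exact: l2_l1_cvgM.
  by apply: l1_cvgN => //; exact: l2_l1_cvgM.
apply: unif_l1_cvgM => //; apply: l1_cvg_sum => // k; apply: l1_cvg_sum => // l.
by apply: l1_cvgD => //; [exact: l2_l1_cvgM|apply: l1_cvgN => //; exact: l2_l1_cvgM].
Qed.

Theorem scal_integral_cvg :
  (\int[leb R n]_(x in U) (scal_coord (Gs m) x * psi x * Num.sqrt (\det (Gs m x))))%R @[m --> \oo] -->
  (\int[leb R n]_(x in U) (scal_coord G x * psi x * Num.sqrt (\det (G x))))%R.
Proof.
rewrite (palatini_integral pG G2 cK KU spsi psiK).
rewrite (_ : (fun m => _) = (fun m => (\int[leb R n]_(x in U) palatini (Gs m) psi x)%R)); last first.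
  by apply/funext => m; rewrite (palatini_integral (@pGs m) (@Gs2 m) cK KU spsi psiK).
have pK (H : 'rV[R]_n -> 'M[R]_n) x : ~ K x -> palatini H psi x = 0.
  have wK i j y : ~ K y -> weight H psi i j y = 0 by move=> nK; rewrite /weight psiK ?mulr0.
  move=> nK; rewrite /palatini big1// => i _; rewrite big1// => j _; rewrite wK// mul0r addr0 big1// => k _.
  by rewrite !(partial_supp _ cK (@wK i j))// !mul0r oppr0 addr0.
by apply: (l1_cvg_integral oU cK KU palatini_cvg) => [m x|x]; exact: pK.
Qed.

End Limit.
End Palatini.

(** * Convergence of curvature integrals on the manifold *)

Section WeightedScalarCurvature.
Variables (R : realType) (n : nat) (M : smoothManifold R n) (g : C2metric M) (gs : nat -> C2metric M).
Hypothesis hM : compact [set: M].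
Hypothesis gcvg : forall a i j, c1_cvg (img a) (fun m x => gs m a x i j) (fun x => g a x i j).
Implicit Types (a : chart M) (K : set 'rV[R]_n) (F : M -> R).

(** Weak convergence of the volume measures: a partition of unity localises the integral, and in
    each chart the densities converge uniformly on compact sets. *)
Lemma continuous_vol_cvg F : continuous F ->
  (\int[vol_measure (gs m) hM]_q F q)%R @[m --> \oo] --> (\int[vol_measure g hM]_q F q)%R.
Proof.
move=> cF; have [s [e [K [ce e0 e1 hK]]]] := partition_of_unity hM.
have cFe p : continuous (fun q => F q * e p q).
  by move=> q; apply: (@continuousM R _ F (e p)); [exact: cF|exact: ce].
have sFe p : chart_supported (chart_at p) (K p) (fun q => F q * e p q).
  have [cK KU h] := hK p; split => // q; rewrite mulf_eq0 negb_or => /andP[_ ]; exact: h.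
have E (g' : C2metric M) : (\int[vol_measure g' hM]_q F q)%R =
    \sum_(p <- s) (\int[leb R n]_(x in img (chart_at p)) (pull (chart_at p) (fun q => F q * e p q) x * sqdet g' (chart_at p) x))%R.
  under eq_bigr => p _ do rewrite -(Rintegral_vol_supp g' hM (sFe p) (cFe p)).
  rewrite -(Rintegral_vol_sum g' hM s cFe); apply: eq_Rintegral => q _.
  by rewrite -mulr_sumr e1 mulr1.
rewrite E (_ : (fun m => _) = (fun m => \sum_(p <- s) (\int[leb R n]_(x in img (chart_at p))
    (pull (chart_at p) (fun q => F q * e p q) x * sqdet (gs m) (chart_at p) x))%R)); last first.
  by apply/funext => m; rewrite E.
apply: (@cvg_big _ _ _ _ xpredT _ _ _ s) => [|p _]; first exact: add_continuous.
have [cK KU _] := hK p; have oU := @img_open _ _ M (chart_at p).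
have pK x : ~ K p x -> pull (chart_at p) (fun q => F q * e p q) x = 0 by exact: pull_supp (sFe p).
have cp := pull_continuous (sFe p) (cFe p).
have sc := sqdet_c1_cvg oU (fun m x ax => metric_posdef (gs m) ax) (fun x ax => metric_posdef g ax) (gcvg (chart_at p)).
have [_ _ us _] := sc.
set P := pull _ _ in pK cp *.
have L : l1_cvg (img (chart_at p)) (fun m x => P x * sqdet (gs m) (chart_at p) x) (fun x => P x * sqdet g (chart_at p) x).
  rewrite (_ : (fun m x => P x * _) = fun m x => sqdet (gs m) (chart_at p) x * P x); last first.
    by apply/funext => m; apply/funext => x; rewrite mulrC.
  rewrite (_ : (fun x => P x * _) = fun x => sqdet g (chart_at p) x * P x); last first.
    by apply/funext => x; rewrite mulrC.
  have cP : cont_on (img (chart_at p)) P by move=> x _; exact: cp.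
  exact (unif_l1_cvgM oU us (l1_cvg_cst cP)).
by apply: (l1_cvg_integral oU cK KU L) => [m x nK|x nK]; rewrite pK ?mul0r.
Qed.

Lemma scal_continuous (g' : C2metric M) : continuous (scal g').
Proof.
move=> q; pose a := chart_at q; have aq : dom a q by exact: dom_chart_at.
apply: (@near_eq_continuous _ _ (scal_coord (g' a) \o coord a)).
  by apply: filterS (open_nbhs_nbhs (conj (dom_open a) aq)) => r ar; rewrite (scal_chart g' ar).
apply: continuous_comp; first exact: coord_cts.
have oU := @img_open _ _ M a; have pG x : img a x -> posdef (g' a x) by exact: metric_posdef.
have uG x : img a x -> g' a x \in unitmx by move=> ax; apply: posdef_unit; exact: pG.
have G2 i j : Ck 2 (img a) (fun x => g' a x i j) by exact: gmx_C2.
have C1 k i j : Ck 1 (img a) (christoffel (g' a) k i j) by exact: (Ck_christoffel oU pG).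
have C0 k i j : Ck 0 (img a) (christoffel (g' a) k i j) by exact: (Ck_le (leq0n 1)).
have P0 l k i j : Ck 0 (img a) (partial l (christoffel (g' a) k i j)) by exact: ((C1 k i j).2 l).2.
suff h : Ck 0 (img a) (scal_coord (g' a)) by apply: h.1; exact: img_coord.
apply: Ck_sum => // i _; apply: Ck_sum => // j _; apply: CkM => //.
  exact: (Ck_le (leq0n 2) (Ck_invmx oU uG G2 i j)).
apply: CkD => //.
  by apply: Ck_sum => // k _; exact: CkB.
apply: Ck_sum => // k _; apply: Ck_sum => // l _.
by apply: CkB => //; exact: CkM.
Qed.

Lemma scal_ext_cvg a K (psi : 'rV[R]_n -> R) : compact K -> K `<=` img a -> smooth setT psi -> (forall x, ~ K x -> psi x = 0) ->
  (\int[vol_measure (gs m) hM]_q (scal (gs m) q * ext a psi q))%R @[m --> \oo] -->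
  (\int[vol_measure g hM]_q (scal g q * ext a psi q))%R.
Proof.
move=> cK KU spsi psiK; have cpsi : continuous psi by move=> x; exact: (Ck_continuous (spsi 0%N)).
have ce := ext_continuous cK KU psiK cpsi.
have [_ _ se] := ext_supported cK KU psiK.
have E (g' : C2metric M) : (\int[vol_measure g' hM]_q (scal g' q * ext a psi q))%R =
    (\int[leb R n]_(x in img a) (scal_coord (g' a) x * psi x * Num.sqrt (\det (g' a x))))%R.
  have cF : continuous (fun q => scal g' q * ext a psi q).
    by move=> q; apply: (@continuousM R _ (scal g') (ext a psi)); [exact: scal_continuous|exact: ce].
  have sF : chart_supported a K (fun q => scal g' q * ext a psi q).
    by split => // q; rewrite mulf_eq0 negb_or => /andP[_]; exact: se.
  rewrite (Rintegral_vol_supp g' hM sF cF); apply: eq_Rintegral => x /set_mem ax.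
  by rewrite pull_img// (scal_chart g' (dom_coordV ax)) coordVK// ext_img.
rewrite E (_ : (fun m => _) = (fun m => (\int[leb R n]_(x in img a) (scal_coord (gs m a) x * psi x * Num.sqrt (\det (gs m a x))))%R)); last first.
  by apply/funext => m; rewrite E.
apply: (scal_integral_cvg (@img_open _ _ M a) _ _ _ _ (gcvg a) cK KU spsi psiK).
- by move=> m x ax; exact: metric_posdef.
- by move=> x ax; exact: metric_posdef.
- by move=> m i j; exact: gmx_C2.
- by move=> i j; exact: gmx_C2.
Qed.

(** F + e/2 is cut by a partition of unity and each piece is approximated in its chart, with a total
    error of at most e/2. *)
Lemma test_upper_approximation F e : continuous F -> 0 < e ->
  exists (I : Type) (s : seq I) (a : I -> chart M) (K : I -> set 'rV[R]_n) (psi : I -> 'rV[R]_n -> R),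
   (forall i, [/\ compact (K i), K i `<=` img (a i), smooth setT (psi i) & forall x, ~ K i x -> psi i x = 0]) /\
   forall q, F q <= \sum_(i <- s) ext (a i) (psi i) q <= F q + e.
Proof.
move=> cF e0; have [s [eta [K [ceta eta0 eta1 hK]]]] := partition_of_unity hM.
(* An error e / (2 N) per piece adds up to at most e/2; the added 1 keeps N positive. *)
pose N := (size s)%:R + 1 : R; have N0 : 0 < N by rewrite ltr_wpDl.
pose d := e / 2 / N; have d0 : 0 < d by rewrite !divr_gt0.
pose F2 q := F q + e / 2.
have cF2 : continuous F2.
  by move=> q; apply: (@continuousD R R^o _ F (fun=> e / 2)); [exact: cF|exact: cst_continuous].
have cFe p : continuous (fun q => F2 q * eta p q).
  by move=> q; apply: (@continuousM R _ F2 (eta p)); [exact: cF2|exact: ceta].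
have sFe p : chart_supported (chart_at p) (K p) (fun q => F2 q * eta p q).
  have [cK KU h] := hK p; split => // q; rewrite mulf_eq0 negb_or => /andP[_ ]; exact: h.
pose u p := pull (chart_at p) (fun q => F2 q * eta p q).
have ex (p : M) : exists rK : set 'rV[R]_n * ('rV[R]_n -> R), [/\ compact rK.1, rK.1 `<=` img (chart_at p), smooth setT rK.2,
    forall x, ~ rK.1 x -> rK.2 x = 0 & forall x, `|rK.2 x - u p x| <= d].
  have [cK KU _] := hK p.
  have [K' [cK' K'U h]] := test_function_density (@img_open _ _ M (chart_at p)) cK KU
    (pull_continuous (sFe p) (cFe p)) (fun x => pull_supp (sFe p)).
  by have [psi [sp p0 pu _]] := h d d0; exists (K', psi).
have [rK hrK] := choice ex.
exists M, s, (fun p => chart_at p), (fun p => (rK p).1), (fun p => (rK p).2); split.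
  by move=> p; have [] := hrK p.
move=> q; have ue p : ext (chart_at p) (u p) q = F2 q * eta p q.
  rewrite /ext; case: asboolP => [aq|naq]; first by rewrite /u pull_img ?coordK//; exact: img_coord.
  have [_ _ h] := sFe p; apply/esym/eqP; apply: contrapT => /negP /h [].
  by [].
have close p : `|ext (chart_at p) (rK p).2 q - F2 q * eta p q| <= d.
  rewrite -ue /ext; case: asboolP => [aq|naq]; last by rewrite subrr normr0 ltW.
  by have [_ _ _ _] := hrK p; apply.
have sumF : \sum_(p <- s) F2 q * eta p q = F2 q by rewrite -mulr_sumr eta1 mulr1.
have tot : `|\sum_(p <- s) ext (chart_at p) (rK p).2 q - F2 q| <= e / 2.
  rewrite -sumF -sumrB; apply: le_trans (ler_norm_sum _ _ _) _.
  apply: (@le_trans _ _ (\sum_(p <- s) d)); first by apply: ler_sum => p _.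
  have -> : \sum_(p <- s) d = d * (size s)%:R by rewrite big_const_seq count_predT iter_addr_0 mulr_natr.
  by rewrite /d mulrAC ler_pdivrMr// ler_wpM2l ?divr_ge0 ?(ltW e0)// /N lerDl.
by move: tot; rewrite ler_distl /F2 => /andP[h1 h2]; apply/andP; split; lra.
Qed.

End WeightedScalarCurvature.

Lemma uniform_cvg_near (R : realType) (T : choiceType) (f_ : nat -> T -> R) (f : T -> R) (e : R) :
  {uniform, f_ @ \oo --> f} -> 0 < e -> \forall m \near \oo, forall q, `|f_ m q - f q| <= e.
Proof.
move=> cf e0; have h : nbhs (f : {uniform T -> R}) [set h : {uniform T -> R} | forall q, `|h q - f q| <= e].
  apply/uniform_nbhs; exists [set xy | ball xy.1 e xy.2]; split; first exact: (@entourage_ball _ _ (PosNum e0)).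
  move=> h /= hh q; have := hh q Logic.I; rewrite /= -ball_normE /ball_ /= distrC; exact: ltW.
exact: (cf _ h).
Qed.

Theorem corollary1p4 (R : realType) (n : nat) (p kappa : R)
    (M : smoothManifold R n) (g : C2metric M) (gs : nat -> C2metric M)
    (phis : nat -> M -> R) (phi : M -> R)
    (hn : (2 <= n)%N)
    (hp : n%:R ^+ 2 / 2 < p)
    (hM : compact [set: M])
    (phis_ge0 : forall i q, 0 <= phis i q)
    (phis_cts : forall i, continuous (phis i))
    (phis_log_lip : forall a : R, 0 < a ->
       exists L : R, 0 < L /\
         forall i, lipschitz_wrt g L (fun q => ln (phis i q + a)))
    (phi_ge0 : forall q, 0 <= phi q)
    (phi_cts : continuous phi)
    (phis_cvg : {uniform, phis @ \oo --> phi})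
    (scal_ge0 : forall i q, 0 <= scal (gs i) q)
    (scal_int : forall i,
       (kappa%:E * \int[vol (gs i)]_q (phis i q)%:E
        <= \int[vol (gs i)]_q (scal (gs i) q * phis i q)%:E)%E)
    (gs_cvg : W1p_cvg g p gs) :
  (kappa%:E * \int[vol g]_q (phi q)%:E
   <= \int[vol g]_q (scal g q * phi q)%:E)%E.
Proof.
have n2 : 2 <= n%:R :> R by rewrite ler_nat.
(* Both bounds come from 2 <= n <= n^2/2 < p. *)
have p2 : 2 <= p by apply: ltW; apply: le_lt_trans hp; rewrite ler_pdivlMr//; nra.
have pn : n%:R < p by apply: le_lt_trans hp; rewrite ler_pdivlMr//; nra.
have [Ts [T [hTs hT hh hD]]] := gs_cvg.
have gcvg a i j := @metric_c1_cvg R n M g gs hM p Ts T p2 pn hTs hT hh hD a i j.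
pose mu (g' : C2metric M) := vol_measure g' hM.
have IE (g' : C2metric M) (F : M -> R) : continuous F -> (\int[vol g']_q (F q)%:E = (\int[mu g']_q F q)%R%:E)%E.
  move=> cF; rewrite /Rintegral fineK//; exact: (integrable_fin_num measurableT (continuous_integrable g' hM cF)).
have cM (F G : M -> R) : continuous F -> continuous G -> continuous (fun q => F q * G q).
  by move=> cF cG q; apply: (@continuousM R _ F G); [exact: cF|exact: cG].
have cD (F G : M -> R) : continuous F -> continuous G -> continuous (fun q => F q + G q).
  by move=> cF cG q; apply: (@continuousD R R^o _ F G); [exact: cF|exact: cG].
have cC (c : R) : continuous (fun _ : M => c) by move=> q; exact: cst_continuous.
have cS (g' : C2metric M) := scal_continuous (g' := g').
have phis_int m : kappa * (\int[mu (gs m)]_q phis m q)%R <= (\int[mu (gs m)]_q (scal (gs m) q * phis m q))%R.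
  by have := scal_int m; rewrite (IE _ _ (phis_cts m)) (IE _ _ (cM _ _ (cS (gs m)) (phis_cts m))) -EFinM lee_fin.
rewrite (IE _ _ phi_cts) (IE _ _ (cM _ _ (cS g) phi_cts)) -EFinM lee_fin.
have [C C0 hC] := compact_bound hM (fun q _ => cS g q).
pose V := (\int[mu g]_q (1 : R))%R.
have V0 : 0 <= V by apply: Rintegral_ge0.
have Zl (g' : C2metric M) (c : R) (F : M -> R) : continuous F -> (\int[mu g']_q (c * F q))%R = c * (\int[mu g']_q F q)%R.
  by move=> cF; rewrite RintegralZl//; exact: continuous_integrable.
have Dl (g' : C2metric M) (F G : M -> R) : continuous F -> continuous G ->
    (\int[mu g']_q (F q + G q))%R = (\int[mu g']_q F q)%R + (\int[mu g']_q G q)%R.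
  by move=> cF cG; rewrite RintegralD//; exact: continuous_integrable.
have le_I (g' : C2metric M) (F G : M -> R) : continuous F -> continuous G -> (forall q, F q <= G q) ->
    (\int[mu g']_q F q)%R <= (\int[mu g']_q G q)%R by move=> cF cG; exact: Rintegral_vol_le.
have cstE (g' : C2metric M) (c : R) : (\int[mu g']_q c)%R = c * (\int[mu g']_q (1 : R))%R.
  by rewrite -(Zl g' c (fun=> 1) (cC 1)); apply: eq_Rintegral => q _; rewrite mulr1.
apply/ler_addgt0Pr => e0 e00.
(* Collects the errors at scale e: 2 C V from R(g) (Psi - phi), 1 from the limit of the curvature
   integrals, and |kappa| (V + 2) from comparing the integrals of [phi] and [phis m]. *)
pose A := 2 * C * V + 1 + `|kappa| * (V + 2).
have A0 : 0 < A.
  by rewrite ltr_wpDr ?mulr_ge0 ?addr_ge0// ltr_wpDl// !mulr_ge0// ltW.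
pose e := e0 / A; have ep : 0 < e by rewrite divr_gt0.
have eA : e * A = e0 by rewrite mulfVK// gt_eqF.
have [I [s [a [K [psi [hpsi hPsi]]]]]] := test_upper_approximation hM (cD _ _ phi_cts (cC e)) ep.
pose Psi q := \sum_(i <- s) ext (a i) (psi i) q.
have cext i : continuous (ext (a i) (psi i)).
  have [cK KU sp pK] := hpsi i; apply: ext_continuous cK KU pK _ => x; exact: (Ck_continuous (sp 0%N)).
have cPsi : continuous Psi.
  rewrite /Psi (_ : (fun q => _) = \sum_(i <- s) ext (a i) (psi i)); last by apply/funext => q; rewrite fct_sumE.
  by elim/big_ind: _ => [|F G cF cG|i _]; [exact: cC|exact: cD|exact: cext].
have PsiE (g' : C2metric M) : (\int[mu g']_q (scal g' q * Psi q))%R =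
    \sum_(i <- s) (\int[mu g']_q (scal g' q * ext (a i) (psi i) q))%R.
  rewrite -(Rintegral_vol_sum g' hM s (fun i => cM _ _ (cS g') (cext i))).
  by apply: eq_Rintegral => q _; rewrite /Psi mulr_sumr.
have Psi_cvg : (\int[mu (gs m)]_q (scal (gs m) q * Psi q))%R @[m --> \oo] --> (\int[mu g]_q (scal g q * Psi q))%R.
  rewrite PsiE (_ : (fun m => _) = (fun m => \sum_(i <- s) (\int[mu (gs m)]_q (scal (gs m) q * ext (a i) (psi i) q))%R)); last first.
    by apply/funext => m; rewrite PsiE.
  apply: (@cvg_big _ _ _ _ xpredT _ _ _ s) => [|i _]; first exact: add_continuous.
  by have [cK KU sp pK] := hpsi i; exact: (@scal_ext_cvg R n M g gs hM gcvg (a i) (K i) (psi i) cK KU sp pK).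
have h1 := uniform_cvg_near phis_cvg ep.
have /cvgrPdist_le /(_ _ ep) h2 := @continuous_vol_cvg R n M g gs hM gcvg phi phi_cts.
have /cvgrPdist_le /(_ _ ltr01) h3 := @continuous_vol_cvg R n M g gs hM gcvg _ (cC 1).
have /cvgrPdist_le /(_ _ ep) h4 := Psi_cvg.
have [m [[m1 m2] [m3 m4]]] : exists m, ((forall q, `|phis m q - phi q| <= e) /\
    `|(\int[mu g]_q phi q)%R - (\int[mu (gs m)]_q phi q)%R| <= e) /\
    (`|V - (\int[mu (gs m)]_q (1 : R))%R| <= 1 /\
    `|(\int[mu g]_q (scal g q * Psi q))%R - (\int[mu (gs m)]_q (scal (gs m) q * Psi q))%R| <= e).
  by near \oo => m; exists m; split; split; near: m.
(* Bounds the volume of g_m, which multiplies the uniform distance between [phis m] and [phi]. *)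
have Vm : (\int[mu (gs m)]_q (1 : R))%R <= V + 1.
  by move: m3; rewrite ler_distlC => /andP[_]; rewrite addrC.
have b1 : (\int[mu (gs m)]_q (scal (gs m) q * phis m q))%R <= (\int[mu (gs m)]_q (scal (gs m) q * Psi q))%R.
  apply: (le_I _ _ _ (cM _ _ (cS (gs m)) (phis_cts m)) (cM _ _ (cS (gs m)) cPsi)) => q; apply: ler_wpM2l; first exact: scal_ge0.
  have /andP[l1 _] := hPsi q; apply: le_trans l1.
  by have := m1 q; rewrite ler_distl => /andP[_].
have b2 : (\int[mu g]_q (scal g q * Psi q))%R <= (\int[mu g]_q (scal g q * phi q))%R + 2 * e * C * V.
  have <- : (\int[mu g]_q (scal g q * phi q + 2 * e * C))%R = (\int[mu g]_q (scal g q * phi q))%R + 2 * e * C * V.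
    by rewrite (Dl g _ (fun=> 2 * e * C) (cM _ _ (cS g) phi_cts) (cC _)) cstE.
  apply: le_I; [exact (cM _ _ (cS g) cPsi)|exact (cD _ _ (cM _ _ (cS g) phi_cts) (cC _))|move=> q].
  have /andP[l1 l2] := hPsi q; rewrite -/(Psi q) in l1 l2.
  have -> : scal g q * Psi q = scal g q * phi q + scal g q * (Psi q - phi q) by ring.
  rewrite lerD2l; apply: le_trans (ler_norm _) _; rewrite normrM mulrC.
  apply: ler_pM => //; last exact: hC.
  by rewrite ger0_norm; lra.
have b3 : `|(\int[mu (gs m)]_q phis m q)%R - (\int[mu (gs m)]_q phi q)%R| <= e * (V + 1).
  have up : (\int[mu (gs m)]_q phis m q)%R <= (\int[mu (gs m)]_q phi q)%R + e * (\int[mu (gs m)]_q (1 : R))%R.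
    rewrite -(cstE (gs m) e) -(Dl (gs m) phi (fun=> e) phi_cts (cC e)).
    apply: (le_I _ _ _ (phis_cts m) (cD _ _ phi_cts (cC e))) => q.
    by have := m1 q; rewrite ler_distl => /andP[_].
  have lo : (\int[mu (gs m)]_q phi q)%R <= (\int[mu (gs m)]_q phis m q)%R + e * (\int[mu (gs m)]_q (1 : R))%R.
    rewrite -(cstE (gs m) e) -(Dl (gs m) (phis m) (fun=> e) (phis_cts m) (cC e)).
    apply: (le_I _ _ _ phi_cts (cD _ _ (phis_cts m) (cC e))) => q.
    by have := m1 q; rewrite ler_distl lerBlDr => /andP[].
  have ev := ler_wpM2l (ltW ep) Vm.
  rewrite ler_distl lerBlDr; apply/andP; split; last by apply: (le_trans up); rewrite lerD2l.
  by apply: (le_trans lo); rewrite lerD2l.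
(* An error e comes from changing the volume measure, and e (V + 1) from changing the function. *)
have b4 : `|(\int[mu g]_q phi q)%R - (\int[mu (gs m)]_q phis m q)%R| <= e * (V + 2).
  rewrite [e * _](_ : _ = e + e * (V + 1)); last by ring.
  apply: le_trans (ler_distD (\int[mu (gs m)]_q phi q)%R _ _) _; apply: lerD => //.
  by rewrite distrC.
have b5 : kappa * (\int[mu g]_q phi q)%R <= kappa * (\int[mu (gs m)]_q phis m q)%R + `|kappa| * (e * (V + 2)).
  rewrite -lerBlDl -mulrBr; apply: le_trans (ler_norm _) _; rewrite normrM.
  exact: ler_wpM2l.
have b6 : (\int[mu (gs m)]_q (scal (gs m) q * Psi q))%R <= (\int[mu g]_q (scal g q * Psi q))%R + e.
  by move: m4; rewrite ler_distlC => /andP[_].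
have b7 := phis_int m.
apply: le_trans b5 _; rewrite -eA.
rewrite (_ : e * A = 2 * e * C * V + e + `|kappa| * (e * (V + 2))); last by rewrite /A; ring.
rewrite [leRHS]addrA lerD2r; apply: (le_trans b7); apply: (le_trans b1); apply: (le_trans b6).
by rewrite addrA lerD2r.
Unshelve. all: by end_near. Qed.
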